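(* Let $\Omega\subset\mathbb{C}^d$ be a bounded convex open set with $C^\infty$ boundary. Then the metric space $(\Omega,d_\Omega)$ is Gromov hyperbolic if and only if $\Omega$ has finite type in the sense of D'Angelo.
   Context: $d_\Omega$ denotes the Kobayashi distance of $\Omega$: the infinitesimal Kobayashi metric is $K_\Omega(x;v)=\inf\{|\xi| : f:\Delta\to\Omega \text{ holomorphic},\ f(0)=x,\ df(\xi)=v\}$ ($\Delta$ the unit disk), and $d_\Omega(x,y)$ is the infimum of $\int_0^1K_\Omega(\gamma(t);\gamma'(t))\,dt$ over $C^\infty$ curves $\gamma$ in $\Omega$ from $x$ to $y$. A proper geodesic metric space is Gromov hyperbolic if there is $\delta\ge 0$ such that every geodesic triangle is $\delta$-thin (each side lies in the $\delta$-neighborhood of the union of the other two). For convex domains with smooth boundary, finite type in the sense of D'Angelo is equivalent to finite line type: writing $\Omega=\{r<0\}$ with $r$ smooth and $\nabla r\neq0$ near $\partial\Omega$, a point $x\in\partial\Omega$ has line type $\sup\{\nu(r\circ\ell)\}$, the supremum over non-trivial complex affine maps $\ell:\mathbb{C}\to\mathbb{C}^d$ with $\ell(0)=x$ of the order of vanishing of $r\circ\ell$ at $0$; finite type means this is bounded over $\partial\Omega$. *)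

(* Defs.v *)
(* C^d is modelled as the real vector space
   'rV[R]_(d + d): the first d coordinates are the real parts, the last d the
   imaginary parts.  C itself is 'rV[R]_(1 + 1). *)
From HB Require Import structures.
From mathcomp Require Import all_boot all_order all_algebra.
From mathcomp Require Import all_classical all_reals all_analysis.
Set Implicit Arguments. Unset Strict Implicit. Unset Printing Implicit Defensive.
Import Order.TTheory GRing.Theory Num.Theory.
Import numFieldNormedType.Exports.
Local Open Scope classical_set_scope.
Local Open Scope ring_scope.

Section Defs.
Variable R : realType.

Definition Cn (d : nat) := 'rV[R]_(d + d).
Definition Cplx := Cn 1.

Definition cmul (d : nat) (zeta : Cplx) (z : Cn d) : Cn d :=
  let a := zeta ord0 (lshift 1 ord0) in
  let b := zeta ord0 (rshift 1 ord0) in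
  let x := lsubmx z in let y := rsubmx z in
  row_mx (a *: x - b *: y) (a *: y + b *: x).

Definition cI : Cplx := row_mx 0 1.

Definition cabs (zeta : Cplx) : R :=
  Num.sqrt (zeta ord0 (lshift 1 ord0) ^+ 2 + zeta ord0 (rshift 1 ord0) ^+ 2).

Definition holo_disk (d : nat) (f : Cplx -> Cn d) : Prop :=
  forall z : Cplx, cabs z < 1 ->
    differentiable f z /\ forall u : Cplx, 'd f z (cmul cI u) = cmul cI ('d f z u).

Definition kob_metric (d : nat) (Omega : set (Cn d)) (x v : Cn d) : \bar R :=
  ereal_inf [set (cabs xi)%:E | xi in
    [set xi : Cplx | exists f : Cplx -> Cn d,
        [/\ holo_disk f, (forall z, cabs z < 1 -> Omega (f z)),
            f 0 = x & 'd f 0 xi = v]]].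

Fixpoint iter_dir (U W : normedModType R) (vs : seq U) (f : U -> W) : U -> W :=
  match vs with
  | [::] => f
  | v :: vs' => fun x => 'D_v (iter_dir vs' f) x
  end.

Definition smooth (U W : normedModType R) (f : U -> W) : Prop :=
  forall vs : seq U, continuous (iter_dir vs f) /\
    forall (v x : U), derivable (iter_dir vs f) x v.

(* C^infty curves gamma : [0,1] -> Omega from x to y (given as restrictions of
   smooth maps R -> C^d) *)
Definition smooth_curve (d : nat) (Omega : set (Cn d)) (x y : Cn d)
    (gamma : R -> Cn d) : Prop :=
  [/\ smooth (gamma : R^o -> Cn d), (forall t, 0 <= t <= 1 -> Omega (gamma t)),
      gamma 0 = x & gamma 1 = y].

Definition kob_dist (d : nat) (Omega : set (Cn d)) (x y : Cn d) : \bar R :=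
  ereal_inf [set (\int[lebesgue_measure]_(t in `[0%R, 1%R])
                     kob_metric Omega (gamma t) ('D_1 (gamma : R^o -> Cn d) t))%E
            | gamma in smooth_curve Omega x y].

Definition geodesic (T : Type) (Omega : set T) (dist : T -> T -> \bar R)
    (sigma : R -> T) (a b : R) (x y : T) : Prop :=
  [/\ a <= b, sigma a = x, sigma b = y,
      (forall s, a <= s <= b -> Omega (sigma s)) &
      (forall s t, a <= s <= b -> a <= t <= b ->
         dist (sigma s) (sigma t) = (`|s - t|)%:E)].

Definition thin_side (T : Type) (dist : T -> T -> \bar R) (delta : R)
    (A B C : set T) : Prop :=
  forall p, A p -> exists q, (B `|` C) q /\ (dist p q <= delta%:E)%E.

Definition gromov_hyperbolic (T : Type) (Omega : set T)
    (dist : T -> T -> \bar R) : Prop :=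
  exists delta : R, 0 <= delta /\
    forall (x y z : T) (s1 s2 s3 : R -> T) (a1 b1 a2 b2 a3 b3 : R),
      geodesic Omega dist s1 a1 b1 x y ->
      geodesic Omega dist s2 a2 b2 y z ->
      geodesic Omega dist s3 a3 b3 z x ->
      let A := s1 @` `[a1, b1] in
      let B := s2 @` `[a2, b2] in
      let C := s3 @` `[a3, b3] in
      [/\ thin_side dist delta A B C, thin_side dist delta B A C &
          thin_side dist delta C A B].

Definition boundary (d : nat) (Omega : set (Cn d)) : set (Cn d) :=
  closure Omega `\` Omega.

Definition defining_function (d : nat) (Omega : set (Cn d)) (r : Cn d -> R^o)
  : Prop :=
  [/\ smooth r, Omega = [set x | r x < 0] &
      forall x, boundary Omega x -> exists v, 'd r x v != 0].

Definition smooth_boundary (d : nat) (Omega : set (Cn d)) : Prop :=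
  exists r, defining_function Omega r.

Definition vanish_order_le (g : Cplx -> R^o) (M : nat) : Prop :=
  exists vs : seq Cplx, (size vs <= M)%N /\ iter_dir vs g 0 != 0.

(* finite (line) type: the line type sup{nu(r o l)} is bounded over the
   boundary, l(zeta) = x + zeta w ranging over non-trivial complex affine
   maps with l(0) = x *)
Definition finite_type (d : nat) (Omega : set (Cn d)) : Prop :=
  exists r, defining_function Omega r /\
    exists M : nat, forall x, boundary Omega x -> forall w : Cn d, w != 0 ->
      vanish_order_le (fun zeta => r (x + cmul zeta w)) M.

End Defs.

(* Main.v *)
(* A convex domain is cut out by its supporting half-spaces [phi xi > 0], [xi] in the boundary; let
   [lam xi v] be the modulus of the complex-linear part of [phi xi] at [v].  The Schwarz lemma for a
   half-plane gives [lam xi v <= 2 phi xi x K(x; v)], and affine disks give [K(x; v) <= 1] as soon as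
   [lam xi v <= phi xi x] for all [xi]; so [K] is comparable to [sup_xi lam xi v / phi xi x].

   Finite type bounds [|r|] from below on complex disks by a power of their radius.  Hence moving a
   point of height [h] towards a base point [o], up to height [2^(nm) h], divides the length of every
   tangent vector by [2^n] up to a constant.  A geodesic therefore cannot stay low for long: it climbs
   along the ray from one end to [o] and descends along the ray from the other, triangles are close to
   tripods, and the space is hyperbolic.

   If the line type is infinite, compactness yields a boundary point [xi] and a complex direction [u]
   in which [r] vanishes to infinite order.  The largest disk in the direction [u] through the point at
   height [t] above [xi] then has a radius decaying slower than any power of [t], so on arbitrarily
   long ranges of scales it is almost constant.  Over such a range of length [n] there are two vertical
   paths at distance about [j] whose ends are [O(j)] apart, with [j] a small multiple of [n].  In a
   hyperbolic space a geodesic between the ends of one path would stay within [O(ln n)] of that path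
   and, away from its ends, of the other one, contradicting that they are [j] apart. *)
Require Import Defs.
From HB Require Import structures.
From mathcomp Require Import all_boot all_order all_algebra.
From mathcomp Require Import all_classical all_reals all_analysis.
From mathcomp Require Import ring lra zify.
Import Order.TTheory GRing.Theory Num.Theory.
Import numFieldNormedType.Exports.
Local Open Scope classical_set_scope.
Local Open Scope ring_scope.
Set Implicit Arguments. Unset Strict Implicit. Unset Printing Implicit Defensive.

(** * Calculus in one variable *)

(** The Kobayashi metric is never computed: every estimate passes through the quotients [lam / phi],
    which give it up to a factor 2, so both implications are proved by coarse arguments that survive
    bounded multiplicative errors. Relations between vertical rays lose a constant at each use; they
    stay usable because climbing higher by a bounded factor restores it, which is why the statements
    carry a height and not only a distance. The contraction comes from a doubling property: where
    the line type is bounded, [r] restricted to a complex line behaves like a polynomial of bounded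
    degree, so doubling a disk multiplies the bound on [|r|] by some [C0], and a climb of the order
    of [(2 * C0) ^ n] pays for a disk [2 ^ n] times larger. In the converse, hyperbolicity enters
    through geodesics, whose existence rests on the compactness of the sets cut out by
    [c * phi xi o <= phi xi z]. Disks are only assumed complex differentiable at each point, so the
    Schwarz lemma rests on Goursat's bisection. *)

Section OneVariable.
Variable R : realType.
Implicit Types f df F : R -> R.

Lemma is_derive_continuous_at f (x l : R) : is_derive x 1 f l -> {for x, continuous f}.
Proof. by move=> [/derivable1_diffP/differentiable_continuous]. Qed.

Lemma is_derive_within f df (a b : R) :
  (forall x, a <= x <= b -> is_derive x 1 f (df x)) -> {within `[a, b], continuous f}.
Proof.
move=> h; apply: continuous_in_subspaceT => x; rewrite inE/= in_itv/= => xab.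
exact: is_derive_continuous_at (h x xab).
Qed.

Lemma mvt_bound f df (a b m C : R) : a <= b ->
  (forall x, a <= x <= b -> is_derive x 1 f (df x)) ->
  (forall x, a <= x <= b -> `|df x - m| <= C) ->
  `|f b - f a - m * (b - a)| <= C * (b - a).
Proof.
rewrite le_eqVlt => /predU1P[-> _ _|ab hf hC]; first by rewrite !subrr !mulr0 subrr normr0.
have [|c cab ->] := @MVT R f df a b ab _ (is_derive_within hf).
  by move=> x; rewrite in_itv/= => /andP[ax xb]; apply: hf; rewrite !ltW.
have ab0 : 0 <= b - a by rewrite subr_ge0 ltW.
rewrite -mulrBl normrM (ger0_norm ab0); apply: ler_wpM2r => //.
by move: cab; rewrite in_itv/= => /andP[ax xb]; apply: hC; rewrite !ltW.
Qed.

(** Retraction of the line onto [[a, b]]: a function known to be continuous only there becomes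
    continuous everywhere after precomposition, as [primitive_ex] requires. *)
Definition clamp (a b x : R) := Num.min (Num.max a x) b.

Lemma clamp_id (a b x : R) : a <= x <= b -> clamp a b x = x.
Proof. by move=> /andP[ax xb]; rewrite /clamp max_r// min_l. Qed.

Lemma clamp_in (a b x : R) : a <= b -> a <= clamp a b x <= b.
Proof. by move=> ab; rewrite /clamp le_min ab le_max lexx/= ge_min lexx orbT. Qed.

Lemma clamp_continuous (a b : R) : continuous (clamp a b).
Proof.
move=> x; rewrite /clamp; apply: continuous_min => //; last exact: cst_continuous.
by apply: continuous_max => //; exact: cst_continuous.
Qed.

(** The fundamental theorem gives a primitive on each bounded interval. Normalised to vanish at 0,
    these agree wherever two of them are defined, and glue. *)
Lemma primitive_ex f : continuous f ->
  exists F, forall x : R, is_derive x 1 F (f x).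
Proof.
move=> cf.
have H (n : nat) : exists F : R -> R, (forall x : R, `|x| < n%:R + 1 -> is_derive x 1 F (f x)) /\ F 0 = 0.
  pose a : R := - (n%:R + 1); pose u : R := n%:R + 2.
  have fi : lebesgue_measure.-integrable `[a, u] (EFin \o f).
    apply: continuous_compact_integrable; first exact: segment_compact.
    exact: continuous_subspaceT.
  pose G (x : R) := (\int[lebesgue_measure]_(t in `[a, x]) f t)%R.
  exists (fun x => G x - G 0); split; last by rewrite subrr.
  move=> x; rewrite ltr_norml => /andP[ax xb].
  have xu : x < u by rewrite (lt_le_trans xb)// /u lerD2l ler1n.
  have [dG G'] := @continuous_FTC1_closed R f a x u xu fi ax (cf x).
  have iG : is_derive x 1 G (f x) by split; [exact: dG|rewrite -G' derive1E].
  by rewrite -(subr0 (f x)); apply: is_deriveB.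
have [F hF] := choice H.
pose N (x : R) := (Num.truncn `|x|).+1.
have NP (x : R) : `|x| < (N x)%:R by rewrite /N truncnS_gt.
have agree m n (x : R) : `|x| < m%:R -> `|x| < n%:R -> F m x = F n x.
  move=> xm xn; have [hm m0] := hF m; have [hn n0] := hF n.
  have key (y : R) : `|y| <= `|x| -> is_derive y 1 (fun z => F m z - F n z) 0.
    move=> yx; rewrite -(subrr (f y)); apply: is_deriveB.
      by apply: hm; rewrite (le_lt_trans yx)// (lt_trans xm)// ltrDl.
    by apply: hn; rewrite (le_lt_trans yx)// (lt_trans xn)// ltrDl.
  apply/eqP; rewrite -subr_eq0 -normr_le0.
  have [x0|x0] := leP 0 x.
    have := @mvt_bound (fun z => F m z - F n z) (fun=> 0) 0 x 0 0 x0.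
    rewrite m0 n0 !mul0r !subr0; apply.
      by move=> y /andP[y0 yx]; apply: key; rewrite !ger0_norm.
    by move=> *; rewrite normr0.
  have := @mvt_bound (fun z => F m z - F n z) (fun=> 0) x 0 0 0 (ltW x0).
  rewrite m0 n0 !mul0r subr0 sub0r subr0 normrN; apply.
    by move=> y /andP[yx y0]; apply: key; rewrite !ler0_norm ?lerN2// ltW.
  by move=> *; rewrite normr0.
exists (fun x => F (N x) x) => x.
have [hm _] := hF (N x).
have hx : is_derive x 1 (F (N x)) (f x) by apply: hm; rewrite (lt_trans (NP x))// ltrDl.
apply: (near_eq_is_derive _ hx).
have : \forall y \near x, `|y| < (N x)%:R.
  have : {for x, continuous (fun y : R => `|y|)} by exact: norm_continuous.
  by move=> /(_ _ (lt_nbhsl (NP x))).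
by apply: filterS => y yN; apply: agree.
Qed.

Lemma deq f (x f' l : R) : is_derive x 1 f f' -> f' = l -> is_derive x 1 f l.
Proof. by move=> + <-. Qed.
Lemma dC (k x : R) : is_derive x 1 (fun=> k) 0.
Proof. exact: is_derive_cst. Qed.
Lemma dI (x : R) : is_derive x 1 (fun x => x) 1.
Proof. exact: is_derive_id. Qed.
Lemma dD f g (x f' g' : R) : is_derive x 1 f f' -> is_derive x 1 g g' ->
  is_derive x 1 (fun x => f x + g x) (f' + g').
Proof. exact: is_deriveD. Qed.
Lemma dB f g (x f' g' : R) : is_derive x 1 f f' -> is_derive x 1 g g' ->
  is_derive x 1 (fun x => f x - g x) (f' - g').
Proof. exact: is_deriveB. Qed.
Lemma dM f g (x f' g' : R) : is_derive x 1 f f' -> is_derive x 1 g g' ->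
  is_derive x 1 (fun x => f x * g x) (f x * g' + g x * f').
Proof. exact: is_deriveM. Qed.
Lemma dMl k f (x f' : R) : is_derive x 1 f f' ->
  is_derive x 1 (fun x => k * f x) (k * f').
Proof. exact: is_deriveZ. Qed.
Lemma dV (x : R) : x != 0 -> is_derive x 1 (fun x => x^-1) (- x ^- 2).
Proof.
move=> x0; have h := differentiable_Rinv x0.
split; first exact/derivable1_diffP.
by rewrite (deriveE _ h) diff_Rinv// /GRing.scale/= mulr1.
Qed.

End OneVariable.

Lemma is_derive_chain (R : realType) (V W : normedModType R) (g : R -> V) (f : V -> W)
    (t : R) (g' : V) :
  is_derive t 1 g g' -> differentiable f (g t) ->
  is_derive t 1 (fun x => f (g x)) ('d f (g t) g').
Proof.
move=> [dg vg] df.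
have dg' : differentiable g t by apply/derivable1_diffP.
have dfg : differentiable (f \o g) t by apply: differentiable_comp.
split; first by apply/derivable1_diffP.
rewrite -[fun x => _]/(f \o g) deriveE// diff_comp//=; congr ('d f (g t) _).
by rewrite -deriveE.
Qed.

(** * The theorems of Goursat and Schwarz *)

Section GoursatAux.
Variable R : realType.
Implicit Types u v z t m M s : R.

Lemma dist_le_itv u v z t s : u <= z <= v -> u <= t <= v -> v - u <= s -> `|t - z| <= s.
Proof. by rewrite ler_norml => /andP[? ?] /andP[? ?] ?; apply/andP; split; lra. Qed.

Lemma sub_itv u v z m M : m <= u -> v <= M -> u <= z <= v -> m <= z <= M.
Proof. by move=> mu vM /andP[uz zv]; rewrite (le_trans mu uz) (le_trans zv vM). Qed.

Lemma norm_sub_sub u v z t s : `|u - z| <= s -> `|v - t| <= s -> `|u - v - (z - t)| <= 2 * s.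
Proof.
move=> hu hv; have -> : u - v - (z - t) = (u - z) - (v - t) by ring.
by apply: le_trans (ler_normB _ _) _; rewrite mulr_natl mulr2n lerD.
Qed.

End GoursatAux.

Section Goursat.
Variable R : realType.
Variables (P Q FP FQ : R -> R -> R) (a b c d : R).
Hypotheses (ab : a < b) (cd : c < d).
Hypothesis hP : forall x y, a <= x <= b -> c <= y <= d -> is_derive y 1 (FP x) (P x y).
Hypothesis hQ : forall x y, a <= x <= b -> c <= y <= d -> is_derive x 1 (FQ y) (Q x y).
Hypothesis hd : forall x y, a <= x <= b -> c <= y <= d -> exists p q q', forall e : R, 0 < e ->
  exists2 del : R, 0 < del & forall x' y' s : R, a <= x' <= b -> c <= y' <= d -> s <= del ->
    `|x' - x| <= s -> `|y' - y| <= s ->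
    `|P x' y' - P x y - p * (x' - x) - q * (y' - y)| <= e * s /\
    `|Q x' y' - Q x y - q' * (x' - x) - p * (y' - y)| <= e * s.

(** Circulation of the form [Q dx + P dy] around a rectangle, written with one-variable primitives.
    It is additive under subdivision. *)
Let E x1 x2 y1 y2 := (FP x2 y2 - FP x2 y1 - FP x1 y2 + FP x1 y1)
  - (FQ y2 x2 - FQ y2 x1 - FQ y1 x2 + FQ y1 x1).

(** The condition [dP/dx = dQ/dy] is the number [p] shared by both expansions in [hd]: the affine
    parts contribute [p * (x2 - x1) * (y2 - y1)] to each half of [E] and cancel, so only the
    remainders are left. *)
Let local_small (x y e : R) : a <= x <= b -> c <= y <= d -> 0 < e ->
  exists2 del : R, 0 < del & forall x1 x2 y1 y2 s : R, a <= x1 -> x1 <= x <= x2 -> x2 <= b ->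
    c <= y1 -> y1 <= y <= y2 -> y2 <= d -> s <= del -> x2 - x1 <= s -> y2 - y1 <= s ->
    `|E x1 x2 y1 y2| <= 4 * e * s ^+ 2.
Proof.
move=> xab ycd e0; have [p [q [q' /(_ e e0) [del del0 H]]]] := hd xab ycd.
exists del => // x1 x2 y1 y2 s ax1 /andP[x1x xx2] x2b cy1 /andP[y1y yy2] y2d sdel sx sy.
have xx : x1 <= x <= x2 by rewrite x1x.
have yy : y1 <= y <= y2 by rewrite y1y.
have x12 : x1 <= x2 by exact: le_trans xx2.
have y12 : y1 <= y2 by exact: le_trans yy2.
have s0 : 0 <= s by apply: le_trans sx; rewrite subr_ge0.
have X2 : x1 <= x2 <= x2 by rewrite x12 lexx.
have X1 : x1 <= x1 <= x2 by rewrite x12 lexx.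
have Y2 : y1 <= y2 <= y2 by rewrite y12 lexx.
have Y1 : y1 <= y1 <= y2 by rewrite y12 lexx.
have A1 : `|(FP x2 y2 - FP x1 y2) - (FP x2 y1 - FP x1 y1) - (p * (x2 - x1)) * (y2 - y1)|
    <= (2 * (e * s)) * (y2 - y1).
  apply: (@mvt_bound R (fun z => FP x2 z - FP x1 z) (fun z => P x2 z - P x1 z)) => // z zy.
    by apply: dB; apply: hP; [exact: sub_itv X2|exact: sub_itv zy|exact: sub_itv X1|exact: sub_itv zy].
  have HH t : x1 <= t <= x2 -> `|P t z - (P x y + p * (t - x) + q * (z - y))| <= e * s.
    move=> tx; have [] := H t z s (sub_itv ax1 x2b tx) (sub_itv cy1 y2d zy) sdel
      (dist_le_itv xx tx sx) (dist_le_itv yy zy sy).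
    by rewrite !opprD !addrA.
  have -> : p * (x2 - x1) = (P x y + p * (x2 - x) + q * (z - y)) - (P x y + p * (x1 - x) + q * (z - y)).
    by ring.
  by apply: norm_sub_sub; apply: HH.
have A2 : `|(FQ y2 x2 - FQ y1 x2) - (FQ y2 x1 - FQ y1 x1) - (p * (y2 - y1)) * (x2 - x1)|
    <= (2 * (e * s)) * (x2 - x1).
  apply: (@mvt_bound R (fun z => FQ y2 z - FQ y1 z) (fun z => Q z y2 - Q z y1)) => // z zx.
    by apply: dB; apply: hQ; [exact: sub_itv zx|exact: sub_itv Y2|exact: sub_itv zx|exact: sub_itv Y1].
  have HH t : y1 <= t <= y2 -> `|Q z t - (Q x y + q' * (z - x) + p * (t - y))| <= e * s.
    move=> ty; have [] := H z t s (sub_itv ax1 x2b zx) (sub_itv cy1 y2d ty) sdel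
      (dist_le_itv xx zx sx) (dist_le_itv yy ty sy).
    by rewrite !opprD !addrA.
  have -> : p * (y2 - y1) = (Q x y + q' * (z - x) + p * (y2 - y)) - (Q x y + q' * (z - x) + p * (y1 - y)).
    by ring.
  by apply: norm_sub_sub; apply: HH.
have es0 : 0 <= e * s by rewrite mulr_ge0// ltW.
have B1 : e * s * (y2 - y1) <= e * s * s by apply: ler_wpM2l.
have B2 : e * s * (x2 - x1) <= e * s * s by apply: ler_wpM2l.
have -> : 4 * e * s ^+ 2 = 4 * (e * s * s) by ring.
have C : E x1 x2 y1 y2 =
  ((FP x2 y2 - FP x1 y2) - (FP x2 y1 - FP x1 y1) - (p * (x2 - x1)) * (y2 - y1)) -
  ((FQ y2 x2 - FQ y1 x2) - (FQ y2 x1 - FQ y1 x1) - (p * (y2 - y1)) * (x2 - x1)).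
  by rewrite /E; ring.
rewrite C; apply: le_trans (ler_normB _ _) _; apply: le_trans (lerD A1 A2) _.
by rewrite -!(mulrA 2); move: B1 B2; lra.
Qed.

Let w n := (b - a) / 2 ^+ n.
Let h n := (d - c) / 2 ^+ n.

Let wS n : w n = w n.+1 + w n.+1.
Proof. by rewrite /w exprS invfM; lra. Qed.
Let hS n : h n = h n.+1 + h n.+1.
Proof. by rewrite /h exprS invfM; lra. Qed.
Let w0 n : 0 < w n. Proof. by rewrite divr_gt0 ?exprn_gt0 ?subr_gt0. Qed.
Let h0 n : 0 < h n. Proof. by rewrite divr_gt0 ?exprn_gt0 ?subr_gt0. Qed.

(** If the circulation had modulus [eps > 0], some quarter of the rectangle would carry a quarter of
    it, and so on; the nested rectangles shrink to a point where [local_small] gives a smaller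
    value. Only differentiability at each point is at hand, which rules out differentiating under
    the integral. *)
Lemma goursat : FP b d - FP b c - FP a d + FP a c = FQ d b - FQ d a - FQ c b + FQ c a.
Proof.
apply/eqP; rewrite -subr_eq0 -/(E a b c d); apply/eqP; apply: contrapT => /eqP E0.
pose eps := `|E a b c d|; have eps0 : 0 < eps by rewrite normr_gt0.
pose good n (z : R * R) := [/\ a <= z.1, z.1 + w n <= b, c <= z.2, z.2 + h n <= d &
   eps / 4 ^+ n <= `|E z.1 (z.1 + w n) z.2 (z.2 + h n)|].
have step (nz : nat * (R * R)) : exists z', good nz.1 nz.2 ->
    [/\ good nz.1.+1 z', nz.2.1 <= z'.1, z'.1 + w nz.1.+1 <= nz.2.1 + w nz.1,
      nz.2.2 <= z'.2 & z'.2 + h nz.1.+1 <= nz.2.2 + h nz.1].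
  case: nz => n [x y] /=.
  have [g|] := pselect (good n (x, y)); last by exists (x, y).
  case: (g) => /= g1 g2 g3 g4 g5.
  have w1 := w0 n.+1; have h1 := h0 n.+1.
  move: g2 g4 g5; rewrite wS hS => g2 g4 g5.
  have split4 : E x (x + (w n.+1 + w n.+1)) y (y + (h n.+1 + h n.+1)) =
     E x (x + w n.+1) y (y + h n.+1) +
     E (x + w n.+1) (x + w n.+1 + w n.+1) y (y + h n.+1) +
     E x (x + w n.+1) (y + h n.+1) (y + h n.+1 + h n.+1) +
     E (x + w n.+1) (x + w n.+1 + w n.+1) (y + h n.+1) (y + h n.+1 + h n.+1).
    by rewrite /E !addrA; ring.
  have e4 : eps / 4 ^+ n = 4 * (eps / 4 ^+ n.+1) by rewrite exprS invfM; field; rewrite expf_neq0.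
  pose t := eps / 4 ^+ n.+1.
  have fin x' y' : t <= `|E x' (x' + w n.+1) y' (y' + h n.+1)| ->
      x <= x' -> x' <= x + w n.+1 -> y <= y' -> y' <= y + h n.+1 ->
    exists z' : R * R, good n (x, y) ->
    [/\ good n.+1 z', x <= z'.1, z'.1 + w n.+1 <= x + (w n.+1 + w n.+1),
      y <= z'.2 & z'.2 + h n.+1 <= y + (h n.+1 + h n.+1)].
    move=> h1' h2' h3' h4' h5'; exists (x', y') => _.
    have hx : x' + w n.+1 <= x + (w n.+1 + w n.+1) by rewrite addrA lerD2r.
    have hy : y' + h n.+1 <= y + (h n.+1 + h n.+1) by rewrite addrA lerD2r.
    split => //; split => //=; first exact: le_trans h2'.
    - exact: le_trans hx g2.
    - exact: le_trans h4'.
    - exact: le_trans hy g4.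
  have [?|l1] := leP t `|E x (x + w n.+1) y (y + h n.+1)|; first by apply: (fin x y); rewrite ?lexx ?lerDl ?(ltW w1) ?(ltW h1).
  have [?|l2] := leP t `|E (x + w n.+1) (x + w n.+1 + w n.+1) y (y + h n.+1)|.
    by apply: (fin (x + w n.+1) y); rewrite ?lexx ?lerDl ?(ltW w1) ?(ltW h1).
  have [?|l3] := leP t `|E x (x + w n.+1) (y + h n.+1) (y + h n.+1 + h n.+1)|.
    by apply: (fin x (y + h n.+1)); rewrite ?lexx ?lerDl ?(ltW w1) ?(ltW h1).
  have [?|l4] := leP t `|E (x + w n.+1) (x + w n.+1 + w n.+1) (y + h n.+1) (y + h n.+1 + h n.+1)|.
    by apply: (fin (x + w n.+1) (y + h n.+1)); rewrite ?lexx ?lerDl ?(ltW w1) ?(ltW h1).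
  exfalso; move: g5; rewrite split4 e4 -/t leNgt => /negP; apply.
  apply: le_lt_trans (ler_normD _ _) _.
  have := ler_normD (E x (x + w n.+1) y (y + h n.+1) +
     E (x + w n.+1) (x + w n.+1 + w n.+1) y (y + h n.+1)) (E x (x + w n.+1) (y + h n.+1) (y + h n.+1 + h n.+1)).
  have := ler_normD (E x (x + w n.+1) y (y + h n.+1))
     (E (x + w n.+1) (x + w n.+1 + w n.+1) y (y + h n.+1)).
  by move: l1 l2 l3 l4; lra.
have [g hg] := choice step.
pose u := fix u n := if n is m.+1 then g (m, u m) else (a, c).
have ug n : good n (u n).
  elim: n => [|n IH]; last by have [] := hg (n, u n) IH.
  by rewrite /good /= /w /h expr0 !divr1 !subrKC /eps; split; rewrite // lexx.
have us n : [/\ (u n).1 <= (u n.+1).1, (u n.+1).1 + w n.+1 <= (u n).1 + w n,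
      (u n).2 <= (u n.+1).2 & (u n.+1).2 + h n.+1 <= (u n).2 + h n].
  by have [] := hg (n, u n) (ug n).
have lim (v wd : nat -> R) : (forall n, 0 < wd n) -> (forall n, v n <= v n.+1) ->
    (forall n, v n.+1 + wd n.+1 <= v n + wd n) -> exists l, forall n, v n <= l <= v n + wd n.
  move=> wd0 v1 v2; exists (sup (range v)) => n.
  have vi : {homo v : i j / (i <= j)%N >-> i <= j} by apply: homo_leq => // ? ? ?; apply: le_trans.
  have vd : {homo (fun i => v i + wd i) : i j / (i <= j)%N >-> j <= i}.
    by apply: (homo_leq (r := fun x y : R => y <= x)) => // ? ? ? p q; apply: le_trans q p.
  have ubn : ubound (range v) (v n + wd n).
    move=> _ [m _ <-]; have [mn|nm] := leqP m n.
      by apply: le_trans (vi _ _ mn) _; rewrite lerDl ltW.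
    by apply: le_trans (vd _ _ (ltnW nm)); rewrite lerDl ltW.
  apply/andP; split; last by apply: ge_sup => //; exists (v 0%N); exists 0%N.
  by apply: ub_le_sup; [exists (v n + wd n)|exists n].
have [x hx] := lim (fun n => (u n).1) w w0 (fun n => let: And4 p _ _ _ := us n in p) (fun n => let: And4 _ p _ _ := us n in p).
have [y hy] := lim (fun n => (u n).2) h h0 (fun n => let: And4 _ _ p _ := us n in p) (fun n => let: And4 _ _ _ p := us n in p).
have xab : a <= x <= b by have [] := ug 0%N; have := hx 0%N; lra.
have ycd : c <= y <= d by have [] := ug 0%N; have := hy 0%N; lra.
pose s := (b - a) + (d - c); have s0 : 0 < s by move: ab cd; rewrite /s; lra.
(* With this [e], the bound of [local_small] at step [n] is half of [eps / 4 ^+ n], the circulation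
   kept by the bisection. *)
pose e := eps / (8 * s ^+ 2).
have e0 : 0 < e by rewrite divr_gt0// mulr_gt0// exprn_gt0.
have [del del0 H] := local_small xab ycd e0.
have [n hn] : exists n, s / 2 ^+ n <= del.
  exists (Num.truncn (s / del)).+1.
  rewrite ler_pdivrMr ?exprn_gt0// mulrC -ler_pdivrMr//.
  apply: le_trans (ltW (truncnS_gt _)) _.
  by rewrite -natrX ler_nat ltnW// ltn_expl.
have [g1 g2 g3 g4 g5] := ug n.
have p2 : 0 < (2 ^+ n : R)^-1 by rewrite invr_gt0 exprn_gt0.
have := H (u n).1 ((u n).1 + w n) (u n).2 ((u n).2 + h n) (s / 2 ^+ n) g1 (hx n) g2 g3 (hy n) g4 hn.
have -> : (u n).1 + w n - (u n).1 <= s / 2 ^+ n.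
  by rewrite addrC addKr /w ler_pM2r//; move: ab cd; rewrite /s; lra.
have -> : (u n).2 + h n - (u n).2 <= s / 2 ^+ n.
  by rewrite addrC addKr /h ler_pM2r//; move: ab cd; rewrite /s; lra.
move=> /(_ isT isT) /(le_trans g5); apply/negP; rewrite -ltNge.
have -> : 4 * e * (s / 2 ^+ n) ^+ 2 = (eps / 4 ^+ n) / 2.
  have -> : (4 : R) ^+ n = (2 ^+ n) ^+ 2 by rewrite -exprM mulnC exprM; congr (_ ^+ _); ring.
  rewrite /e; field; rewrite expf_neq0//=; lra.
by rewrite ltr_pdivrMr// ltr_pMr ?divr_gt0 ?exprn_gt0//; lra.
Qed.

End Goursat.

Section CurveDerive.
Variable R : realType.

Lemma is_derive_scale_const (V : normedModType R) (k : R -> R) (v : V) (t k' : R) :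
  is_derive t 1 k k' -> is_derive t 1 (fun x => k x *: v) (k' *: v).
Proof.
move=> [dk vk]; have dk' : differentiable k t by apply/derivable1_diffP.
split; first by apply/derivable1_diffP/differentiableZl.
rewrite deriveE; last exact: differentiableZl.
by rewrite diffZl//= -deriveE// vk.
Qed.

Lemma is_derive_add (V : normedModType R) (f g : R -> V) (t : R) (f' g' : V) :
  is_derive t 1 f f' -> is_derive t 1 g g' -> is_derive t 1 (fun x => f x + g x) (f' + g').
Proof. exact: is_deriveD. Qed.

Lemma is_derive_line (V : normedModType R) (u v : V) (t : R) :
  is_derive t 1 (fun x : R => u + x *: v) v.
Proof.
rewrite -[v in is_derive _ _ _ v]add0r -[X in 0 + X]scale1r.
by apply: is_derive_add; apply: is_derive_scale_const.
Qed.

End CurveDerive.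

Section LinAt.
Variable R : realType.

Lemma diff_eps (V W : normedModType R) (f : V -> W) (x : V) : differentiable f x ->
  forall e : R, 0 < e -> exists2 del : R, 0 < del &
    forall h : V, `|h| < del -> `|f (h + x) - (f x + 'd f x h)| <= e * `|h|.
Proof.
move=> df e e0; have := diff_locally df; move=> /eqaddoP /(_ e e0).
move=> /nbhs_ballP[r /= r0 hr]; exists r => // h hh.
have := hr h; rewrite -ball_normE /= sub0r normrN; exact.
Qed.

Lemma diff_expansion (f : R * R -> R) (x y p q : R) : differentiable f (x, y) ->
  is_derive x 1 (fun t : R => f (t, y)) p -> is_derive y 1 (fun t : R => f (x, t)) q ->
  forall e : R, 0 < e -> exists2 del : R, 0 < del & forall x' y' s : R, s <= del ->
    `|x' - x| <= s -> `|y' - y| <= s ->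
    `|f (x', y') - f (x, y) - p * (x' - x) - q * (y' - y)| <= e * s.
Proof.
move=> df hp hq e e0.
have E (u v : R * R) (k : R) l : u + k *: v = (x, y) ->
    is_derive k 1 (fun t : R => f (u + t *: v)) l -> 'd f (x, y) v = l.
  move=> uv [_ <-]; have dl := is_derive_line u v k.
  have dfk : differentiable f (u + k *: v) by rewrite uv.
  by have [_ ->] := is_derive_chain dl dfk; rewrite uv.
have lE1 (t : R) : (0, y) + t *: (1, 0) = (t, y) :> R * R.
  by congr pair => /=; rewrite /GRing.scale/= ?mulr0 ?mulr1 ?addr0 ?add0r.
have lE2 (t : R) : (x, 0) + t *: (0, 1) = (x, t) :> R * R.
  by congr pair => /=; rewrite /GRing.scale/= ?mulr0 ?mulr1 ?addr0 ?add0r.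
have E1 : 'd f (x, y) (1, 0) = p.
  apply: (E (0, y) _ x) => //; rewrite [X in is_derive _ _ X _](_ : _ = fun t : R => f (t, y))//.
  by apply/funext => t; rewrite lE1.
have E2 : 'd f (x, y) (0, 1) = q.
  apply: (E (x, 0) _ y) => //; rewrite [X in is_derive _ _ X _](_ : _ = fun t : R => f (x, t))//.
  by apply/funext => t; rewrite lE2.
have [r r0 hr] := diff_eps df e0.
exists (r / 2) => [|x' y' s sr hx hy]; first by rewrite divr_gt0.
have nle : `|(x' - x, y' - y) : R * R| <= s.
  by rewrite /Num.norm /= ge_max hx hy.
have := hr (x' - x, y' - y); rewrite (le_lt_trans nle); last first.
  by rewrite (le_lt_trans sr)// ltr_pdivrMr// ltr_pMr// ltr1n.
move=> /(_ isT) H; apply: le_trans (ler_wpM2l (ltW e0) nle).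
apply: le_trans H; rewrite le_eqVlt; apply/orP; left; apply/eqP; congr (`|_|).
have -> : (x' - x, y' - y) + (x, y) = (x' - x + x, y' - y + y) :> R * R by [].
rewrite !subrK; have -> : 'd f (x, y) (x' - x, y' - y) = p * (x' - x) + q * (y' - y).
  have -> : (x' - x, y' - y) = (x' - x) *: (1, 0) + (y' - y) *: (0, 1) :> R * R.
    by congr pair => /=; rewrite /GRing.scale/= ?mulr0 ?mulr1 ?addr0 ?add0r.
  by rewrite linearD !linearZ/= E1 E2; congr (_ + _); exact: mulrC.
by rewrite !opprD !addrA.
Qed.

End LinAt.

(** * Schwarz lemma for functions with values in a half-plane *)

Section HalfPlane.
Variable R : realType.
Local Notation C := (Cplx R).

Definition c1 : C := row_mx 1 0.
Local Notation J := (cmul (cI R)).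

Lemma cmul_cI (d : nat) (z : Cn R d) : cmul (cI R) z = row_mx (- rsubmx z) (lsubmx z).
Proof.
rewrite /cmul /cI row_mxEl row_mxEr !mxE eqxx/= scale0r scale1r sub0r scale0r add0r scale1r.
by [].
Qed.

Lemma cmul_cI_cI (d : nat) (z : Cn R d) : J (J z) = - z.
Proof. by rewrite !cmul_cI row_mxKl row_mxKr -opp_row_mx hsubmxK. Qed.

Lemma J_c1 : J c1 = cI R.
Proof. by rewrite cmul_cI /c1 row_mxKl row_mxKr oppr0. Qed.

Lemma J_cI : J (cI R) = - c1.
Proof. by have := cmul_cI_cI c1; rewrite J_c1. Qed.

Lemma cabs_coord (x y : R) : cabs (x *: c1 + y *: cI R) = Num.sqrt (x ^+ 2 + y ^+ 2).
Proof.
rewrite /cabs /c1 /cI !scale_row_mx !scaler0 add_row_mx add0r addr0 row_mxEl row_mxEr.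
by rewrite !mxE eqxx/= !mulr1.
Qed.

Lemma cplxE (z : C) : exists x y : R, z = x *: c1 + y *: cI R.
Proof.
exists (z ord0 (lshift 1 ord0)), (z ord0 (rshift 1 ord0)).
rewrite /c1 /cI !scale_row_mx !scaler0 add_row_mx add0r addr0 -[LHS]hsubmxK.
by congr row_mx; apply/matrixP => i j; rewrite !ord1 !mxE eqxx/= mulr1.
Qed.

Definition cis (t : R) : C := cos t *: c1 + sin t *: cI R.
Definition cis' (t : R) : C := (- sin t) *: c1 + cos t *: cI R.

Lemma cabs_cis (r t : R) : 0 <= r -> cabs (r *: cis t) = r.
Proof.
move=> r0; rewrite /cis scalerDr !scalerA cabs_coord !exprMn -mulrDr cos2Dsin2 mulr1.
by rewrite sqrtr_sqr ger0_norm.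
Qed.

Lemma cmul_lin (d : nat) (z : C) (a b : R) (u v : Cn R d) :
  cmul z (a *: u + b *: v) = a *: cmul z u + b *: cmul z v.
Proof.
rewrite /cmul; set p := z _ _; set q := z _ _.
rewrite !scale_row_mx add_row_mx; congr row_mx; apply/rowP => i; rewrite !mxE; ring.
Qed.

Lemma J_cis t : J (cis t) = cis' t.
Proof. by rewrite /cis cmul_lin J_c1 J_cI /cis' scalerN scaleNr addrC. Qed.

Lemma J_cis' t : J (cis' t) = - cis t.
Proof. by rewrite -J_cis cmul_cI_cI. Qed.

Lemma is_derive_cis (t : R) : is_derive t 1 cis (cis' t).
Proof.
by apply: is_derive_add; apply: is_derive_scale_const.
Qed.

Section Schwarz.
Variables (A B : C -> R).
Hypothesis diffA : forall z, cabs z < 1 -> differentiable A z.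
Hypothesis diffB : forall z, cabs z < 1 -> differentiable B z.
Hypothesis CR : forall z u, cabs z < 1 -> 'd B z u = - 'd A z (J u).
Hypothesis A0 : forall z, cabs z < 1 -> 0 <= A z.
Hypothesis B0 : B 0 = 0.

Variable rho : R.
Hypothesis rho01 : 0 < rho < 1.

(* [P] is the real part and [r * Q] the imaginary part of [(A + i B) (1 - (z / rho + rho / z) / 2)]
   at [z = r e^(it)]: the multiplier is [1 - cos t] on the circle [r = rho]. *)
Let rhon0 : rho != 0. Proof. by case/andP: rho01 => h _; rewrite gt_eqF. Qed.
Let al (r : R) := (r * rho^-1 + rho * r^-1) / 2.
Let be (r : R) := (r * rho^-1 - rho * r^-1) / 2.
Let P (r t : R) := A (r *: cis t) * (1 - al r * cos t) + B (r *: cis t) * (be r * sin t).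
Let Q (r t : R) := (B (r *: cis t) * (1 - al r * cos t) - A (r *: cis t) * (be r * sin t)) * r^-1.

Let in_disk (r t : R) : 0 < r -> r <= rho -> cabs (r *: cis t) < 1.
Proof.
by move=> r0 rr; rewrite cabs_cis ?ltW//; case/andP: rho01 => _; apply: le_lt_trans.
Qed.

Let is_derive_r (F : C -> R) (r t : R) : differentiable F (r *: cis t) ->
  is_derive r 1 (fun r => F (r *: cis t)) ('d F (r *: cis t) (cis t)).
Proof.
move=> dF; apply: is_derive_chain => //.
by have := is_derive_scale_const (cis t) (dI r); rewrite scale1r.
Qed.

Let is_derive_t (F : C -> R) (r t : R) : differentiable F (r *: cis t) ->
  is_derive t 1 (fun t => F (r *: cis t)) (r * 'd F (r *: cis t) (cis' t)).
Proof.
move=> dF; have := @is_derive_chain R _ _ (fun t => r *: cis t) F t (r *: cis' t).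
rewrite linearZ; apply => //.
by have := is_deriveZ r (is_derive_cis t); apply.
Qed.

Let dal (r : R) : 0 < r -> is_derive r 1 al (be r * r^-1).
Proof.
move=> r0; have rn0 : r != 0 by rewrite gt_eqF.
have h := dMl 2^-1 (dD (dMl rho^-1 (dI r)) (dMl rho (dV rn0))).
have -> : al = fun x => 2^-1 * (rho^-1 * x + rho * x^-1) by apply/funext => x; rewrite /al; ring.
by apply: (deq h); rewrite /be; field; rewrite rn0 rhon0.
Qed.

Let dbe (r : R) : 0 < r -> is_derive r 1 be (al r * r^-1).
Proof.
move=> r0; have rn0 : r != 0 by rewrite gt_eqF.
have h := dMl 2^-1 (dB (dMl rho^-1 (dI r)) (dMl rho (dV rn0))).
have -> : be = fun x => 2^-1 * (rho^-1 * x - rho * x^-1) by apply/funext => x; rewrite /be; ring.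
by apply: (deq h); rewrite /al; field; rewrite rn0 rhon0.
Qed.

(** The value is literally that of [Qt] below. This is the Cauchy-Riemann equation in polar
    coordinates: [Q dr + P dt] is the imaginary part of the holomorphic function times [dz / z]. *)
Let Pr (r t : R) : 0 < r -> r <= rho ->
  is_derive r 1 (fun r => P r t) ('d A (r *: cis t) (cis t) * (1 - al r * cos t)
    - 'd A (r *: cis t) (cis' t) * (be r * sin t)
    + (B (r *: cis t) * al r * sin t - A (r *: cis t) * be r * cos t) * r^-1).
Proof.
move=> r0 rr; have dk := in_disk t r0 rr.
have ha := is_derive_r (diffA dk); have hb := is_derive_r (diffB dk).
have h := dD (dM ha (dB (dC 1 r) (dM (dal r0) (dC (cos t) r)))) (dM hb (dM (dbe r0) (dC (sin t) r))).
apply: (deq h); rewrite (CR _ dk) J_cis; ring.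
Qed.

Let Qt (r t : R) : 0 < r -> r <= rho ->
  is_derive t 1 (fun t => Q r t) ('d A (r *: cis t) (cis t) * (1 - al r * cos t)
    - 'd A (r *: cis t) (cis' t) * (be r * sin t)
    + (B (r *: cis t) * al r * sin t - A (r *: cis t) * be r * cos t) * r^-1).
Proof.
move=> r0 rr; have dk := in_disk t r0 rr.
have rn0 : r != 0 by rewrite gt_eqF.
have ha := is_derive_t (diffA dk); have hb := is_derive_t (diffB dk).
have h := dM (dB (dM hb (dB (dC 1 t) (dM (dC (al r) t) (is_derive_cos t))))
  (dM ha (dM (dC (be r) t) (is_derive_sin t)))) (dC r^-1 t).
apply: (deq h); rewrite (CR _ dk) J_cis' linearN opprK; field.
by [].
Qed.

Let Pt (r t : R) : 0 < r -> r <= rho -> exists l, is_derive t 1 (fun t => P r t) l.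
Proof.
move=> r0 rr; have dk := in_disk t r0 rr.
have ha := is_derive_t (diffA dk); have hb := is_derive_t (diffB dk).
have h := dD (dM ha (dB (dC 1 t) (dM (dC (al r) t) (is_derive_cos t))))
  (dM hb (dM (dC (be r) t) (is_derive_sin t))).
by eexists; exact: h.
Qed.

Let Qr (r t : R) : 0 < r -> r <= rho -> exists l, is_derive r 1 (fun r => Q r t) l.
Proof.
move=> r0 rr; have dk := in_disk t r0 rr.
have rn0 : r != 0 by rewrite gt_eqF.
have ha := is_derive_r (diffA dk); have hb := is_derive_r (diffB dk).
have h := dM (dB (dM hb (dB (dC 1 r) (dM (dal r0) (dC (cos t) r))))
  (dM ha (dM (dbe r0) (dC (sin t) r)))) (dV rn0).
by eexists; exact: h.
Qed.

Let dfst (z : R * R) : differentiable (fun z : R * R => z.1) z.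
Proof. by apply: (@linear_differentiable _ _ _ fst) => x; exact: cvg_fst. Qed.
Let dsnd (z : R * R) : differentiable (fun z : R * R => z.2) z.
Proof. by apply: (@linear_differentiable _ _ _ snd) => x; exact: cvg_snd. Qed.

Let d1 (f : R -> R) (r t l : R) : is_derive r 1 f l ->
  differentiable (fun z : R * R => f z.1) (r, t).
Proof.
move=> [/derivable1_diffP df _].
exact: (@differentiable_comp _ _ _ _ (fun z : R * R => z.1) f).
Qed.
Let d2 (f : R -> R) (r t l : R) : is_derive t 1 f l ->
  differentiable (fun z : R * R => f z.2) (r, t).
Proof.
move=> [/derivable1_diffP df _].
exact: (@differentiable_comp _ _ _ _ (fun z : R * R => z.2) f).
Qed.

Let dpol (r t : R) : differentiable (fun z : R * R => z.1 *: cis z.2) (r, t).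
Proof.
have -> : (fun z : R * R => z.1 *: cis z.2) =
    (fun z => (z.1 * cos z.2) *: c1 + (z.1 * sin z.2) *: cI R).
  by apply/funext => z; rewrite /cis scalerDr !scalerA.
apply: differentiableD; apply: differentiableZl; apply: differentiableM => //.
  exact: d2 (is_derive_cos t).
exact: d2 (is_derive_sin t).
Qed.

Let dF (F : C -> R) (r t : R) : differentiable F (r *: cis t) ->
  differentiable (fun z : R * R => F (z.1 *: cis z.2)) (r, t).
Proof. exact: (@differentiable_comp _ _ _ _ (fun z : R * R => z.1 *: cis z.2) F _ (dpol r t)). Qed.

Let dP (r t : R) : 0 < r -> r <= rho -> differentiable (fun z : R * R => P z.1 z.2) (r, t).
Proof.
move=> r0 rr; have dk := in_disk t r0 rr.
apply: differentiableD; apply: differentiableM.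
- exact: dF (diffA dk).
- apply: differentiableB; first exact: differentiable_cst.
  by apply: differentiableM; [exact: d1 (dal r0)|exact: d2 (is_derive_cos t)].
- exact: dF (diffB dk).
- by apply: differentiableM; [exact: d1 (dbe r0)|exact: d2 (is_derive_sin t)].
Qed.

Let dQ (r t : R) : 0 < r -> r <= rho -> differentiable (fun z : R * R => Q z.1 z.2) (r, t).
Proof.
move=> r0 rr; have dk := in_disk t r0 rr.
apply: differentiableM; last by apply: (@d1 (fun x => x^-1)); apply: dV; rewrite gt_eqF.
apply: differentiableB; apply: differentiableM.
- exact: dF (diffB dk).
- apply: differentiableB; first exact: differentiable_cst.
  by apply: differentiableM; [exact: d1 (dal r0)|exact: d2 (is_derive_cos t)].
- exact: dF (diffA dk).
- by apply: differentiableM; [exact: d1 (dbe r0)|exact: d2 (is_derive_sin t)].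
Qed.

Let twopi : R := 2 * pi.
Let twopi0 : 0 < twopi. Proof. by rewrite mulr_gt0 ?pi_gt0. Qed.
Let cos_twopi : cos twopi = 1. Proof. by rewrite /twopi mulr_natl cos2pi. Qed.
Let sin_twopi : sin twopi = 0. Proof. by rewrite /twopi mulr_natl sin2pi. Qed.

(** Cauchy's theorem on an annulus. In polar coordinates this is a rectangle whose sides [t = 0] and
    [t = 2 pi] contribute equally because [Q] is periodic; hence [P] has the same integral over the
    circles of radii [rho] and [eps]. *)
Let mean_const (eps : R) : 0 < eps -> eps < rho -> exists F G : R -> R,
  [/\ forall t : R, is_derive t 1 F (P rho t), forall t : R, is_derive t 1 G (P eps t)
    & F twopi - F 0 = G twopi - G 0].
Proof.
move=> e0 er.
have inr r : eps <= r <= rho -> 0 < r /\ r <= rho.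
  by move=> /andP[h ->]; split => //; exact: lt_le_trans h.
have [FP hFP] : exists FP : R -> R -> R, forall r t : R, eps <= r <= rho ->
    is_derive t 1 (FP r) (P r t).
  suff H0 (r : R) : exists F : R -> R, forall t : R, eps <= r <= rho -> is_derive t 1 F (P r t).
    by have [FP h] := choice H0; exists FP.
  have [h|h] := pselect (eps <= r <= rho); last by exists id => t ?.
  have [r0 rr] := inr _ h.
  have [F hF] : exists F : R -> R, forall t : R, is_derive t 1 F (P r t).
    by apply: primitive_ex => t; have [l /is_derive_continuous_at] := Pt t r0 rr.
  by exists F => t _.
have [FQ hFQ] : exists FQ : R -> R -> R, forall t r : R, eps <= r <= rho ->
    is_derive r 1 (FQ t) (Q r t).
  suff H0 (t : R) : exists F : R -> R, forall r : R, eps <= r <= rho -> is_derive r 1 F (Q r t).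
    by have [FQ h] := choice H0; exists FQ.
  (* The clamped radius stays away from 0, where [Q] is singular. *)
  have [F hF] : exists F : R -> R, forall r : R, is_derive r 1 F (Q (clamp eps rho r) t).
    apply: (@primitive_ex _ (fun r => Q (clamp eps rho r) t)) => r.
    have [c0 cr] := inr _ (clamp_in r (ltW er)).
    have [l /is_derive_continuous_at cQ] := Qr t c0 cr.
    exact: (@continuous_comp _ _ _ (clamp eps rho) (Q^~ t) r (@clamp_continuous R eps rho r) cQ).
  by exists F => r h; have := hF r; rewrite clamp_id.
have := @goursat R P Q FP FQ eps rho 0 twopi er twopi0.
move=> /(_ (fun r t h _ => hFP r t h) (fun r t h _ => hFQ t r h)) H.
exists (FP rho), (FP eps); split.
- by move=> t; apply: hFP; rewrite lexx ltW.
- by move=> t; apply: hFP; rewrite lexx ltW.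
have Q2 r : Q r twopi = Q r 0.
  by rewrite /Q /cis cos_twopi sin_twopi cos0 sin0.
have FQ2 : FQ twopi rho - FQ 0 rho - (FQ twopi eps - FQ 0 eps) = 0.
  apply/eqP; rewrite -normr_le0.
  have := @mvt_bound R (fun r => FQ twopi r - FQ 0 r) (fun r => Q r twopi - Q r 0)
    eps rho 0 0 (ltW er).
  rewrite !mul0r subr0; apply.
    by move=> r h; apply: dB; apply: hFQ.
  by move=> r _; rewrite Q2 subrr subr0 normr0.
suff /H : forall x y, eps <= x <= rho -> 0 <= y <= twopi -> exists p q q', forall e : R, 0 < e ->
   exists2 del : R, 0 < del & forall x' y' s : R, eps <= x' <= rho -> 0 <= y' <= twopi -> s <= del ->
    `|x' - x| <= s -> `|y' - y| <= s ->
    `|P x' y' - P x y - p * (x' - x) - q * (y' - y)| <= e * s /\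
    `|Q x' y' - Q x y - q' * (x' - x) - p * (y' - y)| <= e * s.
  by move: FQ2; lra.
move=> r t hr ht; have [r0 rr] := inr _ hr.
have pr := Pr t r0 rr; have qt := Qt t r0 rr.
have [pt hpt] := Pt t r0 rr; have [qr hqr] := Qr t r0 rr.
set p := (X in is_derive r 1 _ X) in pr; rewrite -/p in qt.
exists p, pt, qr => e ep.
have [del1 del10 H1] := diff_expansion (dP t r0 rr) pr hpt ep.
have [del2 del20 H2] := diff_expansion (dQ t r0 rr) hqr qt ep.
exists (Num.min del1 del2); first by rewrite lt_min del10.
move=> x' y' s _ _; rewrite le_min => /andP[s1 s2] hx hy.
by split; [exact: H1|exact: H2].
Qed.

(** On the circle of radius [rho] the multiplier is [1 - cos t >= 0], so the mean of [P] there is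
    nonnegative. By [mean_const] the mean is the same on tiny circles, where the first-order
    expansion at 0 gives [A 0 - rho * 'd A 0 c1 / 2]. *)
Lemma schwarz_halfplane_radial : rho * 'd A 0 c1 <= 2 * A 0.
Proof.
set ax : R := 'd A 0 c1; set ay : R := 'd A 0 (cI R).
have d0 : cabs (0 : C) < 1 by have := @cabs_cis 0 0 (lexx _); rewrite scale0r => ->.
have [rho0 rho1] := andP rho01.
suff H (e : R) : 0 < e -> 0 <= A 0 - rho * ax / 2 + 3 * e.
  apply/ler_addgt0Pr => e e0; have := H (e / 6); rewrite divr_gt0// => /(_ isT); lra.
move=> e0; pose K : R := `|c1 : C| + `|cI R : C| + 1.
have K0 : 0 < K by rewrite ltr_pwDr// addr_ge0.
have eK : 0 < e / K by rewrite divr_gt0.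
have [de1 de10 H1] := diff_eps (diffA d0) eK.
have [de2 de20 H2] := diff_eps (diffB d0) eK.
(* So small that the first-order errors of [A] and [B] are at most [e * r]; the factor [r] offsets
   the growth of the multiplier, which is of the order of [rho / r]. *)
pose r := Num.min (rho / 2) (Num.min (de1 / (2 * K)) (de2 / (2 * K))).
have r0 : 0 < r by rewrite !lt_min !divr_gt0// mulr_gt0.
have rlt : r < rho by rewrite gt_min ltr_pdivrMr// ltr_pMr// ltr1n.
have npol (t : R) : `|r *: cis t| <= r * K.
  rewrite normrZ gtr0_norm//; apply: ler_wpM2l; first exact: ltW.
  apply: le_trans (ler_normD _ _) _; rewrite !normrZ /K.
  have hc : `|cos t| <= 1 by rewrite ler_norml cos_geN1 cos_le1.
  have hs : `|sin t| <= 1 by rewrite ler_norml sin_geN1 sin_le1.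
  have h1 := ler_wpM2r (normr_ge0 (c1 : C)) hc.
  have h2 := ler_wpM2r (normr_ge0 (cI R : C)) hs.
  by apply: le_trans (lerD h1 h2) _; rewrite !mul1r lerDl.
have rK (de : R) : 0 < de -> r <= de / (2 * K) -> r * K < de.
  move=> de0; rewrite ler_pdivlMr ?mulr_gt0// => h; have := mulr_gt0 r0 K0; lra.
have rK1 : r * K < de1 by apply: rK => //; rewrite !ge_min lexx !orbT.
have rK2 : r * K < de2 by apply: rK => //; rewrite !ge_min lexx !orbT.
have bound (t v : R) : v <= e / K * `|r *: cis t| -> v <= e * r.
  move=> /le_trans; apply; rewrite mulrAC ler_pdivrMr// -mulrA.
  by apply: ler_wpM2l; [exact: ltW|exact: npol].
have dAc (t : R) : 'd A 0 (r *: cis t) = r * (cos t * ax + sin t * ay).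
  by rewrite linearZ/= /cis linearD !linearZ.
have dBc (t : R) : 'd B 0 (r *: cis t) = r * (sin t * ax - cos t * ay).
  rewrite linearZ/= CR// J_cis /cis' linearD !linearZ/= -/ax -/ay /GRing.scale/=; ring.
have EA (t : R) : `|A (r *: cis t) - (A 0 + r * (cos t * ax + sin t * ay))| <= e * r.
  apply: (bound t); rewrite -dAc -[in A (r *: _)](addr0 (r *: cis t)); apply: H1.
  exact: le_lt_trans (npol t) rK1.
have EB (t : R) : `|B (r *: cis t) - r * (sin t * ax - cos t * ay)| <= e * r.
  have := H2 (r *: cis t) (le_lt_trans (npol t) rK2); rewrite B0 add0r addr0 dBc.
  exact: bound.
have [F [G [hF hG FG]]] := mean_const r0 rlt.
(* Explicit primitive of [m], which is [P r] with [A] and [B] replaced by their affine parts at 0.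
   Only the term linear in [t] survives over a period. *)
pose M (t : R) := (A 0 - rho * ax / 2) * t + (r * ax - al r * A 0) * sin t - r * ay * cos t
   - (r ^+ 2 / (2 * rho)) * ax * (sin t * cos t) - (r ^+ 2 / (2 * rho)) * ay * (sin t * sin t).
pose m (t : R) := (A 0 + r * (cos t * ax + sin t * ay)) * (1 - al r * cos t)
   + r * (sin t * ax - cos t * ay) * (be r * sin t).
have rn0 : r != 0 by rewrite gt_eqF.
have hM (t : R) : is_derive t 1 M (m t).
  have hc := is_derive_cos t; have hs := is_derive_sin t.
  have h := dB (dB (dB (dD (dMl (A 0 - rho * ax / 2) (dI t)) (dMl (r * ax - al r * A 0) hs))
    (dMl (r * ay) hc)) (dMl (r ^+ 2 / (2 * rho) * ax) (dM hs hc)))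
    (dMl (r ^+ 2 / (2 * rho) * ay) (dM hs hs)).
  apply: (deq h); rewrite /m /al /be; have := cos2Dsin2 t.
  move: (cos t) (sin t) => c s cs.
  have -> : A 0 - rho * ax / 2 = A 0 - rho * ax / 2 * (c ^+ 2 + s ^+ 2) by rewrite cs mulr1.
  by field; rewrite rn0 rhon0.
have alr : 0 <= al r * r <= 1.
  have -> : al r * r = (r * r / rho + rho) / 2 by rewrite /al; field; rewrite rn0 rhon0.
  have h : r * r / rho <= rho by rewrite ler_pdivrMr//; apply: ler_pM; exact: ltW.
  have h' : 0 <= r * r / rho by apply: divr_ge0; [apply: mulr_ge0|]; exact: ltW.
  by apply/andP; split; lra.
have ber : `|be r * r| <= 1.
  have -> : be r * r = (r * r / rho - rho) / 2 by rewrite /be; field; rewrite rn0 rhon0.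
  have h : r * r / rho <= rho by rewrite ler_pdivrMr//; apply: ler_pM; exact: ltW.
  have h' : 0 <= r * r / rho by apply: divr_ge0; [apply: mulr_ge0|]; exact: ltW.
  by rewrite ler_norml; apply/andP; split; lra.
have est (t : R) : `|P r t - m t| <= 3 * e.
  have -> : P r t - m t = (A (r *: cis t) - (A 0 + r * (cos t * ax + sin t * ay))) * (1 - al r * cos t)
      + (B (r *: cis t) - r * (sin t * ax - cos t * ay)) * (be r * sin t).
    by rewrite /P /m; ring.
  have hc : `|cos t| <= 1 by rewrite ler_norml cos_geN1 cos_le1.
  have hs : `|sin t| <= 1 by rewrite ler_norml sin_geN1 sin_le1.
  apply: le_trans (ler_normD _ _) _.
  rewrite (normrM (A _ - _)) (normrM (B _ - _)) (normrM (be r)).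
  have b1 : r * `|1 - al r * cos t| <= 2.
    rewrite -[X in X * _](gtr0_norm r0) -normrM.
    have -> : r * (1 - al r * cos t) = r - (al r * r) * cos t by ring.
    apply: le_trans (ler_normB _ _) _; rewrite gtr0_norm// normrM.
    case/andP: alr => al0 al1; rewrite (ger0_norm al0).
    have : al r * r * `|cos t| <= 1 by rewrite -[leRHS]mulr1 ler_pM.
    lra.
  have b2 : r * (`|be r| * `|sin t|) <= 1.
    rewrite -[X in X * _](gtr0_norm r0) mulrA -normrM mulrC (mulrC r).
    by rewrite -[leRHS]mulr1 ler_pM.
  have := ler_wpM2r (normr_ge0 (1 - al r * cos t)) (EA t).
  have := ler_wpM2r (mulr_ge0 (normr_ge0 (be r)) (normr_ge0 (sin t))) (EB t).
  have := ler_wpM2l (ltW e0) b1; have := ler_wpM2l (ltW e0) b2.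
  move=> h3 h4 h2 h1; apply: le_trans (lerD h1 h2) _.
  by move: h3 h4; rewrite !(mulrA e); lra.
have : `|G twopi - M twopi - (G 0 - M 0) - 0 * (twopi - 0)| <= 3 * e * (twopi - 0).
  apply: (@mvt_bound R (fun t => G t - M t) (fun t => P r t - m t)); first exact: ltW.
  by move=> t _; rewrite subr0; exact: est.
rewrite mul0r !subr0.
have F0 : 0 <= F twopi - F 0.
  have [] := @MVT_segment R F (P rho) 0 twopi (ltW twopi0).
    by apply: (is_derive_within (df := P rho)) => t _.
  move=> t _ ->; rewrite subr0 mulr_ge0// ?(ltW twopi0)// /P.
  have -> : be rho = 0 by rewrite /be; field.
  have -> : al rho = 1 by rewrite /al; field.
  rewrite mul0r mulr0 addr0 mul1r; apply: mulr_ge0; last by rewrite subr_ge0 cos_le1.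
  by apply: A0; apply: in_disk; rewrite ?lexx.
rewrite ler_norml => /andP[_].
rewrite /M cos_twopi sin_twopi cos0 sin0 => h.
rewrite -(pmulr_lge0 _ twopi0); move: FG F0 h; lra.
Qed.

End Schwarz.
End HalfPlane.

Section SchwarzHalfPlane.
Variable R : realType.
Local Notation C := (Cplx R).
Local Notation J := (cmul (cI R)).

Lemma diff_affine_line (V W : normedModType R) (m : V -> W) (z u : V) (w : W) :
  (forall t : R, m (z + t *: u) = m z + t *: w) -> differentiable m z -> 'd m z u = w.
Proof.
move=> hm dm.
have dm0 : differentiable m (z + 0 *: u) by rewrite scale0r addr0.
have [_ h1] := is_derive_chain (is_derive_line z u 0) dm0.
have [_ h2] := is_derive_line (m z) w (0 : R).
rewrite -[in LHS](addr0 z) -(scale0r u) -h1 -h2; congr (derive _ _ _).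
by apply/funext => t; rewrite hm.
Qed.

Lemma diff_compE (U V W : normedModType R) (f : U -> V) (g : V -> W) (x u : U) :
  differentiable f x -> differentiable g (f x) ->
  differentiable (fun z => g (f z)) x /\ 'd (fun z => g (f z)) x u = 'd g (f x) ('d f x u).
Proof.
move=> df dg; have dgf : differentiable (g \o f) x by exact: differentiable_comp.
by split; [exact: dgf|rewrite -[fun z => _]/(g \o f) (diff_comp df dg)].
Qed.

Lemma diff_subE (U V : normedModType R) (f : U -> V) (k : V) (x u : U) : differentiable f x ->
  differentiable (fun z => f z - k) x /\ 'd (fun z => f z - k) x u = 'd f x u.
Proof.
move=> df; have dk : differentiable (cst k : U -> V) x by exact: differentiable_cst.
have dfk : differentiable (f - cst k) x by exact: differentiableB.
split; first exact: dfk.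
rewrite -[fun z => _]/(f - cst k) (diffB df dk).
by rewrite -[LHS]/('d f x u - 'd (cst k) x u) diff_cst subr0.
Qed.

(** The product of the vector [a] by the complex number [z], equal to [cmul z a] ([cmul_crot]), in a
    form where real linearity in [z] is visible. *)
Definition crot (d : nat) (a : Cn R d) (z : C) : Cn R d := z ord0 (lshift 1 ord0) *: a + z ord0 (rshift 1 ord0) *: J a.

Lemma crot_coord (d : nat) (a : Cn R d) (x y : R) : crot a (x *: c1 R + y *: cI R) = x *: a + y *: J a.
Proof.
rewrite /crot; congr (_ *: _ + _ *: _); rewrite /c1 /cI !scale_row_mx !scaler0 add_row_mx add0r addr0 ?row_mxEl ?row_mxEr !mxE eqxx/= mulr1 //.
Qed.

Lemma crot_c1 (d : nat) (a : Cn R d) : crot a (c1 R) = a.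
Proof. by have := crot_coord a 1 0; rewrite !scale1r !scale0r !addr0. Qed.

Lemma crot_line (d : nat) (a : Cn R d) (z u : C) (t : R) : crot a (z + t *: u) = crot a z + t *: crot a u.
Proof.
rewrite /crot !mxE !scalerDl scalerDr !scalerA !addrA; congr (_ + _).
by rewrite -!addrA; congr (_ + _); rewrite addrC.
Qed.

Lemma crot_J (d : nat) (a : Cn R d) (z : C) : crot a (J z) = J (crot a z).
Proof.
have [x [y ->]] := cplxE z.
have -> : J (x *: c1 R + y *: cI R) = (- y) *: c1 R + x *: cI R.
  by rewrite cmul_lin J_c1 J_cI scalerN scaleNr addrC.
by rewrite !crot_coord cmul_lin cmul_cI_cI scalerN scaleNr addrC.
Qed.

Lemma cmul_crot (d : nat) (a : Cn R d) (z : C) : cmul z a = crot a z.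
Proof.
rewrite /crot cmul_cI /cmul -[X in _ = _ *: X + _](hsubmxK a) !scale_row_mx add_row_mx; congr row_mx.
by rewrite scalerN.
Qed.

Lemma cabs_crot (a z : C) : cabs (crot a z) = cabs a * cabs z.
Proof.
have [x [y ->]] := cplxE z; rewrite crot_coord; have [p [q ->]] := cplxE a.
have -> : J (p *: c1 R + q *: cI R) = (- q) *: c1 R + p *: cI R.
  by rewrite cmul_lin J_c1 J_cI scalerN scaleNr addrC.
have -> : x *: (p *: c1 R + q *: cI R) + y *: (- q *: c1 R + p *: cI R) =
    (x * p - y * q) *: c1 R + (x * q + y * p) *: cI R.
  by rewrite !scalerDr !scalerA mulrN !scalerDl -!addrA; congr (_ + _); rewrite addrCA scaleNr.
rewrite !cabs_coord -sqrtrM ?addr_ge0 ?sqr_ge0//; congr Num.sqrt; ring.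
Qed.

Lemma differentiable_crot (d : nat) (a : Cn R d) (z : C) : differentiable (crot a) z.
Proof. by apply: differentiableD; apply: differentiableZl; exact: differentiable_coord. Qed.

Lemma diff_crot (d : nat) (a : Cn R d) (z u : C) : 'd (crot a) z u = crot a u.
Proof.
by apply: diff_affine_line; [move=> t; exact: crot_line|exact: differentiable_crot].
Qed.

Lemma cabs0 : cabs (0 : C) = 0.
Proof. by rewrite /cabs !mxE expr0n /= addr0 sqrtr0. Qed.

(** Rotating the disk by [a] and subtracting the constant [B 0] reduces to the radial case; [rho]
    then tends to 1. *)
Lemma schwarz_halfplane (A B : C -> R) (a : C) :
  (forall z, cabs z < 1 -> differentiable A z) ->
  (forall z, cabs z < 1 -> differentiable B z) ->
  (forall z u, cabs z < 1 -> 'd B z u = - 'd A z (J u)) ->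
  (forall z, cabs z < 1 -> 0 <= A z) -> cabs a = 1 -> 'd A 0 a <= 2 * A 0.
Proof.
move=> dA dB CR A0 a1.
have disk z : cabs z < 1 -> cabs (crot a z) < 1 by rewrite cabs_crot a1 mul1r.
have c0 : crot a 0 = 0 by rewrite /crot !mxE !scale0r addr0.
pose A' (z : C) := A (crot a z); pose B' (z : C) := B (crot a z) - B 0.
have dcomp (F : C -> R) (z u : C) : differentiable F (crot a z) -> differentiable (fun z => F (crot a z)) z /\
    'd (fun z => F (crot a z)) z u = 'd F (crot a z) (crot a u).
  by move=> dF; rewrite -(diff_crot a z u); exact: (diff_compE u (differentiable_crot a z) dF).
have dB' (z u : C) : cabs z < 1 -> differentiable B' z /\ 'd B' z u = 'd B (crot a z) (crot a u).
  move=> z1; have [d1 d2] := dcomp B z u (dB _ (disk _ z1)).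
  have [e1 e2] := diff_subE (B 0) u d1.
  by split; [exact: e1|exact: (etrans e2 d2)].
have d0 : cabs (0 : C) < 1 by rewrite cabs0.
have key (rho : R) : 0 < rho < 1 -> rho * 'd A 0 a <= 2 * A 0.
  move=> hr; have H1 z : cabs z < 1 -> differentiable A' z.
    by move=> z1; have [e _] := dcomp A z 0 (dA _ (disk _ z1)); exact: e.
  have H2 z : cabs z < 1 -> differentiable B' z by move=> z1; have [e _] := dB' z 0 z1.
  have H3 z u : cabs z < 1 -> 'd B' z u = - 'd A' z (J u).
    move=> z1; have [_ e1] := dB' z u z1.
    have [_ e2] := dcomp A z (J u) (dA _ (disk _ z1)).
    apply: (etrans e1); apply: (etrans (CR _ _ (disk _ z1))); congr (- _).
    by apply: esym; apply: (etrans e2); rewrite crot_J.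
  have H4 z : cabs z < 1 -> 0 <= A' z by move=> z1; apply: A0; exact: disk.
  have H5 : B' 0 = 0 by rewrite /B' c0 subrr.
  have [_ e] := dcomp A 0 (c1 R) (dA _ (disk _ d0)).
  have := schwarz_halfplane_radial H1 H2 H3 H4 H5 hr.
  have -> : 'd A' 0 (c1 R) = 'd A 0 a by apply: (etrans e); rewrite c0 crot_c1.
  by rewrite /A' c0.
rewrite leNgt; apply/negP => h; set x : R := 'd A 0 a in h key.
have A00 := A0 0 d0; have x0 : 0 < x by apply: le_lt_trans h; rewrite mulr_ge0.
(* If [x > 2 * A 0], this radius is less than 1, while its product with [x] is the midpoint of
   [2 * A 0] and [x], still larger than [2 * A 0]. *)
have := key ((2 * A 0 + x) / (2 * x)).
rewrite divr_gt0 ?mulr_gt0//=; last by rewrite ltr_wpDl// mulr_ge0.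
have -> : (2 * A 0 + x) / (2 * x) < 1 by rewrite ltr_pdivrMr ?mulr_gt0// mul1r; lra.
move=> /(_ isT).
have -> : (2 * A 0 + x) / (2 * x) * x = (2 * A 0 + x) / 2 by field; rewrite gt_eqF.
lra.
Qed.

End SchwarzHalfPlane.

(** * Smooth functions of several variables *)

Section Directional.
Variables (R : realType) (U W : normedModType R).

Lemma is_derive_dir (f : U -> W) (x v : U) (t : R) : derivable f (x + t *: v) v ->
  is_derive t 1 (fun s : R => f (x + s *: v)) ('D_v f (x + t *: v)).
Proof.
move=> df.
have E : (fun h : R => h^-1 *: (((fun s : R => f (x + s *: v)) \o shift t) (h *: (1 : R)) - f (x + t *: v)))
   = (fun h : R => h^-1 *: ((f \o shift (x + t *: v)) (h *: v) - f (x + t *: v))).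
  apply/funext => h; have e : x + (h * 1 + t) *: v = h *: v + (x + t *: v).
    by rewrite mulr1 scalerDl addrCA.
  by rewrite /= -e.
by split; rewrite /derivable /derive E.
Qed.

End Directional.

Lemma continuous_sum (R : realType) (T : topologicalType) (J : Type) (s : seq J) (F : J -> T -> R^o) (t : T) :
  (forall j, {for t, continuous (F j)}) -> {for t, continuous (fun x => \sum_(j <- s) F j x : R^o)}.
Proof.
move=> hF; elim: s => [|j s IH].
  have -> : (fun x => \sum_(j <- [::]) F j x) = cst (0 : R^o) :> (T -> R^o).
    by apply/funext => x; rewrite big_nil.
  exact: cst_continuous.
have -> : (fun x => \sum_(j <- j :: s) F j x) = (F j \+ (fun x => \sum_(j <- s) F j x)) :> (T -> R^o).
  by apply/funext => x; rewrite big_cons.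
exact: continuousD.
Qed.

Section LinComb.
Variables (R : realType) (n : nat).

Definition lin_comb (c : 'I_n -> R) (h : 'rV[R]_n) : R^o := \sum_i h ord0 i * c i.

Fact lin_comb_linear c : linear (lin_comb c).
Proof.
move=> a u v; rewrite /lin_comb scaler_sumr -big_split/=; apply: eq_bigr => i _.
by rewrite !mxE mulrDl -mulrA.
Qed.
HB.instance Definition _ c := GRing.isLinear.Build R 'rV[R]_n R^o _ (lin_comb c) (lin_comb_linear c).

Lemma lin_comb_continuous c : continuous (lin_comb c).
Proof.
move=> x; apply: continuous_sum => i; apply: continuousM; last exact: cst_continuous.
exact: coord_continuous.
Qed.

Lemma row_delta_sum (h : 'rV[R]_n) : \sum_i h ord0 i *: delta_mx ord0 i = h.
Proof. by rewrite [RHS]matrix_sum_delta big_ord1. Qed.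

Lemma coord_le_norm (h : 'rV[R]_n) i : `|h ord0 i| <= `|h|.
Proof.
rewrite [X in _ <= X]mx_normrE.
exact: (@le_bigmax _ _ _ 0 (fun ij : 'I_1 * 'I_n => `|h ij.1 ij.2|) (ord0, i)).
Qed.

Lemma norm_le_coord (h : 'rV[R]_n) (c : R) : 0 <= c -> (forall i, `|h ord0 i| <= c) -> `|h| <= c.
Proof.
move=> c0 hc; rewrite [X in X <= _]mx_normrE; apply: bigmax_le => // -[i j] _ /=.
by rewrite ord1.
Qed.

Lemma norm_delta (i : 'I_n) : `|delta_mx ord0 i : 'rV[R]_n| <= 1.
Proof.
apply: norm_le_coord => // j; rewrite mxE eqxx/=.
by case: (j == i); rewrite ?normr1 ?normr0.
Qed.

End LinComb.

Section C1.
Variables (R : realType) (n : nat).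
Local Notation U := 'rV[R]_n.
Variable f : U -> R^o.
Hypothesis df : forall x v, derivable f x v.

Lemma mvt_dir (x v : U) : exists2 s : R, 0 <= s <= 1 & f (x + v) - f x = 'D_v f (x + s *: v).
Proof.
have hd (t : R) : is_derive t 1 (fun s : R => f (x + s *: v) : R) ('D_v f (x + t *: v)).
  exact: is_derive_dir.
have [] := @MVT_segment R (fun s : R => f (x + s *: v)) (fun t => 'D_v f (x + t *: v)) 0 1 ler01.
  by apply: (is_derive_within (df := fun t => 'D_v f (x + t *: v))) => t _; exact: hd.
move=> s; rewrite in_itv/= => s01 h; exists s => //.
by move: h; rewrite scale1r scale0r addr0 subr0 mulr1.
Qed.

Lemma derive_scale (x v : U) (t : R) : 'D_(t *: v) f x = t * 'D_v f x.
Proof.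
have h0 : derivable f (x + 0 *: (t *: v)) (t *: v) by exact: df.
have [_ h1] := is_derive_dir h0.
have h2 : derivable f (x + 0 *: v) v by exact: df.
have [d3 h3] := is_derive_dir h2.
rewrite scale0r addr0 in h1; rewrite scale0r addr0 in h3.
pose g (u : R) : R := f (x + u *: v).
have E : (fun s : R => f (x + s *: (t *: v))) = (fun s : R => g (t * s)).
  by apply/funext => s; rewrite scalerA mulrC.
have dg : is_derive (0 : R) 1 (fun s : R => t * s : R) (t * 1) by exact: dMl (dI 0).
have dg0 : differentiable g 0 by apply/derivable1_diffP.
have t0 : differentiable g (t * 0) by rewrite mulr0.
have [_ h4] := is_derive_chain dg t0.
rewrite -h1 E; apply: (etrans h4); rewrite mulr0 mulr1.
have -> : 'd g 0 t = t * 'd g 0 1 by rewrite -[t in LHS]mulr1 -[t * 1]/(t *: (1 : R)) linearZ.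
by congr (_ * _); rewrite -deriveE.
Qed.

Hypothesis cf : forall v, continuous (fun x => 'D_v f x).

(** [smooth] only speaks of directional derivatives. The differential is recovered by moving along
    one coordinate at a time, with the mean value theorem on each leg and the continuity of the
    partial derivatives. *)
Lemma C1_differentiable (x : U) : differentiable f x /\ (forall v, 'd f x v = \sum_i v ord0 i * 'D_(delta_mx ord0 i) f x).
Proof.
pose c i := 'D_(delta_mx ord0 i) f x.
pose P (s : seq 'I_n) (h : U) : U := \sum_(i <- s) h ord0 i *: delta_mx ord0 i.
have Ple s h : `|P s h| <= (size s)%:R * `|h|.
  rewrite /P; elim: s => [|i s IH]; first by rewrite big_nil normr0 mul0r.
  rewrite big_cons/= -natr1 mulrDl mul1r addrC; apply: le_trans (ler_normD _ _) _.
  apply: lerD => //; rewrite normrZ -[leRHS]mulr1.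
  by apply: ler_pM => //; [exact: coord_le_norm|exact: norm_delta].
have key (e : R) s : 0 < e -> exists2 del : R, 0 < del & forall h : U, `|h| < del ->
    `|f (x + P s h) - f x - \sum_(i <- s) h ord0 i * c i| <= (size s)%:R * e * `|h|.
  move=> e0; elim: s => [|i s [d1 d10 H1]].
    by exists 1 => // h _; rewrite /P !big_nil addr0 subrr subr0 normr0 !mul0r.
  have /cvgrPdist_le /(_ e e0) /nbhs_ballP[d2 /= d20 H2] : ('D_(delta_mx ord0 i) f y @[y --> x] --> c i).
    exact: cf.
  pose N : R := (size s).+1%:R.
  have N0 : 0 < N by rewrite ltr0n.
  exists (Num.min d1 (d2 / N)); first by rewrite lt_min d10 divr_gt0.
  move=> h; rewrite lt_min => /andP[h1 h2].
  have [t /andP[t0 t1] ht] := mvt_dir (x + P s h) (h ord0 i *: delta_mx ord0 i).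
  rewrite derive_scale in ht.
  have EP : P (i :: s) h = P s h + h ord0 i *: delta_mx ord0 i by rewrite /P big_cons addrC.
  rewrite big_cons EP addrA.
  set y := x + P s h + t *: _ in ht; set b := f (x + P s h + _) in ht *.
  have -> : b - f x - (h ord0 i * c i + \sum_(j <- s) h ord0 j * c j) =
    (f (x + P s h) - f x - \sum_(j <- s) h ord0 j * c j) + h ord0 i * ('D_(delta_mx ord0 i) f y - c i).
    rewrite mulrBr -ht; ring.
  apply: le_trans (ler_normD _ _) _.
  have -> : (size (i :: s))%:R * e * `|h| = (size s)%:R * e * `|h| + `|h| * e.
    by rewrite /= -natr1; ring.
  apply: lerD; first exact: H1.
  rewrite normrM; apply: ler_pM => //; first exact: coord_le_norm.
  rewrite distrC; apply: H2; rewrite -ball_normE/= /y -addrA opprD addrA subrr add0r normrN.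
  move: h2; rewrite ltr_pdivlMr// => h2; apply: le_lt_trans h2.
  rewrite /N -natr1 mulrDr mulr1 mulrC; apply: le_trans (ler_normD _ _) _.
  apply: lerD; first exact: Ple.
  rewrite !normrZ -[leRHS]mulr1 mulrA; apply: ler_pM => //; last exact: norm_delta.
  rewrite -[leRHS]mul1r; apply: ler_pM => //; last exact: coord_le_norm.
  by rewrite ger0_norm.
have E : f \o shift x = cst (f x) + lin_comb c +o_ (0 : U) id.
  apply/eqaddoP => e e0.
  have e1 : 0 < e / (n%:R + 1) by rewrite divr_gt0// ltr_wpDl.
  have [del del0 H] := key _ (index_enum 'I_n) e1.
  apply/nbhs_ballP; exists del => //= h; rewrite -ball_normE/= sub0r normrN => hd.
  have Hh := H h hd; rewrite /P row_delta_sum in Hh.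
  have sz : size (index_enum 'I_n) = n by rewrite -[RHS](size_enum_ord n) enumT.
  rewrite sz in Hh.
  have -> : (f \o shift x - (cst (f x) + lin_comb c)) h = f (x + h) - f x - \sum_i h ord0 i * c i.
    rewrite -[LHS]/(f (h + x) - (f x + lin_comb c h)) opprD addrA addrC [h + x]addrC.
    by rewrite addrC.
  apply: (le_trans Hh); apply: ler_wpM2r => //; rewrite mulrA ler_pdivrMr ?ltr_wpDl// mulrC.
  by apply: ler_wpM2l; [exact: ltW|rewrite lerDl].
have D := diff_unique (@lin_comb_continuous R n c) E.
split; last by move=> v; rewrite D.
apply/diff_locallyP; rewrite D; split => //; exact: lin_comb_continuous.
Qed.

End C1.

(** * Iterated derivatives and iterated differences *)

Section IterDir.
Variables (R : realType) (n : nat).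
Local Notation U := 'rV[R]_n.
Implicit Types (f g : U -> R^o) (vs ws : seq U) (v x y : U).

Lemma iter_dir_cat vs ws f : iter_dir (vs ++ ws) f = iter_dir vs (iter_dir ws f).
Proof. by elim: vs => //= v vs ->. Qed.

Lemma smooth_iter ws f : smooth f -> smooth (iter_dir ws f).
Proof. by move=> sf vs; rewrite -iter_dir_cat; exact: sf. Qed.

Lemma smooth_continuous f : smooth f -> continuous f.
Proof. by move=> /(_ [::])[]. Qed.

Lemma smooth_derivable f x v : smooth f -> derivable f x v.
Proof. by move=> /(_ [::])[_]; exact. Qed.

Lemma smooth_derive_continuous f v : smooth f -> continuous (fun x => 'D_v f x).
Proof. by move=> /(_ [:: v])[]. Qed.

Lemma smooth_differentiable f x : smooth f -> differentiable f x.
Proof.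
move=> sf; apply: (proj1 (C1_differentiable _ _ x)); first by move=> *; exact: smooth_derivable.
by move=> v; exact: smooth_derive_continuous.
Qed.

Lemma smooth_deriveE f x v : smooth f ->
  'D_v f x = \sum_i v ord0 i * 'D_(delta_mx ord0 i) f x.
Proof.
move=> sf; rewrite deriveE; last exact: smooth_differentiable.
apply: (proj2 (C1_differentiable _ _ x)); first by move=> *; exact: smooth_derivable.
by move=> w; exact: smooth_derive_continuous.
Qed.

Lemma iter_dir_sum (J : Type) (s : seq J) (c : J -> R) (F : J -> U -> R^o) ws :
  (forall j, smooth (F j)) ->
  iter_dir ws (fun x => \sum_(j <- s) c j * F j x) = (fun x => \sum_(j <- s) c j * iter_dir ws (F j) x).
Proof.
move=> sF; elim: ws => [//|v ws IH] /=; rewrite IH; apply/funext => x.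
pose G j := iter_dir ws (F j).
have dG j y : derivable (G j) y v by exact: (proj2 (sF j ws)).
suff [_ ->] : is_derive x v (fun y => \sum_(j <- s) c j * G j y : R^o) (\sum_(j <- s) c j * 'D_v (G j) x) by [].
elim: (s) => [|j t IHt].
  rewrite big_nil [X in is_derive _ _ X _](_ : _ = cst 0); first exact: is_derive_cst.
  by apply/funext => y; rewrite big_nil.
rewrite big_cons [X in is_derive _ _ X _](_ : _ = (c j *: G j) + (fun y => \sum_(j <- t) c j * G j y)); last first.
  by apply/funext => y; rewrite big_cons.
by apply: is_deriveD; apply: is_deriveZ; exact/derivableP.
Qed.

(** Continuity jointly in the point and in the directions, for compactness arguments over boundary
    points and complex directions together. Each moving direction is expanded in the basis and so
    transferred to the list [es] of fixed ones, where [smooth] applies. *)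
Lemma iter_dir_joint (T : topologicalType) (t0 : T) (us : seq (T -> U)) (es : seq U)
    (z : T -> U) f : smooth f -> {for t0, continuous z} ->
  (forall i, (i < size us)%N -> {for t0, continuous (nth z us i)}) ->
  {for t0, continuous (fun t => iter_dir (es ++ [seq u t | u <- us]) f (z t))}.
Proof.
move=> sf cz; elim: us es => [|u us IH] es cus /=.
  rewrite cats0; apply: (@continuous_comp _ _ _ z (iter_dir es f)) => //.
  exact: (proj1 (sf es)).
have -> : (fun t => iter_dir (es ++ u t :: [seq q t | q <- us]) f (z t)) =
    (fun t => \sum_i (u t) ord0 i * iter_dir (rcons es (delta_mx ord0 i) ++ [seq q t | q <- us]) f (z t)).
  apply/funext => t; rewrite iter_dir_cat /=.
  set g := iter_dir _ f; have sg : smooth g by exact: smooth_iter.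
  have -> : (fun x => 'D_(u t) g x) = (fun x => \sum_i u t ord0 i * 'D_(delta_mx ord0 i) g x).
    by apply/funext => x; exact: smooth_deriveE.
  rewrite iter_dir_sum; last by move=> i; exact: (@smooth_iter [:: _]).
  by apply: eq_bigr => i _; rewrite cat_rcons iter_dir_cat.
apply: continuous_sum => i; apply: continuousM.
  have cu : {for t0, continuous u} by exact: (cus 0%N).
  apply: (@continuous_comp _ _ _ u (fun y : U => y ord0 i)) => //.
  exact: coord_continuous.
by apply: IH => j js; exact: (cus j.+1).
Qed.

Lemma iter_dir_shift vs f (a : U) : iter_dir vs (fun x => f (x + a)) = (fun x => iter_dir vs f (x + a)).
Proof.
elim: vs => //= v vs ->; apply/funext => x; rewrite /derive /=.
have E : (fun h : R => h^-1 *: (iter_dir vs f (h *: v + x + a) - iter_dir vs f (x + a))) =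
    (fun h : R => h^-1 *: (iter_dir vs f (h *: v + (x + a)) - iter_dir vs f (x + a))).
  by apply/funext => h; rewrite addrA.
by rewrite E.
Qed.

Lemma iter_dir_sub vs f g : smooth f -> smooth g ->
  iter_dir vs (fun x => f x - g x) = (fun x => iter_dir vs f x - iter_dir vs g x).
Proof.
move=> sf sg; elim: vs => //= v vs ->; apply/funext => x.
have d1 : derivable (iter_dir vs f) x v by exact: (proj2 (sf vs)).
have d2 : derivable (iter_dir vs g) x v by exact: (proj2 (sg vs)).
exact: (deriveB d1 d2).
Qed.

Definition shift_diff (a : U) f : U -> R^o := fun x => f (x + a) - f x.

Lemma iter_dir_shift_diff vs f a : smooth f ->
  iter_dir vs (shift_diff a f) = shift_diff a (iter_dir vs f).
Proof.
move=> sf; rewrite /shift_diff iter_dir_sub//; first by rewrite iter_dir_shift.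
move=> ws; rewrite iter_dir_shift; split.
  move=> x; apply: (@continuous_comp _ _ _ (fun y : U => y + a) (iter_dir ws f)).
    by apply: continuousD => //; exact: cst_continuous.
  exact: (proj1 (sf ws)).
move=> v x; have d : derivable (iter_dir ws f) (x + a) v by exact: (proj2 (sf ws)).
move: d; rewrite /derivable /= => d.
rewrite [X in cvg (X @ _)](_ : _ = (fun h : R => h^-1 *: (iter_dir ws f (h *: v + (x + a)) - iter_dir ws f (x + a)))) //.
by apply/funext => h; rewrite addrA.
Qed.

Lemma smooth_shift_diff f a : smooth f -> smooth (shift_diff a f).
Proof.
move=> sf ws; rewrite iter_dir_shift_diff//; split.
  move=> x; apply: (@continuousB _ _ _ (fun y => iter_dir ws f (y + a)) (iter_dir ws f) x); last exact: (proj1 (sf ws)).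
  apply: (@continuous_comp _ _ _ (fun y : U => y + a) (iter_dir ws f)).
    by apply: continuousD => //; exact: cst_continuous.
  exact: (proj1 (sf ws)).
move=> v x; apply: (@derivableB _ _ _ (fun y => iter_dir ws f (y + a)) (iter_dir ws f)); last exact: (proj2 (sf ws)).
have d : derivable (iter_dir ws f) (x + a) v by exact: (proj2 (sf ws)).
move: d; rewrite /derivable /= => d.
rewrite [X in cvg (X @ _)](_ : _ = (fun h : R => h^-1 *: (iter_dir ws f (h *: v + (x + a)) - iter_dir ws f (x + a)))) //.
by apply/funext => h; rewrite addrA.
Qed.

Fixpoint fdiff vs f (x : U) : R := if vs is v :: ws then fdiff ws f (x + v) - fdiff ws f x else f x.

Lemma fdiff_shift_diff vs f v x : fdiff vs (shift_diff v f) x = fdiff vs f (x + v) - fdiff vs f x.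
Proof.
elim: vs x => //= w vs IH x; rewrite !IH (addrAC x w v); ring.
Qed.

(** Differencing in one direction commutes with differentiating in the others, so the mean value
    theorem applies direction by direction. It links the size of [r] on a disk to its derivatives,
    both to bound [r] from below and to extrapolate it. *)
Lemma fdiff_mvt vs f x (t : R) : smooth f -> 0 <= t -> exists2 z : U,
  `|z - x| <= t * \sum_(v <- vs) `|v| &
  fdiff [seq t *: v | v <- vs] f x = t ^+ size vs * iter_dir vs f z.
Proof.
elim: vs f x => [|v vs IH] f x sf t0.
  by exists x; rewrite ?big_nil ?subrr ?normr0 ?mulr0//= expr0 mul1r.
rewrite [fdiff _ _ _]/= -fdiff_shift_diff.
have [z hz ->] := IH _ x (smooth_shift_diff (t *: v) sf) t0.
rewrite iter_dir_shift_diff// /shift_diff; have sg := smooth_iter vs sf.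
have dg y w : derivable (iter_dir vs f) y w by exact: smooth_derivable.
have [s /andP[s0 s1] ->] := mvt_dir dg z (t *: v).
exists (z + s *: (t *: v)); last first.
  by rewrite (derive_scale dg) /= exprS mulrCA mulrA.
rewrite addrAC big_cons mulrDr addrC; apply: le_trans (ler_normD _ _) _; apply: lerD => //.
rewrite !normrZ mulrA; apply: ler_wpM2r => //; rewrite !ger0_norm//; exact: ler_piMl.
Qed.

Lemma fdiff_bound vs f x (A : R) :
  (forall y, `|y - x| <= \sum_(v <- vs) `|v| -> `|f y| <= A) -> `|fdiff vs f x| <= 2 ^+ size vs * A.
Proof.
elim: vs x => [|v vs IH] x hA /=.
  by rewrite expr0 mul1r; apply: hA; rewrite subrr normr0 big_nil.
apply: le_trans (ler_normB _ _) _; rewrite exprS -mulrA mulr_natl mulr2n; apply: lerD; apply: IH => y hy.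
  apply: hA; have -> : y - x = (y - (x + v)) + v by rewrite opprD addrA subrK.
  by rewrite big_cons addrC; apply: le_trans (ler_normD _ _) _; apply: lerD.
by apply: hA; rewrite big_cons; apply: le_trans hy _; rewrite lerDr.
Qed.

(** The difference of order [k] is the last value plus a combination of the earlier ones, with
    signed binomial coefficients of total modulus [2 ^ k - 1]. *)
Lemma fdiff_extrapolate k f x v (A : R) : (forall j, (j < k)%N -> `|f (x + j%:R *: v)| <= A) ->
  `|f (x + k%:R *: v)| <= `|fdiff (nseq k v) f x| + (2 ^+ k - 1) * A.
Proof.
move=> hA; have H : `|fdiff (nseq k v) f x - f (x + k%:R *: v)| <= (2 ^+ k - 1) * A.
  elim: k x hA => [|k IH] x hA.
    by rewrite /= scale0r addr0 subrr normr0 expr0 subrr mul0r.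
  have h1 : `|fdiff (nseq k v) f (x + v) - f (x + v + k%:R *: v)| <= (2 ^+ k - 1) * A.
    apply: IH => j jk; have := hA j.+1; rewrite ltnS => /(_ jk).
    by rewrite -natr1 scalerDl scale1r -addrA [v + _]addrC.
  have h2 : `|fdiff (nseq k v) f x| <= 2 ^+ k * A.
    have h3 : `|fdiff (nseq k v) f x - f (x + k%:R *: v)| <= (2 ^+ k - 1) * A.
      by apply: IH => j jk; apply: hA; exact: ltnW.
    have h4 := hA k (leqnn _).
    rewrite -(subrK (f (x + k%:R *: v)) (fdiff _ _ _)); apply: le_trans (ler_normD _ _) _.
    lra.
  rewrite /= -natr1 scalerDl scale1r [k%:R *: v + v]addrC (addrA x).
  rewrite (addrAC (fdiff _ _ _)); apply: le_trans (ler_normB _ _) _; rewrite exprS; lra.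
have := ler_normB (fdiff (nseq k v) f x) (fdiff (nseq k v) f x - f (x + k%:R *: v)).
by rewrite subKr => /le_trans; apply; exact: lerD.
Qed.

End IterDir.

(** * Hyperbolicity from contraction *)

Section Frame.
Variables (R : realType) (V : lmodType R) (Om : set V) (I : Type).
Variables (phi lam : I -> V -> R) (o : V) (dK : V -> V -> R) (C2 : R).

(** The vector [v] has length at most [a] at [x] for the metric [sup_i lam i v / phi i x], written
    without quotient or supremum so that linear arithmetic applies for each [i]. *)
Definition Fle (x v : V) (a : R) := forall i, lam i v <= a * phi i x.
Definition U (k : R) (p : V) : V := p + k *: (o - p).

(* The interface through which the hyperbolicity argument sees a convex domain: [phi i > 0] are its
   supporting half-spaces, [lam i] is the length of the complex-linear part of [phi i], [o] is a base
   point and [dK] a distance comparable to the metric [v |-> sup_i lam i v / phi i x]. *)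
Record frame : Prop := Frame {
  phi_aff : forall i x y (t : R), phi i (x + t *: (y - x)) = (1 - t) * phi i x + t * phi i y;
  frame_phi_lip : forall i x v, `|phi i (x + v) - phi i x| <= lam i v;
  lamD : forall i v w, lam i (v + w) <= lam i v + lam i w;
  lamZ : forall i (t : R) v, lam i (t *: v) = `|t| * lam i v;
  phi_gt0 : forall i x, Om x -> 0 < phi i x;
  Om_ge : forall (c : R) x, 0 < c -> (forall i, c * phi i o <= phi i x) -> Om x;
  Om_ex : forall x, Om x -> exists2 c : R, 0 < c & forall i, c * phi i o <= phi i x;
  Om_o : Om o;
  C2_ge1 : 1 <= C2;
  frame_lam_o : forall i p, Om p -> lam i (o - p) <= C2 * phi i o;
  dK_sym : forall x y, Om x -> Om y -> dK x y = dK y x;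
  dK_tri : forall x y z, Om x -> Om y -> Om z -> dK x z <= dK x y + dK y z;
  dK_phi : forall i x y, Om x -> Om y -> phi i y <= phi i x * expR (2 * dK x y);
  dK_lam : forall x y, Om x -> Om y -> Fle x (y - x) (2 * dK x y * expR (2 * dK x y));
  dK_le : forall x y (a : R), Om x -> Om y ->
    (forall t : R, 0 <= t <= 1 -> Fle (x + t *: (y - x)) (y - x) a) -> dK x y <= a
}.

(* A substitute for the distance to the boundary that is concave along the rays to [o]. *)
Definition ht (x : V) : R := sup [set c : R | c <= 1 /\ forall i, c * phi i o <= phi i x].

Hypothesis FR : frame.

Lemma phio i : 0 < phi i o. Proof. exact: (phi_gt0 FR i (Om_o FR)). Qed.

Lemma lam_ge0 i v : 0 <= lam i v.
Proof. exact: le_trans (normr_ge0 _) (frame_phi_lip FR i 0 v). Qed.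

Lemma lam0 i : lam i 0 = 0.
Proof. by rewrite -(scale0r 0) (lamZ FR) normr0 mul0r. Qed.

Lemma lamN i v : lam i (- v) = lam i v.
Proof. by rewrite -scaleN1r (lamZ FR) normrN normr1 mul1r. Qed.

Lemma ht_set x : Om x -> has_sup [set c : R | c <= 1 /\ forall i, c * phi i o <= phi i x].
Proof.
move=> xO; split; last by exists 1 => c [].
have [c c0 hc] := Om_ex FR xO; exists (Num.min c 1); split; first by rewrite ge_min lexx orbT.
move=> i; apply: le_trans (hc i); rewrite ler_pM2r ?phio// ge_min lexx //.
Qed.

Lemma ht_le1 x : Om x -> ht x <= 1.
Proof. by move=> /ht_set[ne _]; apply: ge_sup => // c []. Qed.

Lemma ht_max c x : Om x -> c <= 1 -> (forall i, c * phi i o <= phi i x) -> c <= ht x.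
Proof. by move=> xO c1 hc; apply: ub_le_sup; [case: (ht_set xO)|split]. Qed.

Lemma ht_gt0 x : Om x -> 0 < ht x.
Proof.
move=> xO; have [c c0 hc] := Om_ex FR xO.
apply: (@lt_le_trans _ _ (Num.min c 1)); first by rewrite lt_min c0 ltr01.
apply: ht_max => //; first by rewrite ge_min lexx orbT.
by move=> i; apply: le_trans (hc i); rewrite ler_pM2r ?phio// ge_min lexx.
Qed.

Lemma ht_phi i x : Om x -> ht x * phi i o <= phi i x.
Proof.
move=> xO; rewrite -ler_pdivlMr ?phio//.
by apply: ge_sup; [case: (ht_set xO)|move=> c [_ /(_ i)]; rewrite ler_pdivlMr ?phio].
Qed.

Lemma phiU i k p : phi i (U k p) = (1 - k) * phi i p + k * phi i o.
Proof. by rewrite /U (phi_aff FR). Qed.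

Lemma Om_U k p : Om p -> 0 <= k <= 1 -> Om (U k p).
Proof.
move=> pO /andP[k0 k1]; apply: (Om_ge FR (ht_gt0 pO)) => i; rewrite phiU.
have := ht_phi i pO; have := ht_le1 pO; have := phio i; move=> h1 h2 h3.
have h4 : (1 - k) * (ht p * phi i o) <= (1 - k) * phi i p by rewrite ler_wpM2l// subr_ge0.
have h5 : k * (ht p * phi i o) <= k * phi i o by rewrite ler_wpM2l// ler_piMl// ltW.
lra.
Qed.

Lemma U0 p : U 0 p = p. Proof. by rewrite /U scale0r addr0. Qed.
Lemma U1 p : U 1 p = o. Proof. by rewrite /U scale1r addrC subrK. Qed.

Lemma subU k p q : U k q - U k p = (1 - k) *: (q - p).
Proof.
rewrite /U scalerBl scale1r !scalerBr opprD opprB addrACA; congr (_ + _).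
by rewrite opprB addrC addrA subrK.
Qed.

Lemma UU t k k' p : (1 - k') = (1 - t) * (1 - k) -> U t (U k p) = U k' p.
Proof.
have E s x : o - U s x = (1 - s) *: (o - x) by rewrite /U opprD addrA scalerBl scale1r.
by move=> h; apply: (@subrI _ o); rewrite !E scalerA h.
Qed.

Lemma htU_ge k p : Om p -> 0 <= k <= 1 -> k <= ht (U k p) /\ ht p <= ht (U k p).
Proof.
move=> pO k01; have uO := Om_U pO k01; case/andP: k01 => k0 k1.
have e1 i : 0 <= (1 - k) * phi i p by rewrite mulr_ge0 ?subr_ge0// ltW// (phi_gt0 FR).
split; apply: ht_max => //; first by move=> i; rewrite phiU; have := e1 i; lra.
  exact: ht_le1.
move=> i; rewrite phiU.
have := ht_phi i pO; have := ht_le1 pO; have := phio i; move=> h1 h2 h3.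
have h4 : (1 - k) * (ht p * phi i o) <= (1 - k) * phi i p by rewrite ler_wpM2l// subr_ge0.
have h5 : k * (ht p * phi i o) <= k * phi i o by rewrite ler_wpM2l// ler_piMl// ltW.
lra.
Qed.

Lemma htU_le k p : Om p -> 0 <= k < 1 -> ht (U k p) <= ht p + k.
Proof.
move=> pO /andP[k0 k1]; have k01 : 0 <= k <= 1 by rewrite k0 ltW.
have uO := Om_U pO k01; set c := ht _; rewrite -lerBlDr.
have k1' : 0 < 1 - k by rewrite subr_gt0.
apply: (@le_trans _ _ (Num.max 0 ((c - k) / (1 - k)))).
  have [h|h] := leP (c - k) 0; first by rewrite le_max h.
  by rewrite le_max; apply/orP; right; rewrite ler_pdivlMr//; apply: ler_piMr; [exact: ltW|lra].
rewrite ge_max (ltW (ht_gt0 pO))/=; apply: ht_max => //.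
  by rewrite ler_pdivrMr// mul1r lerB// ht_le1.
move=> i; rewrite mulrAC ler_pdivrMr//.
have := ht_phi i uO; rewrite phiU -/c; lra.
Qed.

Lemma Fle_scale x v a (t : R) : Fle x v a -> Fle x (t *: v) (`|t| * a).
Proof. by move=> h i; rewrite (lamZ FR) -mulrA ler_wpM2l. Qed.

Lemma Fle_add x v w a b : Fle x v a -> Fle x w b -> Fle x (v + w) (a + b).
Proof. by move=> h1 h2 i; rewrite mulrDl (le_trans (lamD FR i v w))// lerD. Qed.

Lemma Fle_weak x v a b : Om x -> a <= b -> Fle x v a -> Fle x v b.
Proof. by move=> xO ab h i; apply: le_trans (h i) _; rewrite ler_pM2r// (phi_gt0 FR). Qed.

Lemma Fle_opp x v a : Fle x v a -> Fle x (- v) a.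
Proof. by move=> h i; rewrite lamN. Qed.

Lemma Fle_phi x y e i : Fle x (y - x) e -> (1 - e) * phi i x <= phi i y <= (1 + e) * phi i x.
Proof.
move=> h; have := le_trans (frame_phi_lip FR i x (y - x)) (h i).
rewrite [x + _]addrC subrK ler_norml; lra.
Qed.

(** A displacement of length [e] multiplies each [phi i] by a factor between [1 - e] and [1 + e]
    ([Fle_phi]), so lengths measured at its two ends are comparable. *)
Lemma Fle_base x y v e a b : Om x -> 0 <= a -> Fle x (y - x) e -> a * (1 + e) <= b ->
  Fle y v a -> Fle x v b.
Proof.
move=> xO a0 xy ab h i; apply: le_trans (h i) _; have /andP[_ h2] := Fle_phi i xy.
apply: le_trans (ler_wpM2l a0 h2) _; rewrite mulrA ler_pM2r// (phi_gt0 FR)//.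
Qed.

Lemma Fle_base' x y v e a b : Om x -> 0 <= b -> Fle x (y - x) e -> a <= b * (1 - e) ->
  Fle x v a -> Fle y v b.
Proof.
move=> xO b0 xy ab h i; apply: le_trans (h i) _; have /andP[h2 _] := Fle_phi i xy.
apply: le_trans (ler_wpM2l b0 h2); rewrite mulrA ler_pM2r// (phi_gt0 FR)//.
Qed.

Lemma dK_ge0 x y : Om x -> Om y -> 0 <= dK x y.
Proof.
move=> xO yO; have h0 : dK x x <= 0.
  by apply: (dK_le FR) => // t _ i; rewrite subrr lam0 mul0r.
have := dK_tri FR xO yO xO; rewrite (dK_sym FR yO xO) => h1.
have := dK_tri FR xO xO xO; lra.
Qed.

Lemma dKxx x : Om x -> dK x x = 0.
Proof.
move=> xO; apply/le_anti; rewrite dK_ge0// andbT.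
by apply: (dK_le FR) => // t _ i; rewrite subrr lam0 mul0r.
Qed.

Lemma dK_Fle x y e : Om x -> Om y -> 0 <= e <= 1 / 2 -> Fle x (y - x) e -> dK x y <= 2 * e.
Proof.
move=> xO yO /andP[e0 e1] h; apply: (dK_le FR) => // t /andP[t0 t1].
apply: (@Fle_base' x _ _ e e) => //; [lra| |].
- move=> i; rewrite [x + _]addrC addrK; apply: le_trans (h i).
  by rewrite (lamZ FR) ger0_norm// ler_piMl// lam_ge0.
- have : 0 <= e * (1 - 2 * e) by rewrite mulr_ge0//; lra.
  lra.
Qed.

(** Bounds from below the cost of a change of height, which [climb] bounds from above: vertical rays
    are quasi-geodesics and [ln ht] is the coordinate along them. *)
Lemma ln_ht_lip x y : Om x -> Om y -> ln (ht y) - ln (ht x) <= 2 * dK x y.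
Proof.
move=> xO yO; have d0 := dK_ge0 xO yO.
have E0 := expR_gt0 (2 * dK x y).
have : ht y * expR (- (2 * dK x y)) <= ht x.
  have e1 : expR (- (2 * dK x y)) <= 1 by rewrite -[leRHS]expR0 ler_expR; lra.
  apply: ht_max => //.
    by rewrite -[leRHS]mulr1; apply: ler_pM; rewrite ?ht_le1 ?expR_ge0// (ltW (ht_gt0 yO)).
  move=> i; rewrite mulrAC expRN ler_pdivrMr// (le_trans (ht_phi i yO))//.
  exact: (dK_phi FR).
rewrite -ler_ln ?posrE ?mulr_gt0 ?ht_gt0 ?expR_gt0// lnM ?posrE ?ht_gt0 ?expR_gt0// expRK; lra.
Qed.

End Frame.

Section Logs.
Variable R : realType.

Lemma ln2_ge : 1 / 2 <= ln 2 :> R.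
Proof.
have := @le_ln1Dx R (- (1 / 2)) ltac:(lra).
have -> : 1 + - (1 / 2) = 2^-1 :> R by lra.
rewrite lnV ?posrE//; lra.
Qed.

Lemma ln_le_div (x a : R) : 0 < x -> 0 < a -> ln x <= x / a + ln a.
Proof.
move=> x0 a0; have := @le_ln1Dx R (x / a - 1).
have -> : 1 + (x / a - 1) = x / a by lra.
rewrite ltrBrDr addNr divr_gt0// => /(_ isT).
rewrite ln_div ?posrE//; lra.
Qed.

Lemma pow2_between (X : R) : 1 <= X -> exists k : nat, X <= 2 ^+ k <= 2 * X.
Proof.
move=> X1; have ex : exists k : nat, X <= 2 ^+ k.
  exists (Num.truncn X).+1; apply: le_trans (ltW (truncnS_gt _)) _.
  by rewrite -natrX ler_nat ltnW// ltn_expl.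
case: (ex_minnP ex) => k hk kmin; exists k; rewrite hk/=.
case: k hk kmin => [|k] hk kmin; first by rewrite expr0; lra.
rewrite exprS ler_pM2l// leNgt; apply/negP => h.
by have := kmin k (ltW h); rewrite ltnn.
Qed.

End Logs.

(** * Length of the vertical rays *)

Section Climb.
Variables (R : realType) (V : lmodType R) (Om : set V) (I : Type).
Variables (phi lam : I -> V -> R) (o : V) (dK : V -> V -> R) (C2 : R).
Hypothesis FR : frame Om phi lam o dK C2.
Local Notation Fle := (Fle phi lam).
Local Notation U := (U o).
Local Notation ht := (ht phi o).
Implicit Types (p q x y z v : V) (k a b c : R).

Lemma U_seg a b p t : U a p + t *: (U b p - U a p) = U (a + t * (b - a)) p.
Proof.
rewrite /U opprD addrACA subrr add0r -scalerBl scalerA -addrA -scalerDl //.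
Qed.

Lemma dK_U_le a b c p : Om p -> 0 <= a -> a <= b -> b <= 1 -> b - a <= c ->
  (forall t, a <= t <= b -> c <= ht (U t p)) -> dK (U a p) (U b p) <= C2.
Proof.
move=> pO a0 ab b1 bac hc; have C20 : 0 <= C2 by apply: le_trans (C2_ge1 FR).
have aO : Om (U a p) by apply: (Om_U FR) => //; rewrite a0 (le_trans ab).
have bO : Om (U b p) by apply: (Om_U FR) => //; rewrite b1 (le_trans a0).
apply: (dK_le FR) => // t /andP[t0 t1] i; rewrite U_seg.
have s0 : 0 <= t * (b - a) by rewrite mulr_ge0 ?subr_ge0.
have s1 : t * (b - a) <= b - a by rewrite ler_piMl ?subr_ge0.
set s := a + _; have sab : a <= s <= b by rewrite /s; apply/andP; split; lra.
have sO : Om (U s p) by apply: (Om_U FR) => //; case/andP: sab => h1 h2; rewrite (le_trans a0) ?(le_trans h2).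
have -> : U b p - U a p = (b - a) *: (o - p).
  by rewrite /U opprD addrACA subrr add0r -scalerBl.
rewrite (lamZ FR) ger0_norm ?subr_ge0//.
have h1 := ht_phi FR i sO; have h2 := frame_lam_o FR i pO; have p0 := phio FR i.
have h3 : (b - a) * lam i (o - p) <= c * (C2 * phi i o).
  by apply: ler_pM; rewrite ?subr_ge0 ?(lam_ge0 FR).
apply: le_trans h3 _; rewrite mulrCA; apply: ler_wpM2l => //.
by apply: le_trans h1; rewrite ler_pM2r// hc.
Qed.

(** Dyadic decomposition of the ray: each doubling of the parameter costs at most [C2], because the
    height along it is at least the length of the parameter interval. *)
Lemma climb_n n k p : Om p -> 0 <= k <= 1 -> k <= 2 ^+ n * ht p ->
  dK p (U k p) <= C2 * n.+1%:R.
Proof.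
move=> pO; have C20 : 0 <= C2 by apply: le_trans (C2_ge1 FR).
elim: n k => [|n IH] k /andP[k0 k1] kh.
  rewrite expr0 mul1r in kh; rewrite mulr1 -[X in dK X _](U0 o p).
  apply: (@dK_U_le 0 k (ht p)) => //; first by rewrite subr0.
  move=> t /andP[t0 tk]; have t01 : 0 <= t <= 1 by rewrite t0 (le_trans tk).
  by have [] := htU_ge FR pO t01.
have [h|h] := leP k (2 ^+ n * ht p).
  apply: le_trans (IH k _ h) _; first by rewrite k0.
  by rewrite ler_wpM2l// ler_nat.
have h2 : k / 2 <= 2 ^+ n * ht p by move: kh; rewrite exprS; lra.
have k2 : 0 <= k / 2 <= 1 by apply/andP; split; lra.
have k01 : 0 <= k <= 1 by rewrite k0.
have := dK_tri FR pO (Om_U FR pO k2) (Om_U FR pO k01).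
move=> /le_trans; apply; rewrite -[n.+2%:R]natr1 mulrDr mulr1; apply: lerD; first exact: IH.
apply: (@dK_U_le _ _ (k / 2)) => //; [lra|lra|lra|].
move=> t /andP[tk tk']; have t01 : 0 <= t <= 1 by apply/andP; split; lra.
by apply: le_trans tk _; have [] := htU_ge FR pO t01.
Qed.

Lemma climb k p : Om p -> ht p <= k <= 1 ->
  dK p (U k p) <= C2 * (4 + 2 * (ln k - ln (ht p))).
Proof.
move=> pO /andP[hk k1]; have h0 := ht_gt0 FR pO.
have k0 : 0 < k by exact: lt_le_trans hk.
have C20 : 0 <= C2 by apply: le_trans (C2_ge1 FR).
have kh1 : 1 <= k / ht p by rewrite ler_pdivlMr// mul1r.
have [n /andP[n1 n2]] := pow2_between kh1.
apply: (@le_trans _ _ (C2 * n.+1%:R)).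
  by apply: climb_n => //; [rewrite (ltW k0)|rewrite -ler_pdivrMr].
apply: ler_wpM2l => //.
have : ln (2 ^+ n) <= ln (2 * (k / ht p)).
  by rewrite ler_ln// posrE ?exprn_gt0// mulr_gt0// divr_gt0.
rewrite lnXn// lnM ?posrE ?divr_gt0// ln_div ?posrE// -(mulr_natl (ln 2)) -natr1 => h.
have l2 := ln2_ge R; have n0 : 0 <= n%:R :> R by [].
have lk : ln (ht p) <= ln k by rewrite ler_ln ?posrE.
have : n%:R * (1 / 2) <= n%:R * ln 2 :> R by rewrite ler_wpM2l.
have [L2|] := leP (ln 2) (1 : R); first lra.
have e2 : 1 + 1 = 2 :> R by lra.
by have := @le_ln1Dx R 1; rewrite e2 => /(_ (lt_trans (ltrN10 _) ltr01)); lra.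
Qed.

End Climb.

(** * Geodesics that stay low are short *)

Section Star.
Variables (R : realType) (V : lmodType R) (Om : set V) (I : Type).
Variables (phi lam : I -> V -> R) (o : V) (dK : V -> V -> R) (C2 : R).
Hypothesis FR : frame Om phi lam o dK C2.
Local Notation Fle := (Fle phi lam).
Local Notation U := (U o).
Local Notation ht := (ht phi o).
Local Notation g p := (ln (ht p)).
Implicit Types (p q x y z v : V) (k a b c : R).

Definition contraction (m : nat) (C : R) := 1 <= C /\ forall (n : nat) p v k a, Om p ->
  (2 ^+ n) ^+ m * ht p <= k -> k <= 1 -> 0 <= a -> Fle p v a -> Fle (U k p) v (C / 2 ^+ n * a).

(* Samples of a geodesic at unit times, up to a bounded error at the end point. *)
Definition qseq (p : nat -> V) (N : nat) := [/\ forall i, (i <= N)%N -> Om (p i),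
  forall i j, (i <= j <= N)%N -> (j - i)%:R - 1 <= dK (p i) (p j)
  & forall i, (i < N)%N -> dK (p i) (p i.+1) <= 2].

Variables (m : nat) (CN : R).
Hypothesis NC : contraction m CN.

Let C20 : 0 < C2. Proof. exact: lt_le_trans (C2_ge1 FR). Qed.
Let CN0 : 0 < CN. Proof. by case: NC => h _; exact: lt_le_trans h. Qed.

(** The bound [1 / 4] on the total length keeps all the points comparable as base points, at the
    price of the factor 2. *)
Lemma chain_up (q : nat -> V) (i j : nat) e : (i <= j)%N ->
  (forall l, (i <= l <= j)%N -> Om (q l)) -> 0 <= e -> (j - i)%:R * e <= 1 / 4 ->
  (forall l, (i <= l < j)%N -> Fle (q l) (q l.+1 - q l) e) ->
  Fle (q i) (q j - q i) (2 * ((j - i)%:R * e)).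
Proof.
move=> ij qO e0 small hq.
have iO : Om (q i) by apply: qO; rewrite leqnn.
have key n : (i + n <= j)%N -> Fle (q i) (q (i + n)%N - q i) (2 * (n%:R * e)).
  elim: n => [|n IH] hn.
    by rewrite addn0 subrr mul0r mulr0 => l; rewrite (lam0 FR) mul0r.
  have hn' : (i + n <= j)%N by rewrite (leq_trans _ hn)// leq_add2l.
  have {}IH := IH hn'.
  have nO : Om (q (i + n)%N) by apply: qO; rewrite leq_addr hn'.
  have ne : n%:R * e <= 1 / 4.
    apply: le_trans small; rewrite ler_wpM2r// ler_nat leq_subRL//.
  have h : Fle (q (i + n)%N) (q (i + n.+1)%N - q (i + n)%N) e.
    by rewrite addnS; apply: hq; rewrite leq_addr -addnS.
  have -> : q (i + n.+1)%N - q i = (q (i + n)%N - q i) + (q (i + n.+1)%N - q (i + n)%N).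
    by rewrite [RHS]addrC addrA subrK.
  have -> : 2 * (n.+1%:R * e) = 2 * (n%:R * e) + 2 * e by rewrite -natr1; ring.
  apply: (Fle_add FR) => //; apply: (Fle_base FR iO e0 IH _ h).
  have : e * (2 * (n%:R * e)) <= e * 1 by rewrite ler_wpM2l//; lra.
  lra.
by have := key (j - i)%N; rewrite subnKC// => /(_ (leqnn _)).
Qed.

(** The bound [2 * D * expR (2 * D)] of [dK_lam] at [D = 2], the largest distance between
    consecutive samples. *)
Definition E0 : R := 4 * (expR (4 : R)).
Let E00 : 0 < E0. Proof. by rewrite mulr_gt0 ?expR_gt0. Qed.

Lemma qseq_Fle (p : nat -> V) N i : qseq p N -> (i < N)%N -> Fle (p i) (p i.+1 - p i) E0.
Proof.
move=> [pO _ p2] iN; have iO := pO i (ltnW iN); have iO' := pO i.+1 iN.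
have d0 := dK_ge0 FR iO iO'; have d2 := p2 i iN.
apply: (Fle_weak FR) (dK_lam FR iO iO') => //; apply: ler_pM => //.
- by rewrite mulr_ge0.
- lra.
- rewrite ler_expR; lra.
Qed.

Lemma up_step n k e p q : Om p -> Om q -> Fle p (q - p) e -> 0 <= e ->
  (2 ^+ n) ^+ m * ht p <= k -> k <= 1 -> Fle (U k p) (U k q - U k p) (CN / 2 ^+ n * e).
Proof.
move=> pO qO h e0 hk k1; have k0 : 0 <= k.
  by apply: le_trans hk; rewrite mulr_ge0 ?exprn_ge0// ltW// (ht_gt0 FR).
have uO : Om (U k p) by apply: (Om_U FR) => //; rewrite k0.
have c0 : 0 <= CN / 2 ^+ n * e by rewrite mulr_ge0// divr_ge0 ?exprn_ge0// ltW.
rewrite subU; have [_ /(_ n p (q - p) k e pO hk k1 e0 h) h'] := NC.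
apply: (Fle_weak FR uO) (Fle_scale FR (1 - k) h').
by rewrite ler_piMl// ger0_norm ?subr_ge0//; lra.
Qed.

Definition A1 : R := 4 * C2.
Definition A2 : R := 2 * (8 * C2 + 2) + 1 + 8 * C2 * m%:R * ln (16 * CN * E0 * (8 * C2 * (m%:R + 1))).

Let g_le0 p : Om p -> g p <= 0.
Proof. by move=> pO; apply: ln_le0; exact: (ht_le1 FR). Qed.

Lemma climb_to k p : Om p -> 0 < k -> ht p <= k ->
  dK p (U (Num.min k 1) p) <= C2 * (4 + 2 * (ln k - g p)).
Proof.
move=> pO k0 hk; have [k1|k1] := leP k 1.
  by apply: (climb FR) => //; rewrite hk.
apply: le_trans (climb FR pO _) _.
  by rewrite lexx (ht_le1 FR).
apply: ler_wpM2l; first exact: ltW.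
by rewrite ln1; have := ln_ge0 (ltW k1); lra.
Qed.

(* Climbing from the samples to a sufficiently larger height contracts the path between them to bounded
   length, so the detour through that height would be shorter than a geodesic staying low for long. *)
Lemma excursion_contract (p : nat -> V) N (i j : nat) T : qseq p N -> (i <= j <= N)%N ->
  (forall l, (i <= l <= j)%N -> g (p l) <= T) ->
  (j - i)%:R <= A1 * (2 * T - g (p i) - g (p j)) + A2.
Proof.
move=> qp /andP[ij jN] hT; have [pO p1 p2] := qp.
have lO l : (i <= l <= j)%N -> Om (p l) by case/andP=> _ h; apply: pO; exact: leq_trans jN.
have iO : Om (p i) by apply: lO; rewrite leqnn.
have jO : Om (p j) by apply: lO; rewrite leqnn ij.
set n := (j - i)%:R : R.
have n0 : 0 <= n by rewrite /n.
have X1 : 1 <= 8 * CN * E0 * (n + 1).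
  have e4 : 1 <= expR (4 : R) by rewrite -[leLHS]expR0 ler_expR.
  have c1 : 1 <= CN by case: NC.
  have : 1 <= CN * (E0 * (n + 1)).
    rewrite -[leLHS]mulr1; apply: ler_pM => //; rewrite -[leLHS]mulr1; apply: ler_pM => //.
      by rewrite /E0; lra.
    by rewrite lerDr.
  lra.
(* [2 ^+ k] is of the order of the number of steps, so that after a contraction by [2 ^+ k] all the
   steps together have length at most [1 / 8]. *)
have [k /andP[hk1 hk2]] := pow2_between X1.
have K0 : 0 < 2 ^+ k :> R by rewrite exprn_gt0.
(* High enough above the level [T] for the steps at all the samples to be contracted by [2 ^+ k]. If
   it exceeds 1, both ends climb to [o] itself. *)
pose kap : R := (2 ^+ k) ^+ m * expR T.
have Km1 : 1 <= (2 ^+ k) ^+ m :> R by rewrite exprn_ege1// exprn_ege1// ler1n.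
have kap0 : 0 < kap by rewrite mulr_gt0 ?expR_gt0// exprn_gt0.
have hle l : (i <= l <= j)%N -> (2 ^+ k) ^+ m * ht (p l) <= kap.
  move=> hl; apply: ler_wpM2l; first by rewrite exprn_ge0// ltW.
  have h0 := ht_gt0 FR (lO l hl).
  by rewrite -ler_ln ?posrE ?expR_gt0// expRK hT.
have hle' l : (i <= l <= j)%N -> ht (p l) <= kap.
  move=> hl; apply: le_trans (hle l hl); apply: ler_peMl => //.
  by rewrite ltW// (ht_gt0 FR)//; exact: lO.
have ii : (i <= i <= j)%N by rewrite leqnn.
have jj : (i <= j <= j)%N by rewrite leqnn ij.
pose k1 := Num.min kap 1.
have k1b : 0 <= k1 <= 1 by rewrite le_min ltW//= ler01 ge_min lexx orbT.
have uO l : (i <= l <= j)%N -> Om (U k1 (p l)) by move=> hl; apply: (Om_U FR) => //; exact: lO.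
have mid : dK (U k1 (p i)) (U k1 (p j)) <= 1.
  have [k11|k11] := leP kap 1; last first.
    by rewrite /k1 min_r ?ltW// !(U1 o) (dKxx FR (Om_o FR)).
  have k1E : k1 = kap by rewrite /k1 min_l.
  rewrite k1E.
  have uO' l : (i <= l <= j)%N -> Om (U kap (p l)) by rewrite -k1E; exact: uO.
  have sm : n * (CN / 2 ^+ k * E0) <= 1 / 8.
    have : (n + 1) * (8 * CN * E0) <= 2 ^+ k by rewrite mulrC.
    have -> : n * (CN / 2 ^+ k * E0) = n * CN * E0 / 2 ^+ k by ring.
    rewrite ler_pdivrMr//.
    have : 0 < CN * E0 by rewrite mulr_gt0.
    lra.
  have e0 : 0 <= CN / 2 ^+ k * E0 by rewrite mulr_ge0// ?divr_ge0// ltW.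
  have st l : (i <= l < j)%N -> Fle (U kap (p l)) (U kap (p l.+1) - U kap (p l)) (CN / 2 ^+ k * E0).
    move=> /andP[il lj]; have hl : (i <= l <= j)%N by rewrite il ltnW.
    have hl' : (i <= l.+1 <= j)%N by rewrite lj (leq_trans il).
    apply: up_step => //; [exact: lO|exact: lO|apply: (qseq_Fle qp)|exact: ltW|exact: hle].
    exact: leq_trans jN.
  have sm4 : (j - i)%:R * (CN / 2 ^+ k * E0) <= 1 / 4 by rewrite -/n; lra.
  have H := @chain_up (fun l => U kap (p l)) i j _ ij uO' e0 sm4 st.
  apply: le_trans (dK_Fle FR (uO' _ ii) (uO' _ jj) _ H) _; rewrite -/n; last lra.
  by apply/andP; split; [apply: mulr_ge0 => //; exact: mulr_ge0|lra].
have hd : n - 1 <= dK (p i) (p j) by apply: p1; rewrite ij.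
have c1 := climb_to iO kap0 (hle' i ii).
have c2 := climb_to jO kap0 (hle' j jj).
have t1 := dK_tri FR iO (uO i ii) jO.
have t2 := dK_tri FR (uO i ii) (uO j jj) jO.
rewrite -/k1 in c1 c2; rewrite (dK_sym FR (uO j jj) jO) in t2.
have lk : ln kap <= m%:R * ln (2 * (8 * CN * E0 * (n + 1))) + T.
  rewrite /kap lnM ?posrE ?expR_gt0 ?exprn_gt0// expRK lerD2r lnXn// -(mulr_natl (ln _)).
  by apply: ler_wpM2l => //; rewrite ler_ln ?posrE//; lra.
(* Chosen so that the term [4 * C2 * m * ln (n + 1)] takes up at most half of [n + 1], plus a
   constant; the inequality can then be solved for [n]. *)
set a : R := 8 * C2 * (m%:R + 1).
have a0 : 0 < a by rewrite !mulr_gt0// ltr_pwDr.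
have ce : 0 < 16 * CN * E0 by rewrite !mulr_gt0.
have n1 : 0 < n + 1 by rewrite ltr_pwDr.
have ll : ln (2 * (8 * CN * E0 * (n + 1))) <= ln (16 * CN * E0 * a) + (n + 1) / a.
  have -> : 2 * (8 * CN * E0 * (n + 1)) = (16 * CN * E0) * (n + 1) by ring.
  rewrite lnM ?posrE// [in leRHS]lnM ?posrE//.
  have := ln_le_div n1 a0; lra.
set L := ln (16 * CN * E0 * a) in ll *.
have m0 : 0 <= m%:R :> R by [].
have cm : 0 <= 4 * C2 * m%:R by rewrite !mulr_ge0// ltW.
have e1 := ler_wpM2l cm ll.
have e2 : 4 * C2 * m%:R * ((n + 1) / a) <= (n + 1) / 2.
  rewrite mulrA ler_pdivrMr// mulrC.
  have -> : (n + 1) / 2 * a = (n + 1) * (4 * C2 * (m%:R + 1)) by rewrite /a; lra.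
  apply: ler_wpM2l; first exact: ltW.
  by apply: ler_wpM2l; [rewrite mulr_ge0// ltW|rewrite lerDl].
have e3 := ler_wpM2l (mulr_ge0 (ler0n _ 4) (ltW C20)) lk.
rewrite /A1 /A2 -/a -/L; move: hd c1 c2 t1 t2 mid e1 e2 e3; rewrite mulrDr; lra.
Qed.

End Star.

(** * Geodesics follow the vertical rays from their ends *)

Section Fellow.
Variables (R : realType) (V : lmodType R) (Om : set V) (I : Type).
Variables (phi lam : I -> V -> R) (o : V) (dK : V -> V -> R) (C2 : R).
Hypothesis FR : frame Om phi lam o dK C2.
Local Notation Fle := (Fle phi lam).
Local Notation U := (U o).
Local Notation ht := (ht phi o).
Local Notation g p := (ln (ht p)).
Implicit Types (x y z v : V) (k a b c : R).

Variables (m : nat) (CN : R).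
Hypothesis NC : contraction Om phi lam o m CN.
Local Notation qseq := (qseq Om dK).
Local Notation A1 := (A1 C2).
Local Notation A2 := (A2 C2 m CN).

Let C20 : 0 < C2. Proof. exact: lt_le_trans (C2_ge1 FR). Qed.
Let CN0 : 0 < CN. Proof. by case: NC => h _; exact: lt_le_trans h. Qed.
Let A10 : 0 < A1. Proof. by rewrite mulr_gt0. Qed.

Lemma qseq_rev (p : nat -> V) N : qseq p N -> qseq (fun i => p (N - i)%N) N.
Proof.
move=> [pO p1 p2]; split.
- by move=> i _; apply: pO; exact: leq_subr.
- move=> i j /andP[ij jN].
  have h : (N - j <= N - i <= N)%N by rewrite leq_sub2l//= leq_subr.
  have := p1 _ _ h; rewrite (dK_sym FR); [|by apply: pO; lia|by apply: pO; lia].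
  by have -> : ((N - i) - (N - j) = j - i)%N by lia.
- move=> i iN; rewrite (dK_sym FR); [|by apply: pO; lia|by apply: pO; lia].
  have := p2 (N - i.+1)%N ltac:(lia).
  by have -> : ((N - i.+1).+1 = N - i)%N by lia.
Qed.

Lemma qseq_glip (p : nat -> V) N i j : qseq p N -> (i <= j <= N)%N ->
  `|g (p j) - g (p i)| <= 4 * (j - i)%:R.
Proof.
move=> qp /andP[ij jN]; have [pO p1 p2] := qp.
have key n : (i + n <= N)%N -> `|g (p (i + n)%N) - g (p i)| <= 4 * n%:R.
  elim: n => [|n IH] hn; first by rewrite addn0 subrr normr0 mulr0.
  have hn' : (i + n < N)%N by rewrite -addnS.
  have nO := pO _ (ltnW hn'); have nO' := pO _ hn'.
  have h1 := ln_ht_lip FR nO nO'; have h2 := ln_ht_lip FR nO' nO.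
  rewrite (dK_sym FR nO' nO) in h2; have h3 := p2 _ hn'.
  have := IH (ltnW hn'); rewrite !addnS !ler_norml -natr1; lra.
by have := key (j - i)%N; rewrite subnKC//; apply.
Qed.

(** A dip below both ends lasts at most [8 * A1 + |A2|] steps, up to its two extreme ones, and
    [ln ht] changes by at most 4 per step. *)
Definition A3 : R := 4 + 4 * (8 * A1 + `|A2|).

Let A30 : 0 < A3.
Proof. by rewrite /A3; have := normr_ge0 A2; have := A10; lra. Qed.

Let nat_facts1 (i w j N : nat) : (i < w)%N -> (w < j)%N -> (j <= N)%N ->
  [/\ (i.+1 <= j.-1 <= N)%N, (i <= i.+1 <= N)%N, (j.-1 <= j <= N)%N & (i.+1 <= w <= N)%N].
Proof. by move=> *; split; lia. Qed.

Let nat_facts2 (i w j : nat) : (i < w)%N -> (w < j)%N ->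
  [/\ (j - j.-1 = 1)%N, (i.+1 - i = 1)%N & (w - i.+1 <= j.-1 - i.+1)%N].
Proof. by move=> *; split; lia. Qed.

(** If [w] is below the level [M] of the lower end, cut at the last index before [w] and the first
    one after it that reach [M]. Strictly between them the samples are at most at level [M], and the
    extreme ones are within 4 of it, so [excursion_contract] makes the dip short, hence shallow. *)
Lemma quasiconcave (p : nat -> V) N i w j : qseq p N -> (i <= w)%N -> (w <= j)%N -> (j <= N)%N ->
  Num.min (g (p i)) (g (p j)) - A3 <= g (p w).
Proof.
move=> qp iw wj jN; set M := Num.min _ _.
have [h|h] := leP M (g (p w)); first by have := A30; lra.
have Mi : M <= g (p i) by rewrite ge_min lexx.
have Mj : M <= g (p j) by rewrite ge_min lexx orbT.
have [i' /andP[i'w Mi'] imax] : exists2 i', (i' <= w)%N && (M <= g (p i')) &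
    forall l, (l <= w)%N -> M <= g (p l) -> (l <= i')%N.
  have ex : exists l, (l <= w)%N && (M <= g (p l)) by exists i; rewrite iw.
  case: (@ex_maxnP (fun l => (l <= w)%N && (M <= g (p l))) w ex).
    by move=> l /andP[].
  by move=> l hl lmax; exists l => // l' h1 h2; apply: lmax; rewrite h1.
have [j' /and3P[wj' j'N Mj'] jmin] : exists2 j', [&& (w <= j')%N, (j' <= N)%N & (M <= g (p j'))] &
    forall l, (w <= l)%N -> M <= g (p l) -> (j' <= l)%N.
  have ex : exists l, (w <= l)%N && (M <= g (p l)) by exists j; rewrite wj.
  case: (ex_minnP ex) => l /andP[hl Ml] lmin; exists l; last first.
    by move=> l' h1 h2; apply: lmin; rewrite h1.
  by rewrite hl Ml andbT/=; apply: leq_trans jN; apply: lmin; rewrite wj.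
have i'w' : (i' < w)%N.
  by rewrite ltn_neqAle i'w andbT; apply/eqP => e; move: h; rewrite -e ltNge Mi'.
have wj'' : (w < j')%N.
  by rewrite ltn_neqAle wj' andbT; apply/eqP => e; move: h; rewrite e ltNge Mj'.
have low l : (i'.+1 <= l <= j'.-1)%N -> g (p l) <= M.
  move=> /andP[l1 l2]; rewrite leNgt; apply/negP => hl; have [lw|wl] := leqP l w.
    by have := leq_trans l1 (imax l lw (ltW hl)); rewrite ltnn.
  have jl := jmin l (ltnW wl) (ltW hl).
  by have := leq_trans jl l2; rewrite -ltnS prednK ?ltnn// (leq_ltn_trans _ wj'').
have [n1 n2 n3 n4] : [/\ (i'.+1 <= j'.-1 <= N)%N, (i' <= i'.+1 <= N)%N, (j'.-1 <= j' <= N)%N &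
    (i'.+1 <= w <= N)%N] by apply: nat_facts1.
have [n5 n6 n7] : [/\ (j' - j'.-1 = 1)%N, (i'.+1 - i' = 1)%N & (w - i'.+1 <= j'.-1 - i'.+1)%N].
  exact: nat_facts2.
have := excursion_contract FR NC qp n1 low.
have := qseq_glip qp n2; have := qseq_glip qp n3; have := qseq_glip qp n4.
rewrite n5 n6; have : (w - i'.+1)%:R <= (j'.-1 - i'.+1)%:R :> R by rewrite ler_nat.
rewrite !ler_norml => h1 /andP[h2 _] /andP[_ h3] /andP[h4 _] h5.
have h6 : A1 * (2 * M - g (p i'.+1) - g (p j'.-1)) <= A1 * 8 by apply: ler_wpM2l; [exact: ltW|lra].
have h7 := ler_norm A2.
rewrite /A3; lra.
Qed.

(** The rays from [p] and [q] have merged by parameter [k]. At [k = 1] both are at [o], so nothing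
    is asked from there on. *)
Definition Rel k p q := k < 1 -> Fle (U k p) (U k q - U k p) (1 / 4).

(** Going further up multiplies the difference by [1 - t] and each [phi i] by at least [1 - t]. *)
Lemma up_Rel k k' e p q : Om p -> Om q -> 0 <= k -> k <= k' -> k' < 1 -> 0 <= e ->
  Fle (U k p) (U k q - U k p) e -> Fle (U k' p) (U k' q - U k' p) e.
Proof.
move=> pO qO k0 kk k1 e0 h.
have k1' : 0 < 1 - k by lra.
pose t := (k' - k) / (1 - k).
have t0 : 0 <= t by apply: divr_ge0; lra.
have t1 : t <= 1 by rewrite ler_pdivrMr//; lra.
have hk : 1 - k' = (1 - t) * (1 - k) by rewrite /t; field; rewrite gt_eqF.
rewrite -!(UU o _ hk) subU => i; rewrite (lamZ FR) (phiU FR) ger0_norm ?subr_ge0//.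
have uO : Om (U k p) by apply: (Om_U FR) => //; apply/andP; split; lra.
have t1' : 0 <= 1 - t by lra.
have h2 := ler_wpM2l t1' (h i).
have h1 : 0 <= e * (t * phi i o) by apply: mulr_ge0 => //; apply: mulr_ge0 => //; exact: ltW (phio FR i).
lra.
Qed.

Lemma Rel_mono k k' p q : Om p -> Om q -> 0 <= k -> k <= k' -> Rel k p q -> Rel k' p q.
Proof.
move=> pO qO k0 kk h k1; apply: (up_Rel pO qO k0 kk k1); first lra.
by apply: h; exact: le_lt_trans k1.
Qed.

(** Climbing by one more bounded factor contracts the gap by 4. This slack makes the relation fit
    for induction and, up to a factor on the height, symmetric and transitive. *)
Lemma Rel_improve : exists2 Q1 : R, 1 <= Q1 & forall k k' p q, Om p -> Om q ->
  ht p <= k -> Rel k p q -> Q1 * k <= k' -> k' < 1 -> Fle (U k' p) (U k' q - U k' p) (1 / 16).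
Proof.
have CN1 : 1 <= CN by case: NC.
have [n /andP[n1 _]] := @pow2_between R (4 * CN) ltac:(lra).
have K0 : 0 < 2 ^+ n :> R by rewrite exprn_gt0.
have K1 : 1 <= (2 ^+ n) ^+ m :> R by rewrite exprn_ege1// exprn_ege1// ler1n.
set M := (2 ^+ n) ^+ m : R in K1.
(* The contraction is applied from [U k p], whose height may reach [2 * k]; a further rise of
   [2 * M * k] is then enough. *)
exists (2 * M + 1); first lra.
move=> k k' p q pO qO hk Rk kk k1.
have k0 : 0 < k by apply: lt_le_trans hk; exact: (ht_gt0 FR).
have Mk : k <= M * k by rewrite ler_peMl// ltW.
have kk1 : k < 1 by lra.
have k1' : 0 < 1 - k by lra.
pose t := (k' - k) / (1 - k).
have tk : k' - k <= t by rewrite ler_pdivlMr//; apply: ler_piMr; lra.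
have t1 : t <= 1 by rewrite ler_pdivrMr//; lra.
have ht' : 1 - k' = (1 - t) * (1 - k) by rewrite /t; field; rewrite gt_eqF.
have k01 : 0 <= k <= 1 by apply/andP; split; lra.
have uO := Om_U FR pO k01; have uO' := Om_U FR qO k01.
rewrite -!(UU o _ ht').
have hU : ht (U k p) <= 2 * k.
  by apply: le_trans (htU_le FR pO _) _; [apply/andP; split; lra|lra].
have := @up_step _ _ _ _ _ _ _ _ _ FR m CN NC n t (1 / 4) _ _ uO uO' (Rk kk1).
have q0 : 0 <= 1 / 4 :> R by lra.
have Mt : M * ht (U k p) <= t.
  by apply: le_trans tk; apply: (@le_trans _ _ (M * (2 * k))); [apply: ler_wpM2l; lra|lra].
move=> /(_ q0 Mt t1) h.
have tO : Om (U t (U k p)) by apply: (Om_U FR) => //; apply/andP; split => //; lra.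
apply: (Fle_weak FR tO) h.
have : CN / 2 ^+ n <= 1 / 4 by rewrite ler_pdivrMr//; lra.
lra.
Qed.

(** The index [s] is the top of the geodesic, so [w] is on its rising part. Induction on [w] by
    blocks of [B] steps: over such a block the height must grow by the factor [Q1], so the relation
    inherited from [p (w - B)] improves to [1 / 16], and the block itself adds only another
    [1 / 16]. *)
Lemma fellow : exists2 Q : R, 1 <= Q & forall (p : nat -> V) N s w, qseq p N ->
  (forall l, (l <= N)%N -> g (p l) <= g (p s)) -> (s <= N)%N -> (w <= s)%N ->
  Rel (Q * ht (p w)) (p w) (p 0%N).
Proof.
have CN1 : 1 <= CN by case: NC.
have [Q1 Q11 hQ1] := Rel_improve.
have lQ1 : 0 <= ln Q1 by exact: ln_ge0.
(* A block of more than [X] steps contradicts [excursion_contract], taken at the level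
   [g (p w) + A3] provided by [quasiconcave], unless [ln ht] has grown by [ln Q1]. *)
pose X := A1 * (2 * A3 + ln Q1) + A2.
pose B := (Num.truncn X).+1.
have BX : X < B%:R by exact: truncnS_gt.
have E00 : 0 < E0 R by rewrite mulr_gt0 ?expR_gt0.
have E01 : 1 <= E0 R.
  have e4 : 1 <= expR (4 : R) by rewrite -[leLHS]expR0 ler_expR.
  by rewrite /E0; lra.
have B1 : 1 <= B%:R :> R by rewrite ler1n.
have Y1 : 1 <= 32 * (B%:R * (CN * E0 R)).
  have : 1 <= B%:R * (CN * E0 R).
    by rewrite -[leLHS]mulr1; apply: ler_pM => //; rewrite -[leLHS]mulr1; apply: ler_pM.
  lra.
have [n /andP[n1 _]] := pow2_between Y1.
have K0 : 0 < 2 ^+ n :> R by rewrite exprn_gt0.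
have K1 : 1 <= (2 ^+ n) ^+ m :> R by rewrite exprn_ege1// exprn_ege1// ler1n.
set M := (2 ^+ n) ^+ m : R in K1.
have eA3 : 1 <= expR A3 by rewrite -[leLHS]expR0 ler_expR ltW.
pose Q := M * expR A3.
have Q1' : 1 <= Q by rewrite -[leLHS]mulr1; apply: ler_pM.
exists Q => // p N s w qp hs sN; have [pO _ _] := qp.
elim/ltn_ind: w => w IH ws kw1.
set k := Q * ht (p w) in kw1 *.
have wN : (w <= N)%N by exact: leq_trans sN.
have wO := pO w wN; have hw := ht_gt0 FR wO.
have k0 : 0 < k by rewrite mulr_gt0// (lt_le_trans ltr01 Q1').
have k01 : 0 <= k <= 1 by rewrite !ltW.
have gle i : (i <= w)%N -> g (p i) <= g (p w) + A3.
  move=> iw; have := quasiconcave qp iw ws sN.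
  rewrite min_l; first lra.
  by apply: hs; exact: leq_trans wN.
have hle i : (i <= w)%N -> ht (p i) <= expR A3 * ht (p w).
  move=> iw; have iO := pO i (leq_trans iw wN); have hi := ht_gt0 FR iO.
  rewrite -ler_ln ?posrE ?mulr_gt0 ?expR_gt0// lnM ?posrE ?expR_gt0// expRK addrC; exact: gle.
have chain i : (i <= w)%N -> (w - i <= B)%N -> Fle (U k (p i)) (U k (p w) - U k (p i)) (1 / 16).
  move=> iw wiB.
  have lO l : (l <= w)%N -> Om (p l) by move=> lw; apply: pO; exact: leq_trans wN.
  have uO l : (l <= w)%N -> Om (U k (p l)) by move=> lw; apply: (Om_U FR) => //; exact: lO.
  set e := CN / 2 ^+ n * E0 R.
  have e0 : 0 <= e by rewrite mulr_ge0// ?divr_ge0// ltW.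
  have sm : (w - i)%:R * e <= 1 / 32.
    apply: (@le_trans _ _ (B%:R * e)); first by apply: ler_wpM2r => //; rewrite ler_nat.
    have -> : B%:R * e = B%:R * (CN * E0 R) / 2 ^+ n by rewrite /e; ring.
    by rewrite ler_pdivrMr//; lra.
  have st l : (i <= l < w)%N -> Fle (U k (p l)) (U k (p l.+1) - U k (p l)) e.
    move=> /andP[il lw]; apply: (up_step FR NC) => //; [exact/lO/ltnW|exact: lO| |exact: ltW| |exact: ltW].
      by apply: (qseq_Fle FR qp); exact: leq_trans wN.
    rewrite -/M /k /Q -mulrA; apply: ler_wpM2l; [lra|exact/hle/ltnW].
  have sm4 : (w - i)%:R * e <= 1 / 4 by lra.
  have uO' l : (i <= l <= w)%N -> Om (U k (p l)) by case/andP=> _; exact: uO.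
  have H := @chain_up _ _ _ _ _ _ _ _ _ FR (fun l => U k (p l)) i w e iw uO' e0 sm4 st.
  by apply: (Fle_weak FR (uO _ iw)) H; lra.
have uw : Om (U k (p w)) by exact: (Om_U FR).
have [wB|Bw] := leqP w B.
  have h := chain 0%N (leq0n _); rewrite subn0 in h; have {}h := h wB.
  have u0 : Om (U k (p 0%N)) by apply: (Om_U FR) => //; apply: pO.
  apply: (Fle_base' FR u0 _ h (a := 1 / 16)); [lra|lra|].
  by rewrite -(opprB (U k (p w))); apply: (Fle_opp FR).
pose i := (w - B)%N; have iw : (i < w)%N by rewrite /i ltn_subrL (leq_ltn_trans _ Bw).
have iO := pO i (leq_trans (ltnW iw) wN); have hi := ht_gt0 FR iO.
have h1 := chain i (ltnW iw); have wi : (w - i = B)%N by rewrite /i subKn// ltnW.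
rewrite wi in h1; have {}h1 := h1 (leqnn _).
have Ri := IH i iw (leq_trans (ltnW iw) ws).
have O0 : Om (p 0%N) by apply: pO.
have ui : Om (U k (p i)) by exact: (Om_U FR).
have hik : ht (p i) <= Q * ht (p i) by rewrite ler_peMl// ltW.
have gap : Q1 * (Q * ht (p i)) <= k.
  rewrite mulrCA; apply: ler_wpM2l; first lra.
  have Q10 : 0 < Q1 by lra.
  rewrite -ler_ln ?posrE ?mulr_gt0// lnM ?posrE//.
  have iwN : (i <= w <= N)%N by rewrite (ltnW iw).
  have := excursion_contract FR NC qp iwN (fun l hl => gle l (proj2 (andP hl))); rewrite wi.
  move=> /(lt_le_trans BX); rewrite /X ltrD2r ltr_pM2l//; lra.
have h2 := hQ1 _ _ _ _ iO O0 hik Ri gap kw1.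
have h3 : Fle (U k (p i)) (U k (p 0%N) - U k (p w)) (1 / 16 + 1 / 16).
  have -> : U k (p 0%N) - U k (p w) = (U k (p 0%N) - U k (p i)) + - (U k (p w) - U k (p i)).
    by rewrite opprB addrA subrK.
  by apply: (Fle_add FR) => //; apply: (Fle_opp FR).
by apply: (Fle_base' FR ui _ h1 _ h3); lra.
Qed.

End Fellow.

(** * Geodesic triangles are close to tripods *)

Section Tripod.
Variables (R : realType) (V : lmodType R) (Om : set V) (I : Type).
Variables (phi lam : I -> V -> R) (o : V) (dK : V -> V -> R) (C2 : R).
Hypothesis FR : frame Om phi lam o dK C2.
Local Notation Fle := (Fle phi lam).
Local Notation U := (U o).
Local Notation ht := (ht phi o).
Local Notation g p := (ln (ht p)).
Implicit Types (x y z v q : V) (k t a b c T : R).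

Variables (m : nat) (CN : R).
Hypothesis NC : contraction Om phi lam o m CN.
Local Notation qseq := (qseq Om dK).
Local Notation Rel := (Rel phi lam o).
Local Notation A3 := (A3 C2 m CN).

Let C20 : 0 < C2. Proof. exact: lt_le_trans (C2_ge1 FR). Qed.

Definition conn k p q := [/\ Om p, Om q, ht p <= k, ht q <= k & Rel k p q].

Lemma conn_mono k k' p q : k <= k' -> conn k p q -> conn k' p q.
Proof.
move=> kk [pO qO hp hq h]; split => //; [exact: le_trans kk|exact: le_trans kk|].
by apply: (Rel_mono FR pO qO _ kk h); apply: le_trans hp; apply/ltW/(ht_gt0 FR).
Qed.

(** The relations are first improved to [1 / 16]; changing the base point, or adding two of them
    ([1 / 16 + 17 / 256]), then stays below [1 / 4]. *)
Lemma conn_symtrans : exists2 Q1 : R, 1 <= Q1 &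
  (forall k p q, conn k p q -> conn (Q1 * k) q p) /\
  (forall k p q z, conn k p q -> conn k q z -> conn (Q1 * k) p z).
Proof.
have [Q1 Q11 H] := Rel_improve FR NC; exists Q1 => //.
have up k p : Om p -> ht p <= k -> ht p <= Q1 * k.
  move=> pO hk; apply: (le_trans hk); apply: ler_peMl => //.
  by apply: le_trans hk; apply/ltW/(ht_gt0 FR).
have uO k p q : conn k p q -> Q1 * k < 1 -> Om (U (Q1 * k) p) /\ Om (U (Q1 * k) q).
  move=> [pO qO hp hq _] k1; have h0 := ht_gt0 FR pO.
  have k0 : 0 <= Q1 * k by apply: mulr_ge0; lra.
  by split; apply: (Om_U FR) => //; apply/andP; split => //; exact: ltW.
split=> [k p q c|k p q z c1 c2].
  case: (c) => pO qO hp hq h; split => //; [exact: up|exact: up|] => k1.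
  have h1 := H _ _ _ _ pO qO hp h (lexx _) k1; have [u1 u2] := uO _ _ _ c k1.
  apply: (Fle_base' FR u1 _ h1 (a := 1 / 16)); [lra|lra|].
  by rewrite -(opprB (U (Q1 * k) q)); apply: (Fle_opp FR).
case: (c1) => pO qO hp hq h; case: (c2) => _ zO _ hz h'.
split => //; [exact: up|exact: up|] => k1.
have h1 := H _ _ _ _ pO qO hp h (lexx _) k1; have [u1 u2] := uO _ _ _ c1 k1.
have h2 := H _ _ _ _ qO zO hq h' (lexx _) k1.
have h3 : Fle (U (Q1 * k) p) (U (Q1 * k) z - U (Q1 * k) q) (17 / 256).
  by apply: (Fle_base FR u1 _ h1 _ h2); lra.
have -> : U (Q1 * k) z - U (Q1 * k) p = (U (Q1 * k) q - U (Q1 * k) p) + (U (Q1 * k) z - U (Q1 * k) q).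
  by rewrite [RHS]addrC addrA subrK.
by apply: (Fle_weak FR u1) (Fle_add FR h1 h3); lra.
Qed.

Lemma conn_dK k X p q : conn k p q -> k <= X * ht p -> k <= X * ht q ->
  dK p q <= C2 * (8 + 4 * ln X) + 1.
Proof.
move=> [pO qO hp hq h] kp kq; have p0 := ht_gt0 FR pO; have q0 := ht_gt0 FR qO.
have k0 : 0 < k by exact: lt_le_trans hp.
have X0 : 0 < X by rewrite -(pmulr_lgt0 _ p0); exact: lt_le_trans kp.
pose k1 := Num.min k 1.
have k1b : 0 <= k1 <= 1 by rewrite le_min (ltW k0) ler01/= ge_min lexx orbT.
have up := Om_U FR pO k1b; have uq := Om_U FR qO k1b.
have mid : dK (U k1 p) (U k1 q) <= 1.
  have [k11|k11] := ltP k 1; last first.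
    by rewrite /k1 min_r// !(U1 o) (dKxx FR (Om_o FR)).
  have k1E : k1 = k by rewrite /k1 min_l// ltW.
  rewrite k1E in up uq *; apply: le_trans (dK_Fle FR up uq _ (h k11)) _; lra.
have c1 := climb_to FR pO k0 hp; have c2 := climb_to FR qO k0 hq.
have t1 := dK_tri FR pO up qO; have t2 := dK_tri FR up uq qO.
rewrite -/k1 in c1 c2; rewrite (dK_sym FR uq qO) in t2.
have l1 : ln k - g p <= ln X.
  by rewrite lerBlDr -lnM ?posrE// ler_ln ?posrE// mulr_gt0.
have l2 : ln k - g q <= ln X.
  by rewrite lerBlDr -lnM ?posrE// ler_ln ?posrE// mulr_gt0.
have e1 := ler_wpM2l (ltW C20) l1; have e2 := ler_wpM2l (ltW C20) l2.
lra.
Qed.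

Variable Q : R.
Hypothesis Q1 : 1 <= Q.
Hypothesis fel : forall (p : nat -> V) N s w, qseq p N ->
  (forall l, (l <= N)%N -> g (p l) <= g (p s)) -> (s <= N)%N -> (w <= s)%N ->
  Rel (Q * ht (p w)) (p w) (p 0%N).

(** [A3] is the defect of quasiconcavity and 4 the largest jump of [ln ht] between consecutive
    samples. *)
Definition BB : R := expR (A3 + 4).

Let A30 : 0 <= A3.
Proof.
rewrite /A3; have : 0 <= A1 C2 by rewrite /A1 mulr_ge0// ltW.
have := normr_ge0 (A2 C2 m CN); lra.
Qed.

Let B1 : 1 <= BB. Proof. by rewrite /BB -[leLHS]expR0 ler_expR; apply: addr_ge0. Qed.

Let Q0 : 0 <= Q. Proof. exact: le_trans ler01 Q1. Qed.

Let QB1 : 1 <= Q * BB. Proof. by rewrite -[leLHS]mulr1; apply: ler_pM. Qed.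

Lemma qseq_left (p : nat -> V) N s : qseq p N ->
  (forall l, (l <= N)%N -> g (p l) <= g (p s)) -> (s <= N)%N ->
  (forall w, (w <= s)%N -> conn (Q * BB * ht (p w)) (p w) (p 0%N)) /\
  (forall t, ht (p 0%N) <= t -> t <= ht (p s) ->
     exists2 w, (w <= s)%N & t <= ht (p w) /\ ht (p w) <= BB * t).
Proof.
move=> qp hs sN; have [pO _ _] := qp.
have wN w : (w <= s)%N -> (w <= N)%N by move=> h; exact: leq_trans sN.
have h0 w : (w <= N)%N -> 0 < ht (p w) by move=> wN'; apply: (ht_gt0 FR); exact: pO.
split=> [w ws|t t0 ts].
  have wO := pO w (wN w ws); have O0 := pO 0%N (leq0n _).
  have hw := h0 w (wN w ws); have h00 := h0 0%N (leq0n _).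
  have QQ : Q * ht (p w) <= Q * BB * ht (p w).
    by rewrite ler_pM2r// ler_peMr.
  split => //; first by rewrite ler_peMl// ltW.
    have := quasiconcave FR NC qp (leq0n w) ws sN.
    rewrite min_l; last exact: hs.
    rewrite lerBlDr => h; apply: (@le_trans _ _ (BB * ht (p w))); last first.
      by rewrite ler_pM2r// ler_peMl// ltW// expR_gt0.
    rewrite -ler_ln ?posrE ?mulr_gt0 ?expR_gt0// lnM ?posrE ?expR_gt0// expRK; lra.
  apply: (Rel_mono FR wO O0 _ QQ); last exact: (fel qp hs sN ws).
  by apply: mulr_ge0 => //; exact: ltW.
have ex : exists l, t <= ht (p l) by exists s.
case: (ex_minnP ex) => w hw wmin; have ws : (w <= s)%N by exact: wmin.
exists w => //; split => //.
case: w hw wmin ws => [|w] hw wmin ws.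
  by apply: (le_trans t0); rewrite ler_peMl//; apply: le_trans t0; apply/ltW/h0.
have w1 : (w <= w.+1 <= N)%N by rewrite leqnSn wN.
have wt : ht (p w) < t by rewrite ltNge; apply/negP => /wmin; rewrite ltnn.
have hw0 : 0 < ht (p w) by apply: h0; apply: wN; exact: ltnW.
apply: (@le_trans _ _ (BB * ht (p w))); last by rewrite ler_pM2l ?expR_gt0// ltW.
have := qseq_glip FR qp w1; rewrite subSnn ler_norml => /andP[_ h].
have hw1 := h0 _ (wN _ ws).
rewrite -ler_ln ?posrE ?mulr_gt0 ?expR_gt0// lnM ?posrE ?expR_gt0// expRK.
by have := A30; lra.
Qed.

(* A geodesic side as a tripod: it follows the vertical rays from [x] and [y] up to height [T]. *)
Definition side (S : V -> Prop) x y T := [/\ ht x <= T, ht y <= T,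
  forall p, S p -> ht p <= T /\ (conn (Q * BB * ht p) p x \/ conn (Q * BB * ht p) p y),
  (forall t, ht x <= t -> t <= T -> exists2 p, S p &
     [/\ conn (Q * BB * ht p) p x, t <= ht p & ht p <= BB * t]) /\
  (forall t, ht y <= t -> t <= T -> exists2 p, S p &
     [/\ conn (Q * BB * ht p) p y, t <= ht p & ht p <= BB * t]) &
  exists2 p, S p & [/\ conn (Q * BB * T) p x, conn (Q * BB * T) p y & ht p = T]].

(** A geodesic does not rise far above the height where the rays from its ends merge; [side] alone
    does not express this. *)
Definition top_bound (BX : R -> R) x y T := forall X T', 1 <= X -> conn (X * T') x y ->
  ht x <= T' -> ht y <= T' -> T <= BX X * T'.

Lemma side_sym S x y T : side S x y T -> side S y x T.
Proof.
move=> [h1 h2 h3 [h4 h5] [p Sp [p1 p2 p3]]]; split => //.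
  by move=> q /h3[? [?|?]]; split => //; [right|left].
by exists p.
Qed.

Lemma conn_join Q1' k p q x : 1 <= Q1' ->
  ((forall k p q, conn k p q -> conn (Q1' * k) q p) /\
  (forall k p q z, conn k p q -> conn k q z -> conn (Q1' * k) p z)) ->
  conn k p x -> conn k q x -> conn (Q1' * (Q1' * k)) p q.
Proof.
move=> Q11 [cs ct] c1 c2; apply: ct (cs _ _ _ c2); apply: conn_mono c1.
case: c2 => qO _ hq _ _; apply: ler_peMl => //.
by apply: le_trans hq; apply/ltW/(ht_gt0 FR).
Qed.

(** The peak [s] splits the geodesic into two parts to which [qseq_left] applies. For [top_bound]:
    samples at height about [T'] on the two flanks are connected through the ends, hence at bounded
    distance, so they are few steps apart and the peak between them is not much higher. *)
Lemma qseq_side : exists2 BX : R -> R, (forall X, 1 <= X -> 1 <= BX X) & forall (p : nat -> V) N, qseq p N ->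
  exists2 T, side (fun z => exists2 i, (i <= N)%N & z = p i) (p 0%N) (p N) T &
    top_bound BX (p 0%N) (p N) T.
Proof.
have [Q1' Q11' hQ] := conn_symtrans; have [cs ct] := hQ.
pose Y (X : R) := Q1' * (Q1' * (Q1' * (Q1' * (Q * BB * BB * X)))).
pose D (X : R) := C2 * (8 + 4 * ln (Y X)) + 1.
have BB0 : 0 < BB by exact: lt_le_trans ltr01 B1.
have Q00 : 0 < Q by exact: lt_le_trans ltr01 Q1.
have Q1'0 : 0 <= Q1' by exact: le_trans ler01 _.
have Qmul (a : R) : 0 <= a -> a <= Q1' * a by move=> a0; exact: ler_peMl.
have QBX X : 1 <= X -> X <= Q * BB * BB * X.
  move=> X1; apply: ler_peMl; first exact: le_trans ler01 X1.
  by rewrite -[leLHS]mulr1; apply: ler_pM.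
have Y1 X : 1 <= X -> 1 <= Y X.
  move=> X1; apply: (le_trans X1); apply: (le_trans (QBX X X1)).
  have h0 : 0 <= Q * BB * BB * X.
    by apply: mulr_ge0; [rewrite !mulr_ge0// ltW|exact: le_trans ler01 X1].
  have h1 := mulr_ge0 Q1'0 h0; have h2 := mulr_ge0 Q1'0 h1; have h3 := mulr_ge0 Q1'0 h2.
  apply: (le_trans (Qmul _ h0)); apply: (le_trans (Qmul _ h1)).
  by apply: (le_trans (Qmul _ h2)); exact: Qmul.
have D0 X : 1 <= X -> 0 <= D X.
  move=> X1; rewrite /D; have := ln_ge0 (Y1 X X1) => l0.
  by apply: addr_ge0 => //; apply: mulr_ge0; [exact: ltW|lra].
pose BX (X : R) := BB * expR (4 * (D X + 1)).
have E1 X : 1 <= X -> 1 <= expR (4 * (D X + 1)).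
  by move=> X1; rewrite -[leLHS]expR0 ler_expR; have := D0 X X1; lra.
exists BX; first by move=> X X1; rewrite -[leLHS]mulr1; apply: ler_pM => //; exact: E1.
move=> p N qp; have [pO p1 _] := qp.
have [s sN hs] : exists2 s, (s <= N)%N & forall l, (l <= N)%N -> g (p l) <= g (p s).
  elim: (N) => [|n [s sn IH]]; first by exists 0%N => // l; rewrite leqn0 => /eqP ->.
  have [h|h] := leP (g (p n.+1)) (g (p s)).
    exists s; first exact: leqW.
    by move=> l; rewrite leq_eqVlt ltnS => /predU1P[->//|]; exact: IH.
  exists n.+1 => // l; rewrite leq_eqVlt ltnS => /predU1P[->//|/IH].
  by move=> /le_trans; apply; exact: ltW.
have qr := qseq_rev FR NC qp.
have sr : (N - s <= N)%N by exact: leq_subr.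
have hsr l : (l <= N)%N -> g (p (N - l)%N) <= g (p (N - (N - s))%N).
  by move=> lN; rewrite (subKn sN); apply: hs; exact: leq_subr.
have [L1 L2] := qseq_left qp hs sN.
have [M1 M2] := qseq_left qr hsr sr.
rewrite subn0 in M1 M2; rewrite subKn// in M2.
have hO l : (l <= N)%N -> 0 < ht (p l) by move=> lN; apply: (ht_gt0 FR); exact: pO.
have hsT l : (l <= N)%N -> ht (p l) <= ht (p s).
  by move=> lN; have := hs l lN; rewrite ler_ln ?posrE ?hO.
have M1' w : (s <= w)%N -> (w <= N)%N -> conn (Q * BB * ht (p w)) (p w) (p N).
  by move=> sw wN; have := M1 (N - w)%N; rewrite subKn//; apply; rewrite leq_sub2l.
have M2' t : ht (p N) <= t -> t <= ht (p s) ->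
    exists2 w, (s <= w <= N)%N & t <= ht (p w) /\ ht (p w) <= BB * t.
  move=> t0 ts; have [w ws hw] := M2 t t0 ts; exists (N - w)%N => //.
  by rewrite leq_subr andbT leq_subRL 1?addnC -?leq_subRL// (leq_trans ws).
exists (ht (p s)); first split; [exact: hsT|exact: hsT| | | |].
- move=> _ [i iN ->]; split; first exact: hsT.
  have [h|h] := leqP i s; first by left; exact: L1.
  by right; apply: M1' => //; exact: ltnW.
- split=> t t0 ts.
    have [w ws [w1 w2]] := L2 t t0 ts; exists (p w); first by exists w => //; exact: leq_trans sN.
    by split => //; exact: L1.
  have [w /andP[ws wN] [w1 w2]] := M2' t t0 ts; exists (p w); first by exists w.
  by split => //; exact: M1'.
- exists (p s); first by exists s.
  by split => //; [exact: L1|exact: M1'].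
move=> X T' X1 cxy xT yT.
have T'0 : 0 < T' by apply: lt_le_trans xT; exact: hO.
have [h|h] := leP (ht (p s)) T'.
  apply: (le_trans h); apply: ler_peMl; first exact: ltW.
  by rewrite -[leLHS]mulr1; apply: ler_pM => //; exact: E1.
have [w ws [w1 w2]] := L2 T' xT (ltW h).
have [w' /andP[ws' wN'] [w1' w2']] := M2' T' yT (ltW h).
have wN : (w <= N)%N by exact: leq_trans sN.
pose K := Q * BB * BB * X * T'.
have QB0 : 0 <= Q * BB by exact: le_trans ler01 QB1.
have big a : a <= BB * T' -> Q * BB * a <= K.
  move=> ha; apply: (@le_trans _ _ (Q * BB * (BB * T'))); first exact: ler_wpM2l.
  rewrite mulrA /K ler_pM2r//; apply: ler_peMr => //.
  by apply: mulr_ge0 => //; exact: ltW.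
have c1 := conn_mono (big _ w2) (L1 w ws).
have c2 := conn_mono (big _ w2') (M1' w' ws' wN').
have c3 : conn K (p 0%N) (p N).
  by apply: conn_mono cxy; rewrite /K ler_pM2r//; exact: QBX.
have K0 : 0 <= K.
  by apply: mulr_ge0; last exact: ltW; apply: (@le_trans _ _ 1) => //; apply: (le_trans X1); exact: QBX.
have c4 := conn_join Q11' hQ c2 c3.
have KQ : K <= Q1' * (Q1' * K) by apply: (le_trans (Qmul _ K0)); apply: Qmul; exact: mulr_ge0.
have c5 := conn_join Q11' hQ (conn_mono KQ c1) c4.
have YE : Q1' * (Q1' * (Q1' * (Q1' * K))) = Y X * T' by rewrite /Y /K -!mulrA.
rewrite YE in c5.
have Y0 : 0 <= Y X by exact: le_trans ler01 (Y1 X X1).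
have dd := conn_dK c5 (ler_wpM2l Y0 w1) (ler_wpM2l Y0 w1').
have ww' : (w <= w')%N by exact: leq_trans ws'.
have := p1 w w'; rewrite ww' => /(_ wN') d1.
have ss : (s - w)%:R <= (w' - w)%:R :> R by rewrite ler_nat leq_sub2r.
have := qseq_glip FR qp (i := w) (j := s); rewrite ws => /(_ sN); rewrite ler_norml => /andP[_ gs].
have hw0 := hO w wN; have hs0 := hO s sN.
have := D0 X X1; rewrite /D => DX0.
rewrite /BX mulrAC -ler_ln ?posrE ?mulr_gt0 ?expR_gt0// lnM ?posrE ?mulr_gt0 ?expR_gt0//.
rewrite expRK; apply: (@le_trans _ _ (g (p w) + 4 * (D X + 1))).
  by rewrite /D; lra.
by rewrite lerD2r ler_ln ?posrE ?mulr_gt0.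
Qed.

(** Three cases for the height [t] of [p] on the branch of [x]. If [t <= T2], the side to [z] passes
    on the same branch at that height. If [T2 < t <= T3], the rays of [x] and [z] have merged by
    height about [t], and the third side follows the branch of [z]. Otherwise all three rays merge
    at about [max T2 T3], which [top_bound] makes comparable to [t], and the peak of one of the
    other sides is close. *)
Lemma tripod (BX : R -> R) : (forall X, 1 <= X -> 1 <= BX X) ->
  exists2 D : R, 0 <= D & forall S1 S2 S3 x y z T1 T2 T3,
    side S1 x y T1 -> top_bound BX x y T1 -> side S2 x z T2 -> side S3 y z T3 ->
    forall p, S1 p -> conn (Q * BB * ht p) p x -> exists2 q, S2 q \/ S3 q & dK p q <= D.
Proof.
move=> BX1; have [f f1 hQ] := conn_symtrans; have [cs ct] := hQ.
pose W := Q * BB; have W1 : 1 <= W by [].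
have W0 : 0 <= W by exact: le_trans ler01 W1.
have f0 : 0 <= f by exact: le_trans ler01 f1.
have BB0 : 0 <= BB by exact: le_trans ler01 B1.
have fM (a : R) : 0 <= a -> a <= f * a by move=> a0; exact: ler_peMl.
have fm (a b : R) : a <= b -> f * a <= f * b by move=> ab; exact: ler_wpM2l.
have f0M (a : R) : 0 <= a -> 0 <= f * a by move=> a0; exact: mulr_ge0.
(* Here and in [Xm], each factor [f] pays for one use of symmetry or transitivity of [conn] in the
   longest chain of relations. *)
pose X4 := f * (f * (f * (f * W))).
have X41 : 1 <= X4.
  by do 4 (apply: (le_trans _ (fM _ _)); last by rewrite ?f0M).
pose b := Num.max BB (BX X4).
have b1 : 1 <= b by rewrite le_max B1.
have bBB : BB <= b by rewrite le_max lexx.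
have bX : BX X4 <= b by rewrite le_max lexx orbT.
have b0 : 0 <= b by exact: le_trans ler01 b1.
pose Xm := f * (f * (f * (f * (f * (W * BB * W))))).
have WBW : W <= W * BB * W /\ W * BB <= W * BB * W.
  split; last by apply: ler_peMr => //; exact: mulr_ge0.
  by apply: ler_peMl => //; rewrite -[leLHS]mulr1; apply: ler_pM.
have WW0 : 0 <= W * BB * W by rewrite !mulr_ge0.
have Xm1 : 1 <= Xm.
  do 5 (apply: (le_trans _ (fM _ _)); last by rewrite ?f0M).
  exact: le_trans W1 WBW.1.
have Xm0 : 0 <= Xm by exact: le_trans ler01 Xm1.
pose D := C2 * (8 + 4 * ln (Xm * b)) + 1.
have Xmb1 : 1 <= Xm * b by rewrite -[leLHS]mulr1; apply: ler_pM.
exists D.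
  rewrite /D; apply: addr_ge0 => //; apply: mulr_ge0; first exact: ltW.
  by have := ln_ge0 Xmb1; lra.
move=> S1 S2 S3 x y z T1 T2 T3 [x1 y1 h1 _ _] tb [x2 z2 _ [h2 _] [q2 S2q [q2x q2z q2T]]].
move=> [y3 z3 _ [_ h3] [q3 S3q [q3y q3z q3T]]] p S1p cpx.
set t := ht p in cpx; case: (cpx) => pO xO _ hx _.
have t0 : 0 < t by exact: (ht_gt0 FR).
have t0' := ltW t0.
have pt (a : R) : 0 <= a -> 0 <= a * t by move=> a0; exact: mulr_ge0.
have fin k q : S2 q \/ S3 q -> conn k p q -> k <= Xm * t -> t <= b * ht q ->
    exists2 q, S2 q \/ S3 q & dK p q <= D.
  move=> Sq c kX tq; exists q => //; apply: (conn_dK (conn_mono kX c)).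
    by rewrite -mulrA; apply: ler_wpM2l => //; exact: ler_peMl.
  by rewrite -mulrA; exact: ler_wpM2l.
have XmE : Xm * t = f * (f * (f * (f * (f * (W * BB * W * t))))) by rewrite /Xm -!mulrA.
have bound2 (a : R) : 0 <= a -> a <= W * BB * W * t -> f * (f * a) <= Xm * t.
  move=> a0 aW; rewrite XmE; have h0 := pt _ WW0.
  apply: (@le_trans _ _ (f * (f * (W * BB * W * t)))); first by do 2 apply: (fm _ _).
  by do 3 (apply: (le_trans _ (fM _ _)); last by rewrite ?f0M).
have bound5 (a : R) : a <= W * BB * W * t -> f * (f * (f * (f * (f * a)))) <= Xm * t.
  by move=> aW; rewrite XmE; do 5 apply: (fm _ _).
have WWt (a : R) : a <= W * BB * W -> a * t <= W * BB * W * t by move=> h; exact: ler_wpM2r.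
have [tT2|T2t] := leP t T2.
  (* The branch of [x] only offers heights above that of [x]; [conn] bounds [ht x] by [W * t], so
     raising [t] to it is harmless. *)
  pose t' := Num.max t (ht x).
  have tt' : t <= t' by rewrite le_max lexx.
  have xt' : ht x <= t' by rewrite le_max lexx orbT.
  have t'W : t' <= W * t by rewrite ge_max hx ler_peMl.
  have t'T : t' <= T2 by rewrite ge_max tT2.
  have [q Sq [qx q1 q2']] := h2 t' xt' t'T.
  have tq : t <= ht q by exact: le_trans q1.
  have c1 : conn (W * BB * W * t) q x.
    have -> : W * BB * W * t = W * (BB * (W * t)) by rewrite !mulrA.
    apply: conn_mono qx; apply: (@ler_wpM2l _ W) => //.
    by apply: (le_trans q2'); exact: ler_wpM2l.
  have c2 := conn_mono (WWt _ WBW.1) cpx.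
  apply: (fin _ q (or_introl Sq) (conn_join f1 hQ c2 c1)); first by apply: bound2 => //; exact: pt.
  by apply: (le_trans tq); apply: ler_peMl => //; exact: le_trans tq.
have Wt (T : R) : T <= t -> W * T <= W * t by move=> h; exact: ler_wpM2l.
have q2x' := conn_mono (Wt _ (ltW T2t)) q2x.
have q2z' := conn_mono (Wt _ (ltW T2t)) q2z.
have pq2 := conn_join f1 hQ cpx q2x'.
have Wt0 := pt _ W0.
have Wf2 : W * t <= f * (f * (W * t)) by apply: (le_trans (fM _ Wt0)); apply: fM; exact: f0M.
have pz := ct _ _ _ _ pq2 (conn_mono Wf2 q2z').
have [tT3|T3t] := leP t T3.
  have [q Sq [qz q1 q2']] := h3 t (le_trans z2 (ltW T2t)) tT3.
  have c1 : conn (W * BB * t) q z.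
    have -> : W * BB * t = W * (BB * t) by rewrite !mulrA.
    by apply: conn_mono qz; exact: (@ler_wpM2l _ W).
  have WB0 : 0 <= W * BB * t by apply: pt; exact: mulr_ge0.
  have c2 : conn (f * (f * (f * (W * BB * t)))) p z.
    by apply: conn_mono pz; do 3 apply: (fm _ _); apply: ler_wpM2r => //; exact: ler_peMr.
  have c3 : conn (f * (f * (f * (W * BB * t)))) q z.
    apply: conn_mono c1; do 3 (apply: (le_trans _ (fM _ _)); last by rewrite ?f0M).
    by [].
  apply: (fin _ q (or_intror Sq) (conn_join f1 hQ c2 c3)).
    by apply: bound5; exact: WWt WBW.2.
  by apply: (le_trans q1); apply: ler_peMl => //; exact: le_trans q1.
pose T := Num.max T2 T3.
have TT2 : T2 <= T by rewrite le_max lexx.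
have TT3 : T3 <= T by rewrite le_max lexx orbT.
have T0 : 0 <= T by apply: le_trans TT2; rewrite -q2T; apply/ltW/(ht_gt0 FR); case: q2x.
have WT (a : R) : a <= T -> W * a <= W * T by move=> h; exact: ler_wpM2l.
have jn q u v : conn (W * T) q u -> conn (W * T) q v -> conn (f * (f * (W * T))) u v.
  move=> c1 c2; apply: ct (cs _ _ _ c1) _; apply: conn_mono c2.
  by apply: fM; exact: mulr_ge0.
have xz := jn _ _ _ (conn_mono (WT _ TT2) q2x) (conn_mono (WT _ TT2) q2z).
have yz := jn _ _ _ (conn_mono (WT _ TT3) q3y) (conn_mono (WT _ TT3) q3z).
have xy := conn_join f1 hQ xz yz.
have XE : f * (f * (f * (f * (W * T)))) = X4 * T by rewrite /X4 -!mulrA.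
rewrite XE in xy.
have T1b := tb _ _ X41 xy (le_trans x2 TT2) (le_trans y3 TT3).
have tb' : t <= b * T.
  by apply: (le_trans (h1 p S1p).1); apply: (le_trans T1b); exact: ler_wpM2r.
have [h|h] := leP T3 T2.
  have TE : T = T2 by rewrite /T max_l.
  apply: (fin _ q2 (or_introl S2q) pq2); first by apply: bound2 => //; exact: WWt WBW.1.
  by rewrite q2T -TE.
have TE : T = T3 by rewrite /T max_r// ltW.
have q3z' := conn_mono (Wt _ (ltW T3t)) q3z.
have W3 : W * t <= f * (f * (f * (W * t))).
  by do 3 (apply: (le_trans _ (fM _ _)); last by rewrite ?f0M).
apply: (fin _ q3 (or_intror S3q) (conn_join f1 hQ pz (conn_mono W3 q3z'))).
  by apply: bound5; exact: WWt WBW.1.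
by rewrite q3T -TE.
Qed.

End Tripod.

Definition real_geodesic (R : realType) (V : Type) (Om : set V) (dK : V -> V -> R)
    (sg : R -> V) (a b : R) (x y : V) :=
  [/\ a <= b, sg a = x, sg b = y, (forall s, a <= s <= b -> Om (sg s)) &
  (forall s t, a <= s <= b -> a <= t <= b -> dK (sg s) (sg t) = `|s - t|)].

(** * Contraction implies thin triangles *)

Section FrameThin.
Variables (R : realType) (V : lmodType R) (Om : set V) (I : Type).
Variables (phi lam : I -> V -> R) (o : V) (dK : V -> V -> R) (C2 : R).
Hypothesis FR : frame Om phi lam o dK C2.
Variables (m : nat) (CN : R).
Hypothesis NC : contraction Om phi lam o m CN.
Local Notation qseq := (qseq Om dK).
Local Notation ht := (ht phi o).

Local Notation rgeod := (real_geodesic Om dK).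

(** Cutting into [N] equal steps of length [c], with [N] the integer part of the total length plus
    one, gives [(j - i) * c >= j - i - 1] since [N * (1 - c) <= 1]. This is the error allowed in
    [qseq]. *)
Lemma geod_qseq sg a b x y : rgeod sg a b x y -> exists p N, [/\ qseq p N, p 0%N = x, p N = y,
  (forall i, (i <= N)%N -> exists2 t, a <= t <= b & p i = sg t) &
  (forall t, a <= t <= b -> exists2 i, (i <= N)%N & dK (sg t) (p i) <= 1)].
Proof.
move=> [ab sa sb sO sd]; pose N := (Num.truncn (b - a)).+1.
have N0 : 0 < N%:R :> R by rewrite ltr0n.
have N1 : b - a < N%:R by exact: truncnS_gt.
have N2 : N%:R - 1 <= b - a.
  by rewrite /N -natr1 addrK; rewrite truncn_le subr_ge0.
pose c := (b - a) / N%:R.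
have c0 : 0 <= c by apply: divr_ge0; lra.
have c1 : c <= 1 by rewrite ler_pdivrMr//; lra.
have cN : c * N%:R = b - a by rewrite /c divfK// gt_eqF.
have inab i : (i <= N)%N -> a <= a + i%:R * c <= b.
  move=> iN; have h0 : 0 <= i%:R * c by apply: mulr_ge0.
  have h1 : i%:R * c <= N%:R * c by apply: ler_wpM2r => //; rewrite ler_nat.
  by apply/andP; split; lra.
have dist i j : (i <= j)%N -> (j <= N)%N -> dK (sg (a + i%:R * c)) (sg (a + j%:R * c)) = (j - i)%:R * c.
  move=> ij jN; rewrite sd ?inab//; last exact: leq_trans jN.
  have h : i%:R * c <= j%:R * c by apply: ler_wpM2r => //; rewrite ler_nat.
  rewrite distrC ger0_norm; last by lra.
  by rewrite natrB//; ring.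
exists (fun i => sg (a + i%:R * c)), N; split.
- split.
  + by move=> i iN; apply: sO; exact: inab.
  + move=> i j /andP[ij jN]; rewrite dist//.
    have h1 : (j - i)%:R <= N%:R :> R by rewrite ler_nat (leq_trans (leq_subr _ _)).
    have h2 : (j - i)%:R * (N%:R - 1) <= (j - i)%:R * (c * N%:R).
      by apply: ler_wpM2l => //; rewrite cN.
    rewrite -(ler_pM2r N0); lra.
  + by move=> i iN; rewrite dist// subSnn mul1r; lra.
- by rewrite mul0r addr0.
- by rewrite mulrC cN -sb; congr sg; ring.
- by move=> i iN; exists (a + i%:R * c) => //; exact: inab.
move=> t tab; have [cz|cnz] := eqVneq c 0.
  exists 0%N => //; rewrite mul0r addr0 sd ?lexx//.
  by move: cN; rewrite cz mul0r => h; rewrite ler_norml; lra.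
have cp : 0 < c by rewrite lt_neqAle eq_sym cnz.
pose i := Num.truncn ((t - a) / c).
have q0 : 0 <= (t - a) / c by apply: divr_ge0; lra.
have i1 : i%:R <= (t - a) / c by rewrite truncn_le.
have i2 : (t - a) / c < i.+1%:R by exact: truncnS_gt.
rewrite ler_pdivlMr// in i1; rewrite ltr_pdivrMr// -natr1 in i2.
have iN : (i <= N)%N.
  rewrite -(ler_nat R) -(ler_pM2r cp) mulrC [leRHS]mulrC cN; lra.
exists i => //; rewrite sd ?inab// ger0_norm; lra.
Qed.

Theorem frame_thin : exists2 D : R, 0 <= D &
  forall x y z s1 s2 s3 a1 b1 a2 b2 a3 b3, rgeod s1 a1 b1 x y -> rgeod s2 a2 b2 y z ->
    rgeod s3 a3 b3 z x -> forall s, a1 <= s <= b1 ->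
    (exists2 t, a2 <= t <= b2 & dK (s1 s) (s2 t) <= D) \/
    (exists2 t, a3 <= t <= b3 & dK (s1 s) (s3 t) <= D).
Proof.
have [Q Q1 fel] := fellow FR NC.
have [BX BX1 hside] := qseq_side FR NC Q1 fel.
have [f f1 [cs _]] := conn_symtrans FR NC.
have [D D0 hD] := tripod FR NC Q1 BX1.
have BX1' X : 1 <= X -> 1 <= BX (f * X).
  by move=> X1; apply: BX1; rewrite -[leLHS]mulr1; apply: ler_pM.
(* For a point on the branch of [y] the first side is read backwards. As [conn] is symmetric only up
   to [f], the reversed side satisfies [top_bound] with [BX (f * X)]. *)
have [D' D'0 hD'] := tripod FR NC Q1 (BX := fun X => BX (f * X)) BX1'.
exists (1 + Num.max D D'); first by rewrite addr_ge0// le_max D0.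
move=> x y z s1 s2 s3 a1 b1 a2 b2 a3 b3 g1 g2 g3 s sab.
have [p1 [N1 [q1 p1x p1y in1 near1]]] := geod_qseq g1.
have [p2 [N2 [q2 p2y p2z in2 _]]] := geod_qseq g2.
have [p3 [N3 [q3 p3z p3x in3 _]]] := geod_qseq g3.
have [T1 sd1 tb1] := hside p1 N1 q1; have [T2 sd2 _] := hside p2 N2 q2.
have [T3 sd3 _] := hside p3 N3 q3.
rewrite p1x p1y in sd1 tb1; rewrite p2y p2z in sd2; rewrite p3z p3x in sd3.
have [i iN di] := near1 s sab.
have [pO1 _ _] := q1; have [pO2 _ _] := q2; have [pO3 _ _] := q3.
have sO : Om (s1 s) by case: g1 => _ _ _ h _; exact: h.
have tb1' : top_bound Om phi lam o (fun X => BX (f * X)) y x T1.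
  move=> X T' X1 c hy hx; apply: tb1 => //; first by rewrite -[leLHS]mulr1; apply: ler_pM.
  by rewrite -mulrA; exact: cs.
have [_ _ h1 _ _] := sd1; have [_ h2] := h1 (p1 i) (ex_intro2 _ _ i iN erefl).
have iO := pO1 i iN.
have [q [[j jN qE]|[j jN qE]] dq] : exists2 q, (exists2 i, (i <= N3)%N & q = p3 i) \/
    (exists2 i, (i <= N2)%N & q = p2 i) & dK (p1 i) q <= Num.max D D'.
- have [c|c] := h2.
    have [q Sq dq] := hD _ _ _ _ _ _ _ _ _ sd1 tb1 (side_sym sd3) sd2 (p1 i) (ex_intro2 _ _ i iN erefl) c.
    by exists q => //; rewrite le_max dq.
  have [q Sq dq] := hD' _ _ _ _ _ _ _ _ _ (side_sym sd1) tb1' sd2 (side_sym sd3) (p1 i) (ex_intro2 _ _ i iN erefl) c.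
  by exists q; [case: Sq => ?; [right|left]|rewrite le_max dq orbT].
- right; have [t tab qt] := in3 j jN; exists t => //; rewrite -qt -qE.
  have qO : Om q by rewrite qE; exact: pO3.
  by apply: le_trans (dK_tri FR sO iO qO) _; exact: lerD.
left; have [t tab qt] := in2 j jN; exists t => //; rewrite -qt -qE.
have qO : Om q by rewrite qE; exact: pO2.
by apply: le_trans (dK_tri FR sO iO qO) _; exact: lerD.
Qed.

End FrameThin.

(** * Long parallel paths *)

Section Rails.
Variables (R : realType) (V : Type) (Om : set V) (dK : V -> V -> R) (del : R).
Hypothesis sym : forall x y, Om x -> Om y -> dK x y = dK y x.
Hypothesis tri : forall x y z, Om x -> Om y -> Om z -> dK x z <= dK x y + dK y z.
Hypothesis dxx : forall x, Om x -> dK x x = 0.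
Hypothesis del0 : 0 <= del.

Local Notation tgeod := (real_geodesic Om dK).

Hypothesis ex_geod : forall x y, Om x -> Om y -> exists sg a b, tgeod sg a b x y.
Hypothesis thin : forall x y z s1 s2 s3 a1 b1 a2 b2 a3 b3, tgeod s1 a1 b1 x y ->
  tgeod s2 a2 b2 y z -> tgeod s3 a3 b3 z x -> forall s, a1 <= s <= b1 ->
    (exists2 t, a2 <= t <= b2 & dK (s1 s) (s2 t) <= del) \/
    (exists2 t, a3 <= t <= b3 & dK (s1 s) (s3 t) <= del).

Let rev_in (a b t : R) : a <= t <= b -> a <= a + b - t <= b.
Proof. by move=> ?; apply/andP; split; lra. Qed.

Lemma real_geodesic_rev sg a b x y : tgeod sg a b x y -> tgeod (fun t => sg (a + b - t)) a b y x.
Proof.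
move=> [ab sa sb sO sd]; split => //.
- by rewrite addrAC subrr add0r.
- by rewrite addrK.
- by move=> s /rev_in/sO.
- move=> s t /rev_in hs /rev_in ht; rewrite sd// distrC; congr (`|_|); ring.
Qed.

(** Cut the path at its middle vertex: a thin triangle moves the point to a geodesic over one of the
    halves at cost [del]. After [k] halvings a single step of length at most [C] remains. *)
Lemma geod_log (C : R) (k : nat) (p : nat -> V) sg a b : 0 <= C ->
  (forall i, (i <= 2 ^ k)%N -> Om (p i)) ->
  (forall i, (i < 2 ^ k)%N -> dK (p i) (p i.+1) <= C) ->
  tgeod sg a b (p 0%N) (p (2 ^ k)%N) -> forall s, a <= s <= b ->
  exists2 i, (i <= 2 ^ k)%N & dK (sg s) (p i) <= k%:R * del + C.
Proof.
move=> C0; elim: k p sg a b => [|k IH] p sg a b pO pC g s sab.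
  exists 0%N => //; case: g => ab sa sb sO sd.
  rewrite mul0r add0r -sa sd ?lexx// ger0_norm; last by lra.
  have := pC 0%N isT; rewrite -sa -[X in p X]/(2 ^ 0)%N -sb sd ?lexx ?ab//.
  by rewrite ler0_norm; lra.
have P0 : (0 <= 2 ^ k.+1)%N by [].
have Pk : (2 ^ k <= 2 ^ k.+1)%N by rewrite leq_exp2l.
have Ek : (2 ^ k.+1 = 2 ^ k + 2 ^ k)%N by rewrite expnS mul2n addnn.
have [s2 [a2 [b2 g2]]] := ex_geod (pO _ Pk) (pO _ (leqnn _)).
have [s3 [a3 [b3 g3]]] := ex_geod (pO _ P0) (pO _ Pk).
have sO : Om (sg s) by case: g => _ _ _ h _; exact: h.
have fin q i : Om q -> (i <= 2 ^ k.+1)%N -> dK (sg s) q <= del -> dK q (p i) <= k%:R * del + C ->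
    exists2 i, (i <= 2 ^ k.+1)%N & dK (sg s) (p i) <= k.+1%:R * del + C.
  move=> qO iN h1 h2; exists i => //; apply: le_trans (tri sO qO (pO i iN)) _.
  by rewrite -natr1; lra.
have [[t tab ht]|[t tab ht]] := thin g (real_geodesic_rev g2) (real_geodesic_rev g3) sab.
  have tab' := rev_in tab.
  have qO : Om (s2 (a2 + b2 - t)) by case: g2 => _ _ _ h _; exact: h.
  have := IH (fun i => p (2 ^ k + i)%N) s2 a2 b2; rewrite addn0 -Ek => {}IH.
  have [||i iN hi] := IH _ _ g2 _ tab'.
  - by move=> i iN; apply: pO; rewrite Ek leq_add2l.
  - by move=> i iN; rewrite addnS; apply: pC; rewrite Ek ltn_add2l.
  - by apply: (fin _ (2 ^ k + i)%N qO _ ht hi); rewrite Ek leq_add2l.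
have tab' := rev_in tab.
have qO : Om (s3 (a3 + b3 - t)) by case: g3 => _ _ _ h _; exact: h.
have [||i iN hi] := IH p s3 a3 b3 _ _ g3 _ tab'.
- by move=> i iN; apply: pO; exact: leq_trans Pk.
- by move=> i iN; apply: pC; exact: leq_trans Pk.
by apply: (fin _ i qO _ ht hi); exact: leq_trans Pk.
Qed.

Lemma pow2_gt_linear (A B : R) : 0 <= A -> 0 <= B -> exists k : nat, A * k%:R + B < (2 ^ k)%:R.
Proof.
move=> A0 B0; pose i := (Num.truncn (2 * A + B)).+1.
have hi : 2 * A + B < i%:R by exact: truncnS_gt.
have i2 (n : nat) : (n.+1 <= 2 ^ n)%N by exact: ltn_expl.
exists (i + i)%N; rewrite expnD natrM natrD.
apply: (@lt_le_trans _ _ (i%:R * i.+1%:R)); last first.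
  by apply: ler_pM => //; rewrite ler_nat// ltnW.
have i1 : 1 <= i%:R :> R by rewrite ler1n.
have h1 : (2 * A + B) * i.+1%:R < i%:R * i.+1%:R by rewrite ltr_pM2r// ltr0n.
apply: le_lt_trans h1; rewrite -natr1.
have : B * 1 <= B * (i%:R + 1) by apply: ler_wpM2l => //; lra.
lra.
Qed.

(** The constants are uniform in both [j] and [n], so the separation [j] may be taken proportional
    to the length [n], which beats the logarithm of [geod_log]. *)
Definition rails (C c : R) := forall j n : nat, (0 < n)%N -> exists a b : nat -> V,
  [/\ (forall i, (i <= n)%N -> Om (a i) /\ Om (b i)),
      (forall i, (i < n)%N -> dK (a i) (a i.+1) <= C /\ dK (b i) (b i.+1) <= C),
      dK (a 0%N) (b 0%N) <= C * j.+1%:R /\ dK (a n) (b n) <= C * j.+1%:R,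
      (forall i l, (i <= n)%N -> (l <= n)%N -> c * j%:R - C <= dK (a i) (b l)) &
      c * n%:R - C <= dK (a 0%N) (a n)].

(** The midpoint of a geodesic from [a 0] to [a n] is too far from the short ends of the
    quadrilateral, so thinness puts it near a geodesic from [b 0] to [b n]. By [geod_log] it is
    within [O(k)] of both paths, where [n = 2 ^ k], while their separation is about [c * j], of the
    order of [2 ^ k]. *)
Lemma rails_absurd (C c : R) : 1 <= C -> 0 < c -> ~ rails C c.
Proof.
move=> C1 c0 rl; have C0 : 0 < C by lra.
have dl : 0 <= del by [].
have cI0 : 0 < c^-1 by rewrite invr_gt0.
pose A := 4 * C / c * (2 * del / c).
pose B1 := 4 * C / c * ((2 * del + 3 * C + c) / c).
pose B2 := 2 * (3 * C + 4 * del) / c.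
have cv : 0 < c^-1 by rewrite invr_gt0.
have A0 : 0 <= A.
  by rewrite /A; apply: mulr_ge0; apply: mulr_ge0; rewrite ?(ltW cv)//; lra.
have B10 : 0 <= B1.
  by apply: mulr_ge0; apply: mulr_ge0; rewrite ?(ltW cv)//; lra.
have B20 : 0 <= B2 by apply: mulr_ge0; rewrite ?(ltW cv)//; lra.
have [k hk] := pow2_gt_linear A0 (addr_ge0 B10 B20).
set n := (2 ^ k)%N in hk; have n0 : (0 < n)%N by rewrite expn_gt0.
have Ak0 : 0 <= A * k%:R by apply: mulr_ge0.
have n1 : 2 * (3 * C + 4 * del) < c * n%:R.
  rewrite [c * _]mulrC -ltr_pdivrMr//; apply: le_lt_trans hk; rewrite -/B2 addrA lerDr.
  exact: addr_ge0.
have n2 : (2 * del * k%:R + 2 * del + 3 * C + c) / c * (4 * C / c) < n%:R.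
  apply: le_lt_trans hk; rewrite -subr_ge0; apply: le_trans B20 _.
  by rewrite le_eqVlt; apply/orP; left; apply/eqP; rewrite /A /B1 /B2; ring.
(* The largest [j] with [C * j <= c * n / 4]: the ends of the quadrilateral, of length at most
   [C * (j + 1)], then stay well below half of the geodesic from [a 0] to [a n]. *)
pose j := Num.truncn (c * n%:R / (4 * C)).
have nn0 : 0 <= n%:R :> R by [].
have cn0 : 0 <= c * n%:R / (4 * C) by apply: divr_ge0; [apply: mulr_ge0 => //; exact: ltW|lra].
have j1 : j%:R <= c * n%:R / (4 * C) by rewrite truncn_le.
have j2 : c * n%:R / (4 * C) < j%:R + 1 by rewrite natr1; exact: truncnS_gt.
have C4 : 0 < 4 * C by lra.
rewrite ler_pdivlMr// in j1.
have j3 : 2 * del * k%:R + 2 * del + 3 * C < c * j%:R.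
  move: n2; rewrite -ltr_pdivlMr ?divr_gt0// invf_div => n2.
  have : (2 * del * k%:R + 2 * del + 3 * C + c) / c < j%:R + 1.
    by apply: lt_trans n2 _; rewrite mulrA [n%:R * c]mulrC.
  by rewrite ltr_pdivrMr//; lra.
have [a [b [abO abC [e0 en] ab aa]]] := rl j n n0.
have [a0O b0O] := abO 0%N (leq0n _); have [anO bnO] := abO n (leqnn _).
have [s1 [l1 [r1 g1]]] := ex_geod a0O anO.
have [s2 [l2 [r2 g2]]] := ex_geod anO bnO.
have [s3 [l3 [r3 g3]]] := ex_geod bnO a0O.
have [s4 [l4 [r4 g4]]] := ex_geod a0O b0O.
have [s5 [l5 [r5 g5]]] := ex_geod b0O bnO.
pose mid := (l1 + r1) / 2.
case: (g1) => lr1 s1l s1r O1 d1.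
have len : r1 - l1 = dK (a 0%N) (a n).
  by rewrite -s1l -s1r d1 ?lexx ?lr1// distrC ger0_norm// subr_ge0.
have midin : l1 <= mid <= r1 by rewrite /mid; apply/andP; split; lra.
have mO := O1 _ midin.
have m0 : dK (s1 mid) (a 0%N) = (r1 - l1) / 2.
  by rewrite -s1l d1 ?lexx ?lr1// /mid ger0_norm; lra.
have m1 : dK (s1 mid) (a n) = (r1 - l1) / 2.
  by rewrite -s1r d1 ?lexx ?lr1// /mid ler0_norm; lra.
have len1 s l r x y t : tgeod s l r x y -> l <= t <= r -> dK x (s t) <= dK x y /\ dK (s t) y <= dK x y.
  move=> [lr sl sr _ sd] tlr; rewrite -sl -sr !sd ?lexx ?lr//.
  by rewrite !ler0_norm; lra.
have far : C * j.+1%:R + 2 * del < (r1 - l1) / 2.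
  by rewrite len -natr1; lra.
have [[t tin ht]|[t tin ht]] := thin g1 g2 g3 midin.
  have qO : Om (s2 t) by case: (g2) => _ _ _ h _; exact: h.
  have [h1 _] := len1 _ _ _ _ _ _ g2 tin.
  have := tri mO qO anO; rewrite m1 (sym qO anO); lra.
have qO : Om (s3 t) by case: (g3) => _ _ _ h _; exact: h.
have [[u uin hu]|[u uin hu]] := thin g3 g4 g5 tin.
  have qO' : Om (s4 u) by case: (g4) => _ _ _ h _; exact: h.
  have [h1 _] := len1 _ _ _ _ _ _ g4 uin.
  have := tri mO qO a0O; have := tri qO qO' a0O; rewrite m0 (sym qO' a0O); lra.
have qO' : Om (s5 u) by case: (g5) => _ _ _ h _; exact: h.
have aO i : (i <= 2 ^ k)%N -> Om (a i) by move=> /abO[].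
have bO i : (i <= 2 ^ k)%N -> Om (b i) by move=> /abO[].
have aC i : (i < 2 ^ k)%N -> dK (a i) (a i.+1) <= C by move=> /abC[].
have bC i : (i < 2 ^ k)%N -> dK (b i) (b i.+1) <= C by move=> /abC[].
have [i iN hi] := geod_log (ltW C0) aO aC g1 midin.
have [l lN hl] := geod_log (ltW C0) bO bC g5 uin.
have := ab i l iN lN.
have := tri (aO i iN) mO (bO l lN); have := tri mO qO (bO l lN).
have := tri qO qO' (bO l lN); rewrite (sym (aO i iN) mO); lra.
Qed.

End Rails.

(** * Convex domains and their supporting half-spaces *)

Lemma affine_cont (R : realType) (V : normedModType R) (z : V) (t : R) : continuous (fun x : V => x + t *: (z - x)).
Proof.
move=> x; apply: cvgD; first exact: cvg_id.
by apply: cvgZl_tmp; apply: cvgB; [exact: cvg_cst|exact: cvg_id].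
Qed.

Definition good_domain (R : realType) (d : nat) (Om : set (Cn R d)) (r : Cn R d -> R^o) :=
  [/\ bounded_set Om, open Om, convex_set Om & defining_function Om r].

Section Geometry.
Variables (R : realType) (d : nat).
Local Notation V := (Cn R d).
Local Notation J := (cmul (cI R)).
Variables (Om : set V) (r : V -> R^o).
Hypothesis HD : good_domain Om r.
Let Ob : bounded_set Om. Proof. by case: HD. Qed.
Let Oo : open Om. Proof. by case: HD. Qed.
Let Oc : convex_set Om. Proof. by case: HD. Qed.
Let Or : defining_function Om r. Proof. by case: HD. Qed.
Implicit Types (x y z v w xi : V).

Let sr : smooth r. Proof. by case: Or. Qed.
Let rO x : Om x = (r x < 0). Proof. by case: Or => _ -> _. Qed.

Lemma closure_le0 x : closure Om x -> r x <= 0.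
Proof.
move=> xc; have cl : closed [set x | r x <= 0].
  apply: (@closed_comp _ _ r [set y : R | y <= 0]); last exact: closed_le.
  by move=> y _; exact: smooth_continuous.
apply: (cl x); apply: closure_subset xc => y /=; rewrite rO; exact: ltW.
Qed.

Lemma bd_r0 xi : boundary Om xi -> r xi = 0.
Proof.
move=> [xc nx]; apply/le_anti; rewrite closure_le0//= leNgt.
by apply/negP => h; apply: nx; rewrite rO.
Qed.

(** ['d r xi] is not normalised: only quotients taken at the same [xi] matter, and [phi xi o] serves
    as the unit. *)
Definition phi xi z : R := 'd r xi (xi - z).
Definition lam xi v : R := Num.sqrt ('d r xi v ^+ 2 + 'd r xi (J v) ^+ 2).

Lemma convexP x y (t : R) : Om x -> Om y -> 0 <= t <= 1 -> Om (x + t *: (y - x)).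
Proof.
move=> xO yO /andP[t0 t1].
have := Oc (x := y) (y := x) (Itv01 t0 t1); rewrite !inE => /(_ yO xO).
rewrite -[conv _ _ _]/(t *: y + (1 - t) *: x).
by move=> h; have -> : x + t *: (y - x) = t *: y + (1 - t) *: x;
  [rewrite scalerBr scalerBl scale1r addrCA|].
Qed.

Lemma diff_le0 xi v : r xi = 0 -> (forall t : R, 0 < t <= 1 -> r (xi + t *: v) <= 0) -> 'd r xi v <= 0.
Proof.
move=> r0 hr; rewrite leNgt; apply/negP => l0.
have v0 : 0 < `|v| by rewrite normr_gt0; apply/eqP => v0; move: l0; rewrite v0 linear0 ltxx.
have e0 : 0 < 'd r xi v / (2 * `|v|) by rewrite divr_gt0 ?mulr_gt0.
have [del del0 H] := diff_eps (smooth_differentiable xi sr) e0.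
pose t := Num.min 1 (del / (2 * `|v|)).
have t0 : 0 < t by rewrite lt_min ltr01 divr_gt0 ?mulr_gt0.
have tv : `|t *: v| < del.
  rewrite normrZ gtr0_norm//; apply: (@le_lt_trans _ _ (del / (2 * `|v|) * `|v|)).
    by apply: ler_wpM2r => //; rewrite ge_min lexx orbT.
  have -> : del / (2 * `|v|) * `|v| = del / 2 by field; rewrite gt_eqF.
  lra.
have := H _ tv; rewrite r0 add0r linearZ/= normrZ gtr0_norm//.
have -> : 'd r xi v / (2 * `|v|) * (t * `|v|) = t * 'd r xi v / 2 by field; rewrite gt_eqF.
have := hr t; rewrite t0 ge_min lexx => /(_ isT).
have tl : 0 < t * 'd r xi v by rewrite mulr_gt0.
rewrite addrC ler_norml => h1 /andP[h2 _].
by move: h2; rewrite -[t *: 'd r xi v]/(t * 'd r xi v); lra.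
Qed.

Lemma closure_segment x z (t : R) : closure Om x -> Om z -> 0 <= t <= 1 -> r (x + t *: (z - x)) <= 0.
Proof.
move=> xc zO t01.
have cl : closed [set x : V | r (x + t *: (z - x)) <= 0].
  apply: (@closed_comp _ _ (fun x : V => r (x + t *: (z - x))) [set y : R | y <= 0]); last exact: closed_le.
  move=> y _; apply: (@continuous_comp _ _ _ (fun x : V => x + t *: (z - x)) r); last exact: smooth_continuous.
  exact: affine_cont.
apply: (cl x); apply: closure_subset xc => y /= yO; apply: ltW; rewrite -rO; exact: convexP.
Qed.

Lemma phi_lin xi x v (t : R) : phi xi (x + t *: v) = phi xi x - t * 'd r xi v.
Proof. by rewrite /phi opprD addrA linearB linearZ. Qed.

Lemma phi_ge0 xi z : boundary Om xi -> Om z -> 0 <= phi xi z.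
Proof.
move=> bx zO; rewrite /phi -opprB linearN oppr_ge0; apply: diff_le0; first exact: bd_r0.
move=> t /andP[t0 t1]; apply: closure_segment => //; last by rewrite ltW.
by case: bx.
Qed.

Lemma open_line z v : Om z -> exists2 e : R, 0 < e & forall t : R, `|t| <= e -> Om (z + t *: v).
Proof.
move=> zO; have /nbhs_ballP[e /= e0 he] : nbhs z Om by apply: open_nbhs_nbhs; split.
have v1 : 0 < `|v| + 1 by rewrite ltr_wpDl.
exists (e / (2 * (`|v| + 1))) => [|t ht]; first by rewrite divr_gt0// mulr_gt0.
apply: he; rewrite -ball_normE/= opprD addrA subrr add0r normrN normrZ.
apply: (@le_lt_trans _ _ (e / (2 * (`|v| + 1)) * (`|v| + 1))).
  by apply: ler_pM => //; rewrite lerDl.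
have -> : e / (2 * (`|v| + 1)) * (`|v| + 1) = e / 2 by field; rewrite gt_eqF.
lra.
Qed.

(** An affine form that is nonnegative on an open set and vanishes at one of its points is constant;
    the nonzero gradient of [r] at [xi] excludes this. *)
Lemma phi_pos xi z : boundary Om xi -> Om z -> 0 < phi xi z.
Proof.
move=> bx zO; rewrite lt_neqAle phi_ge0// andbT; apply/eqP => h0.
have [v v0] : exists v, 'd r xi v != 0 by case: Or => _ _ /(_ xi bx).
have [e e0 he] := open_line v zO.
have e1 : Om (z + e *: v) by apply: he; rewrite gtr0_norm.
have e2 : Om (z + (- e) *: v) by apply: he; rewrite normrN gtr0_norm.
have := phi_ge0 bx e1; have := phi_ge0 bx e2; rewrite !phi_lin -h0 => h1 h2.
move/eqP: v0; apply; have : e * 'd r xi v = 0 by lra.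
by move/eqP; rewrite mulf_eq0 gt_eqF//= => /eqP.
Qed.

Lemma phi_closure_ge0 xi z : boundary Om xi -> closure Om z -> 0 <= phi xi z.
Proof.
move=> bx zc; have cl : closed [set z : V | 0 <= phi xi z].
  apply: (@closed_comp _ _ (phi xi) [set y : R | 0 <= y]); last exact: closed_ge.
  move=> y _; apply: (@continuous_comp _ _ _ (fun z : V => xi - z) ('d r xi)).
    by apply: continuousB => //; exact: cst_continuous.
  by apply: diff_continuous; exact: smooth_differentiable.
apply: (cl z); apply: closure_subset zc => y /= yO; exact: phi_ge0.
Qed.

Lemma bd_between p z : Om p -> ~ Om z -> exists2 t : R, 0 < t <= 1 & boundary Om (p + t *: (z - p)).
Proof.
move=> pO nz; pose E := [set t : R | 0 <= t <= 1 /\ Om (p + t *: (z - p))].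
have E0 : E 0 by split; [rewrite lexx ler01|rewrite scale0r addr0].
have Es : has_sup E by split; [exists 0|exists 1 => t [/andP[]]].
pose s := sup E.
have s0 : 0 <= s by apply: ub_le_sup => //; case: Es.
have s1 : s <= 1 by apply: ge_sup; [exists 0|move=> t [/andP[]]].
have below t : 0 <= t -> t < s -> Om (p + t *: (z - p)).
  move=> t0 /sup_gt[|u [/andP[u0 u1] uO] tu]; first by exists 0.
  have u0' : 0 < u by exact: le_lt_trans tu.
  have := @convexP p _ (t / u) pO uO; rewrite divr_ge0//= ler_pdivrMr// mul1r (ltW tu) => /(_ isT).
  by rewrite [p + u *: _]addrC addrK scalerA divfK// gt_eqF.
have ns : ~ Om (p + s *: (z - p)).
  move=> sO; have [e e0 he] := open_line (z - p) sO.
  have [s1'|s1'] := ltP s 1; last first.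
    have s1e : s = 1 by apply/le_anti/andP; split.
    by apply: nz; move: sO; rewrite s1e scale1r addrC subrK.
  pose u := s + Num.min e (1 - s).
  have m0 : 0 < Num.min e (1 - s) by rewrite lt_min e0 subr_gt0.
  suff : u <= s by rewrite /u gerDl leNgt m0.
  apply: ub_le_sup; first by case: Es.
  split.
    by rewrite /u addr_ge0 ?(ltW m0)//= -lerBrDl ge_min lexx orbT.
  rewrite /u scalerDl addrA; apply: he; rewrite gtr0_norm// ge_min lexx //.
have s0' : 0 < s.
  rewrite lt_neqAle s0 andbT; apply/eqP => h; apply: ns; rewrite -h scale0r addr0 //.
exists s; first by rewrite s0'.
split => // B /nbhs_ballP[e /= e0 he].
have v1 : 0 < `|z - p| + 1 by rewrite ltr_wpDl.
pose dl := Num.min s (e / (2 * (`|z - p| + 1))).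
have dl0 : 0 < dl by rewrite lt_min s0'/= divr_gt0// mulr_gt0.
exists (p + (s - dl) *: (z - p)); split.
  apply: below; last by rewrite gtrBl.
  by rewrite subr_ge0 ge_min lexx.
apply: he; rewrite -ball_normE/= opprD addrACA subrr add0r -scalerBl opprB addrC subrK.
rewrite normrZ gtr0_norm//; apply: (@le_lt_trans _ _ (e / (2 * (`|z - p| + 1)) * (`|z - p| + 1))).
  by apply: ler_pM; rewrite ?(ltW dl0)// ?ge_min ?lexx ?orbT// lerDl.
have -> : e / (2 * (`|z - p| + 1)) * (`|z - p| + 1) = e / 2 by field; rewrite gt_eqF.
lra.
Qed.

Lemma phi_xi0 xi : phi xi xi = 0. Proof. by rewrite /phi subrr linear0. Qed.

Lemma phi_affine xi x y (t : R) : phi xi (x + t *: (y - x)) = (1 - t) * phi xi x + t * phi xi y.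
Proof.
rewrite phi_lin; have -> : 'd r xi (y - x) = phi xi x - phi xi y.
  by rewrite /phi -linearB/=; congr (_ _); rewrite opprB [RHS]addrC addrA subrK.
by ring.
Qed.

(** The segment from [o] to a point outside crosses the boundary at some [xi], where [phi xi]
    vanishes although it is positive at both ends. *)
Lemma Om_phi o z : Om o -> (forall xi, boundary Om xi -> 0 < phi xi z) -> Om z.
Proof.
move=> oO hz; apply: contrapT => nz; have [t /andP[t0 t1] bt] := bd_between oO nz.
have := phi_affine (o + t *: (z - o)) o z t; rewrite phi_xi0.
have h1 := phi_pos bt oO; have h2 := hz _ bt.
have : 0 <= (1 - t) * phi (o + t *: (z - o)) o by rewrite mulr_ge0 ?subr_ge0// (ltW h1).
have : 0 < t * phi (o + t *: (z - o)) z by rewrite mulr_gt0.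
lra.
Qed.

Lemma phi_ex o x : Om o -> Om x -> exists2 c : R, 0 < c & forall xi, boundary Om xi -> c * phi xi o <= phi xi x.
Proof.
move=> oO xO; have [e e0 he] := open_line (o - x) xO.
have e1 : 0 < 1 + e by rewrite addr_gt0.
exists (e / (1 + e)) => [|xi bx]; first by rewrite divr_gt0.
have xe : Om (x + (- e) *: (o - x)) by apply: he; rewrite normrN gtr0_norm.
have := phi_ge0 bx xe; rewrite phi_affine => h.
by rewrite mulrAC ler_pdivrMr//; lra.
Qed.

Lemma norm_J v : `|J v| <= `|v|.
Proof.
apply: norm_le_coord => // i; rewrite cmul_cI -[in X in _ <= X](hsubmxK v).
rewrite mxE; case: (splitP i) => k _.
  rewrite mxE normrN -(row_mxEr (lsubmx v) (rsubmx v)); exact: coord_le_norm.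
rewrite -(row_mxEl (lsubmx v) (rsubmx v)); exact: coord_le_norm.
Qed.

Lemma JJ v : J (J v) = - v. Proof. exact: cmul_cI_cI. Qed.
Lemma J_add v w : J (v + w) = J v + J w.
Proof. by have := cmul_lin (cI R) 1 1 v w; rewrite !scale1r. Qed.
Lemma J_scale (t : R) v : J (t *: v) = t *: J v.
Proof. by have := cmul_lin (cI R) t 0 v 0; rewrite !scale0r !addr0. Qed.

Lemma hyp_le (a b c : R) : 0 <= c -> a ^+ 2 + b ^+ 2 <= c ^+ 2 -> Num.sqrt (a ^+ 2 + b ^+ 2) <= c.
Proof. by move=> c0 h; rewrite -[c]ger0_norm// -sqrtr_sqr ler_wsqrtr. Qed.

Lemma hyp_sqr (a b : R) : Num.sqrt (a ^+ 2 + b ^+ 2) ^+ 2 = a ^+ 2 + b ^+ 2.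
Proof. by rewrite sqr_sqrtr// addr_ge0// sqr_ge0. Qed.

Lemma hyp_cs (a b c s : R) : c * a + s * b <= Num.sqrt (c ^+ 2 + s ^+ 2) * Num.sqrt (a ^+ 2 + b ^+ 2).
Proof.
rewrite -sqrtrM ?addr_ge0 ?sqr_ge0//; apply: le_trans (ler_norm _) _.
rewrite -sqrtr_sqr; apply: ler_wsqrtr; rewrite -subr_ge0.
have -> : (c ^+ 2 + s ^+ 2) * (a ^+ 2 + b ^+ 2) - (c * a + s * b) ^+ 2 = (c * b - s * a) ^+ 2 by ring.
exact: sqr_ge0.
Qed.

Lemma hyp_add (a b c s : R) : Num.sqrt ((a + c) ^+ 2 + (b + s) ^+ 2) <=
  Num.sqrt (a ^+ 2 + b ^+ 2) + Num.sqrt (c ^+ 2 + s ^+ 2).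
Proof.
apply: hyp_le; first by rewrite addr_ge0 ?sqrtr_ge0.
rewrite [leRHS]sqrrD !hyp_sqr -mulr_natr; have := hyp_cs c s a b; lra.
Qed.

Lemma hyp_ex (a b : R) : exists c s : R, c ^+ 2 + s ^+ 2 = 1 /\ c * a + s * b = Num.sqrt (a ^+ 2 + b ^+ 2).
Proof.
set n := Num.sqrt _; have [n0|n0] := eqVneq n 0.
  exists 1, 0; split; first by ring.
  have := hyp_sqr a b; rewrite -/n n0 expr0n/= => h.
  have : a ^+ 2 = 0 by apply/le_anti; rewrite sqr_ge0 andbT; have := sqr_ge0 b; lra.
  by move/eqP; rewrite sqrf_eq0 => /eqP ->; ring.
have h := hyp_sqr a b; rewrite -/n in h.
exists (a / n), (b / n); split.
  by rewrite !expr_div_n -mulrDl -h divff// expf_neq0.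
by rewrite mulrAC [b / n * b]mulrAC -mulrDl -!expr2 -h expr2 mulfK.
Qed.

Lemma lam_ge xi v : `|'d r xi v| <= lam xi v.
Proof. by rewrite -sqrtr_sqr; apply: ler_wsqrtr; rewrite lerDl sqr_ge0. Qed.

Lemma lam_rot xi v (c s : R) : c ^+ 2 + s ^+ 2 = 1 -> 'd r xi (c *: v + s *: J v) <= lam xi v.
Proof.
move=> cs; rewrite linearD !linearZ/=; apply: le_trans (hyp_cs _ _ _ _) _.
by rewrite cs sqrtr1 mul1r.
Qed.

(** Some complex rotation of [v] makes the value of the complex functional real and nonnegative, so
    bounds on real parts become bounds on moduli. *)
Lemma lam_sup xi v : exists c s : R, c ^+ 2 + s ^+ 2 = 1 /\ 'd r xi (c *: v + s *: J v) = lam xi v.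
Proof.
have [c [s [cs h]]] := hyp_ex ('d r xi v) ('d r xi (J v)); exists c, s; split => //.
by rewrite linearD !linearZ/= /lam -h.
Qed.

Lemma lam_add xi v w : lam xi (v + w) <= lam xi v + lam xi w.
Proof. by rewrite /lam J_add !linearD/=; exact: hyp_add. Qed.

Lemma lam_scale xi (t : R) v : lam xi (t *: v) = `|t| * lam xi v.
Proof.
rewrite /lam J_scale !linearZ/= -[_ *: 'd r xi v]/(_ * _) -[_ *: 'd r xi (J v)]/(_ * _).
by rewrite !exprMn -mulrDr sqrtrM ?sqr_ge0// sqrtr_sqr.
Qed.

Lemma lamJ xi v : lam xi (J v) = lam xi v.
Proof. by rewrite /lam JJ linearN sqrrN addrC. Qed.

Lemma phi_lip xi x v : `|phi xi (x + v) - phi xi x| <= lam xi v.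
Proof.
by have := phi_lin xi x v 1; rewrite scale1r mul1r => ->; rewrite addrC addKr normrN lam_ge.
Qed.

(** A ball around [o] inside the domain makes [phi xi] nonnegative at [o + v] for short [v], which
    bounds ['d r xi v] by [phi xi o] with a constant independent of [xi]. *)
Lemma lam_norm o : Om o -> exists2 C1 : R, 0 < C1 & forall xi v, boundary Om xi -> lam xi v <= C1 * `|v| * phi xi o.
Proof.
move=> oO; have /nbhs_ballP[e /= e0 he] : nbhs o Om by apply: open_nbhs_nbhs; split.
have e2 : 0 < e / 2 by rewrite divr_gt0.
have L0 xi v : boundary Om xi -> 'd r xi v <= 2 / e * `|v| * phi xi o.
  move=> bx; have [->|v0] := eqVneq v 0; first by rewrite linear0 normr0 mulr0 mul0r.
  have nv : 0 < `|v| by rewrite normr_gt0.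
  have : Om (o + (e / 2 / `|v|) *: v).
    apply: he; rewrite -ball_normE/= opprD addrA subrr add0r normrN normrZ gtr0_norm ?divr_gt0//.
    by rewrite divfK ?gt_eqF//; lra.
  move=> /(phi_ge0 bx); rewrite phi_lin subr_ge0 mulrAC ler_pdivrMr//.
  have -> : 2 / e * `|v| * phi xi o = (phi xi o * `|v|) * (e / 2)^-1 by field; rewrite gt_eqF.
  by rewrite ler_pdivlMr// mulrC.
exists (4 / e) => [|xi v bx]; first by rewrite divr_gt0.
have [c [s [cs <-]]] := lam_sup xi v.
apply: le_trans (L0 _ _ bx) _; have o0 := phi_pos bx oO.
have c1 : `|c| <= 1 by rewrite -(@ler_pXn2r _ 2) ?nnegrE// real_normK ?num_real// expr1n; have := sqr_ge0 s; lra.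
have s1 : `|s| <= 1 by rewrite -(@ler_pXn2r _ 2) ?nnegrE// real_normK ?num_real// expr1n; have := sqr_ge0 c; lra.
have : `|c *: v + s *: J v| <= 2 * `|v|.
  apply: le_trans (ler_normD _ _) _; rewrite !normrZ mulr_natl mulr2n; apply: lerD.
    exact: ler_piMl.
  by apply: le_trans (norm_J v); exact: ler_piMl.
move=> h; rewrite ler_pM2r//; apply: (@le_trans _ _ (2 / e * (2 * `|v|))).
  by rewrite ler_wpM2l// ltW// divr_gt0.
by rewrite le_eqVlt; apply/orP; left; apply/eqP; ring.
Qed.

Lemma bounded_ex (A : set V) : bounded_set A -> exists2 M : R, 0 < M & forall x, A x -> `|x| <= M.
Proof.
move=> [M [_ h]]; exists (Num.max (M + 1) 1); first by rewrite lt_max ltr01 orbT.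
move=> x Ax; apply: (h _ _ x Ax) => //; rewrite lt_max ltrDl ltr01 //.
Qed.

Lemma closure_norm (M : R) : (forall x, Om x -> `|x| <= M) -> forall x, closure Om x -> `|x| <= M.
Proof.
move=> h x xc; have cl : closed [set x : V | `|x| <= M].
  apply: (@closed_comp _ _ (fun x : V => `|x|) [set y : R | y <= M]); last exact: closed_le.
  by move=> y _; exact: norm_continuous.
by apply: (cl x); apply: closure_subset xc => y /=; exact: h.
Qed.

Lemma compact_closure : compact (closure Om).
Proof.
apply: bounded_closed_compact; last exact: closed_closure.
have [M _ h] := bounded_ex Ob; exists M; split; first exact: num_real.
by move=> x Mx y yc; apply: le_trans (ltW Mx); exact: closure_norm yc.
Qed.

Lemma compact_boundary : compact (boundary Om).
Proof.
apply: (subclosed_compact _ compact_closure); last by move=> x [].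
rewrite /boundary setDE; apply: closedI; first exact: closed_closure.
by rewrite closedC.
Qed.

Lemma lam_o o : Om o -> exists2 C2 : R, 1 <= C2 & forall xi p, boundary Om xi -> Om p -> lam xi (o - p) <= C2 * phi xi o.
Proof.
move=> oO; have [C1 C10 hC] := lam_norm oO; have [M M0 hM] := bounded_ex Ob.
exists (Num.max 1 (C1 * (2 * M))); first by rewrite le_max lexx.
move=> xi p bx pO; apply: le_trans (hC _ _ bx) _; rewrite ler_pM2r ?phi_pos// le_max.
apply/orP; right; rewrite ler_pM2l//; apply: le_trans (ler_normB _ _) _.
have := hM _ oO; have := hM _ pO; lra.
Qed.

End Geometry.

(** * The Kobayashi metric *)

(** The differential as a relation with an explicit candidate [D]: linearity and the chain rule are
    computed on [D], without rewriting under ['d]. *)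
Definition hasd (R : realType) (U V : normedModType R) (f : U -> V) (x : U) (D : U -> V) :=
  differentiable f x /\ forall u, 'd f x u = D u.

Lemma hasd_ex (R : realType) (U V : normedModType R) (f : U -> V) (x : U) : differentiable f x ->
  exists D, hasd f x D.
Proof. by exists ('d f x). Qed.

Lemma hasd_affine2 (R : realType) (U V : normedModType R) (f g : U -> V) (a b : R) (x : U) D E :
  hasd f x D -> hasd g x E -> hasd (fun z => a *: f z + b *: g z) x (fun u => a *: D u + b *: E u).
Proof.
move=> [df hD] [dg hE]; have da : differentiable (a *: f) x by exact: differentiableZ.
have db : differentiable (b *: g) x by exact: differentiableZ.
have dab : differentiable (a *: f + b *: g) x by exact: differentiableD.
split=> [|u]; first exact: dab.
have h1 := f_equal (fun F => F u) (diffD da db).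
have h2 := f_equal (fun F => F u) (diffZ a df).
have h3 := f_equal (fun F => F u) (diffZ b dg).
apply: (etrans h1); apply: (etrans (f_equal2 +%R h2 h3)).
exact: (f_equal2 (fun p q => a *: p + b *: q) (hD u) (hE u)).
Qed.

Lemma hasd_comp (R : realType) (U V W : normedModType R) (f : U -> V) (g : V -> W) (x : U) D E :
  hasd f x D -> hasd g (f x) E -> hasd (fun z => g (f z)) x (fun u => E (D u)).
Proof.
move=> [df hD] [dg hE]; split=> [|u]; first exact: (proj1 (diff_compE 0 df dg)).
by apply: (etrans (proj2 (diff_compE u df dg))); rewrite -hD; exact: hE.
Qed.

Lemma hasd_line (R : realType) (U V : normedModType R) (f : U -> V) (x : U) D :
  differentiable f x -> (forall u (t : R), f (x + t *: u) = f x + t *: D u) -> hasd f x D.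
Proof. by move=> df h; split=> // u; apply: diff_affine_line => // t. Qed.

Lemma hasd_cst (R : realType) (U V : normedModType R) (x : U) (a : V) : hasd (fun=> a) x (fun=> 0).
Proof. by apply: hasd_line => [|u t]; [exact: differentiable_cst|rewrite scaler0 addr0]. Qed.

Lemma schwarz_hasd (R : realType) (A B : Cplx R -> R^o) (a : Cplx R) (D : Cplx R -> R^o) :
  (forall z, cabs z < 1 -> exists E F : Cplx R -> R^o, [/\ hasd A z E, hasd B z F &
    forall u, F u = - E (cmul (cI R) u)]) ->
  (forall z, cabs z < 1 -> 0 <= A z) -> cabs a = 1 -> hasd A 0 D -> D a <= 2 * A 0.
Proof.
move=> h A0 a1 [_ hD].
have dA z : cabs z < 1 -> differentiable A z by move=> /h[E [F [[dA _] _ _]]].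
have dB z : cabs z < 1 -> differentiable B z by move=> /h[E [F [_ [dB _] _]]].
have AB z u : cabs z < 1 -> 'd B z u = - 'd A z (cmul (cI R) u).
  move=> /h[E [F [[_ hE] [_ hF] EF]]].
  exact: (etrans (hF u) (etrans (EF u) (f_equal -%R (esym (hE _))))).
have H := schwarz_halfplane dA dB AB A0 a1.
exact: (eq_ind _ (fun t : R => t <= 2 * A 0) H _ (hD a)).
Qed.

Lemma affine_differentiable (R : realType) n (m : 'rV[R]_n -> R^o) (L : 'rV[R]_n -> R) :
  (forall a b (t : R), m (a + t *: b) = m a + t * L b) -> forall a, differentiable m a.
Proof.
move=> hm a.
have E s (h : 'rV[R]_n) : m (\sum_(i <- s) h ord0 i *: delta_mx ord0 i) =
    m 0 + \sum_(i <- s) h ord0 i * L (delta_mx ord0 i).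
  elim: s => [|i s IH]; first by rewrite !big_nil addr0.
  by rewrite !big_cons addrC hm IH -addrA; congr (_ + _); rewrite addrC.
have -> : m = cst (m 0) + lin_comb (fun i => L (delta_mx ord0 i)).
  by apply/funext => h; rewrite -{1}[h]row_delta_sum E.
apply: differentiableD; first exact: differentiable_cst.
by apply: linear_differentiable; exact: lin_comb_continuous.
Qed.

Section Kobayashi.
Variables (R : realType) (d : nat).
Local Notation V := (Cn R d).
Local Notation C := (Cplx R).
Local Notation J := (cmul (cI R)).
Variables (Om : set V) (r : V -> R^o).
Hypothesis HD : good_domain Om r.
Implicit Types (x y v w : V).
Local Notation phi := (phi r).
Local Notation lam := (lam r).

(** The unit ball of the Kobayashi metric at [x], made of the derivatives at 0 of holomorphic disks
    through [x]. *)
Definition cand x w := exists f : C -> V,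
  [/\ holo_disk f, (forall z, cabs z < 1 -> Om (f z)), f 0 = x & 'd f 0 (c1 R) = w].

Definition hol (f : C -> V) (z : C) (D : C -> V) := hasd f z D /\ forall u, D (J u) = J (D u).

Lemma hol_ex f z : holo_disk f -> cabs z < 1 -> exists D, hol f z D.
Proof.
move=> hf z1; have [df Jf] := hf z z1; have [D hD] := hasd_ex df; exists D; split => // u.
by case: hD => _ hD; rewrite -!hD; exact: Jf.
Qed.

Lemma candP x w : cand x w <-> exists f : C -> V,
  [/\ forall z, cabs z < 1 -> exists D, hol f z D, (forall z, cabs z < 1 -> Om (f z)), f 0 = x &
      exists D, hol f 0 D /\ D (c1 R) = w].
Proof.
have c0 : cabs (0 : C) < 1 by rewrite cabs0.
split=> -[f [hf fO f0 f1]]; exists f; split => //.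
- by move=> z; exact: hol_ex.
- have [D [hD JD]] := hol_ex hf c0; exists D; split => //.
  by case: hD => _ <-.
- move=> z z1; have [D [[dD hD] JD]] := hf z z1; split => // u.
  by apply: (etrans (hD _)); rewrite JD -hD.
by have [D [[[_ hD] _] <-]] := f1.
Qed.

Lemma hol_affine2 f g z (a b : R) D E : hol f z D -> hol g z E ->
  hol (fun z => a *: f z + b *: g z) z (fun u => a *: D u + b *: E u).
Proof.
move=> [hD JD] [hE JE]; split; first exact: hasd_affine2.
by move=> u; rewrite JD JE cmul_lin.
Qed.

(** Convex combinations of two disks stay in the convex domain. With equal base points this gives
    subadditivity of the metric; with a constant disk it compares the metrics at two points. *)
Lemma cand_mix x y v w (t : R) : cand x v -> cand y w -> 0 <= t <= 1 ->
  cand (x + t *: (y - x)) (v + t *: (w - v)).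
Proof.
move=> /candP[f [hf fO f0 [D [hD D1]]]] /candP[g [hg gO g0 [D' [hD' D'1]]]] t01; apply/candP.
have E (a b : V) : (1 - t) *: a + t *: b = a + t *: (b - a).
  by rewrite scalerBl scale1r scalerBr addrAC -addrA.
exists (fun z => (1 - t) *: f z + t *: g z); split.
- move=> z z1; have [F hF] := hf z z1; have [G hG] := hg z z1.
  by exists (fun u => (1 - t) *: F u + t *: G u); exact: hol_affine2.
- by move=> z z1; rewrite E; apply: (convexP HD) => //; [exact: fO|exact: gO].
- by rewrite f0 g0 E.
exists (fun u => (1 - t) *: D u + t *: D' u); split; first exact: hol_affine2.
by rewrite D1 D'1 E.
Qed.

Lemma hol_cst x z : hol (fun=> x) z (fun=> 0).
Proof. by split; [exact: hasd_cst|move=> u; rewrite -(scaler0 V (0 : R)) J_scale !scale0r]. Qed.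

Lemma cand_const x : Om x -> cand x 0.
Proof.
move=> xO; apply/candP; exists (fun=> x); split => // [z _|].
  by exists (fun=> 0); exact: hol_cst.
by exists (fun=> 0); split => //; exact: hol_cst.
Qed.

Lemma hasd_crot n (a : Cn R n) z : hasd (crot a) z (crot a).
Proof. by apply: hasd_line => [|u t]; [exact: differentiable_crot|exact: crot_line]. Qed.

Lemma cand_rot x (f : C -> V) (a : C) : holo_disk f -> (forall z, cabs z < 1 -> Om (f z)) ->
  f 0 = x -> cabs a <= 1 -> cand x ('d f 0 a).
Proof.
move=> hf fO f0 a1; apply/candP; exists (fun z => f (crot a z)).
have ca z : cabs z < 1 -> cabs (crot a z) < 1.
  by move=> z1; rewrite cabs_crot; apply: le_lt_trans z1; rewrite ler_piMl// sqrtr_ge0.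
have cr0 : crot a 0 = 0 by rewrite /crot !mxE !scale0r addr0.
have c0 : cabs (0 : C) < 1 by rewrite cabs0.
have H z : cabs z < 1 -> forall D, hol f (crot a z) D -> hol (fun z => f (crot a z)) z (fun u => D (crot a u)).
  move=> z1 D [hD JD]; split; first exact: hasd_comp (hasd_crot a z) hD.
  by move=> u; rewrite crot_J JD.
split => [z z1|z z1||].
- have [D hD] := hol_ex hf (ca z z1); exists (fun u => D (crot a u)); exact: H.
- exact/fO/ca.
- by rewrite cr0.
have [D hD] := hol_ex hf c0; exists (fun u => D (crot a u)); split.
  exact: (H 0 c0 D (eq_ind_r (fun z => hol f z D) hD cr0)).
by case: hD => -[_ hD] _; rewrite crot_c1 hD.
Qed.

Lemma cabsN (a : C) : cabs (- a) = cabs a.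
Proof. by rewrite /cabs !mxE !sqrrN. Qed.

Lemma cabs_c1 : cabs (c1 R) = 1.
Proof.
have := cabs_coord (1 : R) 0; rewrite scale1r scale0r addr0 => ->.
by rewrite expr0n/= addr0 expr1n sqrtr1.
Qed.

Lemma cabs_scale (t : R) (a : C) : cabs (t *: a) = `|t| * cabs a.
Proof. by rewrite /cabs !mxE !exprMn -mulrDr sqrtrM ?sqr_ge0// sqrtr_sqr. Qed.

Lemma cand_opp x w : cand x w -> cand x (- w).
Proof.
move=> [f [hf fO f0 <-]]; rewrite -linearN; apply: cand_rot => //.
by rewrite cabsN cabs_c1.
Qed.

Lemma cand_Fle x w : Om x -> (forall xi, boundary Om xi -> lam xi w <= phi xi x) -> cand x w.
Proof.
move=> xO hw; apply/candP; exists (fun z => x + crot w z).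
have dl z : hol (fun z => x + crot w z) z (crot w).
  split; last exact: crot_J.
  apply: hasd_line => [|u t]; last by rewrite crot_line addrA.
  by apply: differentiableD; [exact: differentiable_cst|exact: differentiable_crot].
split => [z _|z z1||].
- by exists (crot w).
- apply: (Om_phi HD xO) => xi bx; have [p [q zE]] := cplxE z.
  have := phi_lin r xi x (crot w z) 1; rewrite scale1r mul1r => ->.
  rewrite subr_gt0; have p0 := phi_pos HD bx xO.
  move: z1; rewrite zE cabs_coord crot_coord linearD !linearZ/= => z1.
  apply: le_lt_trans (hyp_cs _ _ _ _) _; apply: (@le_lt_trans _ _ (Num.sqrt (p ^+ 2 + q ^+ 2) * phi xi x)).
    by apply: ler_wpM2l; [exact: sqrtr_ge0|exact: hw].
  by rewrite -[ltRHS]mul1r ltr_pM2r.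
- by rewrite /crot !mxE !scale0r !addr0.
by exists (crot w); split => //; rewrite crot_c1.
Qed.

(** [phi xi] composed with the disk is the real part of a holomorphic function with values in a
    half-plane. Its derivative is taken in the direction [a], rotated so that the real part realises
    the modulus [lam xi w]. *)
Lemma cand_lam x w xi : cand x w -> boundary Om xi -> lam xi w <= 2 * phi xi x.
Proof.
move=> /candP[f [hf fO f0 [D [hD0 D1]]]] bx; have [c [s [cs <-]]] := lam_sup r xi w.
have c0 : cabs (0 : C) < 1 by rewrite cabs0.
have hm (m : V -> R^o) (L : V -> R^o) a : (forall a b (t : R), m (a + t *: b) = m a + t * L b) -> hasd m a L.
  by move=> h; apply: hasd_line; [exact: affine_differentiable h a|move=> u t; exact: h].
pose B a : R^o := 'd r xi (J a).
have eA a b (t : R) : phi xi (a + t *: b) = phi xi a + t * - 'd r xi b by rewrite phi_lin mulrN.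
have eB a b (t : R) : B (a + t *: b) = B a + t * 'd r xi (J b).
  by rewrite /B J_add J_scale linearD linearZ.
have hA z D' : hol f z D' -> hasd (fun z => phi xi (f z) : R^o) z (fun u => - 'd r xi (D' u)).
  by move=> [h _]; exact: (hasd_comp h (hm (phi xi) _ (f z) eA)).
have hB z D' : hol f z D' -> hasd (fun z => B (f z)) z (fun u => 'd r xi (J (D' u))).
  by move=> [h _]; exact: (hasd_comp h (hm B _ (f z) eB)).
pose a := - (c *: c1 R + s *: J (c1 R)) : C.
have a1 : cabs a = 1 by rewrite cabsN J_c1 cabs_coord cs sqrtr1.
have Da : D a = - (c *: w + s *: J w).
  case: hD0 => -[_ hD0] JD; rewrite -hD0 /a linearN linearD !linearZ/= !hD0; congr (- (_ + _)).
    by rewrite D1.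
  by rewrite JD D1.
have := schwarz_hasd _ _ a1 (hA 0 D hD0) => /(_ (fun z => B (f z))).
rewrite Da linearN opprK f0; apply => z z1.
  have [D' hD'] := hf z z1; exists (fun u => - 'd r xi (D' u)), (fun u => 'd r xi (J (D' u))).
  by split; [exact: hA|exact: hB|move=> u; rewrite opprK; case: hD' => _ ->].
by apply: (phi_ge0 HD) => //; exact: fO.
Qed.

Definition kset x v := [set a : R | 0 < a /\ cand x (a^-1 *: v)].
Definition kob x v : R := inf (kset x v).

Lemma kset_lb x v : has_lbound (kset x v).
Proof. by exists 0 => a [/ltW]. Qed.

Lemma kob_le x v (a : R) : 0 < a -> cand x (a^-1 *: v) -> kob x v <= a.
Proof. by move=> a0 h; apply: ge_inf; [exact: kset_lb|split]. Qed.

Lemma kset_Fle x v (a : R) : Om x -> 0 < a ->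
  (forall xi, boundary Om xi -> lam xi v <= a * phi xi x) -> kset x v a.
Proof.
move=> xO a0 h; split => //; apply: cand_Fle => // xi bx.
by rewrite lam_scale gtr0_norm ?invr_gt0// mulrC ler_pdivrMr// mulrC; exact: h.
Qed.

Lemma kob_Fle x v (a : R) : Om x -> 0 < a ->
  (forall xi, boundary Om xi -> lam xi v <= a * phi xi x) -> kob x v <= a.
Proof. by move=> xO a0 h; have [_ c] := kset_Fle xO a0 h; exact: kob_le. Qed.

Lemma kset_ne x : Om x -> exists2 C1 : R, 0 < C1 & forall v a, 0 < a -> C1 * `|v| <= a -> kset x v a.
Proof.
move=> xO; have [C1 C10 h] := lam_norm HD xO; exists C1 => // v a a0 va.
apply: kset_Fle => // xi bx; apply: le_trans (h _ _ bx) _.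
by apply: ler_wpM2r => //; exact/ltW/(phi_pos HD).
Qed.

Lemma kset_inf x v : Om x -> has_inf (kset x v).
Proof.
move=> xO; split; last exact: kset_lb.
have [C1 C10 h] := kset_ne xO; exists (C1 * `|v| + 1); apply: h; last by rewrite lerDl.
by rewrite ltr_wpDl// mulr_ge0// ltW.
Qed.

Lemma kob_ge0 x v : Om x -> 0 <= kob x v.
Proof. by move=> xO; apply: lb_le_inf; [case: (kset_inf v xO)|move=> a [/ltW]]. Qed.

Lemma kob_ex x v (e : R) : Om x -> 0 < e -> exists a : R, [/\ 0 < a, a < kob x v + e & cand x (a^-1 *: v)].
Proof.
move=> xO e0; have [a [a0 ca] lt] := inf_adherent e0 (kset_inf v xO).
by exists a.
Qed.

Lemma kob_lam x v xi : Om x -> boundary Om xi -> lam xi v <= 2 * phi xi x * kob x v.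
Proof.
move=> xO bx; have p0 := phi_pos HD bx xO; have p2 : 0 < 2 * phi xi x by rewrite mulr_gt0.
rewrite mulrC -ler_pdivrMr//; apply: lb_le_inf; first by case: (kset_inf v xO).
move=> a [a0 /cand_lam/(_ bx)]; rewrite lam_scale gtr0_norm ?invr_gt0// mulrC ler_pdivrMr// => h.
by rewrite ler_pdivrMr// mulrC.
Qed.

Lemma kob_metricE x v : Om x -> kob_metric Om x v = (kob x v)%:E.
Proof.
move=> xO; apply/le_anti/andP; split.
  apply/lee_addgt0Pr => e e0; have [a [a0 ae [f [hf fO f0 f1]]]] := kob_ex v xO e0.
  apply: ge_ereal_inf; exists a%:E; last by rewrite -EFinD lee_fin ltW.
  exists (a *: c1 R); last by rewrite cabs_scale cabs_c1 mulr1 gtr0_norm.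
  exists f; split => //; apply: (etrans (linearZ _ _)) => /=.
  by apply: (etrans (f_equal (fun y => a *: y) f1)); rewrite scalerA divff ?gt_eqF// scale1r.
apply: le_ereal_inf_tmp => _ [xi [f [hf fO f0 f1]] <-]; rewrite lee_fin.
(* The extra [e] keeps the divisor positive when [xi = 0]. *)
apply/ler_addgt0Pr => e e0; have c0 : 0 <= cabs xi by exact: sqrtr_ge0.
have a0 : 0 < cabs xi + e by rewrite ltr_wpDl.
apply: kob_le => //; have := @cand_rot x f ((cabs xi + e)^-1 *: xi) hf fO f0.
have -> : 'd f 0 ((cabs xi + e)^-1 *: xi) = (cabs xi + e)^-1 *: v.
  by apply: (etrans (linearZ _ _)) => /=; exact: (f_equal (fun y => _ *: y) f1).
apply; rewrite cabs_scale gtr0_norm ?invr_gt0// mulrC ler_pdivrMr// mul1r lerDl ltW //.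
Qed.

Lemma kob_add x v w : Om x -> kob x (v + w) <= kob x v + kob x w.
Proof.
move=> xO; apply/ler_addgt0Pr => e e0; have e2 : 0 < e / 2 by rewrite divr_gt0.
have [a [a0 ae ca]] := kob_ex v xO e2; have [b [b0 be cb]] := kob_ex w xO e2.
have ab : 0 < a + b by rewrite addr_gt0.
apply: (@le_trans _ _ (a + b)); last by lra.
apply: kob_le => //; have t01 : 0 <= b / (a + b) <= 1 by rewrite (divr_ge0 (ltW b0) (ltW ab))/= ler_pdivrMr// mul1r lerDr ltW.
have := cand_mix ca cb t01; rewrite subrr scaler0 addr0.
have -> // : a^-1 *: v + (b / (a + b)) *: (b^-1 *: w - a^-1 *: v) = (a + b)^-1 *: (v + w).
rewrite scalerBr !scalerA scalerDr addrC addrAC -addrA -scalerBl addrC.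
by congr (_ *: _ + _ *: _); field; rewrite !gt_eqF.
Qed.

Lemma kob_scale_pos x v (t : R) : Om x -> 0 <= t -> kob x (t *: v) = t * kob x v.
Proof.
have H (s : R) u : Om x -> 0 < s -> kob x (s *: u) <= s * kob x u.
  move=> xO s0; rewrite mulrC -ler_pdivrMr//; apply: lb_le_inf; first by case: (kset_inf u xO).
  move=> a [a0 ca]; rewrite ler_pdivrMr//; apply: kob_le; first by rewrite mulr_gt0.
  by rewrite scalerA invfM -mulrA mulVf ?gt_eqF// mulr1.
move=> xO; rewrite le_eqVlt => /predU1P[<-|t0].
  rewrite scale0r mul0r; apply/le_anti; rewrite kob_ge0// andbT; apply/ler_addgt0Pr => e e0.
  by apply: kob_le; rewrite ?add0r// scaler0; exact: cand_const.
apply/le_anti; rewrite H//=; have := H t^-1 (t *: v) xO; rewrite invr_gt0 => /(_ t0).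
by rewrite scalerA mulVf ?gt_eqF// scale1r mulrC ler_pdivlMr// mulrC.
Qed.

Lemma kob_opp x v : Om x -> kob x (- v) = kob x v.
Proof.
have H u : Om x -> kob x (- u) <= kob x u.
  move=> xO; apply: lb_le_inf; first by case: (kset_inf u xO).
  by move=> a [a0 ca]; apply: kob_le => //; rewrite scalerN; exact: cand_opp.
by move=> xO; apply/le_anti; rewrite H//= -{1}[v]opprK H.
Qed.

(** [y] is the barycentre of [x] and [x + e^-1 *: (y - x)] with weights [1 - e] and [e]; mixing a
    disk at [x] with the constant disk at the other point gives a disk at [y] with derivative scaled
    by [1 - e]. *)
Lemma kob_base x y v (e : R) : Om x -> 0 < e < 1 -> Om (x + e^-1 *: (y - x)) ->
  (1 - e) * kob y v <= kob x v.
Proof.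
move=> xO /andP[e0 e1] uO; have e1' : 0 < 1 - e by rewrite subr_gt0.
apply: lb_le_inf; first by case: (kset_inf v xO).
move=> a [a0 ca]; rewrite mulrC -ler_pdivlMr//; apply: kob_le; first by rewrite divr_gt0.
have t01 : 0 <= e <= 1 by rewrite (ltW e0) (ltW e1).
have := cand_mix ca (cand_const uO) t01; rewrite [x + _ - x]addrC addKr scalerA divff ?gt_eqF// scale1r [x + _]addrC subrK.
by rewrite sub0r scalerN scalerA -scalerBl invf_div mulrBl mul1r.
Qed.

(** [kob_base] in both directions handles the base point and [kob_add] the vector. Continuity lets
    the length of a curve be expressed by a primitive. *)
Lemma kob_cont x0 v0 (e : R) : Om x0 -> 0 < e -> exists2 del : R, 0 < del &
  forall y v, `|y - x0| < del -> `|v - v0| < del -> Om y /\ `|kob y v - kob x0 v0| <= e.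
Proof.
move=> xO e0; have [_ Oo _ _] := HD.
have /nbhs_ballP[rho /= rho0 hrho] : nbhs x0 Om by apply: open_nbhs_nbhs; split.
have [C1 C10 hC] := kset_ne xO; set A := kob x0 v0; have A0 : 0 <= A by exact: kob_ge0.
have base y v (s : R) : 0 < s <= 1 / 2 -> `|y - x0| < s * rho / 3 -> [/\ Om y, (1 - s) * kob y v <= kob x0 v & (1 - s) * kob x0 v <= kob y v].
  move=> /andP[s0 s1] h.
  have inO z : `|z - x0| < rho -> Om z by move=> hz; apply: hrho; rewrite -ball_normE/= distrC.
  have s1' : s < 1 by lra.
  have sr : s * rho <= 1 / 2 * rho by rewrite ler_pM2r.
  have hs : `|s^-1 *: (y - x0)| < rho / 3.
    by rewrite normrZ gtr0_norm ?invr_gt0// mulrC ltr_pdivrMr//; have -> : rho / 3 * s = s * rho / 3 by ring.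
  have yO : Om y by apply: inO; lra.
  split => //; apply: kob_base; rewrite ?s0//; apply: inO.
    by rewrite addrC addKr; lra.
  rewrite addrAC; apply: le_lt_trans (ler_normD _ _) _.
  by rewrite -[x0 - y]opprB scalerN normrN; lra.
pose s := Num.min (1 / 2) (e / (4 * (A + 1))).
have A1 : 0 < 4 * (A + 1) by lra.
have s0 : 0 < s by rewrite lt_min !divr_gt0//; lra.
have s1 : s <= 1 / 2 by rewrite ge_min lexx.
have sA : s * A <= e / 4.
  apply: (@le_trans _ _ (e / (4 * (A + 1)) * (A + 1))).
    by apply: ler_pM; rewrite ?(ltW s0)//; [rewrite ge_min lexx orbT|lra].
  by rewrite le_eqVlt; apply/orP; left; apply/eqP; field; rewrite gt_eqF//; lra.
pose del := Num.min (s * rho / 3) (Num.min (rho / 6) (e / (4 * C1 + 4))).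
have C14 : 0 < 4 * C1 + 4 by lra.
have del0 : 0 < del by rewrite !lt_min !divr_gt0// mulr_gt0.
exists del => // y v hy hv.
have [yO h1 h2] : [/\ Om y, (1 - s) * kob y v0 <= A & (1 - s) * A <= kob y v0].
  by apply: base; rewrite ?s0//; apply: lt_le_trans hy _; rewrite ge_min lexx.
split => //.
have half w : kob y w <= 2 * (C1 * `|w|).
  have hh : `|y - x0| < 1 / 2 * rho / 3.
    by apply: lt_le_trans hy _; rewrite !ge_min; apply/orP; right; apply/orP; left; lra.
  have h01 : 0 < (1 / 2 : R) <= 1 / 2 by rewrite lexx andbT.
  have [_ h _] := @base y w (1 / 2) h01 hh.
  have : kob x0 w <= C1 * `|w|; last by lra.
  apply/ler_addgt0Pr => e' e'0; have a0 : 0 < C1 * `|w| + e' by rewrite ltr_wpDl// mulr_ge0// ltW.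
  by have [|_ c] := hC w _ a0; [rewrite lerDl ltW|exact: kob_le].
have dv : C1 * `|v - v0| <= e / 4.
  apply: (@le_trans _ _ (C1 * (e / (4 * C1 + 4)))).
    by rewrite ler_pM2l//; apply: (le_trans (ltW hv)); rewrite !ge_min lexx !orbT.
  by rewrite mulrA ler_pdivrMr//; have := mulr_gt0 e0 C10; lra.
have a1 := kob_add v0 (v - v0) yO; rewrite addrC subrK in a1.
have a2 := kob_add v (v0 - v) yO; rewrite [v + _]addrC subrK in a2.
have a3 := half (v - v0); have a4 := half (v0 - v); rewrite [`|v0 - v|]distrC in a4.
have k0 := kob_ge0 v0 yO.
have kA : kob y v0 <= 2 * A.
  have : s * kob y v0 <= 1 / 2 * kob y v0 by rewrite ler_wpM2r.
  lra.
have sk : s * kob y v0 <= 2 * (s * A) by rewrite mulrCA ler_pM2l.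
rewrite ler_norml; lra.
Qed.

End Kobayashi.

(** * Smooth curves *)

Section DeriveLine.
Variables (R : realType) (V : normedModType R).
Implicit Types (f g : R -> V) (k : R -> R).

Lemma is_derive_cvg f (t : R) l : is_derive t 1 f l <->
  (fun h : R => h^-1 *: (f (t + h) - f t)) @ 0^' --> l.
Proof.
have E : (fun h : R => h^-1 *: ((f \o shift t) (h *: (1 : R)) - f t)) = (fun h => h^-1 *: (f (t + h) - f t)).
  by apply/funext => h /=; rewrite -[h%:A]/(h * 1) mulr1 [t + h]addrC.
split=> [[df <-]|h].
  by move: df; rewrite /derivable /derive E.
split; first by rewrite /derivable E; apply/cvg_ex; exists l.
by rewrite /derive E; exact: cvg_lim h.
Qed.

Lemma is_derive_eps f (t : R) l : (forall e : R, 0 < e -> exists2 del : R, 0 < del &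
  forall h : R, `|h| < del -> `|f (t + h) - f t - h *: l| <= e * `|h|) -> is_derive t 1 f l.
Proof.
move=> H; apply/is_derive_cvg; apply/cvgrPdist_le => e e0; have [del del0 hd] := H e e0.
near=> h; have h0 : h != 0 by near: h; exact: nbhs_dnbhs_neq.
have hn : `|h| < del by near: h; exact: dnbhs0_lt.
have hp : 0 < `|h| by rewrite normr_gt0.
have -> : l - h^-1 *: (f (t + h) - f t) = - (h^-1 *: (f (t + h) - f t - h *: l)).
  by rewrite [in RHS]scalerBr scalerA mulVf// scale1r opprB.
by rewrite normrN normrZ normfV mulrC ler_pdivrMr//; exact: hd.
Unshelve. all: by end_near. Qed.

Lemma is_derive_local f g (t l' : R) l : 0 < l' -> (forall s, `|s - t| < l' -> f s = g s) ->
  is_derive t 1 g l -> is_derive t 1 f l.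
Proof.
move=> l0 fg [dg <-]; apply: is_derive_eps => e e0.
have dg' : differentiable g t by exact/derivable1_diffP.
have [del del0 hd] := diff_eps dg' e0.
exists (Num.min l' del) => [|h]; first by rewrite lt_min l0.
rewrite lt_min => /andP[h1 h2]; rewrite !fg ?subrr ?normr0 ?[t + h]addrC ?addrK//.
have := hd h h2; rewrite opprD addrA; have -> // : 'd g t h = h *: 'D_1 g t.
by rewrite deriveE// -linearZ/=; congr ('d g t _); rewrite -[_ *: _]/(h * 1) mulr1.
Qed.

End DeriveLine.

Lemma is_derive_scal (R : realType) (V : normedModType R) (k : R -> R) (f : R -> V) (t k' : R) f' :
  is_derive t 1 k k' -> is_derive t 1 f f' ->
  is_derive t 1 (fun s => k s *: f s) (k' *: f t + k t *: f').
Proof.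
move=> dk df; apply/is_derive_cvg.
have -> : (fun h : R => h^-1 *: (k (t + h) *: f (t + h) - k t *: f t)) =
    (fun h : R => (h^-1 * (k (t + h) - k t)) *: f (t + h) + k t *: (h^-1 *: (f (t + h) - f t))).
  apply/funext => h; rewrite [k t *: (_ *: _)]scalerA [k t * _]mulrC -!scalerA -scalerDr.
  by congr (_ *: _); rewrite scalerBl scalerBr addrA subrK.
have h1 : (fun h : R => h^-1 * (k (t + h) - k t)) @ 0^' --> k'.
  exact: (@is_derive_cvg R R k t k').1 dk.
have h2 : (fun h : R => h^-1 *: (f (t + h) - f t)) @ 0^' --> f' by exact/is_derive_cvg.
have h3 : (fun h : R => f (t + h)) @ 0^' --> f t.
  have cf : {for t, continuous f}.
    by apply: differentiable_continuous; apply/derivable1_diffP; case: df.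
  apply: (@cvg_comp _ _ _ (fun h : R => t + h) f _ (nbhs t)); last exact: cf.
  have h4 : (fun h : R => t + h) @ 0^' --> t + 0 by apply: cvgD; [exact: cvg_cst|exact: nbhs_dnbhs].
  by rewrite addr0 in h4; exact: h4.
apply: cvgD; last exact: cvgZl_tmp.
exact: cvgZ h1 h3.
Qed.

Lemma is_derive_chain1 (R : realType) (V : normedModType R) (a : R -> R) (f : R -> V) (t a' : R) f' :
  is_derive t 1 a a' -> is_derive (a t) 1 f f' -> is_derive t 1 (fun s => f (a s)) (a' *: f').
Proof.
move=> da [df <-]; have df' : differentiable f (a t) by exact/derivable1_diffP.
have h := is_derive_chain da df'.
have -> // : a' *: 'D_1 f (a t) = 'd f (a t) a'.
by rewrite deriveE// -linearZ/=; congr ('d f (a t) _); rewrite -[_ *: _]/(a' * 1) mulr1.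
Qed.

(** On the line [smooth] amounts to [Ck n] for all [n] ([Ck_smooth], [smooth_Ck]); exhibiting the
    successive derivatives makes closure under products and composition an easy induction. *)
Fixpoint Ck (R : realType) (V : normedModType R) (k : nat) (f : R -> V) : Prop :=
  if k is k'.+1 then exists g, (forall t : R, is_derive t 1 f (g t)) /\ Ck k' g else True.

Section CkTheory.
Variable R : realType.

Lemma Ck_pred (V : normedModType R) k (f : R -> V) : Ck k.+1 f -> Ck k f.
Proof.
elim: k f => // k IH f [g [hg cg]]; exists g; split => //; exact: IH.
Qed.

Lemma Ck_add (V : normedModType R) k (f g : R -> V) : Ck k f -> Ck k g -> Ck k (fun t => f t + g t).
Proof.
elim: k f g => // k IH f g [f' [hf cf]] [g' [hg cg]]; exists (fun t => f' t + g' t); split; last exact: IH.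
by move=> t; exact: is_derive_add.
Qed.

Lemma Ck_cst (V : normedModType R) k (a : V) : Ck k (fun _ : R => a).
Proof.
elim: k a => // k IH a; exists (fun=> 0); split; last exact: IH.
by move=> t; exact: is_derive_cst.
Qed.

Lemma Ck_scal (V : normedModType R) n (k : R -> R) (f : R -> V) : Ck n k -> Ck n f -> Ck n (fun t => k t *: f t).
Proof.
elim: n k f => // n IH k f hk hf; have [k' [dk ck]] := hk; have [f' [df cf]] := hf.
exists (fun t => k' t *: f t + k t *: f' t); split; first by move=> t; exact: is_derive_scal.
by apply: Ck_add; apply: IH => //; exact: Ck_pred.
Qed.

Lemma Ck_comp (V : normedModType R) n (a : R -> R) (f : R -> V) : Ck n a -> Ck n f -> Ck n (fun t => f (a t)).
Proof.
elim: n a f => // n IH a f ha [f' [df cf]]; have [a' [da ca]] := ha.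
exists (fun t => a' t *: f' (a t)); split; first by move=> t; exact: is_derive_chain1.
apply: Ck_scal => //; apply: IH => //; exact: Ck_pred.
Qed.

Lemma Ck_line (V : normedModType R) n (u v : V) : Ck n (fun t : R => u + t *: v).
Proof.
case: n => // n; exists (fun=> v); split; last exact: Ck_cst.
by move=> t; exact: is_derive_line.
Qed.

Lemma Ck_smooth (V : normedModType R) (f : R^o -> V) : (forall n, Ck n (f : R -> V)) -> smooth f.
Proof.
move=> cf; have H vs : forall n, Ck n (iter_dir vs f : R -> V).
  elim: vs => // v vs IH n; have [g [dg cg]] := IH n.+1.
  have -> : iter_dir (v :: vs) f = (fun t : R => v *: g t) :> (R -> V).
    apply/funext => t; have [dg1 dg2] := dg t.
    have df : differentiable (iter_dir vs f : R -> V) t by exact/derivable1_diffP.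
    rewrite /= (deriveE v df) -dg2 (deriveE _ df) -linearZ/=; congr ('d _ t _).
    by rewrite -[_ *: _]/(v * 1) mulr1.
  by apply: Ck_scal => //; exact: Ck_cst.
move=> vs; have [g [dg _]] := H vs 1%N.
have df t : differentiable (iter_dir vs f : R -> V) t.
  by apply/derivable1_diffP; case: (dg t).
by split=> [t|v t]; [exact: differentiable_continuous|exact: diff_derivable].
Qed.

Lemma smooth_Ck (V : normedModType R) (f : R^o -> V) : smooth f -> forall n, Ck n (f : R -> V).
Proof.
move=> sf n; have H : forall ws, Ck n (iter_dir ws f : R -> V); last exact: (H [::]).
elim: n => // n IH ws; exists (iter_dir ((1 : R^o) :: ws) f : R -> V); split; last exact: IH.
by move=> t; split => //; have [_ h] := sf ws; exact: h.
Qed.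

(** The functions [p(1/t) e^(-1/t)] extended by 0 form a class closed under differentiation, [p]
    becoming [X^2 (p - p')], so smoothness at 0 is proved for all of them at once. *)
Definition flat (p : {poly R}) (t : R) : R := if 0 < t then p.[t^-1] * expR (- t^-1) else 0.

Lemma poly_exp_bound (p : {poly R}) : exists2 C : R, 0 <= C & forall u : R, 0 < u -> `|p.[u]| <= C * expR u.
Proof.
have hX (n : nat) : exists K : R, 0 <= K /\ forall u : R, 0 < u -> u ^+ n <= K * expR u.
  exists (n%:R ^+ n); split=> [|u u0]; first exact: exprn_ge0.
  case: n => [|n]; first by rewrite !expr0 mul1r; have := expR_ge1Dx u; lra.
  have n0 : 0 < n.+1%:R :> R by [].
  have -> : expR u = expR (u / n.+1%:R) ^+ n.+1 by rewrite -expRM_natl mulrC divfK.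
  have e0 := expR_gt0 (u / n.+1%:R).
  rewrite -exprMn; apply: lerXn2r; rewrite ?nnegrE; [exact: ltW|by apply: mulr_ge0 => //; exact: ltW|].
  by rewrite mulrC -ler_pdivrMr//; apply: le_trans (expR_ge1Dx _); rewrite lerDr ler01.
have [K hK] := choice hX.
exists (\sum_(i < size p) `|p`_i| * K i) => [|u u0].
  by apply: sumr_ge0 => i _; apply: mulr_ge0 => //; case: (hK i).
rewrite horner_coef mulr_suml; apply: le_trans (ler_norm_sum _ _ _) _; apply: ler_sum => i _.
rewrite normrM -mulrA; apply: ler_wpM2l => //; have [_ h] := hK i.
by rewrite ger0_norm ?exprn_ge0 ?(ltW u0)//; exact: h.
Qed.

Lemma flat_derive (p : {poly R}) (t : R) : is_derive t 1 (flat p) (flat ('X^2 * (p - p^`())) t).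
Proof.
have [t0|t0|t0] := ltgtP t 0.
- have -> : flat ('X^2 * (p - p^`())) t = 0 by rewrite /flat ltNge (ltW t0).
  apply: (@is_derive_local _ _ _ (fun=> 0) t (- t)); rewrite ?oppr_gt0//.
  by move=> s /ltr_distlDr; rewrite subrr => h; rewrite /flat ltNge ltW.
- rewrite /flat t0.
  apply: (@is_derive_local _ _ _ (fun t => p.[t^-1] * expR (- t^-1)) t t) => //.
    by move=> s; rewrite distrC => /ltr_distlBl; rewrite subrr => ->.
  have tn : t != 0 by rewrite gt_eqF.
  have d1 : is_derive t 1 (fun s => s^-1) (- t ^- 2) := dV tn.
  have dN : is_derive t 1 (fun s : R => - s^-1) (t ^- 2).
    by apply: (deq (is_deriveN d1)); rewrite opprK.
  have d2 : is_derive t 1 (fun s => p.[s^-1]) (- t ^- 2 * p^`().[t^-1]).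
    exact: (is_derive_chain1 d1 (is_derive_poly p t^-1)).
  have d3 : is_derive t 1 (fun s => expR (- s^-1)) (t ^- 2 * expR (- t^-1)).
    exact: (is_derive_chain1 dN (is_derive_expR (- t^-1))).
  apply: (deq (dM d2 d3)); rewrite hornerM hornerXn hornerD hornerN exprVn.
  by ring.
(* With [u = 1 / h], the bound [u^2 |p(u)| <= C e^u] says that the function is at most [C * h^2] at
   [h]. *)
rewrite t0 /flat ltxx; have [C C0 hC] := poly_exp_bound ('X^2 * p).
apply: is_derive_eps => e e0; exists (e / (C + 1)) => [|h hh]; first by rewrite divr_gt0// ltr_wpDl.
rewrite add0r ltxx scaler0 !subr0; case: ifP => h0; last by rewrite normr0 mulr_ge0// ltW.
have hv : 0 < h^-1 by rewrite invr_gt0.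
have := hC _ hv; rewrite !hornerE normrM normrX gtr0_norm// exprVn mulrC ler_pdivrMr ?exprn_gt0// => hp.
rewrite normrM [`|expR _|]gtr0_norm ?expR_gt0// expRN ler_pdivrMr ?expR_gt0//.
apply: (le_trans hp); rewrite mulrAC; apply: ler_wpM2r; first exact/ltW/expR_gt0.
rewrite gtr0_norm// expr2 mulrA; apply: ler_wpM2r; first exact: ltW.
rewrite gtr0_norm// in hh; rewrite ltr_pdivlMr ?ltr_wpDl// in hh.
have := mulr_ge0 C0 (ltW h0); lra.
Qed.

Lemma Ck_flat n (p : {poly R}) : Ck n (flat p).
Proof.
elim: n p => // n IH p; exists (flat ('X^2 * (p - p^`()))); split; last exact: IH.
by move=> t; exact: flat_derive.
Qed.

Lemma smooth_step : exists S S' : R -> R, [/\ forall n, Ck n S, forall t : R, is_derive t 1 S (S' t),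
  forall t : R, t <= 0 -> S t = 0 /\ S' t = 0, forall t : R, 1 <= t -> S t = 1 /\ S' t = 0 &
  forall t, 0 <= S' t /\ 0 <= S t <= 1].
Proof.
pose b (t : R) := flat 1 t *: flat 1 (1 + t *: (- 1)).
have E1 t : 1 + t *: (- 1) = 1 - t :> R by rewrite -[_ *: _]/(t * - 1) mulrN1.
have bE t : b t = flat 1 t * flat 1 (1 - t) by rewrite /b E1.
have cb n : Ck n b.
  by apply: Ck_scal; [exact: Ck_flat|apply: (@Ck_comp _ n (fun t => 1 + t *: (-1))); [exact: Ck_line|exact: Ck_flat]].
have cont_b : continuous b.
  have [g [dg _]] := cb 1%N => t; apply: differentiable_continuous; apply/derivable1_diffP; by case: (dg t).
have fl0 (t : R) : 0 <= flat 1 t by rewrite /flat; case: ifP => // _; rewrite hornerC mul1r ltW// expR_gt0.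
have b0 t : 0 <= b t by rewrite bE mulr_ge0.
have bl t : t <= 0 -> b t = 0 by move=> t0; rewrite bE /flat ltNge t0/= mul0r.
have br t : 1 <= t -> b t = 0 by move=> t1; rewrite bE /flat subr_gt0 [t < 1]ltNge t1/= mulr0.
have [F dF] := primitive_ex cont_b.
have fc : {within `[0, 1], continuous F} by apply: (@is_derive_within _ F b) => x _; exact: dF.
have [c /[!in_itv]/= /andP[c0 c1] hc] := MVT ltr01 (fun x _ => dF x) fc.
rewrite subr0 mulr1 in hc.
have F01 : 0 < F 1 - F 0.
  by rewrite hc bE /flat c0 subr_gt0 c1 !hornerC !mul1r mulr_gt0// expR_gt0.
set k := (F 1 - F 0)^-1; have k0 : 0 < k by rewrite invr_gt0.
have mono x y : x <= y -> F x <= F y.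
  rewrite le_eqVlt => /predU1P[->//|xy].
  have fcxy : {within `[x, y], continuous F} by apply: (@is_derive_within _ F b) => z _; exact: dF.
  have [z _ hz] := MVT xy (fun x _ => dF x) fcxy.
  by rewrite -subr_ge0 hz mulr_ge0// subr_ge0 ltW.
have Fl t : t <= 0 -> F t = F 0.
  move=> t0; have := @mvt_bound _ F b t 0 0 0 t0 (fun x _ => dF x).
  rewrite !mul0r subr0 => h; apply/eqP; rewrite eq_sym -subr_eq0 -normr_le0; apply: h => x /andP[_ x0].
  by rewrite subr0 bl// normr0.
have Fr t : 1 <= t -> F t = F 1.
  move=> t1; have := @mvt_bound _ F b 1 t 0 0 t1 (fun x _ => dF x).
  rewrite !mul0r subr0 => h; apply/eqP; rewrite -subr_eq0 -normr_le0; apply: h => x /andP[x1 _].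
  by rewrite subr0 br// normr0.
exists (fun t => k * (F t - F 0)), (fun t => k * b t); split.
- have cF n : Ck n F by case: n => // n; exists b.
  move=> n; apply: (@Ck_scal R n (fun=> k) (fun t => F t - F 0)); first exact: Ck_cst.
  by apply: Ck_add => //; exact: Ck_cst.
- move=> t; apply: dMl; apply: (deq (dB (dF t) (dC (F 0) t))); exact: subr0.
- by move=> t t0; rewrite Fl// subrr bl// mulr0.
- by move=> t t0; rewrite Fr// br// mulr0 mulVf ?gt_eqF.
move=> t; split; first by rewrite mulr_ge0// ltW.
have [t0|t0] := leP t 0; first by rewrite Fl// subrr mulr0 lexx ler01.
have [t1|t1] := leP 1 t; first by rewrite Fr// mulVf ?gt_eqF// ler01 lexx.
rewrite mulr_ge0 ?(ltW k0)// ?subr_ge0 ?mono ?(ltW t0)//= mulrC ler_pdivrMr// mul1r lerD2r.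
by apply: mono; exact: ltW.
Qed.
End CkTheory.

(** * The Kobayashi distance *)

Section Increasing.
Variable R : realType.

Lemma incr_le (h dh : R -> R) (a b : R) : a <= b -> (forall x, a <= x <= b -> is_derive x 1 h (dh x)) ->
  (forall x, a <= x <= b -> 0 <= dh x) -> h a <= h b.
Proof.
move=> ab dhx h0; have [c cab hc] := MVT_segment ab (fun x xab => dhx x (subset_itv_oo_cc xab)) (is_derive_within dhx).
by rewrite -subr_ge0 hc mulr_ge0 ?subr_ge0//; apply: h0; rewrite in_itv /= in cab.
Qed.

Lemma derive_le (f g df dg : R -> R) (a b : R) : a <= b ->
  (forall x, a <= x <= b -> is_derive x 1 f (df x)) ->
  (forall x, a <= x <= b -> is_derive x 1 g (dg x)) ->
  (forall x, a <= x <= b -> df x <= dg x) -> f b - f a <= g b - g a.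
Proof.
move=> ab hf hg h; have := @incr_le (fun x => g x - f x) (fun x => dg x - df x) a b ab.
have H : forall x, a <= x <= b -> is_derive x 1 (fun x => g x - f x) (dg x - df x).
  by move=> x xab; apply: dB; [exact: hg|exact: hf].
have H0 : forall x, a <= x <= b -> 0 <= dg x - df x by move=> x xab; rewrite subr_ge0; exact: h.
by move=> /(_ H H0); lra.
Qed.

Lemma affine_chain n (m : 'rV[R]_n -> R^o) (L : 'rV[R]_n -> R) (g : R -> 'rV[R]_n) (t : R) g' :
  (forall a b (s : R), m (a + s *: b) = m a + s * L b) -> is_derive t 1 g g' ->
  is_derive t 1 (fun s => m (g s) : R) (L g').
Proof.
move=> hm dg; have dm := affine_differentiable hm (g t).
apply: (deq (is_derive_chain dg dm)); apply: diff_affine_line => // s; exact: hm.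
Qed.

End Increasing.

Section Distance.
Variables (R : realType) (d : nat).
Local Notation V := (Cn R d).
Local Notation J := (cmul (cI R)).
Variables (Om : set V) (r : V -> R^o).
Hypothesis HD : good_domain Om r.
Implicit Types (x y z v w : V) (g : R -> V) (F : R -> R).
Local Notation phi := (phi r).
Local Notation lam := (lam r).
Local Notation kob := (kob Om).

(** [F] is a primitive of the speed, so [F 1 - F 0] is the length; estimates along curves become
    comparisons of derivatives instead of integrals. *)
Definition path x y g g' F := [/\ forall n, Ck n g, forall t : R, is_derive t 1 g (g' t),
  forall t : R, 0 <= t <= 1 -> Om (g t), g 0 = x /\ g 1 = y &
  forall t : R, 0 <= t <= 1 -> is_derive t 1 F (kob (g t) (g' t))].

Definition lens x y := [set l : R | exists g g' F, path x y g g' F /\ l = F 1 - F 0].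
Definition dK x y : R := inf (lens x y).

Lemma kob_clamp_continuous g g' : continuous g -> continuous g' -> (forall t, 0 <= t <= 1 -> Om (g t)) ->
  continuous (fun t : R => kob (g (clamp 0 1 t)) (g' (clamp 0 1 t))).
Proof.
move=> cg cg' gO t; pose c := @clamp R 0 1.
have cI s : 0 <= c s <= 1 by apply: clamp_in.
have cc : continuous c by exact: clamp_continuous.
apply/cvgrPdist_le => e e0.
have [del del0 H] := kob_cont HD (g' (c t)) (gO _ (cI t)) e0.
have c1 : {for t, continuous (fun t => g (c t))} by apply: continuous_comp; [exact: cc|exact: cg].
have c2 : {for t, continuous (fun t => g' (c t))} by apply: continuous_comp; [exact: cc|exact: cg'].
near=> s; have h1 : `|g (c t) - g (c s)| < del by near: s; move/cvgrPdist_lt: c1; exact.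
have h2 : `|g' (c t) - g' (c s)| < del by near: s; move/cvgrPdist_lt: c2; exact.
by rewrite distrC in h1; rewrite distrC in h2; have [_] := H _ _ h1 h2; rewrite distrC.
Unshelve. all: by end_near. Qed.

Lemma Ck_continuous (W : normedModType R) (f : R -> W) : Ck 1 f -> continuous f.
Proof.
by move=> [f' [df _]] t; apply: differentiable_continuous; apply/derivable1_diffP; case: (df t).
Qed.

Lemma curve_path x y (g : R^o -> V) : smooth_curve Om x y g -> exists F, path x y g (fun t => 'D_1 g t) F.
Proof.
move=> [sg gO g0 g1]; have cg := smooth_Ck sg.
have [g' [dg cg']] := cg 2%N.
have E : (fun t => 'D_1 g t) = g' by apply/funext => t; case: (dg t).
have [F hF] := primitive_ex (kob_clamp_continuous (Ck_continuous (cg 1%N)) (Ck_continuous cg') gO).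
exists F; rewrite E; split => // t t01.
by apply: (deq (hF t)); rewrite clamp_id.
Qed.

Lemma path_integral x y g g' F : path x y g g' F ->
  (\int[lebesgue_measure]_(t in `[0%R, 1%R]) kob_metric Om (g t) ('D_1 (g : R^o -> V) t) = (F 1 - F 0)%:E)%E.
Proof.
move=> [cg dg gO _ dF].
pose h t := kob (g (clamp 0 1 t)) (g' (clamp 0 1 t)).
have cg' : continuous g'.
  have [g2 [dg2 cg2]] := cg 2%N; have -> : g' = g2; last exact: Ck_continuous cg2.
  by apply/funext => t; case: (dg t) => _ <-; case: (dg2 t).
have ch : continuous h by exact: kob_clamp_continuous (Ck_continuous (cg 1%N)) cg' gO.
have -> : (\int[lebesgue_measure]_(t in `[0%R, 1%R]) kob_metric Om (g t) ('D_1 (g : R^o -> V) t) =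
   \int[lebesgue_measure]_(t in `[0%R, 1%R]) (h t)%:E)%E.
  apply: eq_integral => t; rewrite inE /= in_itv /= => t01; rewrite (kob_metricE HD); last exact: gO.
  by rewrite /h clamp_id//; case: (dg t) => _ ->.
have cF (t : R) : 0 <= t <= 1 -> {for t, continuous F}.
  by move=> /dF h'; exact: is_derive_continuous_at h'.
rewrite EFinB; apply: continuous_FTC2 => //.
- exact: continuous_subspaceT.
- split.
  + by move=> t; rewrite in_itv/= => /andP[t0 t1]; have [] := dF t; rewrite ?(ltW t0) ?(ltW t1).
  + by apply: cvg_at_right_filter; apply: cF; rewrite lexx ler01.
  by apply: cvg_at_left_filter; apply: cF; rewrite lexx ler01.
move=> t; rewrite in_itv/= => /andP[t0 t1].
have t01 : 0 <= t <= 1 by rewrite (ltW t0) (ltW t1).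
by rewrite derive1E /h clamp_id//; case: (dF t t01).
Qed.

Lemma path_curve x y g g' F : path x y g g' F -> smooth_curve Om x y (g : R^o -> V).
Proof. by move=> [cg dg gO [g0 g1] dF]; split => //; exact: Ck_smooth. Qed.

Lemma path_affine_chain x y g g' F m (L : V -> R) (t : R) : path x y g g' F ->
  (forall a b (s : R), m (a + s *: b) = m a + s * L b) -> is_derive t 1 (fun s => m (g s) : R) (L (g' t)).
Proof. by move=> [_ dg _ _ _] hm; exact: affine_chain. Qed.

Lemma path_mono x y g g' F (s t : R) : path x y g g' F -> 0 <= s -> s <= t -> t <= 1 -> F s <= F t.
Proof.
move=> [_ _ gO _ dF] s0 st t1; apply: (incr_le st (dh := fun t => kob (g t) (g' t))) => u /andP[su ut].
  by apply: dF; rewrite (le_trans s0 su) (le_trans ut t1).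
by apply: (kob_ge0 HD); apply: gO; rewrite (le_trans s0 su) (le_trans ut t1).
Qed.

Lemma lens_ge0 x y l : lens x y l -> 0 <= l.
Proof. by move=> [g [g' [F [p ->]]]]; rewrite subr_ge0; apply: (path_mono p). Qed.

(** Gronwall's argument: the bound [|phi'| <= lam <= 2 * phi * kob] makes [phi * expR (- 2 * F)]
    nonincreasing along the curve. *)
Lemma path_phi x y g g' F xi (t : R) : path x y g g' F -> boundary Om xi -> 0 <= t <= 1 ->
  phi xi (g t) <= phi xi x * expR (2 * (F t - F 0)).
Proof.
move=> p bx /andP[t0 t1]; have [_ _ gO [g0 _] dF] := p.
have dphi (s : R) : is_derive s 1 (fun s => phi xi (g s) : R) (- 'd r xi (g' s)).
  by apply: (path_affine_chain (L := fun b => - 'd r xi b) _ p) => a b u; rewrite phi_lin mulrN.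
have dE (s : R) : 0 <= s <= 1 -> is_derive s 1 (fun s => expR ((-2) * (F s - F 0)))
    ((- 2 * kob (g s) (g' s)) * expR ((-2) * (F s - F 0))).
  move=> s01; have d1 : is_derive s 1 (fun s => (-2) * (F s - F 0)) ((-2) * kob (g s) (g' s)).
    by apply: dMl; apply: (deq (dB (dF s s01) (dC (F 0) s))); exact: subr0.
  exact: (is_derive_chain1 d1 (is_derive_expR _)).
have st s : 0 <= s <= t -> 0 <= s <= 1 by move=> /andP[-> st]; exact: le_trans st t1.
have := derive_le t0 (fun s h => dM (dphi s) (dE s (st s h))) (fun s _ => dC 0 s).
have H s : 0 <= s <= t -> phi xi (g s) * (- 2 * kob (g s) (g' s) * expR (-2 * (F s - F 0))) +
    expR (-2 * (F s - F 0)) * - 'd r xi (g' s) <= 0.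
  move=> /st s01; have h1 := kob_lam HD (g' s) (gO s s01) bx; have h2 := lam_ge r xi (g' s).
  have -> : phi xi (g s) * (- 2 * kob (g s) (g' s) * expR (-2 * (F s - F 0))) +
    expR (-2 * (F s - F 0)) * - 'd r xi (g' s) = - (expR (-2 * (F s - F 0)) *
      (2 * phi xi (g s) * kob (g s) (g' s) + 'd r xi (g' s))) by ring.
  rewrite oppr_le0 mulr_ge0// ?(ltW (expR_gt0 _))//.
  by have := le_trans h2 h1; rewrite ler_norml => /andP[]; lra.
move=> /(_ H); rewrite !subrr mulr0 expR0 mulr1 g0 subr_le0 mulNr expRN.
by rewrite ler_pdivrMr ?expR_gt0.
Qed.

(** Integrates [lam xi (g' t) <= 2 * phi xi (g t) * kob (g t) (g' t)] with [path_phi] inserted. The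
    rotation is fixed by the total displacement, so that a real linear form is integrated. *)
Lemma path_lam x y g g' F xi : path x y g g' F -> boundary Om xi ->
  lam xi (y - x) <= phi xi x * (expR (2 * (F 1 - F 0)) - 1).
Proof.
move=> p bx; have [_ _ gO [g0 g1] dF] := p.
have [c [s [cs <-]]] := lam_sup r xi (y - x).
pose m a : R^o := 'd r xi (c *: a + s *: J a).
have hm a b (t : R) : m (a + t *: b) = m a + t * m b.
  have E : m a + t * m b = 'd r xi ((c *: a + s *: J a) + t *: (c *: b + s *: J b)).
    by rewrite linearD linearZ.
  rewrite E /m J_add J_scale; congr ('d r xi _).
  by rewrite !scalerDr !scalerA addrACA ![t * _]mulrC.
have dm (t : R) : is_derive t 1 (fun s => m (g s) : R) (m (g' t)) := path_affine_chain t p hm.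
have dE (t : R) : 0 <= t <= 1 -> is_derive t 1 (fun t => phi xi x * expR (2 * (F t - F 0)))
    (phi xi x * ((2 * kob (g t) (g' t)) * expR (2 * (F t - F 0)))).
  move=> t01; have d1 : is_derive t 1 (fun s => 2 * (F s - F 0)) (2 * kob (g t) (g' t)).
    by apply: dMl; apply: (deq (dB (dF t t01) (dC (F 0) t))); exact: subr0.
  apply: dMl; exact: (is_derive_chain1 d1 (is_derive_expR _)).
have := derive_le ler01 (fun t _ => dm t) dE.
have H t : 0 <= t <= 1 -> m (g' t) <= phi xi x * ((2 * kob (g t) (g' t)) * expR (2 * (F t - F 0))).
  move=> t01; apply: (le_trans (lam_rot r xi (g' t) cs)); apply: (le_trans (kob_lam HD (g' t) (gO t t01) bx)).
  have -> : phi xi x * ((2 * kob (g t) (g' t)) * expR (2 * (F t - F 0))) =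
     2 * (phi xi x * expR (2 * (F t - F 0))) * kob (g t) (g' t) by ring.
  apply: ler_wpM2r; first exact: (kob_ge0 HD _ (gO t t01)).
  by rewrite ler_pM2l//; exact: path_phi p bx t01.
move=> /(_ H); rewrite g0 g1 subrr mulr0 expR0 mulr1 => h.
have -> : 'd r xi (c *: (y - x) + s *: J (y - x)) = m y - m x.
  by have := hm y x (-1); rewrite scaleN1r mulN1r.
by apply: (le_trans h); rewrite [leRHS]mulrBr mulr1.
Qed.

Lemma path_line x y : Om x -> Om y -> exists F, path x y (fun t => x + t *: (y - x)) (fun=> y - x) F.
Proof.
move=> xO yO; have cg n := Ck_line n x (y - x).
have gO t : 0 <= t <= 1 -> Om (x + t *: (y - x)) := convexP HD xO yO (t := t).
have [F hF] := primitive_ex (kob_clamp_continuous (Ck_continuous (cg 1%N)) (Ck_continuous (Ck_cst 1 (y - x))) gO).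
exists F; split => //; last by move=> t t01; apply: (deq (hF t)); rewrite clamp_id.
- by move=> t; exact: is_derive_line.
by rewrite scale0r addr0 scale1r addrC subrK.
Qed.

Lemma path_sub x y g g' F (a c : R) : path x y g g' F -> 0 <= c -> 0 <= a -> a + c <= 1 ->
  path (g a) (g (a + c)) (fun t => g (a + t *: c)) (fun t => c *: g' (a + t *: c)) (fun t => F (a + t *: c)).
Proof.
move=> [cg dg gO _ dF] c0 a0 ac.
have I01 t : 0 <= t <= 1 -> 0 <= a + t *: c <= 1.
  move=> /andP[t0 t1]; have h0 : 0 <= t * c by exact: mulr_ge0.
  have h1 : t * c <= c by exact: ler_piMl.
  by rewrite -[t *: c]/(t * c); lra.
have da (t : R) : is_derive t 1 (fun t : R => a + t *: c) c by exact: is_derive_line.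
split.
- by move=> n; apply: (@Ck_comp _ _ n (fun t => a + t *: c)) => //; exact: Ck_line.
- by move=> t; exact: (is_derive_chain1 (da t) (dg _)).
- by move=> t /I01; exact: gO.
- by rewrite scale0r addr0 scale1r.
move=> t /I01 h; apply: (deq (is_derive_chain1 (da t) (dF _ h))).
by rewrite (kob_scale_pos HD _ (gO _ h) c0).
Qed.

Lemma path_rev x y g g' F : path x y g g' F -> exists g2 g2' F2, path y x g2 g2' F2 /\ F2 1 - F2 0 = F 1 - F 0.
Proof.
move=> [cg dg gO [g0 g1] dF].
have I01 (t : R) : 0 <= t <= 1 -> 0 <= (1 : R) + t *: (-1 : R) <= 1.
  by rewrite -[t *: _]/(t * -1); lra.
have da (t : R) : is_derive t 1 (fun t : R => 1 + t *: (-1 : R)) (-1) by exact: is_derive_line.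
exists (fun t => g (1 + t *: (-1))), (fun t => (-1) *: g' (1 + t *: (-1))), (fun t => (-1) * F (1 + t *: (-1))).
split; first split.
- by move=> n; apply: (@Ck_comp _ _ n (fun t => 1 + t *: (-1 : R))) => //; exact: Ck_line.
- by move=> t; exact: (is_derive_chain1 (da t) (dg _)).
- by move=> t /I01; exact: gO.
- by rewrite scale0r addr0 scale1r subrr.
- move=> t /I01 h; apply: (deq (dMl (-1) (is_derive_chain1 (da t) (dF _ h)))).
  by rewrite -[_ *: kob _ _]/(_ * _) mulrA mulrNN !mul1r scaleN1r (kob_opp HD _ (gO _ h)).
by rewrite scale0r addr0 scale1r subrr; ring.
Qed.

(** The junction must be smooth, so each curve is slowed down to rest there by a smooth step. At
    every time one of the parameters [a], [b] is stationary at the junction, hence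
    [g1 (a t) + g2 (b t) - y] runs along one curve and then along the other. *)
Lemma path_concat x y z g1 g1' F1 g2 g2' F2 : path x y g1 g1' F1 -> path y z g2 g2' F2 ->
  exists g g' F, path x z g g' F /\ F 1 - F 0 = (F1 1 - F1 0) + (F2 1 - F2 0).
Proof.
move=> [cg1 dg1 gO1 [g10 g11] dF1] [cg2 dg2 gO2 [g20 g21] dF2].
have [S [S' [cS dS S0 S1 SP]]] := smooth_step R.
pose a (t : R) := S ((0 : R) + t *: (2 : R)); pose a' (t : R) := 2 * S' ((0 : R) + t *: (2 : R)).
pose b (t : R) := S ((-1 : R) + t *: (2 : R)); pose b' (t : R) := 2 * S' ((-1 : R) + t *: (2 : R)).
have tE (t : R) : (0 : R) + t *: (2 : R) = 2 * t by rewrite add0r -[_ *: _]/(_ * _) mulrC.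
have tE' (t : R) : (-1 : R) + t *: (2 : R) = 2 * t - 1 by rewrite addrC -[_ *: _]/(_ * _) mulrC.
have ca n : Ck n a by apply: (@Ck_comp _ _ n (fun t => (0 : R) + t *: (2 : R))) => //; exact: Ck_line.
have cb n : Ck n b by apply: (@Ck_comp _ _ n (fun t => (-1 : R) + t *: (2 : R))) => //; exact: Ck_line.
have da (t : R) : is_derive t 1 a (a' t) by apply: (is_derive_chain1 (is_derive_line _ _ t) (dS _)).
have db (t : R) : is_derive t 1 b (b' t) by apply: (is_derive_chain1 (is_derive_line _ _ t) (dS _)).
have a01 t : 0 <= a' t /\ 0 <= a t <= 1 by have [h1 h2] := SP ((0 : R) + t *: (2 : R)); split => //; apply: mulr_ge0.
have b01 t : 0 <= b' t /\ 0 <= b t <= 1 by have [h1 h2] := SP ((-1 : R) + t *: (2 : R)); split => //; apply: mulr_ge0.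
have dich t : (b t = 0 /\ b' t = 0) \/ (a t = 1 /\ a' t = 0).
  have [h|h] := leP t (1 / 2).
    by left; rewrite /b /b'; have [|-> ->] := S0 ((-1 : R) + t *: (2 : R)); rewrite ?mulr0// tE'; lra.
  by right; rewrite /a /a'; have [|-> ->] := S1 ((0 : R) + t *: (2 : R)); rewrite ?mulr0// tE; lra.
pose g t := g1 (a t) + (g2 (b t) + - y).
pose g' t := a' t *: g1' (a t) + b' t *: g2' (b t).
pose F t := F1 (a t) + F2 (b t).
have b0 : b 0 = 0 by rewrite /b; have [|->] := S0 ((-1 : R) + (0 : R) *: (2 : R)); rewrite // tE'; lra.
have a0 : a 0 = 0 by rewrite /a; have [|->] := S0 ((0 : R) + (0 : R) *: (2 : R)); rewrite // tE; lra.
have b1 : b 1 = 1 by rewrite /b; have [|->] := S1 ((-1 : R) + (1 : R) *: (2 : R)); rewrite // tE'; lra.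
have a1 : a 1 = 1 by rewrite /a; have [|->] := S1 ((0 : R) + (1 : R) *: (2 : R)); rewrite // tE; lra.
have gE t : (b t = 0 /\ g t = g1 (a t)) \/ (a t = 1 /\ g t = g2 (b t)).
  have [[h _]|[h _]] := dich t; [left|right]; split => //; rewrite /g h.
    by rewrite g20 subrr addr0.
  by rewrite g11 addrCA subrr addr0.
exists g, g', F; split; last by rewrite /F a0 a1 b0 b1; ring.
split.
- move=> n; apply: Ck_add; first exact: Ck_comp.
  by apply: Ck_add; [exact: Ck_comp|exact: Ck_cst].
- move=> t; apply: is_derive_add; first exact: (is_derive_chain1 (da t) (dg1 _)).
  rewrite -[b' t *: _]addr0; apply: is_derive_add.
  exact: (is_derive_chain1 (db t) (dg2 _)).
- move=> t _; have [[_ ->]|[_ ->]] := gE t; first by apply: gO1; case: (a01 t).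
  by apply: gO2; case: (b01 t).
- by rewrite /g a0 a1 b0 b1 g10 g11 g20 g21 subrr addr0 addrCA subrr addr0.
move=> t _; have [a'0 aI] := a01 t; have [b'0 bI] := b01 t.
have d1 : is_derive t 1 (fun t => F1 (a t)) (a' t * kob (g1 (a t)) (g1' (a t))).
  exact: (is_derive_chain1 (da t) (dF1 _ aI)).
have d2 : is_derive t 1 (fun t => F2 (b t)) (b' t * kob (g2 (b t)) (g2' (b t))).
  exact: (is_derive_chain1 (db t) (dF2 _ bI)).
apply: (deq (dD d1 d2)); rewrite -(kob_scale_pos HD _ (gO1 _ aI) a'0) -(kob_scale_pos HD _ (gO2 _ bI) b'0).
have k0 y' : Om y' -> kob y' 0 = 0 by move=> yO; rewrite -(scale0r 0) (kob_scale_pos HD)// mul0r.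
have [[hb hb']|[ha ha']] := dich t.
  have -> : g t = g1 (a t) by rewrite /g hb g20 subrr addr0.
  by rewrite /g' hb' !scale0r addr0 (k0 _ (gO2 _ bI)) addr0.
have -> : g t = g2 (b t) by rewrite /g ha g11 addrCA subrr addr0.
by rewrite /g' ha' !scale0r add0r (k0 _ (gO1 _ aI)) add0r.
Qed.

Lemma lens_lb x y : has_lbound (lens x y).
Proof. by exists 0 => l; exact: lens_ge0. Qed.

Lemma lens_ne x y : Om x -> Om y -> lens x y !=set0.
Proof.
by move=> xO yO; have [F p] := path_line xO yO; exists (F 1 - F 0), (fun t => x + t *: (y - x)), (fun=> y - x), F.
Qed.

Lemma kob_distE x y : Om x -> Om y -> kob_dist Om x y = (dK x y)%:E.
Proof.
move=> xO yO; rewrite /kob_dist /dK -(ereal_inf_EFin (lens_lb x y) (lens_ne xO yO)); congr ereal_inf.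
apply/seteqP; split => [_ [g sg <-]|_ [l [g [g' [F [p ->]]]] <-]].
  have [F p] := curve_path sg; exists (F 1 - F 0); last exact: esym (path_integral p).
  by exists g, (fun t => 'D_1 g t), F.
by exists g; [exact: path_curve p|exact: path_integral p].
Qed.

Lemma dK_path x y g g' F : path x y g g' F -> dK x y <= F 1 - F 0.
Proof. by move=> p; apply: ge_inf; [exact: lens_lb|exists g, g', F]. Qed.

Lemma dK_ge x y (a : R) : Om x -> Om y -> (forall g g' F, path x y g g' F -> a <= F 1 - F 0) -> a <= dK x y.
Proof.
move=> xO yO h; apply: lb_le_inf; first exact: lens_ne.
by move=> l [g [g' [F [p ->]]]]; exact: h p.
Qed.

Lemma dK_ex x y (e : R) : Om x -> Om y -> 0 < e -> exists g g' F, path x y g g' F /\ F 1 - F 0 < dK x y + e.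
Proof.
move=> xO yO e0; have hi : has_inf (lens x y) by split; [exact: lens_ne|exact: lens_lb].
by have [l [g [g' [F [p ->]]]] lt] := inf_adherent e0 hi; exists g, g', F.
Qed.

Lemma dK_le_line x y (a : R) : Om x -> Om y -> 0 <= a ->
  (forall t : R, 0 <= t <= 1 -> forall xi, boundary Om xi -> lam xi (y - x) <= a * phi xi (x + t *: (y - x))) ->
  dK x y <= a.
Proof.
move=> xO yO a0 h; apply/ler_addgt0Pr => e e0; have [F p] := path_line xO yO.
apply: (le_trans (dK_path p)); have [_ _ gO _ dF] := p.
have ae : 0 < a + e by rewrite ltr_wpDl.
have := derive_le ler01 dF (fun t _ => dMl (a + e) (dI t)); rewrite !mulr1 mulr0 subr0; apply.
move=> t t01; apply: (kob_Fle HD) => //; first exact: gO.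
move=> xi bx; apply: (le_trans (h t t01 xi bx)); rewrite ler_pM2r ?lerDl ?(ltW e0)//.
exact: (phi_pos HD bx (gO t t01)).
Qed.

Definition Bd := {xi : V | boundary Om xi}.
Definition phiB (i : Bd) := phi (sval i).
Definition lamB (i : Bd) := lam (sval i).

Lemma kob_frame o xi0 : Om o -> boundary Om xi0 -> exists C2, frame Om phiB lamB o dK C2.
Proof.
move=> oO bx0; have [C2 C21 hC2] := lam_o HD oO; exists C2.
have dsym x y : Om x -> Om y -> dK x y <= dK y x.
  move=> xO yO; apply: dK_ge => // g g' F p; have [g2 [g2' [F2 [p2 <-]]]] := path_rev p.
  exact: dK_path p2.
split => //.
- by move=> i x y t; exact: phi_affine.
- by move=> i x v; exact: phi_lip.
- by move=> i v w; exact: lam_add.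
- by move=> i t v; exact: lam_scale.
- by move=> [xi bx] x xO; exact: (phi_pos HD).
- move=> c x c0 h; apply: (Om_phi HD oO) => xi bx; apply: lt_le_trans (h (exist _ xi bx)).
  by rewrite mulr_gt0//; exact: (phi_pos HD).
- move=> x xO; have [c c0 h] := phi_ex HD oO xO; exists c => // -[xi bx]; exact: h.
- by move=> [xi bx] p pO; exact: hC2.
- by move=> x y xO yO; apply/le_anti; rewrite !dsym.
- move=> x y z xO yO zO; apply/ler_addgt0Pr => e e0; have e2 : 0 < e / 2 by rewrite divr_gt0.
  have [g1 [g1' [F1 [p1 l1]]]] := dK_ex xO yO e2; have [g2 [g2' [F2 [p2 l2]]]] := dK_ex yO zO e2.
  have [g [g' [F [p lF]]]] := path_concat p1 p2.
  by apply: (le_trans (dK_path p)); rewrite lF; lra.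
- move=> [xi bx] x y xO yO; rewrite /phiB /=.
  have px := phi_pos HD bx xO; have py := phi_pos HD bx yO.
  rewrite -[leLHS]lnK ?posrE// -[phi xi x]lnK ?posrE// -expRD ler_expR.
  suff : (ln (phi xi y) - ln (phi xi x)) / 2 <= dK x y by lra.
  apply: dK_ge => // g g' F p; have [_ _ _ [_ g1] _] := p.
  have := path_phi p bx (t := 1); rewrite ler01 lexx => /(_ isT); rewrite g1.
  rewrite -[leLHS]lnK ?posrE// -{1}[phi xi x]lnK ?posrE// -expRD ler_expR; lra.
- move=> x y xO yO [xi bx]; rewrite /phiB /lamB /=; have px := phi_pos HD bx xO.
  set D := dK x y; have D0 : 0 <= D.
    by apply: dK_ge => // g g' F p; rewrite subr_ge0; apply: (path_mono p).
  have l0 : 0 <= lam xi (y - x) by exact: sqrtr_ge0.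
  set q := lam xi (y - x) / phi xi x; have q0 : 0 <= q by rewrite divr_ge0// ltW.
  have q1 : 0 < 1 + q by rewrite ltr_wpDr.
  have h : ln (1 + q) / 2 <= D.
    apply: dK_ge => // g g' F p; have := path_lam p bx; rewrite mulrC -ler_pdivrMr// -/q => h.
    have : ln (1 + q) <= ln (expR (2 * (F 1 - F 0))).
      by rewrite ler_ln ?posrE ?expR_gt0//; lra.
    rewrite expRK; lra.
  have h1 : 1 + q <= expR (2 * D) by rewrite -[leLHS]lnK ?posrE// ler_expR; lra.
  (* Equivalent to [1 - 2 * D <= expR (- 2 * D)]; it turns [1 + q <= expR (2 * D)] into the bound
     [q <= 2 * D * expR (2 * D)] of [dK_lam]. *)
  have h2 : expR (2 * D) * (1 - 2 * D) <= 1.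
    rewrite -[leRHS](expRxMexpNx_1 (2 * D)); apply: ler_wpM2l; first exact/ltW/expR_gt0.
    by have := expR_ge1Dx (- (2 * D)); lra.
  rewrite -ler_pdivrMr// -/q; lra.
(* The boundary point [xi0] serves here: with one supporting half-space, the hypothesis at [t = 0]
   forces [0 <= a]. *)
move=> x y a xO yO h; apply: dK_le_line => //.
  have t0 : 0 <= (0 : R) <= 1 by rewrite lexx ler01.
  have := h 0 t0 (exist _ xi0 bx0); rewrite scale0r addr0 /lamB /phiB/= => ha.
  have : 0 <= a * phi xi0 x by apply: le_trans ha; exact: sqrtr_ge0.
  by rewrite pmulr_lge0//; exact: (phi_pos HD).
by move=> t t01 xi bx; exact: (h t t01 (exist _ xi bx)).
Qed.

End Distance.

(** * Existence of geodesics *)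

Section Geodesics.
Variables (R : realType) (d : nat).
Local Notation V := (Cn R d).
Variables (Om : set V) (r : V -> R^o).
Hypothesis HD : good_domain Om r.
Variables (o xi0 : V).
Hypothesis oO : Om o.
Hypothesis bx0 : boundary Om xi0.
Implicit Types (x y z : V).
Local Notation phi := (phi r).
Local Notation lam := (lam r).
Local Notation dK := (dK Om).

Let FR : exists C2, frame Om (phiB (Om := Om) r) (lamB (Om := Om) r) o dK C2.
Proof. have h := kob_frame HD oO bx0. exact h. Qed.

Lemma dK_near x (e : R) : Om x -> 0 < e -> exists2 del : R, 0 < del & forall y, `|y - x| < del -> Om y /\ dK x y <= e.
Proof.
move=> xO e0; have [C2 F] := FR; have [_ Oo _ _] := HD.
have /nbhs_ballP[rho /= rho0 hrho] : nbhs x Om by apply: open_nbhs_nbhs; split.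
have [C1 C10 hC] := lam_norm HD xO.
pose e1 := Num.min (1 / 2) (e / 2); have e10 : 0 < e1 by rewrite lt_min !divr_gt0.
exists (Num.min rho (e1 / C1)) => [|y]; first by rewrite lt_min rho0 divr_gt0.
rewrite lt_min => /andP[h1 h2].
have yO : Om y by apply: hrho; rewrite -ball_normE/= distrC.
split => //; have e12 : e1 <= 1 / 2 by rewrite ge_min lexx.
have e1e : e1 <= e / 2 by rewrite ge_min lexx orbT.
have e1I : 0 <= e1 <= 1 / 2 by rewrite (ltW e10).
have h : Fle (phiB (Om := Om) r) (lamB (Om := Om) r) x (y - x) e1.
  move=> [xi bx]; apply: (le_trans (hC _ _ bx)); apply: ler_wpM2r; first exact/ltW/(phi_pos HD).
  by rewrite mulrC -ler_pdivlMr// ltW.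
by have := dK_Fle F xO yO e1I h; lra.
Qed.

(** Distance zero makes ['d r xi v] vanish for all [xi], so a whole real line would lie in the
    bounded domain. *)
Lemma dK_eq0 x y : Om x -> Om y -> dK x y = 0 -> x = y.
Proof.
move=> xO yO xy; have [C2 F] := FR; apply/eqP; rewrite eq_sym -subr_eq0; apply/eqP.
set v := y - x; apply: contrapT => /eqP v0.
have l0 xi : boundary Om xi -> 'd r xi v = 0.
  move=> bx; have := dK_lam F xO yO (exist _ xi bx); rewrite xy mulr0 mul0r mul0r /lamB/= => h.
  by apply/eqP; rewrite -normr_le0; apply: le_trans (lam_ge r xi v) h.
have inO (t : R) : Om (x + t *: v).
  by apply: (Om_phi HD oO) => xi bx; rewrite phi_lin l0// mulr0 subr0; exact: (phi_pos HD).
have [Ob _ _ _] := HD; have [M M0 hM] := bounded_ex Ob.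
have nv : 0 < `|v| by rewrite normr_gt0.
have := hM _ (inO ((2 * M + 1) / `|v|)); have := hM _ xO => h1 h2.
have : `|((2 * M + 1) / `|v|) *: v| <= M + M.
  have -> : ((2 * M + 1) / `|v|) *: v = (x + ((2 * M + 1) / `|v|) *: v) - x by rewrite addrAC subrr add0r.
  by apply: le_trans (ler_normB _ _) _; exact: lerD.
rewrite normrZ ger0_norm ?divr_ge0//; first by rewrite divfK ?gt_eqF//; lra.
lra.
Qed.

(** An almost minimal path, parametrised by its length rescaled to [[0, D]]. Distances between its
    points are at most the length of the arc, and the triangle inequality through [x] and [y] bounds
    them from below. *)
Lemma approx_geodesic x y (e : R) : Om x -> Om y -> 0 < dK x y -> 0 < e -> exists sg : R -> V,
  [/\ sg 0 = x, sg (dK x y) = y, forall u, 0 <= u <= dK x y -> Om (sg u) &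
   forall u v : R, 0 <= u <= dK x y -> 0 <= v <= dK x y -> `|dK (sg u) (sg v) - `|u - v| | <= e].
Proof.
move=> xO yO; set D := dK x y => D0 e0; have [C2 FR'] := FR.
have [g [g' [F [p lD]]]] := dK_ex HD xO yO e0; rewrite -/D in lD.
set l := F 1 - F 0 in lD; have [_ _ gO [g0 g1] dF] := p.
have Dl : D <= l by exact: (dK_path HD p).
have l0 : 0 < l by exact: lt_le_trans Dl.
have sub s t : 0 <= s -> s <= t -> t <= 1 -> dK (g s) (g t) <= F t - F s.
  move=> s0 st t1; have c0 : 0 <= t - s by rewrite subr_ge0.
  have ac : s + (t - s) <= 1 by rewrite addrC subrK.
  have := dK_path HD (path_sub HD p c0 s0 ac).
  by rewrite scale1r scale0r addr0 [s + _]addrC subrK.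
have cF : {within `[0, 1], continuous F} by exact: is_derive_within dF.
(* The times for [u = 0] and [u = D] are prescribed separately: [F] may be constant on intervals,
   and the intermediate value theorem alone would not give the ends. *)
have /choice[T hT] u : exists t : R, 0 <= u <= D ->
    [/\ 0 <= t <= 1, F t - F 0 = u * l / D, u = 0 -> t = 0 & u = D -> t = 1].
  have [->|u0] := eqVneq u 0.
    by exists 0 => _; rewrite lexx ler01 subrr !mul0r; split => // h; move: D0; rewrite -h ltxx.
  have [->|uD] := eqVneq u D.
    exists 1 => _; rewrite lexx ler01; split => //; last by move=> h; move: D0; rewrite h ltxx.
    by rewrite mulrC mulKf ?gt_eqF.
  have [uI|] := boolP (0 <= u <= D); last by exists 0.
  have /andP[ua ub] := uI.
  have q0 : 0 <= u * l / D by apply: divr_ge0; [apply: mulr_ge0 => //; exact: ltW|exact: ltW].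
  have ql : u * l / D <= l by rewrite ler_pdivrMr// mulrC ler_pM2l.
  have [|c /[!in_itv]/= c01 hc] := IVT ler01 cF (v := F 0 + u * l / D).
    have h2 : F 0 + u * l / D <= F 1 by rewrite -lerBrDl.
    by rewrite ge_min le_max lerDl q0 h2 orbT.
  exists c => _; split => //; first by rewrite hc addrC addKr.
    by move=> h; rewrite h eqxx in u0.
  by move=> h; rewrite h eqxx in uD.
exists (fun u => g (T u)).
have z0D : 0 <= (0 : R) <= D by rewrite lexx ltW.
have DD : 0 <= D <= D by rewrite lexx ltW.
have mono u v : 0 <= u <= D -> 0 <= v <= D -> u < v -> T u <= T v.
  move=> uI vI uv; have [/andP[a1 a2] a3 _ _] := hT u uI; have [/andP[b1 b2] b3 _ _] := hT v vI.
  rewrite leNgt; apply/negP => h; have := path_mono HD p b1 (ltW h) a2.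
  have : u * l / D < v * l / D by rewrite ltr_pM2r ?invr_gt0// ltr_pM2r.
  lra.
have key u v : 0 <= u <= D -> 0 <= v <= D -> u < v -> `|dK (g (T u)) (g (T v)) - (v - u)| <= e.
  move=> uI vI uv; have [/andP[a1 a2] a3 _ _] := hT u uI; have [/andP[b1 b2] b3 _ _] := hT v vI.
  have h1 := sub _ _ a1 (mono u v uI vI uv) b2.
  have h2 := sub _ _ (lexx 0) a1 a2; have h3 := sub _ _ b1 b2 (lexx 1); rewrite g0 in h2; rewrite g1 in h3.
  have O1 : Om (g (T u)) by apply: gO; rewrite a1.
  have O2 : Om (g (T v)) by apply: gO; rewrite b1.
  have t1 := dK_tri FR' xO O1 yO; have t2 := dK_tri FR' O1 O2 yO; rewrite -/D in t1.
  have E : (v - u) * l / D = v * l / D - u * l / D by rewrite !mulrBl.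
  have w1 : v - u <= (v - u) * l / D.
    by rewrite ler_pdivlMr// ler_pM2l ?subr_gt0.
  have w2 : (v - u) * l / D <= v - u + e.
    rewrite ler_pdivrMr//; have vD : v - u <= D by case/andP: uI; case/andP: vI; lra.
    have : (v - u) * (l - D) <= D * e by apply: ler_pM; rewrite ?subr_ge0 ?(ltW uv)//; lra.
    lra.
  rewrite ler_norml; rewrite /l in w1 w2 E a3 b3 lD Dl *; lra.
split.
- by have [_ _ h _] := hT 0 z0D; rewrite h.
- by have [_ _ _ h] := hT D DD; rewrite h.
- by move=> u /hT[h _ _ _]; exact: gO.
move=> u v uI vI; have [uv|uv|->] := ltgtP u v.
- by rewrite [`|u - v|]distrC [`|v - u|]gtr0_norm ?subr_gt0//; exact: key.
- rewrite [`|u - v|]gtr0_norm ?subr_gt0// (dK_sym FR'); first exact: key.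
    by have [h _ _ _] := hT u uI; exact: gO.
  by have [h _ _ _] := hT v vI; exact: gO.
have [h _ _ _] := hT v vI; rewrite (dKxx FR') ?subrr ?normr0 ?subrr ?normr0 ?ltW//; exact: gO.
Qed.

(** The approximate geodesics stay in the compact set [K], so by Tychonoff they have a cluster point
    for pointwise convergence. The geodesic condition compares two parameters at a time and
    distances are continuous, so pointwise clustering is enough. *)
Lemma geodesic_ex x y : Om x -> Om y -> exists sg a b, real_geodesic Om dK sg a b x y.
Proof.
move=> xO yO; have [C2 FR'] := FR; set D := dK x y.
have D0 : 0 <= D by exact: (dK_ge0 FR').
have [De|Dn] := eqVneq D 0.
  exists (fun=> x), 0, 0; split => //; first exact: dK_eq0.
  move=> s t /andP[s0 s1] /andP[t0 t1]; rewrite (dKxx FR')//.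
  have -> : s = t by lra.
  by rewrite subrr normr0.
have Dp : 0 < D by rewrite lt_neqAle eq_sym Dn.
have approx (n : nat) : exists sg : R -> V, [/\ sg 0 = x, sg D = y, forall u, 0 <= u <= D -> Om (sg u) &
   forall u v : R, 0 <= u <= D -> 0 <= v <= D -> `|dK (sg u) (sg v) - `|u - v| | <= n.+1%:R^-1].
  by apply: approx_geodesic => //; rewrite invr_gt0.
have /choice[S hS] := approx.
have z0D : 0 <= (0 : R) <= D by rewrite lexx.
have DD : 0 <= D <= D by rewrite lexx D0.
have [c0 c00 hc0] := phi_ex HD oO xO.
pose c := c0 * expR (- (2 * (D + 1))).
have c_gt0 : 0 < c by rewrite mulr_gt0// expR_gt0.
pose K := [set z : V | forall xi, boundary Om xi -> c * phi xi o <= phi xi z].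
have KO z : K z -> Om z.
  move=> Kz; apply: (Om_phi HD oO) => xi bx; apply: lt_le_trans (Kz xi bx).
  by rewrite mulr_gt0//; exact: (phi_pos HD).
have cK : compact K.
  apply: bounded_closed_compact.
    have [Ob _ _ _] := HD; have [M M0 hM] := bounded_ex Ob.
    exists M; split => [|M' MM z /KO zO]; first exact: num_real.
    by apply: le_trans (ltW MM); exact: hM.
  have -> : K = \bigcap_(xi in boundary Om) [set z | c * phi xi o <= phi xi z].
    by apply/seteqP; split => z h xi bx; exact: h.
  apply: closed_bigI => xi bx.
  apply: (@closed_comp _ _ (phi xi) [set y : R | c * phi xi o <= y]); last exact: closed_ge.
  move=> z _; have df : differentiable (phi xi : V -> R^o) z.
    by apply: (affine_differentiable (L := fun b => - 'd r xi b)) => a b t; rewrite phi_lin mulrN.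
  exact: differentiable_continuous df.
have KS z : Om z -> dK x z <= D + 1 -> K z.
  move=> zO xz xi bx; have h := dK_phi FR' (exist _ xi bx) zO xO; rewrite /phiB/= in h.
  have pz := phi_pos HD bx zO; rewrite (dK_sym FR' zO xO) in h.
  rewrite /c mulrAC expRN ler_pdivrMr ?expR_gt0//; apply: (le_trans (hc0 _ bx)); apply: (le_trans h).
  by rewrite ler_pM2l// ler_expR; lra.
pose T n u := if 0 <= u <= D then S n u else x.
have TK n u : K (T n u).
  rewrite /T; case: ifP => uI; last by apply: KS => //; rewrite (dKxx FR')//; lra.
  have [S0 _ SO Sd] := hS n; apply: KS; first exact: SO.
  have := Sd 0 u z0D uI; rewrite S0 sub0r normrN [`|u|]ger0_norm; last by case/andP: uI.
  have : n.+1%:R^-1 <= 1 :> R by rewrite invf_le1// ler1n.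
  move=> i1 i2; have := le_trans i2 i1; case/andP: uI => _ uD; rewrite ler_norml => /andP[_]; clear -uD; lra.
have := @tychonoff R (fun=> V) (fun=> K) (fun=> cK).
have PF : ProperFilter (T @ \oo) by apply: fmap_proper_filter.
move=> /(_ (T @ \oo) PF); case; first by exists 0%N => // n _ u; apply: TK.
move=> sg [sgK clu]; exists sg, 0, D.
have close u (e : R) (N : nat) : 0 < e -> forall v, exists n, [/\ (N <= n)%N, `|T n u - sg u| < e & `|T n v - sg v| < e].
  move=> e0 v.
  have nb w : nbhs (sg : prod_topology (fun _ : R => V)) [set f | `|f w - sg w| < e].
    have /(_ [set z | `|z - sg w| < e]) := @proj_continuous R (fun=> V) w sg; apply.
    by apply/nbhs_ballP; exists e => //= z; rewrite -ball_normE/= distrC.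
  have nb2 : (T @ \oo) [set f | exists2 n, (N <= n)%N & f = T n].
    by exists N => // n /= Nn; exists n.
  have nbuv : nbhs (sg : prod_topology (fun _ : R => V)) ([set f | `|f u - sg u| < e] `&` [set f | `|f v - sg v| < e]).
    by apply: (@filterI _ _ (@nbhs_filter (prod_topology (fun _ : R => V)) sg)); exact: nb.
  have [f [[n Nn ->] [h1 h2]]] := clu _ _ nb2 nbuv.
  by exists n.
have ends u z : 0 <= u <= D -> (forall n, S n u = z) -> sg u = z.
  move=> uI hz; apply/eqP; rewrite eq_sym -subr_eq0 -normr_le0; apply/ler_addgt0Pr => e e0.
  have [n [_ h _]] := close u e 0%N e0 u; rewrite /T uI hz in h; rewrite add0r; exact: ltW.
split => //.
- by apply: ends => // n; case: (hS n).
- by apply: ends => // n; case: (hS n).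
- by move=> s _; apply: KO; exact: sgK.
move=> s t sI tI; apply/eqP; rewrite -subr_eq0 -normr_le0; apply/ler_addgt0Pr => e e0; rewrite add0r.
have e3 : 0 < e / 3 by rewrite divr_gt0.
have sO := KO _ (sgK s); have tO := KO _ (sgK t).
have [d1 d10 hd1] := dK_near sO e3; have [d2 d20 hd2] := dK_near tO e3.
pose N := Num.truncn (e / 3)^-1.
have m0 : 0 < Num.min d1 d2 by rewrite lt_min d10.
have [n [Nn]] := close s _ N m0 t; rewrite !lt_min => /andP[a1 _] /andP[_ b1].
have [TsO ds] := hd1 _ a1; have [TtO dt] := hd2 _ b1.
have [_ _ _ Sd] := hS n; have := Sd s t sI tI.
have -> : S n s = T n s by rewrite /T sI.
have -> : S n t = T n t by rewrite /T tI.
have nE : n.+1%:R^-1 <= e / 3.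
  rewrite -[e / 3]invrK lef_pV2 ?posrE ?invr_gt0//; apply: ltW; apply: lt_le_trans (truncnS_gt _) _.
  by rewrite ler_nat ltnS.
have q1 := dK_tri FR' sO TsO TtO; have q2 := dK_tri FR' sO TtO tO.
have q3 := dK_tri FR' TsO sO tO; have q4 := dK_tri FR' TsO tO TtO.
rewrite (dK_sym FR' TtO tO) in q2; rewrite (dK_sym FR' TsO sO) in q3.
move=> i1; have := le_trans i1 nE; rewrite !ler_norml => /andP[j1 j2].
by apply/andP; split; lra.
Qed.

End Geodesics.

(** * Finite type *)

(** Turns local validity with some threshold into a common threshold, for properties that persist
    when the threshold decreases. *)
Lemma compact_uniform (R : realType) (V W : normedModType R) (K : set V) (S : set W)
    (P : R -> V -> W -> Prop) : compact K -> compact S ->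
  (forall x y, K x -> S y -> exists2 e : R, 0 < e & forall x' y', `|x' - x| < e -> `|y' - y| < e -> P e x' y') ->
  (forall e e' x y, 0 < e' -> e' <= e -> P e x y -> P e' x y) ->
  exists2 e : R, 0 < e & forall x y, K x -> S y -> P e x y.
Proof.
move=> cK cS loc mono; have := compact_setX cK cS => /compact_near_coveringP.
move=> /(_ R 0^'+ (fun e p => P e p.1 p.2) _) H.
have {H}H : \forall e \near 0^'+, K `*` S `<=` [set p | P e p.1 p.2].
  apply: H => -[x y] [/= Kx Sy]; have [e e0 he] := loc x y Kx Sy.
  exists (ball (x, y) e, [set e' : R | 0 < e' <= e]) => /=.
    split; first exact: nbhsx_ballx.
    near=> e'; apply/andP; split; near: e'; [exact: nbhs_right_gt|exact: nbhs_right_le].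
  move=> [[x' y'] e'] /= [[h1 h2] /andP[e'0 e'e]].
  by apply: (mono e) => //; apply: he; rewrite distrC; [move: h1|move: h2]; rewrite -ball_normE.
have H2 : \forall e \near (0 : R)^'+, 0 < e by exact: nbhs_right_gt.
near (0 : R)^'+ => e; exists e => [|x y Kx Sy]; first by near: e.
have h : K `*` S `<=` [set p | P e p.1 p.2] by near: e.
exact: (h (x, y)).
Unshelve. all: by end_near. Qed.

(** * Growth of [r] on complex disks *)

Section Jets.
Variables (R : realType) (d : nat).
Local Notation V := (Cn R d).
Local Notation C := (Cplx R).
Variable r : V -> R^o.
Hypothesis sr : smooth r.
Implicit Types (x y p w u : V) (z : C).

Lemma norm_cmul z w : `|cmul z w| <= 2 * `|z| * `|w|.
Proof.
rewrite cmul_crot /crot; apply: le_trans (ler_normD _ _) _; rewrite !normrZ.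
have -> : 2 * `|z| * `|w| = `|z| * `|w| + `|z| * `|w| by ring.
by apply: lerD; apply: ler_pM => //; rewrite ?coord_le_norm//; exact: norm_J.
Qed.

Lemma cmulDl z z' w (t : R) : cmul (z + t *: z') w = cmul z w + t *: cmul z' w.
Proof. by rewrite !cmul_crot crot_line. Qed.

Lemma cmul0l w : cmul (0 : C) w = 0.
Proof. by rewrite cmul_crot /crot !mxE !scale0r addr0. Qed.

Lemma cmul_c1 w : cmul (c1 R) w = w.
Proof. by rewrite cmul_crot crot_c1. Qed.

Lemma cmul_sub z w w' : cmul z (w - w') = cmul z w - cmul z w'.
Proof. by have := cmul_lin z 1 (-1) w w'; rewrite !scale1r !scaleN1r. Qed.

Lemma cmul_cont_r z : continuous (fun w => cmul z w).
Proof.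
move=> w; apply: (proj2 (cvgrPdist_le (FF := nbhs_filter w) (fun w => cmul z w) (cmul z w))) => e e0; apply/nbhs_ballP.
have z0 : 0 < 2 * `|z| + 1 by rewrite ltr_wpDl// mulr_ge0.
exists (e / (2 * `|z| + 1)) => /=; first by rewrite divr_gt0.
move=> u; rewrite -ball_normE/= ltr_pdivlMr// => h.
rewrite -cmul_sub; apply: le_trans (norm_cmul _ _) _.
have := normr_ge0 (w - u); lra.
Qed.

Lemma cmul_cont_l p w : continuous (fun z => p + cmul z w).
Proof.
have -> : (fun z => p + cmul z w) = (fun z => p + crot w z) by apply/funext => z; rewrite cmul_crot.
move=> z; have df : differentiable (fun z => p + crot w z) z.
  by apply: differentiableD; [exact: differentiable_cst|exact: differentiable_crot].
exact: differentiable_continuous df.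
Qed.

Lemma jet_eps (vs : seq C) x w (e : R) : 0 < e -> exists2 del : R, 0 < del & forall x' w',
  `|x' - x| < del -> `|w' - w| < del ->
  `|iter_dir [seq cmul v w' | v <- vs] r x' - iter_dir [seq cmul v w | v <- vs] r x| <= e.
Proof.
move=> e0; pose T := (V * V)%type.
pose us : seq (T -> V) := [seq (fun t : T => cmul v t.2) | v <- vs].
have := @iter_dir_joint R _ T (x, w) us [::] fst r sr.
have -> : (fun t : T => iter_dir ([::] ++ [seq h t | h <- us]) r t.1) =
    (fun t : T => iter_dir [seq cmul v t.2 | v <- vs] r t.1).
  by apply/funext => t; rewrite /= /us -map_comp.
have c1 : {for (x, w), continuous (fst : T -> V)} by exact: cvg_fst.
have c2 i : (i < size us)%N -> {for (x, w), continuous (nth (fst : T -> V) us i)}.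
  rewrite size_map => iv; rewrite (nth_map 0)//.
  by apply: (@continuous_comp _ _ _ (snd : T -> V) (fun u => cmul _ u)); [exact: cvg_snd|exact: cmul_cont_r].
move=> /(_ c1 c2) /cvgrPdist_le /(_ e e0) /nbhs_ballP[del /= del0 h].
exists del => // x' w' hx hw; rewrite distrC; apply: (h (x', w')).
by split; rewrite -ball_normE /= distrC.
Qed.

Lemma iter_dir_comp p w (vs : seq C) : iter_dir vs (fun z => r (p + cmul z w)) =
  (fun z => iter_dir [seq cmul v w | v <- vs] r (p + cmul z w)).
Proof.
elim: vs => //= v vs ->; apply/funext => z; rewrite /derive /=.
set f := iter_dir _ r.
have -> : (fun h : R => h^-1 *: (f (p + cmul (h *: v + z) w) - f (p + cmul z w))) =
    (fun h : R => h^-1 *: (f (h *: cmul v w + (p + cmul z w)) - f (p + cmul z w))) => //.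
apply/funext => h; congr (_ *: (f _ - _)).
by rewrite [h *: v + z]addrC cmulDl addrA; exact: addrC.
Qed.

Lemma smooth_comp p w : smooth (fun z => r (p + cmul z w) : R^o).
Proof.
move=> vs; rewrite iter_dir_comp; set f := iter_dir _ r; split => [z|v z].
  by apply: (@continuous_comp _ _ _ (fun z => p + cmul z w) f); [exact: cmul_cont_l|exact: (proj1 (sr _))].
have := (proj2 (sr [seq cmul v0 w | v0 <- vs])) (cmul v w) (p + cmul z w); rewrite /derivable -/f /=.
have -> // : (fun h : R => h^-1 *: (f (h *: cmul v w + (p + cmul z w)) - f (p + cmul z w))) =
  (fun h : R => h^-1 *: (f (p + cmul (h *: v + z) w) - f (p + cmul z w))).
apply/funext => h; congr (_ *: (f _ - _)).
by rewrite [h *: v + z]addrC cmulDl [RHS]addrA; exact: addrC.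
Qed.

Lemma compact_ball0 (n : nat) (M : R) : compact [set x : 'rV[R]_n | `|x| <= M].
Proof.
apply: bounded_closed_compact.
  by exists M; split => [|M' MM z /= zM]; [exact: num_real|apply: le_trans zM (ltW MM)].
apply: (@closed_comp _ _ (fun x : 'rV[R]_n => `|x|) [set y : R | y <= M]); last exact: closed_le.
by move=> y _; exact: norm_continuous.
Qed.

Lemma compact_sphere (n : nat) : compact [set x : 'rV[R]_n | `|x| = 1].
Proof.
have -> : [set x : 'rV[R]_n | `|x| = 1] = [set x : 'rV[R]_n | `|x| <= 1] `&` (fun x : 'rV[R]_n => `|x|) @^-1` [set y : R | 1 <= y].
  apply/seteqP; split => x /= => [->|[h1 h2]]; first by rewrite lexx.
  by apply/le_anti; rewrite h1.
apply: compact_closedI; first exact: compact_ball0.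
apply: closed_comp; last exact: closed_ge.
by move=> y _; exact: norm_continuous.
Qed.

Lemma jet_bound (k : nat) (M N : R) : exists2 B : R, 0 < B & forall x u, `|x| <= M -> `|u| <= N ->
  `|iter_dir (nseq k u) r x| <= B.
Proof.
have E u : nseq k u = [seq cmul v u | v <- nseq k (c1 R)] by rewrite map_nseq cmul_c1.
pose P (e : R) x u := e * `|iter_dir (nseq k u) r x| <= 1.
have [e e0 h] : exists2 e : R, 0 < e & forall x u, `|x| <= M -> `|u| <= N -> P e x u.
  apply: (compact_uniform (@compact_ball0 _ M) (@compact_ball0 _ N)) => [x u _ _|e e' x u e'0 ee]; last first.
    by apply: le_trans; apply: ler_wpM2r.
  have [del del0 h] := jet_eps (nseq k (c1 R)) x u ltr01.
  set D := `|iter_dir (nseq k u) r x|; have D0 : 0 <= D by exact: normr_ge0.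
  have D1 : 0 < D + 1 by lra.
  exists (Num.min del (D + 1)^-1) => [|x' u']; first by rewrite lt_min del0 invr_gt0.
  rewrite !lt_min => /andP[h1 _] /andP[h2 _]; have := h x' u' h1 h2; rewrite -!E => h3.
  have h4 : `|iter_dir (nseq k u') r x'| <= D + 1.
    rewrite -[iter_dir _ r x'](subrK (iter_dir (nseq k u) r x)).
    by apply: le_trans (ler_normD _ _) _; rewrite addrC lerD2l.
  apply: (@le_trans _ _ ((D + 1)^-1 * (D + 1))); last by rewrite mulVf ?gt_eqF.
  apply: ler_pM => //; first by rewrite le_min (ltW del0) invr_ge0 ltW.
  by rewrite ge_min lexx orbT.
exists e^-1 => [|x u hx hu]; first by rewrite invr_gt0.
by rewrite -[leRHS]mul1r ler_pdivlMr// mulrC; exact: h.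
Qed.

Definition small p w (rho s : R) := forall z, `|z| <= rho -> `|r (p + cmul z w)| <= s.

(** Near a given point and direction, some fixed derivative of order [k <= M] stays away from 0. By
    [fdiff_mvt] it is a difference quotient with numerator at most [2 ^ k * s] and denominator of
    the order of [rho ^ k]. *)
Lemma lower_bound (K : set V) (M : nat) : compact K ->
  (forall x w, K x -> `|w| = 1 -> exists vs : seq C, (size vs <= M)%N /\ iter_dir vs (fun z => r (x + cmul z w) : R^o) 0 != 0) ->
  exists2 c : R, 0 < c & forall p w rho s, K p -> `|w| = 1 -> 0 < rho -> rho <= c -> small p w rho s -> c * rho ^+ M <= s.
Proof.
move=> cK hv.
pose P (e : R) p w := forall rho s, 0 < rho -> rho <= e -> small p w rho s -> e * rho ^+ M <= s.
have [e e0 h] : exists2 e : R, 0 < e & forall p w, K p -> `|w| = 1 -> P e p w; last first.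
  by exists e => // p w rho s Kp w1 r0 re sm; exact: (h p w Kp w1 rho s r0 re sm).
apply: (compact_uniform cK (@compact_sphere _)) => [x w0 Kx /= w1|e e' x u e'0 ee h rho s r0 re sm]; last first.
  by apply: le_trans (h rho s r0 (le_trans re ee) sm); apply: ler_wpM2r => //; rewrite exprn_ge0 ?ltW.
have [vs [svs]] := hv x w0 Kx w1; rewrite iter_dir_comp cmul0l addr0 => hn0.
set h0 := `|iter_dir [seq cmul v w0 | v <- vs] r x|.
have h00 : 0 < h0 by rewrite normr_gt0.
have h02 : 0 < h0 / 2 by rewrite divr_gt0.
have [del del0 hd] := jet_eps vs x w0 h02.
set Sg := \sum_(v <- vs) `|v|; have Sg0 : 0 <= Sg by apply: sumr_ge0.
have S1 : 0 < 1 + Sg by lra.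
set k := size vs in svs.
set c := h0 / 2 / (2 * (1 + Sg)) ^+ k.
have c0 : 0 < c by rewrite divr_gt0// exprn_gt0// mulr_gt0.
exists (Num.min (Num.min 1 (del / 6)) c); first by rewrite !lt_min ltr01 c0 divr_gt0.
move=> p w; rewrite !lt_min => /andP[/andP[p1 p2] _] /andP[/andP[q1 q2] _] rho s r0.
rewrite !le_min => /andP[/andP[r1 r2] _] sm.
have wn : `|w| <= 2.
  by have := ler_normD w0 (w - w0); rewrite addrC subrK w1; lra.
(* Keeps the nodes of the iterated difference and the mean value point inside the disk of radius
   [rho]. *)
pose t := rho / (1 + Sg); have t0 : 0 < t by rewrite divr_gt0.
have tS : t * Sg <= rho.
  by rewrite /t mulrAC ler_pdivrMr// ler_pM2l//; lra.
have [z hz] := fdiff_mvt vs (0 : C) (smooth_comp p w) (ltW t0).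
rewrite subr0 in hz; have {}hz := le_trans hz tS.
rewrite iter_dir_comp => E.
have b1 : `|fdiff [seq t *: v | v <- vs] (fun z => r (p + cmul z w) : R^o) 0| <= 2 ^+ k * s.
  rewrite /k -[size vs](size_map (fun v => t *: v)); apply: fdiff_bound => y; rewrite subr0 big_map => hy; apply: sm.
  apply: (le_trans hy); apply: le_trans tS; rewrite mulr_sumr; apply: ler_sum => v _.
  by rewrite normrZ gtr0_norm.
have b2 : h0 / 2 <= `|iter_dir [seq cmul v w | v <- vs] r (p + cmul z w)|.
  have e1 : `|p + cmul z w - x| < del.
    rewrite addrAC; apply: le_lt_trans (ler_normD _ _) _; have := norm_cmul z w.
    have : 2 * `|z| * `|w| <= 4 * (del / 6).
      have -> : 4 * (del / 6) = 2 * (del / 6) * 2 by ring.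
      apply: ler_pM; rewrite ?mulr_ge0//.
      by rewrite ler_pM2l//; exact: (le_trans hz r2).
    lra.
  have e2 : `|w - w0| < del by lra.
  have := hd _ _ e1 e2; rewrite distrC => h1.
  have := ler_normB (iter_dir [seq cmul v w0 | v <- vs] r x) (iter_dir [seq cmul v w0 | v <- vs] r x - iter_dir [seq cmul v w | v <- vs] r (p + cmul z w)).
  by rewrite subKr -/h0 => h2; have := lerB_dist (iter_dir [seq cmul v w0 | v <- vs] r x) (iter_dir [seq cmul v w | v <- vs] r (p + cmul z w)); rewrite -/h0; lra.
rewrite E normrM normrX gtr0_norm// in b1.
have b3 : t ^+ k * (h0 / 2) <= 2 ^+ k * s.
  by apply: le_trans b1; rewrite ler_pM2l// exprn_gt0.
have b4 : c * rho ^+ k <= s.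
  rewrite /c mulrAC ler_pdivrMr ?exprn_gt0 ?mulr_gt0// exprMn mulrA.
  have sk : 0 < (1 + Sg) ^+ k by rewrite exprn_gt0.
  rewrite -ler_pdivrMr//; move: b3; rewrite /t expr_div_n; set a := rho ^+ k; set b := (1 + Sg) ^+ k.
  have -> : a / b * (h0 / 2) = h0 / 2 * a / b by ring.
  by rewrite [s * _]mulrC.
apply: (le_trans _ b4); apply: ler_pM.
- by apply: ltW; rewrite !lt_min ltr01 c0 divr_gt0.
- by apply: exprn_ge0; exact: ltW.
- by rewrite ge_min lexx orbT.
by apply: ler_wiXn2l => //; exact: ltW.
Qed.

Lemma bernoulli_le (x : R) (n : nat) : 0 <= x -> 1 + n%:R * x <= (1 + x) ^+ n.
Proof.
move=> x0; elim: n => [|n IH]; first by rewrite mul0r addr0 expr0.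
rewrite exprS; apply: (@le_trans _ _ ((1 + x) * (1 + n%:R * x))); last by rewrite ler_pM2l//; lra.
have := mulr_ge0 (ler0n R n) (mulr_ge0 x0 x0); rewrite -natr1; lra.
Qed.

(** From [M + 1] equally spaced nodes in the disk, the value at radius [(1 + 1 / M) * rho] is
    extrapolated; the difference of order [M + 1] is [O(rho ^ (M + 1))], hence [O(s)] by the lower
    bound. By Bernoulli's inequality, [M] such enlargements reach [2 * rho]. *)
Lemma doubling (K : set V) (N0 c : R) (M : nat) : (0 < M)%N -> (forall x, K x -> `|x| <= N0) -> 0 < c ->
  (forall p w rho s, K p -> `|w| = 1 -> 0 < rho -> rho <= c -> small p w rho s -> c * rho ^+ M <= s) ->
  exists C0 rho0 : R, [/\ 1 <= C0, 0 < rho0, rho0 <= c & forall p w rho s, K p -> `|w| = 1 -> 0 < rho -> rho <= rho0 ->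
    small p w rho s -> small p w (2 * rho) (C0 * s)].
Proof.
move=> M0 KN c0 lb; have [B B0 hB] := jet_bound M.+1 (N0 + 2 * M.+1%:R) 2.
pose C1 := B / c + 2 ^+ M.+1.
have p2 : 1 <= 2 ^+ M.+1 :> R by rewrite exprn_ege1// ler1n.
have C11 : 1 <= C1 by rewrite /C1; have : 0 < B / c by [rewrite divr_gt0]; lra.
have M0' : 0 < M%:R :> R by rewrite ltr0n.
have step p w rho s : K p -> `|w| = 1 -> 0 < rho -> rho <= c -> rho <= 1 -> small p w rho s ->
    small p w ((1 + M%:R^-1) * rho) (C1 * s).
  move=> Kp w1 r0 rc r1 sm z hz; set g : C -> R^o := fun z => r (p + cmul z w).
  have s0 : 0 <= s by apply: le_trans (sm 0 _); rewrite ?normr0 ?(ltW r0).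
  have k0 : 0 < M.+1%:R :> R by [].
  have kE : M.+1%:R = M%:R + 1 :> R by rewrite natr1.
  pose v := M.+1%:R^-1 *: z; pose v' := rho^-1 *: v.
  have nv : `|v| <= rho / M%:R.
    rewrite /v normrZ gtr0_norm ?invr_gt0// mulrC ler_pdivrMr//; apply: (le_trans hz).
    by rewrite le_eqVlt; apply/orP; left; apply/eqP; rewrite kE; field; rewrite gt_eqF.
  have nv' : `|v'| <= 1.
    rewrite /v' normrZ gtr0_norm ?invr_gt0// mulrC ler_pdivrMr// mul1r; apply: (le_trans nv).
    by rewrite ler_pdivrMr// ler_peMr ?ler1n// ltW.
  have := @fdiff_extrapolate R _ M.+1 g 0 v s.
  have -> : 0 + M.+1%:R *: v = z by rewrite add0r /v scalerA divff ?gt_eqF// scale1r.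
  have hA j : (j < M.+1)%N -> `|g (0 + j%:R *: v)| <= s.
    rewrite ltnS => jM; apply: sm; rewrite add0r normrZ ger0_norm//.
    apply: (@le_trans _ _ (M%:R * (rho / M%:R))); first by apply: ler_pM => //; rewrite ler_nat.
    by rewrite mulrC divfK ?gt_eqF.
  move=> /(_ hA) h1; apply: (le_trans h1).
  have -> : nseq M.+1 v = [seq rho *: t | t <- nseq M.+1 v'].
    by rewrite map_nseq /v' scalerA divff ?gt_eqF// scale1r.
  have [z' hz' ->] := fdiff_mvt (nseq M.+1 v') (0 : C) (smooth_comp p w) (ltW r0).
  rewrite size_nseq iter_dir_comp map_nseq normrM normrX (gtr0_norm r0).
  have nz : `|z'| <= M.+1%:R.
    rewrite subr0 in hz'; apply: (le_trans hz'); rewrite big_nseq iter_addr_0 -[`|v'| *+ _]mulr_natl.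
    rewrite mulrCA; apply: ler_piMr => //; rewrite -[leRHS]mulr1; apply: ler_pM => //; exact: ltW.
  have hb : `|iter_dir (nseq M.+1 (cmul v' w)) r (p + cmul z' w)| <= B.
    apply: hB.
      apply: le_trans (ler_normD _ _) _; apply: lerD; first exact: KN.
      by apply: le_trans (norm_cmul _ _) _; rewrite w1 mulr1 ler_pM2l.
    by apply: le_trans (norm_cmul _ _) _; rewrite w1 mulr1; lra.
  have hs : rho ^+ M.+1 <= s / c.
    rewrite ler_pdivlMr// mulrC; apply: le_trans (lb p w rho s Kp w1 r0 rc sm).
    by rewrite ler_pM2l// ler_wiXn2l// ltW.
  have : rho ^+ M.+1 * `|iter_dir (nseq M.+1 (cmul v' w)) r (p + cmul z' w)| <= s / c * B.
    by apply: ler_pM => //; rewrite exprn_ge0// ltW.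
  have -> : C1 * s = s / c * B + 2 ^+ M.+1 * s by rewrite /C1; ring.
  move=> hh; apply: lerD => //; rewrite ler_wpM2r//; lra.
pose q : R := 1 + M%:R^-1; have q0 : 1 <= q by rewrite lerDl invr_ge0.
have qn n : 0 < q ^+ n by rewrite exprn_gt0//; lra.
pose rho0 := Num.min c 1 / q ^+ M.
have m0 : 0 < Num.min c 1 by rewrite lt_min c0 ltr01.
have qM1 : 1 <= q ^+ M by rewrite exprn_ege1.
exists (C1 ^+ M), rho0; split.
- by rewrite exprn_ege1.
- by rewrite divr_gt0.
- rewrite ler_pdivrMr//; apply: (@le_trans _ _ c); first by rewrite ge_min lexx.
  by rewrite ler_peMr// ltW.
move=> p w rho s Kp w1 r0 rr sm.
have iter n : (n <= M)%N -> small p w (q ^+ n * rho) (C1 ^+ n * s).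
  elim: n => [|n IH] nM; first by rewrite !expr0 !mul1r.
  rewrite !exprS -!mulrA; have qr : q ^+ n * rho <= Num.min c 1.
    apply: (@le_trans _ _ (q ^+ M * rho)); first by rewrite ler_pM2r// ler_weXn2l// ltnW.
    by move: rr; rewrite /rho0 ler_pdivlMr// mulrC.
  move: qr; rewrite le_min => /andP[qr1 qr2].
  apply: step => //; first by rewrite mulr_gt0.
  by apply: IH; exact: ltnW.
move=> z hz; apply: (iter M (leqnn _)); apply: (le_trans hz); rewrite ler_pM2r//.
have := @bernoulli_le M%:R^-1 M; rewrite divff ?gt_eqF// invr_ge0 ler0n => /(_ isT); exact.
Qed.

End Jets.

Lemma le_of_opp_le_sub (R : realFieldType) (a b c : R) : - c <= - a - b -> 0 <= b -> a <= c.
Proof. lra. Qed.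

Lemma ler_half_scaled (R : realFieldType) (a r l p : R) : 4 * a * r * l <= a * p -> a * (2 * r * l) <= a * (p / 2).
Proof. lra. Qed.

(** * Contraction along vertical rays *)

Section Contraction.
Variables (R : realType) (d : nat).
Local Notation V := (Cn R d).
Local Notation C := (Cplx R).
Local Notation J := (cmul (cI R)).
Variables (Om : set V) (r : V -> R^o).
Hypothesis HD : good_domain Om r.
Variables (o xi0 : V).
Hypothesis oO : Om o.
Hypothesis bx0 : boundary Om xi0.
Implicit Types (x y p q w v xi : V) (z : C).
Local Notation phi := (phi r).
Local Notation lam := (lam r).
Local Notation h := (ht (phiB (Om := Om) r) o).

Let sr : smooth r. Proof. by case: HD => _ _ _ []. Qed.
Let rO x : Om x = (r x < 0). Proof. by case: HD => _ _ _ [_ -> _]. Qed.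
Let FR : exists C2, frame Om (phiB (Om := Om) r) (lamB (Om := Om) r) o (dK Om) C2.
Proof. have h := kob_frame HD oO bx0. exact h. Qed.

Lemma lam_cmul xi z w : lam xi (cmul z w) <= 2 * `|z| * lam xi w.
Proof.
have l0 : 0 <= lam xi w by exact: sqrtr_ge0.
rewrite cmul_crot /crot; apply: (le_trans (lam_add _ _ _ _)); rewrite !lam_scale lamJ.
have -> : 2 * `|z| * lam xi w = `|z| * lam xi w + `|z| * lam xi w by ring.
by apply: lerD; apply: ler_wpM2r => //; exact: coord_le_norm.
Qed.

(** Continue the ray from [o] beyond [q] by its own length. If its end is inside, [q] has height at
    least [1 / 2]; otherwise the boundary is met at a fraction [t], so [h q >= t / 2], and the mean
    value theorem bounds [|r q|] by a multiple of [t]. *)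
Lemma r_le_ht : exists2 Cr : R, 0 < Cr & forall q, Om q -> `|r q| <= Cr * h q.
Proof.
have [C2 F] := FR; have [Ob _ _ _] := HD; have [M M0 hM] := bounded_ex Ob.
have [B B0 hB] := jet_bound sr 1 (3 * M) (2 * M); have [B' B'0 hB'] := jet_bound sr 0 M 0.
exists (2 * B + 2 * B') => [|q qO]; first by lra.
have h0 := ht_gt0 F qO; have nq := hM _ qO; have no := hM _ oO.
have nqo : `|q - o| <= 2 * M by apply: le_trans (ler_normB _ _) _; lra.
have Lq xi : 'd r xi (q - o) = phi xi o - phi xi q.
  by rewrite /phi -linearB; congr ('d r xi _); rewrite opprB [RHS]addrC addrA subrK.
have [zO|nz] := pselect (Om (q + (q - o))).
  have : 1 / 2 <= h q.
    apply: (ht_max F) => //; first by lra.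
    move=> [xi bx]; rewrite /phiB/=; have := phi_ge0 HD bx zO.
    by have := phi_lin r xi q (q - o) 1; rewrite scale1r mul1r Lq => ->; lra.
  have := hB' q 0 nq; rewrite normr0 => /(_ (lexx _)) /= hr hh; apply: (le_trans hr).
  have : B' * (1 / 2) <= B' * h q by rewrite ler_pM2l.
  have : 0 < B * h q by rewrite mulr_gt0.
  lra.
have [t /andP[t0 t1]] := bd_between HD qO nz; rewrite [q + _ - q]addrAC subrr add0r => bt.
have : t / 2 <= h q.
  apply: (ht_max F) => //; first by lra.
  move=> [xi bx]; rewrite /phiB/=; have := phi_closure_ge0 HD bx (proj1 bt).
  rewrite phi_lin Lq => hp; have po := phi_pos HD bx oO; have pq := phi_pos HD bx qO.
  have : t * phi xi q <= 1 * phi xi q by rewrite ler_wpM2r// ltW.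
  lra.
have dg x y : derivable r x y by exact: smooth_derivable.
have [s /andP[s0 s1]] := mvt_dir dg q (t *: (q - o)).
rewrite (bd_r0 HD bt) sub0r (derive_scale dg) => E hh.
have nz' : `|q + s *: (t *: (q - o))| <= 3 * M.
  apply: le_trans (ler_normD _ _) _; rewrite !normrZ !ger0_norm ?(ltW t0)//.
  have : s * (t * `|q - o|) <= `|q - o|.
    by rewrite mulrA; apply: ler_piMl => //; rewrite -[leRHS]mulr1; apply: ler_pM => //; exact: ltW.
  lra.
have hd := hB _ _ nz' nqo; rewrite /= in hd.
rewrite -normrN E normrM gtr0_norm//.
have : t * `|'D_(q - o) r (q + s *: (t *: (q - o)))| <= 2 * h q * B by apply: ler_pM => //; [exact: ltW|lra].
have : 0 < B' * h q by rewrite mulr_gt0.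
lra.
Qed.

(** At [xi] the derivative of [r] in the direction [xi - o] is [phi xi o > 0]; compactness of the
    boundary makes the growth uniform. *)
Lemma transversal : exists2 c : R, 0 < c & forall xi (t : R), boundary Om xi -> 0 <= t <= c -> c * t <= r (xi + t *: (xi - o)).
Proof.
have [Ob _ _ _] := HD; have [M M0 hM] := bounded_ex Ob.
pose P (e : R) (xi y : V) := boundary Om xi -> forall t : R, 0 <= t <= e -> e * t <= r (xi + t *: (xi - o)).
have [e e0 he] : exists2 e : R, 0 < e & forall xi y, boundary Om xi -> [set 0] y -> P e xi y; last first.
  by exists e => // xi t bx t01; exact: (he xi 0 bx erefl bx t t01).
apply: (compact_uniform (compact_boundary HD) (@compact_set1 _ 0)) => [x1 y bx1 _|e e' xi y e'0 ee hP bx t /andP[t0 te]]; last first.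
  apply: (@le_trans _ _ (e * t)); first by rewrite ler_wpM2r.
  by apply: (hP bx t); rewrite t0 (le_trans te ee).
pose a := phi x1 o; have a0 : 0 < a by exact: (phi_pos HD).
have a2 : 0 < a / 2 by rewrite divr_gt0.
have [del del0 hd] := jet_eps sr [:: c1 R] x1 (x1 - o) a2; rewrite /= cmul_c1 in hd.
have M2 : 0 < 2 + 2 * M by lra.
exists (Num.min (del / (2 + 2 * M)) (a / 2)) => [|xi y']; first by rewrite lt_min !divr_gt0.
rewrite lt_min => /andP[h1 _] _ bx t /andP[t0]; rewrite le_min => /andP[t1 _].
have nxo : `|xi - o| <= 2 * M.
  have := closure_norm hM (proj1 bx); have := hM _ oO; have := ler_normB xi o; lra.
have dg u v : derivable r u v by exact: smooth_derivable.
have [s /andP[s0 s1]] := mvt_dir dg xi (t *: (xi - o)).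
rewrite (bd_r0 HD bx) subr0 (derive_scale dg) => ->; rewrite mulrC; apply: ler_wpM2l => //.
apply: (@le_trans _ _ (a / 2)); first by rewrite ge_min lexx orbT.
have ed : del / (2 + 2 * M) <= del by rewrite ler_pdivrMr// ler_peMr//; [exact: ltW|lra].
have n1 : `|xi + s *: (t *: (xi - o)) - x1| < del.
  rewrite addrAC; apply: le_lt_trans (ler_normD _ _) _; rewrite !normrZ !ger0_norm//.
  have : s * (t * `|xi - o|) <= del / (2 + 2 * M) * (2 * M).
    apply: (@le_trans _ _ (t * `|xi - o|)); first by apply: ler_piMl => //; exact: mulr_ge0.
    by apply: ler_pM.
  have : del / (2 + 2 * M) * (2 + 2 * M) = del by rewrite divfK ?gt_eqF.
  have : 0 < del / (2 + 2 * M) by rewrite divr_gt0.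
  lra.
have n2 : `|xi - o - (x1 - o)| < del by rewrite opprB addrA subrK; exact: lt_le_trans ed.
have := hd _ _ n1 n2; rewrite cmul_c1.
have -> : 'D_(x1 - o) r x1 = a by rewrite /a /phi -(deriveE _ (smooth_differentiable x1 sr)).
by rewrite ler_norml => /andP[]; lra.
Qed.

(** A point [q] outside lies on the ray from [o] past a boundary point [x1], at excess [tau], which
    [transversal] bounds by [A / c]. Nearness to a point [p] of the domain brings [tau] into the
    range of [transversal]. *)
Lemma outer : exists Co rho1 : R, [/\ 0 < Co, 0 < rho1 & forall p q (A : R) xi, Om p -> `|q - p| <= rho1 ->
  0 <= A -> r q <= A -> boundary Om xi -> - (Co * A * phi xi o) <= phi xi q].
Proof.
have [c c0 hc] := transversal; have [C1 C10 hC1] := lam_norm HD oO.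
exists c^-1, (c / C1); split; rewrite ?invr_gt0 ?divr_gt0// => p q A xi pO qp A0 rA bx.
have po := phi_pos HD bx oO.
have CA : 0 <= c^-1 * A * phi xi o.
  by apply: mulr_ge0; [apply: mulr_ge0 => //; rewrite invr_ge0|]; exact: ltW.
have [qO|nq] := pselect (Om q).
  by apply: le_trans (phi_ge0 HD bx qO); rewrite oppr_le0.
have [t /andP[t0 t1] bt] := bd_between HD oO nq; set x1 := o + t *: (q - o) in bt.
have tn : t != 0 by rewrite gt_eqF.
pose tau := (1 - t) / t; have tau0 : 0 <= tau by rewrite divr_ge0 ?subr_ge0// ltW.
have qE : q = x1 + tau *: (x1 - o).
  have e : x1 - o = t *: (q - o) by rewrite /x1 addrC addKr.
  rewrite e /x1 scalerA /tau divfK// -addrA -scalerDl [t + _]addrC subrK scale1r.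
  by rewrite addrC subrK.
have phq xi' : t * phi xi' q = phi xi' x1 - (1 - t) * phi xi' o by rewrite /x1 phi_affine; ring.
have tE : t * tau = 1 - t by rewrite /tau mulrC divfK.
have tc : tau <= c.
  have b1 := phi_pos HD bt oO; have b2 := phi_ge0 HD bt pO.
  have b3 : phi x1 q = - tau * phi x1 o.
    apply: (mulfI tn); rewrite phq phi_xi0 sub0r mulrA mulrN tE; ring.
  have b4 := phi_lip r x1 p (q - p); rewrite [p + _]addrC subrK in b4.
  have b5 := le_trans b4 (hC1 _ _ bt).
  have b6 : C1 * `|q - p| * phi x1 o <= c * phi x1 o.
    by rewrite ler_pM2r// mulrC -ler_pdivlMr.
  have := le_trans b5 b6; rewrite ler_norml => /andP[b7 _].
  rewrite -(ler_pM2r b1); rewrite b3 mulNr in b7; exact: (le_of_opp_le_sub b7 b2).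
have tA : tau <= c^-1 * A.
  rewrite mulrC ler_pdivlMr// mulrC; apply: le_trans rA; rewrite qE; apply: hc => //.
  by rewrite tau0.
have p1 := phi_closure_ge0 HD bx (proj1 bt).
have : - tau * phi xi o <= phi xi q.
  by rewrite -(ler_pM2l t0) phq mulrA mulrN tE mulNr lerDr.
have : tau * phi xi o <= c^-1 * A * phi xi o by rewrite ler_pM2r.
lra.
Qed.

(** For [k <= 1 / 2] the factor [1 - k] is harmless; for larger [k] the term in [phi xi o] takes
    over, since [phi xi p] is at most [1 + C2] times it. *)
Lemma phi_U_bound : exists2 K5 : R, 1 <= K5 & forall xi p (k : R), boundary Om xi -> Om p -> 0 <= k <= 1 ->
  phi xi p + k / 2 * phi xi o <= K5 * phi xi (U o k p).
Proof.
have [C2 C21 hC2] := lam_o HD oO; exists (2 * (2 + C2)) => [|xi p k bx pO /andP[k0 k1]]; first by lra.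
have po := phi_pos HD bx oO; have pp := phi_pos HD bx pO.
have := phi_lip r xi p (o - p); rewrite [p + _]addrC subrK => l1.
have := le_trans l1 (hC2 _ _ bx pO); rewrite ler_norml => /andP[l2 l3].
rewrite /U phi_affine.
have e1 : 0 <= k * phi xi o by rewrite mulr_ge0// ltW.
have e2 : 0 <= (1 - k) * phi xi p by rewrite mulr_ge0 ?subr_ge0// ltW.
have [kh|kh] := leP k (1 / 2).
  have : 1 / 2 * phi xi p <= (1 - k) * phi xi p by rewrite ler_pM2r//; lra.
  have : 2 * (2 + 1) * ((1 - k) * phi xi p + k * phi xi o) <= 2 * (2 + C2) * ((1 - k) * phi xi p + k * phi xi o).
    by rewrite ler_wpM2r ?addr_ge0//; lra.
  lra.
have : 1 / 2 * phi xi o <= k * phi xi o by rewrite ler_pM2r//; lra.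
have : k * phi xi o <= 1 * phi xi o by rewrite ler_pM2r.
have c2 : 0 <= 2 * (2 + C2) by lra.
have := mulr_ge0 c2 e2 => e3 e4 e5.
have : 2 * (2 + C2) * (1 / 2 * phi xi o) <= 2 * (2 + C2) * (k * phi xi o) by rewrite ler_wpM2l.
lra.
Qed.

(** On this disk every [phi xi] varies by at most half of its value at [p], so the disk stays in the
    domain at heights at most [3 / 2 * h p]. *)
Lemma Fle_small C2 (Cr : R) p w (rho : R) : frame Om (phiB (Om := Om) r) (lamB (Om := Om) r) o (dK Om) C2 ->
  (forall q, Om q -> `|r q| <= Cr * h q) -> Om p -> 0 <= rho -> 0 <= Cr ->
  (forall xi, boundary Om xi -> 2 * rho * lam xi w <= phi xi p / 2) -> small r p w rho (Cr * (3 / 2 * h p)).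
Proof.
move=> F hCr pO rho0 Cr0 hw z hz; set q := p + cmul z w.
have hq xi : boundary Om xi -> `|phi xi q - phi xi p| <= phi xi p / 2.
  move=> bx; apply: (le_trans (phi_lip _ _ _ _)); apply: (le_trans (lam_cmul _ _ _)).
  have lw : 0 <= lam xi w by exact: sqrtr_ge0.
  by apply: (le_trans _ (hw xi bx)); rewrite ler_wpM2r// ler_pM2l.
have qO : Om q.
  apply: (Om_phi HD oO) => xi bx; have := hq _ bx; have := phi_pos HD bx pO.
  by rewrite ler_norml => p0 /andP[]; lra.
apply: (le_trans (hCr _ qO)); apply: ler_wpM2l => //.
have : 2 / 3 * h q <= h p.
  apply: (ht_max F) => //; first by have := ht_le1 F qO; lra.
  move=> [xi bx]; have := ht_phi F (exist _ xi bx) qO; have := hq _ bx; rewrite /phiB/=.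
  by rewrite ler_norml => /andP[]; lra.
lra.
Qed.

(** Consider the point of the disk where [phi xi] has dropped by [Rn * lam xi w]: since [r <= A]
    there, it cannot lie further beyond the half-space than the last hypothesis allows. *)
Lemma disk_lam (Co A k Rn : R) p w xi : boundary Om xi -> 0 <= Rn -> `|w| = 1 -> small r p w Rn A ->
  2 * (Co * A) <= k ->
  (forall q, `|q - p| <= 2 * Rn -> r q <= A -> - (Co * A * phi xi o) <= phi xi q) ->
  Rn * lam xi w <= phi xi p + k / 2 * phi xi o.
Proof.
move=> bx Rn0 w1 sm kA out; have po := phi_pos HD bx oO.
have [c' [s' [cs hs]]] := lam_sup r xi w.
pose z := c' *: c1 R + s' *: cI R.
have zw : cmul z w = c' *: w + s' *: J w by rewrite cmul_crot crot_coord.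
have z1 : `|z| <= 1.
  have b1 (u u' : R) : u ^+ 2 + u' ^+ 2 = 1 -> `|u| <= 1.
    by move=> e; rewrite -(@ler_pXn2r _ 2) ?nnegrE// real_normK ?num_real// expr1n; have := sqr_ge0 u'; lra.
  have sc : s' ^+ 2 + c' ^+ 2 = 1 by rewrite addrC.
  apply: norm_le_coord => // i; rewrite /z /c1 /cI !scale_row_mx !scaler0 add_row_mx addr0 add0r.
  rewrite mxE; case: (splitP i) => j _; rewrite !mxE ?ord1 ?eqxx /= ?mulr1; [exact: b1 cs|exact: b1 sc].
pose q := p + cmul (Rn *: z) w.
have nz : `|Rn *: z| <= Rn by rewrite normrZ ger0_norm//; apply: ler_piMr.
have rq : r q <= A by apply: le_trans (ler_norm _) _; exact: sm.
have qp : `|q - p| <= 2 * Rn.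
  by rewrite /q addrAC subrr add0r; apply: (le_trans (norm_cmul _ _)); rewrite w1 mulr1 ler_pM2l.
have := out q qp rq.
have qE : cmul (Rn *: z) w = Rn *: cmul z w by rewrite -[Rn *: z]add0r cmulDl cmul0l add0r.
rewrite /q qE phi_lin zw hs => hq.
have : Co * A * phi xi o <= k / 2 * phi xi o by rewrite ler_pM2r//; lra.
lra.
Qed.

Theorem finite_contraction (M : nat) :
  (forall x, boundary Om x -> forall w, w != 0 -> vanish_order_le (fun z => r (x + cmul z w)) M) ->
  exists m CN, contraction Om (phiB (Om := Om) r) (lamB (Om := Om) r) o m CN.
Proof.
move=> ft; have [C2 F] := FR; have [Ob _ _ _] := HD; have [N0 N00 hN0] := bounded_ex Ob.
have cK := compact_closure HD.
(* At interior points [r] itself is nonzero, so order 0 works; [M.+1] provides the positive order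
   that [doubling] divides by. *)
have hv x w : closure Om x -> `|w| = 1 -> exists vs : seq C, (size vs <= M.+1)%N /\ iter_dir vs (fun z => r (x + cmul z w) : R^o) 0 != 0.
  move=> xc w1; have w0 : w != 0 by rewrite -normr_gt0 w1.
  have [xO|nx] := pselect (Om x).
    by exists [::]; split => //=; rewrite cmul0l addr0; move: xO; rewrite rO => /lt_eqF ->.
  have [vs [s1 s2]] := ft x (conj xc nx) w w0; exists vs; split => //; exact: leqW.
have [c c0 lb] := lower_bound sr cK hv.
have [C0 [rho0 [C01 rho00 rho0c dbl]]] := doubling sr (ltn0Sn M) (closure_norm hN0) c0 lb.
have [Cr Cr0 hCr] := r_le_ht; have [Co [rho1 [Co0 rho10 out]]] := outer.
have [K5 K51 hK5] := phi_U_bound; have K50 : 0 < K5 by lra.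
pose rh := Num.min rho0 (rho1 / 2); have rh0 : 0 < rh by rewrite lt_min rho00 divr_gt0.
have rhr : rh <= rho0 by rewrite ge_min lexx.
have rhr1 : rh <= rho1 / 2 by rewrite ge_min lexx orbT.
have [l [hl _]] : exists l : nat, 3 * Co * Cr <= 2 ^+ l /\ true.
  have [|l /andP[hl _]] := pow2_between (X := 1 + 3 * Co * Cr).
    by rewrite lerDl !mulr_ge0// ltW.
  by exists l; split => //; lra.
have [m0 /andP[hm0 _]] : exists m0 : nat, 2 * C0 <= 2 ^+ m0 <= 2 * (2 * C0) by apply: pow2_between; lra.
(* [m0] pays for the factor [2 * C0] of each doubling; [M.+2] serves to bound [2 ^ n] when the disk
   outgrows [rh]. *)
pose m := (m0 + M.+2)%N.
pose Q := 3 / 2 * Cr / (c * rh ^+ M.+1).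
have Q0 : 0 < Q by rewrite /Q divr_gt0 ?mulr_gt0 ?exprn_gt0//; lra.
pose CN := 1 + K5 * 2 ^+ l + 4 * K5 + K5 * Q.
have l0 : 0 < 2 ^+ l :> R by rewrite exprn_gt0.
have kl : 0 < K5 * 2 ^+ l by rewrite mulr_gt0.
have kQ : 0 < K5 * Q by rewrite mulr_gt0.
have CN1 : 1 <= CN by rewrite /CN; lra.
have CNl : K5 * 2 ^+ l <= CN by rewrite /CN; lra.
have CN4 : 4 * K5 <= CN by rewrite /CN; lra.
have CNQ : K5 * Q <= CN by rewrite /CN; lra.
have CN0 : 0 <= CN by apply: le_trans CN1.
have C00 : 0 < C0 by apply: lt_le_trans C01.
have C20 : 0 <= 2 * C0 by rewrite mulr_ge0// ltW.
have Cr32 : 0 <= 3 / 2 * Cr by rewrite mulr_ge0// ltW.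
clearbody CN.
exists m, CN; split => //.
move=> n p v k a pO hk k1 a0 Fp [xi bx]; rewrite /phiB /lamB /=.
have h0 := ht_gt0 F pO.
have k0 : 0 <= k by apply: le_trans hk; rewrite mulr_ge0 ?exprn_ge0 ?ltW.
have k01 : 0 <= k <= 1 by rewrite k0.
have UO : Om (U o k p) := Om_U F pO k01.
have pU := phi_pos HD bx UO; have pp := phi_pos HD bx pO; have po := phi_pos HD bx oO.
have n0 : 0 < 2 ^+ n :> R by rewrite exprn_gt0.
have hU := hK5 _ _ _ bx pO k01.
have ko : 0 <= k / 2 * phi xi o by rewrite mulr_ge0 ?divr_ge0// ltW.
have M0 : lam xi v <= a * (K5 * phi xi (U o k p)).
  by apply: (le_trans (Fp (exist _ xi bx))); apply: ler_wpM2l => //; rewrite /phiB/=; apply: le_trans hU; rewrite lerDl.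
have fin K : K <= CN -> lam xi v <= K / 2 ^+ n * a * phi xi (U o k p) -> lam xi v <= CN / 2 ^+ n * a * phi xi (U o k p).
  move=> KC hh; apply: (le_trans hh); rewrite ler_pM2r//; apply: ler_wpM2r => //.
  by rewrite ler_pM2r ?invr_gt0.
have fin2 K : K5 * 2 ^+ n <= K -> K <= CN -> lam xi v <= CN / 2 ^+ n * a * phi xi (U o k p).
  move=> hK KC; apply: (fin K KC); apply: (le_trans M0); rewrite mulrA ler_pM2r// [a * K5]mulrC; apply: ler_wpM2r => //.
  by rewrite ler_pdivlMr.
have [nl|ln] := ltnP n l.
  apply: (fin2 (K5 * 2 ^+ l)) => //.
  by rewrite ler_pM2l// ler_weXn2l ?ler1n// ltnW.
have [v0|vn] := eqVneq v 0.
  have -> : lam xi v = 0 by rewrite v0 -(scale0r 0) lam_scale normr0 mul0r.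
  by apply: mulr_ge0; [apply: mulr_ge0 => //; apply: divr_ge0 => //; exact: ltW|exact: ltW].
have [a_0|an] := eqVneq a 0; first by move: M0; rewrite a_0 mul0r mulr0 mul0r.
have ap : 0 < a by rewrite lt_neqAle eq_sym an.
have nv : 0 < `|v| by rewrite normr_gt0.
pose w := `|v|^-1 *: v; have w1 : `|w| = 1 by rewrite /w normrZ gtr0_norm ?invr_gt0// mulVf ?gt_eqF.
have vw xi' : lam xi' v = `|v| * lam xi' w.
  by rewrite /w lam_scale gtr0_norm ?invr_gt0// mulrA divff ?mul1r ?gt_eqF.
pose rho := `|v| / (4 * a); have rho_0 : 0 < rho by rewrite divr_gt0// mulr_gt0.
have vrho : `|v| = 4 * a * rho by rewrite /rho mulrC divfK// gt_eqF// mulr_gt0.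
pose s := Cr * (3 / 2 * h p).
have sm0 : small r p w rho s.
  apply: (Fle_small F hCr pO (ltW rho_0) (ltW Cr0)) => xi' bx'; rewrite -(ler_pM2l ap); apply: ler_half_scaled.
  by have := Fp (exist _ xi' bx'); rewrite /lamB /phiB /= vw vrho.
have [big|sml] := leP (2 ^+ n * rho) rh; last first.
  pose rho' := Num.min rho rh; have rho'0 : 0 < rho' by rewrite lt_min rho_0.
  have rn : rh <= 2 ^+ n * rho'.
    rewrite /rho'; case: (leP rho rh) => _; first exact: ltW.
    by rewrite ler_peMl ?exprn_ege1 ?ler1n// ltW.
  have sm' : small r p w rho' s by move=> z hz; apply: sm0; apply: (le_trans hz); rewrite ge_min lexx.
  have rc : rho' <= c by apply: (@le_trans _ _ rh); [rewrite ge_min lexx orbT|exact: le_trans rho0c].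
  have := lb p w rho' s (subset_closure pO) w1 rho'0 rc sm' => lbs.
  apply: (fin2 (K5 * Q)) => //.
  rewrite ler_pM2l// /Q ler_pdivlMr ?mulr_gt0 ?exprn_gt0//.
  set X : R := 2 ^+ n; have X1 : 1 <= X by rewrite exprn_ege1// ler1n.
  have hX : X ^+ M.+2 * h p <= 1.
    apply: le_trans k1; apply: le_trans hk; rewrite ler_pM2r// /m exprD -[leLHS]mul1r ler_pM2r ?exprn_gt0//.
    by rewrite exprn_ege1.
  have h1 : rh ^+ M.+1 <= X ^+ M.+1 * rho' ^+ M.+1.
    rewrite -exprMn; apply: lerXn2r; rewrite ?nnegrE //; [exact: ltW|].
    by apply: mulr_ge0; exact: ltW.
  have h2 : X * (c * rh ^+ M.+1) <= X * (X ^+ M.+1 * s).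
    rewrite ler_pM2l//; apply: (@le_trans _ _ (c * (X ^+ M.+1 * rho' ^+ M.+1))); first by rewrite ler_pM2l.
    by rewrite mulrCA ler_pM2l// exprn_gt0.
  apply: (le_trans h2); rewrite mulrA -exprS /s.
  have -> : X ^+ M.+2 * (Cr * (3 / 2 * h p)) = 3 / 2 * Cr * (X ^+ M.+2 * h p) by ring.
  by apply: ler_piMr.
have smn j : (j <= n)%N -> small r p w (2 ^+ j * rho) (C0 ^+ j * s).
  elim: j => [|j IH] jn; first by rewrite !expr0 !mul1r.
  rewrite !exprS -!mulrA; apply: dbl => //; [exact: subset_closure|by rewrite mulr_gt0 ?exprn_gt0| |by apply: IH; exact: ltnW].
  apply: le_trans rhr; apply: le_trans big; rewrite ler_pM2r// ler_weXn2l ?ler1n//; exact: ltnW.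
apply: (fin (4 * K5)) => //.
set Rn := 2 ^+ n * rho in big; have Rn0 : 0 < Rn by rewrite mulr_gt0.
pose A := C0 ^+ n * s; have A0 : 0 <= A.
  by apply: mulr_ge0; [exact/exprn_ge0/ltW|rewrite /s; do 3?apply: mulr_ge0 => //; exact: ltW].
have kA : 2 * (Co * A) <= k.
  apply: le_trans hk; rewrite /A /s.
  have -> : 2 * (Co * (C0 ^+ n * (Cr * (3 / 2 * h p)))) = (3 * Co * Cr) * C0 ^+ n * h p by field.
  rewrite ler_pM2r// -exprM mulnC exprM.
  have -> : (2 ^+ m) ^+ n = (2 ^+ m0 * 2 ^+ M.+2 : R) ^+ n by rewrite /m exprD.
  apply: (@le_trans _ _ ((2 * C0) ^+ n)).
    rewrite exprMn ler_pM2r ?exprn_gt0//.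
    by apply: (le_trans hl); rewrite ler_weXn2l ?ler1n.
  apply: lerXn2r; rewrite ?nnegrE//.
  apply: (le_trans hm0); rewrite ler_peMr ?exprn_ge0// exprn_ege1// ler1n //.
have hR : Rn * lam xi w <= K5 * phi xi (U o k p).
  apply: le_trans hU; apply: (disk_lam (A := A) (Co := Co) bx (ltW Rn0) w1 (smn n (leqnn _))) => //.
  move=> q qp rq; apply: (out p q A xi) => //.
  by apply: (le_trans qp); rewrite mulrC -ler_pdivlMr//; exact: le_trans rhr1.
have -> : 4 * K5 / 2 ^+ n * a * phi xi (U o k p) = 4 * a / 2 ^+ n * (K5 * phi xi (U o k p)) by ring.
apply: (@le_trans _ _ (4 * a / 2 ^+ n * (Rn * lam xi w))).
  rewrite vw vrho /Rn le_eqVlt; apply/orP; left; apply/eqP; field; rewrite gt_eqF//.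
by apply: ler_wpM2l => //; rewrite divr_ge0 ?mulr_ge0// ltW.
Qed.

End Contraction.

(** * Infinite type *)

(** Otherwise [g] would shrink by more than the factor [B] at each step, faster than the lower bound
    [del / b ^ k] permits. *)
Lemma growth_step (R : realType) (g : nat -> R) (del b B : R) : 0 < del -> 0 < b -> b < B ->
  (forall k, del / b ^+ k <= g k) -> exists k, g k <= B * g k.+1.
Proof.
move=> del0 b0 bB hg; apply: contrapT => no.
have B0 : 0 < B by exact: lt_trans bB.
have st k : B * g k.+1 < g k.
  by rewrite ltNge; apply/negP => h; apply: no; exists k.
have it k : B ^+ k * g k <= g 0%N.
  elim: k => [|k IH]; first by rewrite expr0 mul1r.
  by apply: le_trans IH; rewrite exprSr -mulrA ler_pM2l ?exprn_gt0// ltW.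
pose x := B / b - 1; have x0 : 0 < x by rewrite subr_gt0 ltr_pdivlMr// mul1r.
have bd k : del * (1 + k%:R * x) <= g 0%N.
  apply: le_trans (it k); apply: (@le_trans _ _ (B ^+ k * (del / b ^+ k))); last by rewrite ler_pM2l ?exprn_gt0.
  have -> : B ^+ k * (del / b ^+ k) = del * (1 + x) ^+ k.
    by rewrite /x addrC subrK expr_div_n mulrCA.
  by rewrite ler_pM2l//; apply: bernoulli_le; exact: ltW.
have g0 : 0 <= g 0%N by apply: le_trans (hg 0%N); rewrite expr0 divr1 ltW.
pose k := (Num.truncn (g 0%N / del / x)).+1.
have hk : g 0%N / del / x < k%:R by exact: truncnS_gt.
have := bd k; rewrite ltr_pdivrMr// ltr_pdivrMr// in hk.
have : 0 < del by []. 
lra.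
Qed.

(** Here [x] and [y] are the values of some [phi k] at [xi] and [o], [p] is [rad s], [l] is
    [lam k u], and the right-hand sides are [phi k] at [L1 t] displaced by [th * p]. *)
Lemma far_disk_ineq_low (R : realFieldType) (s t th eta x y p l L : R) : 0 <= x -> 0 <= y -> 0 < s -> 2 * s <= t ->
  t <= eta / 8 -> 0 <= th -> th <= 1 - eta -> p * l <= (1 - s) * x + s * y -> L <= l -> 0 <= p ->
  t / 2 * y <= (1 - t) * x + t * y - th * p * L /\ (1 - th) / 2 * ((1 - s) * x + s * y) <= (1 - t) * x + t * y - th * p * L.
Proof.
move=> x0 y0 s0 st te th0 th1 pl Ll p0.
have h1 : th * p * L <= th * ((1 - s) * x + s * y).
  apply: (@le_trans _ _ (th * (p * l))); last by rewrite ler_wpM2l.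
  by rewrite -mulrA; apply: ler_wpM2l => //; apply: ler_wpM2l.
have a1 : 0 <= ((1 - t) - th * (1 - s)) * x.
  apply: mulr_ge0 => //; have := mulr_ge0 th0 (ltW s0); lra.
have th11 : 0 <= 1 - th by lra.
have a2 : 0 <= (t / 2 - th * s) * y by apply: mulr_ge0 => //; have := mulr_ge0 th11 (ltW s0); lra.
have a3 : 0 <= ((1 - t) - th * (1 - s) - (1 - th) / 2 * (1 - s)) * x.
  apply: mulr_ge0 => //; have := mulr_ge0 th0 (ltW s0); have := mulr_ge0 th11 (ltW s0); lra.
have a4 : 0 <= (t - th * s - (1 - th) / 2 * s) * y.
  by apply: mulr_ge0 => //; have := mulr_ge0 th11 (ltW s0); lra.
by split; lra.
Qed.

(** [X] and [Y] are values of one [phi k] on the first path and [b] is its value on the second: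
    about [P], against at most about [eta * P]. The errors, of order [e = eta / 8], do not blur
    this, so [E], which bounds the quotient, is at least of the order of [1 / eta]. *)
Lemma far_disk_ineq_high (R : realType) (eta e P Y X b E : R) : 0 < eta -> eta <= 1 -> e = eta / 8 -> 0 < P ->
  (1 - e) * P <= X -> (1 - e) * Y <= (1 + e) * ((1 + e) * P) -> b = Y - (1 - eta) * P -> X <= b * E -> 0 < E -> 1 <= 2 * eta * E.
Proof.
move=> eta0 eta1 eE P0 hX hY hb hE E0.
have e0 : 0 < e by lra.
have Y1 : Y <= (1 + 4 * e) * P.
  have e1 : 0 < 1 - e by lra.
  rewrite -(ler_pM2l e1); apply: (le_trans hY); rewrite !mulrA ler_pM2r//.
  have := mulr_ge0 (ltW e0) (ltW e1); have : 0 <= e * (1 / 8 - e) by apply: mulr_ge0; lra.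
  lra.
have b1 : b <= 3 / 2 * eta * P by rewrite hb; rewrite eE in Y1; lra.
have : b * E <= 3 / 2 * eta * P * E by rewrite ler_pM2r.
move=> h2; have h3 : 7 / 8 * P <= 3 / 2 * eta * P * E.
  apply: le_trans h2; apply: le_trans hE; apply: le_trans hX; rewrite ler_pM2r//; lra.
have : 7 / 8 <= 3 / 2 * eta * E.
  by rewrite -(ler_pM2r P0); lra.
lra.
Qed.

Lemma ln_pow_bound (R : realType) (j : nat) (D : R) : 1 <= 2 * (2 ^+ j)^-1 * expR (2 * D) -> j%:R / 4 - 1 <= D.
Proof.
move=> h; have p0 : 0 < 2 ^+ j :> R by rewrite exprn_gt0.
have h1 : (2 ^+ j) / 2 <= expR (2 * D).
  by rewrite ler_pdivrMr//; move: h; rewrite [2 * _]mulrC -mulrA mulrC ler_pdivlMr// mul1r mulrC.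
have : ln (2 ^+ j / 2) <= 2 * D by rewrite -[2 * D]expRK ler_ln ?posrE ?expR_gt0 ?divr_gt0.
rewrite ln_div ?posrE// lnXn// -[ln 2 *+ j]mulr_natl.
have l1 := ln2_ge R; have l2 : ln 2 <= 1 :> R.
  rewrite -[leRHS]expRK ler_ln ?posrE ?expR_gt0//; have := expR_ge1Dx (1 : R); lra.
have : j%:R * (1 / 2) <= j%:R * ln 2 :> R by rewrite ler_wpM2l.
lra.
Qed.

Lemma half_weight_le (R : realFieldType) (w x y : R) : 0 <= x -> 0 < y -> 0 < w -> w <= 1 -> w / 2 * y <= (1 - w) * x + w * y.
Proof.
move=> x0 y0 w0 w1; have : 0 <= (1 - w) * x by rewrite mulr_ge0// subr_ge0.
have := mulr_gt0 w0 y0; lra.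
Qed.

Lemma ler_quarter (R : realFieldType) (x y : R) : x * (1 / 2) <= 2 * y -> x / 4 <= y.
Proof. lra. Qed.

(** * Parallel paths in a flat complex direction *)

Section Rails.
Variables (R : realType) (d : nat).
Local Notation V := (Cn R d).
Local Notation C := (Cplx R).
Local Notation J := (cmul (cI R)).
Variables (Om : set V) (r : V -> R^o).
Hypothesis HD : good_domain Om r.
Variables (o xi u : V).
Hypothesis oO : Om o.
Hypothesis bxi : boundary Om xi.
Hypothesis u1 : `|u| = 1.
Hypothesis flat_u : forall (k : nat) (z : C), iter_dir (nseq k (cmul z u)) r xi = 0.
Implicit Types (x y p q w v : V) (z : C).
Local Notation phi := (phi r).
Local Notation lam := (lam r).
Local Notation dK := (dK Om).

Let sr : smooth r. Proof. by case: HD => _ _ _ []. Qed.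
Let FR : exists C2, frame Om (phiB (Om := Om) r) (lamB (Om := Om) r) o dK C2.
Proof. have h := kob_frame HD oO bxi. exact h. Qed.

(** All derivatives along each real line in the complex direction [u] vanish at [xi]; the mean value
    theorem, used [N] times from a bound on the derivative of order [N], gives order [N] in
    [|z|]. *)
Lemma flat_order (N : nat) : exists2 B : R, 0 < B & forall z, `|z| <= 1 -> `|r (xi + cmul z u)| <= B * `|z| ^+ N.
Proof.
have [B B0 hB] := jet_bound sr N (`|xi| + 2) 2; exists B => // z z1.
have [->|zn] := eqVneq z 0.
  by rewrite cmul0l addr0 (bd_r0 HD bxi) normr0 mulr_ge0 ?exprn_ge0// ltW.
have t0 : 0 < `|z| by rewrite normr_gt0.
pose y := cmul (`|z|^-1 *: z) u.
have ny : `|y| <= 2.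
  apply: (le_trans (norm_cmul _ _)); rewrite u1 mulr1 normrZ gtr0_norm ?invr_gt0// mulVf ?mulr1//.
  by rewrite gt_eqF.
have zy : cmul z u = `|z| *: y.
  rewrite /y -[`|z| *: _]add0r -(cmul0l u) -cmulDl add0r scalerA divff ?gt_eqF// scale1r //.
have claim m : (m <= N)%N -> forall t : R, 0 <= t <= 1 -> `|iter_dir (nseq (N - m) y) r (xi + t *: y)| <= B * t ^+ m.
  elim: m => [|m IH] mN t /andP[tg tl].
    rewrite subn0 expr0 mulr1; apply: hB => //; apply: le_trans (ler_normD _ _) _; rewrite lerD2l normrZ ger0_norm//.
    by rewrite -[leRHS]mul1r; apply: ler_pM.
  have kE : (N - m)%N = (N - m.+1).+1 by rewrite subnSK.
  set k := (N - m.+1)%N in kE *; set f := iter_dir (nseq k y) r.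
  have sf : smooth f by exact: smooth_iter.
  have df a b : derivable f a b by exact: smooth_derivable.
  have [s /andP[s0 s1]] := mvt_dir df xi (t *: y).
  have f0 : f xi = 0 by exact: (flat_u k (`|z|^-1 *: z)).
  rewrite (derive_scale df) f0 subr0 => ->.
  rewrite normrM ger0_norm// exprS mulrCA; apply: ler_wpM2l => //.
  have st : 0 <= s * t <= 1.
    by rewrite mulr_ge0//= -[leRHS]mul1r; apply: ler_pM.
  have := IH (ltnW mN) _ st; rewrite kE /= -scalerA => h; apply: (le_trans h).
  rewrite ler_pM2l//; apply: lerXn2r; rewrite ?nnegrE ?mulr_ge0//; exact: ler_piMl.
by have := claim N (leqnn _) `|z|; rewrite subnn /= zy normr_ge0 z1 => /(_ isT).
Qed.

(* [rad t] is the comparison radius of the largest disk through [L1 t] in the flat direction [u];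
   flatness makes it decay slower than every power of [t]. *)
Definition L1 (t : R) := U o t xi.
Definition Rad (t a : R) := forall k, boundary Om k -> a * lam k u <= phi k (L1 t).
Definition rad (t : R) : R := sup [set a : R | 0 <= a /\ Rad t a].

Lemma phi_L1 k t : phi k (L1 t) = (1 - t) * phi k xi + t * phi k o.
Proof. exact: phi_affine. Qed.

Lemma phi_xi_ge0 k : boundary Om k -> 0 <= phi k xi.
Proof. by move=> bk; apply: (phi_closure_ge0 HD bk); case: bxi. Qed.

Lemma L1_O t : 0 < t <= 1 -> Om (L1 t).
Proof.
move=> /andP[t0 t1]; apply: (Om_phi HD oO) => k bk; rewrite phi_L1.
have := phi_xi_ge0 bk; have po := phi_pos HD bk oO => px.
have : 0 <= (1 - t) * phi k xi by rewrite mulr_ge0// subr_ge0.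
have : 0 < t * phi k o by rewrite mulr_gt0.
lra.
Qed.

Lemma lam_ge0' k v : 0 <= lam k v. Proof. exact: sqrtr_ge0. Qed.

Lemma Rad_sup t : 0 < t <= 1 -> has_sup [set a : R | 0 <= a /\ Rad t a].
Proof.
move=> t01; have LO := L1_O t01; have [Ob _ _ _] := HD; have [M M0 hM] := bounded_ex Ob.
split; first by exists 0; split => // k bk; rewrite mul0r; exact/ltW/(phi_pos HD bk LO).
exists (4 * M) => a [a0 ha].
have inO : Om (L1 t + (a / 2) *: u).
  apply: (Om_phi HD oO) => k bk; rewrite phi_lin; have pk := phi_pos HD bk LO.
  have h1 := ha k bk; have := le_trans (ler_norm _) (lam_ge r k u) => h2.
  have : a / 2 * 'd r k u <= a / 2 * lam k u by rewrite ler_wpM2l// divr_ge0.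
  lra.
have := hM _ inO; have := hM _ LO => n1 n2.
have : `|(a / 2) *: u| <= M + M.
  have -> : (a / 2) *: u = (L1 t + (a / 2) *: u) - L1 t by rewrite addrAC subrr add0r.
  by apply: le_trans (ler_normB _ _) _; exact: lerD.
rewrite normrZ u1 mulr1 ger0_norm ?divr_ge0//; lra.
Qed.

Lemma rad_Rad t : 0 < t <= 1 -> Rad t (rad t).
Proof.
move=> t01 k bk; have [ne bd] := Rad_sup t01; have LO := L1_O t01.
have [l0|ln] := eqVneq (lam k u) 0; first by rewrite l0 mulr0; exact/ltW/(phi_pos HD bk LO).
have l0 : 0 < lam k u by rewrite lt_neqAle eq_sym ln lam_ge0'.
by rewrite -ler_pdivlMr//; apply: ge_sup => // a [a0 ha]; rewrite ler_pdivlMr//; exact: ha.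
Qed.

Lemma Rad_le t a : 0 < t <= 1 -> 0 <= a -> Rad t a -> a <= rad t.
Proof. by move=> t01 a0 ha; apply: ub_le_sup; [case: (Rad_sup t01)|split]. Qed.

Lemma rad_ge0 t : 0 < t <= 1 -> 0 <= rad t.
Proof.
move=> t01; apply: Rad_le => // k bk; rewrite mul0r; exact/ltW/(phi_pos HD bk (L1_O t01)).
Qed.

(** By [flat_order], a disk of radius [a] at [xi] exceeds the half-spaces by [O(a ^ N)] only, and
    raising its centre by a height [s] of that order brings its half inside. So [rad s] is at least
    of the order of [s ^ (1 / N)], for every [N]. *)
Lemma rad_lower (N : nat) : exists2 del0 : R, 0 < del0 & forall a s : R, 0 < a -> a <= del0 -> a ^+ N <= del0 * s ->
  0 < s -> s <= 1 / 2 -> a / 2 <= rad s.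
Proof.
have [B B0 hB] := flat_order N; have [Co [rho1 [Co0 rho10 out]]] := outer HD oO.
have [Ob _ _ _] := HD; have [M M0 hM] := bounded_ex Ob.
pose d1 := Num.min (Num.min 1 (rho1 / 4)) (2 * Co * B)^-1.
have CB : 0 < 2 * Co * B by rewrite !mulr_gt0.
exists d1 => [|a s a0 ad aN s0 s1]; first by rewrite !lt_min ltr01 invr_gt0 CB divr_gt0.
move: ad; rewrite !le_min => /andP[/andP[a1 a2] _].
have s01 : 0 < s <= 1 by rewrite s0/=; lra.
apply: Rad_le => //; first by rewrite divr_ge0// ltW.
move=> k bk; have po := phi_pos HD bk oO; have px := phi_xi_ge0 bk.
have sm : small r xi u a (B * a ^+ N).
  move=> z za; apply: (le_trans (hB z (le_trans za a1))); rewrite ler_pM2l//.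
  by apply: lerXn2r; rewrite ?nnegrE// ltW.
have A0 : 0 <= B * a ^+ N by rewrite mulr_ge0 ?exprn_ge0// ltW.
have kA : 2 * (Co * (B * a ^+ N)) <= s.
  have -> : 2 * (Co * (B * a ^+ N)) = (2 * Co * B) * a ^+ N by ring.
  rewrite mulrC -ler_pdivlMr// mulrC; apply: (le_trans aN); rewrite ler_pM2r//.
  by rewrite /d1 ge_min lexx orbT.
(* [outer] wants a point of the domain near [q], and [xi] is on the boundary: the point [L1 tau]
   slightly above it is used. *)
pose tau := Num.min 1 (rho1 / (4 * M)).
have tau0 : 0 < tau <= 1 by rewrite lt_min ltr01 divr_gt0 ?mulr_gt0//= ge_min lexx.
have nxo : `|xi - o| <= 2 * M.
  have := closure_norm hM (proj1 bxi); have := hM _ oO; have := ler_normB xi o; lra.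
have := @disk_lam _ _ _ _ HD o oO Co (B * a ^+ N) s a xi u k bk (ltW a0) u1 sm kA.
have H q : `|q - xi| <= 2 * a -> r q <= B * a ^+ N -> - (Co * (B * a ^+ N) * phi k o) <= phi k q.
  move=> qa rq; apply: (out (L1 tau) q _ k (L1_O tau0) _ A0 rq bk).
  have -> : q - L1 tau = (q - xi) + tau *: (xi - o).
    by rewrite /L1 /U opprD addrA -[xi - o]opprB scalerN.
  apply: le_trans (ler_normD _ _) _; rewrite normrZ gtr0_norm; last by case/andP: tau0.
  have : tau * `|xi - o| <= rho1 / (4 * M) * (2 * M).
    by apply: ler_pM => //; [case/andP: tau0 => /ltW|rewrite ge_min lexx orbT].
  have -> : rho1 / (4 * M) * (2 * M) = rho1 / 2 by field; rewrite gt_eqF.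
  lra.
move=> /(_ H) h1; rewrite phi_L1.
have : 1 / 2 * phi k xi <= (1 - s) * phi k xi by rewrite ler_wpM2r//; lra.
have : 0 <= s * phi k o by rewrite mulr_ge0// ltW.
lra.
Qed.

(* Otherwise [rad] would grow by a factor [1 + e] on every block of [n + 1] dyadic scales, hence
   decay at least like a power of [t]. *)
Lemma good_scale (n : nat) (e s0 : R) : 0 < e -> e <= 1 / 2 -> 0 < s0 -> exists2 s : R, 0 < s &
  (2 ^+ n.+1 * s <= s0) /\ rad (2 ^+ n.+1 * s) <= (1 + e) * rad s.
Proof.
move=> e0 e1 s00; set M : R := 2 ^+ n.+1; have M1 : 1 <= M by rewrite exprn_ege1// ler1n.
have Mp : 0 < M by lra.
(* With [N] such that [M <= b ^+ N], [rad_lower] at order [N.+1] shows that [rad (s1 / M ^+ k)]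
   decays no faster than [1 / b ^+ k]; as [b < 1 + e], [growth_step] finds the scale. *)
pose b := 1 + e / 2; have b1 : 1 < b by rewrite /b; lra.
have [N hN] : exists N : nat, M <= b ^+ N.
  exists (Num.truncn (M / (e / 2))).+1; apply: le_trans (bernoulli_le _ _); last by lra.
  have : M / (e / 2) < (Num.truncn (M / (e / 2))).+1%:R by exact: truncnS_gt.
  by rewrite ltr_pdivrMr ?divr_gt0//; lra.
pose s1 := Num.min s0 (1 / 2); have s10 : 0 < s1 by rewrite lt_min s00; lra.
have [del' del'0 hdel'] := rad_lower N.+1.
pose a1 := Num.min (Num.min 1 del') (del' * s1).
have a1p : 0 < a1 by rewrite !lt_min ltr01 del'0 mulr_gt0.
have a1N : a1 ^+ N.+1 <= del' * s1.
  rewrite exprS; apply: (@le_trans _ _ (a1 * 1)); last by rewrite mulr1 ge_min lexx orbT.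
  by rewrite ler_pM2l// exprn_ile1 ?(ltW a1p)// !ge_min lexx.
have Mk k : 0 < M ^+ k by rewrite exprn_gt0.
have Mk1 k : 1 <= M ^+ k by rewrite exprn_ege1.
have bk k : 0 < b ^+ k by rewrite exprn_gt0//; lra.
have low k : a1 / 2 / b ^+ k <= rad (s1 / M ^+ k).
  have -> : a1 / 2 / b ^+ k = a1 / b ^+ k / 2 by rewrite mulrAC.
  have bk1 : 1 <= b ^+ k by rewrite exprn_ege1// ltW.
  apply: hdel'.
  - by rewrite divr_gt0.
  - rewrite ler_pdivrMr//; apply: (@le_trans _ _ del'); first by rewrite !ge_min lexx orbT.
    by rewrite ler_peMr// ltW.
  - rewrite expr_div_n mulrA; apply: ler_pM => //; rewrite ?exprn_ge0 ?(ltW a1p)//.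
      by rewrite invr_ge0 exprn_ge0// ltW.
    have hMb : M ^+ k <= (b ^+ k) ^+ N.+1.
      rewrite [(b ^+ k) ^+ _]exprAC; apply: lerXn2r; rewrite ?nnegrE.
      - exact: ltW.
      - by apply/exprn_ge0/ltW; lra.
      by apply: (le_trans hN); rewrite ler_weXn2l//; exact: ltW.
    by rewrite lef_pV2 ?posrE// exprn_gt0.
  - by rewrite divr_gt0.
  rewrite ler_pdivrMr//; by apply: (@le_trans _ _ (1 / 2)); [rewrite ge_min lexx orbT|rewrite ler_peMr].
have a12 : 0 < a1 / 2 by rewrite divr_gt0.
have b0 : 0 < b by lra.
have bB : b < 1 + e by rewrite /b; lra.
have [k hk] := growth_step a12 b0 bB low.
exists (s1 / M ^+ k.+1); first by rewrite divr_gt0.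
have -> : M * (s1 / M ^+ k.+1) = s1 / M ^+ k by rewrite exprS; field; rewrite !gt_eqF.
split => //; rewrite ler_pdivrMr//; apply: (@le_trans _ _ s0); first by rewrite ge_min lexx.
by rewrite ler_peMr// ltW.
Qed.

Lemma L1_mono k s t : boundary Om k -> 0 <= s -> s <= t -> t <= 1 -> (1 - t) * phi k (L1 s) <= phi k (L1 t).
Proof.
move=> bk s0 st t1; rewrite !phi_L1; have x0 := phi_xi_ge0 bk; have y0 := phi_pos HD bk oO.
have : 0 <= (1 - t) * s * phi k xi by rewrite !mulr_ge0//; lra.
have : 0 <= (t - s) * phi k o by rewrite mulr_ge0 ?subr_ge0// ltW.
have : 0 <= t * s * phi k o by rewrite !mulr_ge0//; [lra|exact: ltW].
lra.
Qed.

Lemma lam_rot2 k v (c s : R) : c ^+ 2 + s ^+ 2 = 1 -> lam k (c *: v + s *: J v) <= lam k v.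
Proof.
move=> cs; have [c' [s' [cs' <-]]] := lam_sup r k (c *: v + s *: J v).
have -> : c' *: (c *: v + s *: J v) + s' *: J (c *: v + s *: J v) = (c' * c - s' * s) *: v + (c' * s + s' * c) *: J v.
  rewrite J_add !J_scale JJ !scalerDr !scalerA scalerN scalerBl scalerDl.
  by rewrite -!addrA; congr (_ + _); rewrite addrA addrC.
apply: lam_rot; have -> : (c' * c - s' * s) ^+ 2 + (c' * s + s' * c) ^+ 2 = (c' ^+ 2 + s' ^+ 2) * (c ^+ 2 + s ^+ 2) by ring.
by rewrite cs cs' mulr1.
Qed.

Lemma vstep : exists2 K : R, 1 <= K & forall v t, 0 < t -> 2 * t <= 1 ->
  (forall a k, t <= a <= 2 * t -> boundary Om k -> a / 2 * phi k o <= phi k (L1 a + v)) ->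
  dK (L1 t + v) (L1 (2 * t) + v) <= K.
Proof.
have [C2 F] := FR; have [Ob _ _ _] := HD; have [M M0 hM] := bounded_ex Ob.
have [C1 C10 hC1] := lam_norm HD oO; exists (1 + 2 * (C1 * (2 * M))) => [|v t t0 t1 low].
  by rewrite lerDl !mulr_ge0// ltW.
have nox : `|o - xi| <= 2 * M.
  have := closure_norm hM (proj1 bxi); have := hM _ oO; have := ler_normB o xi; lra.
have inO a : t <= a <= 2 * t -> Om (L1 a + v).
  move=> aI; apply: (Om_phi HD oO) => k bk; apply: lt_le_trans (low a k aI bk).
  by rewrite mulr_gt0 ?divr_gt0//; [case/andP: aI; lra|exact: (phi_pos HD)].
apply: (dK_le F); [apply: inO; lra|apply: inO; lra|] => a /andP[a0 a1] [k bk]; rewrite /phiB /lamB /=.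
have E : L1 (2 * t) + v - (L1 t + v) = t *: (o - xi).
  rewrite /L1 /U opprD addrACA subrr addr0 opprD addrACA subrr add0r -scalerBl; congr (_ *: _); ring.
have -> : L1 t + v + a *: (L1 (2 * t) + v - (L1 t + v)) = L1 (t + a * t) + v.
  by rewrite E scalerA addrAC; congr (_ + v); rewrite /L1 /U -addrA -scalerDl.
have aI : t <= t + a * t <= 2 * t.
  have : 0 <= a * t by rewrite mulr_ge0// ltW.
  have : a * t <= 1 * t by rewrite ler_pM2r.
  lra.
have y0 := phi_pos HD bk oO.
have h1 : t / 2 * phi k o <= phi k (L1 (t + a * t) + v).
  apply: le_trans (low _ k aI bk); rewrite ler_pM2r//; case/andP: aI; lra.
rewrite E lam_scale gtr0_norm//.
have h2 : lam k (o - xi) <= C1 * (2 * M) * phi k o.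
  by apply: (le_trans (hC1 k (o - xi) bk)); rewrite ler_pM2r// ler_pM2l.
set K := C1 * (2 * M) in h2 *; have K0 : 0 <= K by rewrite !mulr_ge0// ltW.
apply: (@le_trans _ _ (t * (K * phi k o))); first by rewrite ler_pM2l.
have := ler_wpM2l K0 h1.
have : 0 <= phi k (L1 (t + a * t) + v) by apply: le_trans h1; rewrite mulr_ge0 ?divr_ge0// ltW.
lra.
Qed.

(** Walks from the centre towards the rim of the disk, halving the distance that remains: each stage
    costs at most 2. The radius is that of the scale [s], used at a larger height [t]. *)
Lemma hchain s t eta v (j m : nat) : 0 < s -> 2 * s <= t -> t <= eta / 8 -> eta = (2 ^+ j)^-1 -> (m <= j)%N ->
  (forall k, boundary Om k -> lam k v <= lam k u) ->
  Om (L1 t + ((1 - (2 ^+ m)^-1) * rad s) *: v) /\ dK (L1 t) (L1 t + ((1 - (2 ^+ m)^-1) * rad s) *: v) <= 2 * m%:R.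
Proof.
move=> s0 st te eE mj hv; have [C2 F] := FR.
have p0 n : 0 < 2 ^+ n :> R by rewrite exprn_gt0.
have eta1 : eta <= 1 by rewrite eE invf_le1// exprn_ege1// ler1n.
have s01 : 0 < s <= 1 by lra.
have t01 : 0 < t <= 1 by lra.
have r0 := rad_ge0 s01.
have low th k : boundary Om k -> 0 <= th -> th <= 1 - eta ->
    t / 2 * phi k o <= phi k (L1 t + (th * rad s) *: v) /\
    (1 - th) / 2 * phi k (L1 s) <= phi k (L1 t + (th * rad s) *: v).
  move=> bk th0 th1; rewrite phi_lin !phi_L1; apply: (@far_disk_ineq_low _ _ _ _ eta _ _ _ (lam k u)) => //.
  - exact: phi_xi_ge0.
  - exact/ltW/(phi_pos HD).
  - by rewrite -phi_L1; exact: rad_Rad.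
  by apply: le_trans (hv k bk); apply: le_trans (ler_norm _) (lam_ge r k v).
have inO th : 0 <= th -> th <= 1 - eta -> Om (L1 t + (th * rad s) *: v).
  move=> th0 th1; apply: (Om_phi HD oO) => k bk; have [h _] := low th k bk th0 th1.
  apply: lt_le_trans h; apply: mulr_gt0; [by lra|exact: (phi_pos HD)].
have thb n : (n <= j)%N -> 0 <= 1 - (2 ^+ n)^-1 :> R /\ 1 - (2 ^+ n)^-1 <= 1 - eta.
  move=> nj; split; first by rewrite subr_ge0 invf_le1// exprn_ege1// ler1n.
  by rewrite lerD2l lerN2 eE lef_pV2 ?posrE// ler_weXn2l// ler1n.
elim: m mj => [|m IH] mj.
  rewrite expr0 invr1 subrr mul0r scale0r addr0 mulr0; split; first exact: L1_O.
  by rewrite (dKxx F) //; exact: L1_O.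
have [yO d1] := IH (ltnW mj); have [a1 a2] := thb m (ltnW mj); have [b1 b2] := thb m.+1 mj.
have O2 := inO _ b1 b2; split => //.
apply: (le_trans (dK_tri F (L1_O t01) yO O2)); have -> : 2 * m.+1%:R = 2 * m%:R + 2 :> R by rewrite -[m.+1%:R]natr1; ring.
apply: lerD => //.
apply: (dK_le F) => // a /andP[a0 a1'] [k bk]; rewrite /phiB /lamB /=.
set q := (2 ^+ m.+1)^-1 : R; have q0 : 0 < q by rewrite invr_gt0.
have qE : (2 ^+ m)^-1 = 2 * q by rewrite /q exprS; field; rewrite gt_eqF.
rewrite -/q qE in a1 a2 b1 b2 *.
have E : L1 t + ((1 - q) * rad s) *: v - (L1 t + ((1 - 2 * q) * rad s) *: v) = (q * rad s) *: v.
  by rewrite opprD addrACA subrr add0r -scalerBl; congr (_ *: _); ring.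
rewrite E; have -> : L1 t + ((1 - 2 * q) * rad s) *: v + a *: ((q * rad s) *: v) = L1 t + ((1 - 2 * q + a * q) * rad s) *: v.
  by rewrite scalerA -addrA -scalerDl; congr (_ + _ *: _); ring.
have aq : 0 <= a * q by rewrite mulr_ge0// ltW.
have aq1 : a * q <= q by apply: ler_piMl => //; exact: ltW.
have th0 : 0 <= 1 - 2 * q + a * q by lra.
have th1 : 1 - 2 * q + a * q <= 1 - eta by lra.
have [_ h] := low _ k bk th0 th1.
rewrite lam_scale ger0_norm; last by rewrite mulr_ge0// ltW.
have h2 := rad_Rad s01 bk; have h3 := hv k bk.
have h4 : q * rad s * lam k v <= q * phi k (L1 s).
  rewrite -mulrA ler_pM2l//; apply: le_trans h2; exact: ler_wpM2l.
have ps : 0 < phi k (L1 s) by apply: (phi_pos HD bk); exact: L1_O.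
have h5 : q * phi k (L1 s) <= (1 - (1 - 2 * q + a * q)) * phi k (L1 s) by rewrite ler_pM2r//; lra.
move: h h4 h5; set Z := phi k (L1 t + _); lra.
Qed.

(** The second path is the first one displaced by the fraction [1 - 2 ^ - j] of a radius that is
    nearly the same at all scales from [s] to [T n], so one displacement serves the whole range.
    [hchain] bounds the distance between corresponding points by [2 * j], and a half-space almost
    touched at the top scale separates the paths by about [j / 4]. *)
Lemma rails_ex : exists2 K : R, 1 <= K & rails Om dK K (1 / 4).
Proof.
have [C2 F] := FR; have [K K1 hK] := vstep; have [C1 C10 hC1] := lam_norm HD oO.
exists (K + 2) => [|j n n0]; first by lra.
have [eta etaE] : exists eta : R, eta = (2 ^+ j)^-1 by exists (2 ^+ j)^-1.
have [e eE] : exists e : R, e = eta / 8 by exists (eta / 8).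
have pj : 1 <= 2 ^+ j :> R by rewrite exprn_ege1// ler1n.
have eta0 : 0 < eta by rewrite etaE invr_gt0 exprn_gt0.
have eta1 : eta <= 1 by rewrite etaE invf_le1// exprn_gt0.
have e0 : 0 < e by rewrite eE divr_gt0.
have e18 : e <= 1 / 8 by rewrite eE ler_pM2r.
have e1 : e <= 1 / 2 by apply: le_trans e18 _; lra.
clear pj.
have [s s0 [sM hs]] := good_scale n e0 e1 e0.
have [T TE] : exists T : nat -> R, forall i, T i = 2 ^+ i.+1 * s by exists (fun i => 2 ^+ i.+1 * s).
have T0 i : 0 < T i by rewrite TE mulr_gt0// exprn_gt0.
have TS i : T i.+1 = 2 * T i by rewrite !TE exprS mulrA.
have Tle i l : (i <= l)%N -> T i <= T l by move=> il; rewrite !TE ler_pM2r// ler_weXn2l// ler1n.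
have Ts i : 2 * s <= T i by have := Tle 0%N i (leq0n _); rewrite {1}TE expr1.
have Tn i : (i <= n)%N -> T i <= e by move=> /Tle h; apply: (le_trans h); rewrite TE.
have T2 : rad (T n) <= (1 + e) * rad s by rewrite TE.
have TnE : T n = 2 ^+ n * T 0%N by rewrite !TE exprS expr1; ring.
clear TE sM hs.
have e11 : e <= 1 by apply: le_trans e18 _; rewrite ler_pdivrMr// mul1r ler1n.
have ep1 : 0 < 1 + e by apply: addr_gt0.
have T01 i : (i <= n)%N -> 0 < T i <= 1 by move=> /Tn h; rewrite T0/=; exact: le_trans h e11.
have s01 : 0 < s <= 1.
  rewrite s0; apply: le_trans (le_trans (Ts n) (le_trans (Tn n (leqnn _)) e11)).
  by rewrite ler_peMl ?ler1n// ltW.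
have t0 := T01 n (leqnn _).
have rn0 : 0 < rad (T n).
  apply: (@lt_le_trans _ _ (T n / C1)); first by rewrite divr_gt0.
  apply: Rad_le => //; first by rewrite divr_ge0// ltW.
  move=> k bk; have := hC1 k u bk; rewrite u1 mulr1 => h; rewrite phi_L1.
  have : 0 <= (1 - T n) * phi k xi.
    by apply: mulr_ge0; [rewrite subr_ge0; case/andP: t0|exact: phi_xi_ge0].
  have : T n / C1 * lam k u <= T n / C1 * (C1 * phi k o) by rewrite ler_pM2l// divr_gt0.
  have -> : T n / C1 * (C1 * phi k o) = T n * phi k o by field; rewrite gt_eqF.
  by move=> h1 h2; apply: (le_trans h1); rewrite lerDr.
(* As [rad (T n)] is the largest admissible radius, some half-space [k] forbids enlarging it by
   [1 + e]. By [L1_mono] it is nearly as tight at the lower scales. *)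
have [k [bk hk]] : exists k, boundary Om k /\ phi k (L1 (T n)) < (1 + e) * rad (T n) * lam k u.
  apply: contrapT => no; have : (1 + e) * rad (T n) <= rad (T n); last first.
    by rewrite leNgt mulrDl mul1r ltrDl mulr_gt0.
  apply: (Rad_le t0); first by apply: mulr_ge0; exact: ltW.
  by move=> k bk; rewrite leNgt; apply/negP => h; apply: no; exists k.
have [c' [s' [cs hL]]] := lam_sup r k u.
(* The flat direction rotated to point straight at the half-space [k]: ['d r k v = lam k u]. *)
pose v := c' *: u + s' *: J u.
have hv k' : boundary Om k' -> lam k' v <= lam k' u by move=> _; exact: lam_rot2.
pose a i := L1 (T i); pose b i := L1 (T i) + ((1 - eta) * rad s) *: v.
have chain i : (i <= n)%N -> Om (b i) /\ dK (a i) (b i) <= 2 * j%:R.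
  move=> iN; have Tie : T i <= eta / 8 by rewrite -eE; exact: Tn.
  by have := @hchain s (T i) eta v j j s0 (Ts i) Tie etaE (leqnn _) hv; rewrite -etaE.
have aO i : (i <= n)%N -> Om (a i) by move=> iN; exact: L1_O (T01 i iN).
have j0 : 0 <= j%:R :> R by [].
have rs0 := rad_ge0 s01.
have jb : 2 * j%:R <= (K + 2) * j.+1%:R :> R.
  by apply: ler_pM; rewrite ?ler_nat// lerDr (le_trans ler01 K1).
exists a, b; split.
- by move=> i iN; split; [exact: aO|case: (chain i iN)].
- move=> i iN; have tI : 2 * T i <= 1 by rewrite -TS; case/andP: (T01 i.+1 iN).
  have [Tl Tl2] : T i <= e /\ 2 * T i <= e by rewrite -TS; split; apply: Tn => //; exact: ltnW.
  split.
    have -> : a i = L1 (T i) + 0 by rewrite addr0.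
    have -> : a i.+1 = L1 (2 * T i) + 0 by rewrite addr0 /a TS.
    apply: (@le_trans _ _ K); last by rewrite lerDl.
    apply: hK => // w k' /andP[w1 w2] bk'; rewrite addr0 phi_L1.
    have := phi_xi_ge0 bk'; have := phi_pos HD bk' oO => y0 x0.
    have := T0 i => Ti0.
    have w0 : 0 < w := lt_le_trans Ti0 w1.
    have wl : w <= 1 := le_trans w2 tI.
    exact: half_weight_le.
  rewrite /b TS; apply: (@le_trans _ _ K); last by rewrite lerDl.
  apply: hK => // w k' /andP[w1 w2] bk'; rewrite phi_lin phi_L1.
  have [] := @far_disk_ineq_low R s w (1 - eta) eta (phi k' xi) (phi k' o) (rad s) (lam k' u) ('d r k' v) => //.
  + exact: phi_xi_ge0.
  + exact/ltW/(phi_pos HD).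
  + exact: le_trans (Ts i) w1.
  + by rewrite -eE; exact: le_trans w2 Tl2.
  + by rewrite subr_ge0.
  + by rewrite -phi_L1; exact: rad_Rad.
  by apply: le_trans (hv k' bk'); apply: le_trans (ler_norm _) (lam_ge r k' v).
- split; [have [_ h] := chain 0%N (leq0n _)|have [_ h] := chain n (leqnn _)]; exact: le_trans h jb.
- move=> i l iN lN; have [bO _] := chain l lN.
  have P0 : 0 < rad s * lam k u.
    have pk := phi_pos HD bk (L1_O t0); have h1 := lt_trans pk hk.
    have l0 : 0 < lam k u.
      by rewrite -(pmulr_rgt0 _ (mulr_gt0 ep1 rn0)).
    have rs : 0 < rad s by rewrite -(pmulr_rgt0 _ ep1); exact: (lt_le_trans rn0 T2).
    exact: (mulr_gt0 rs l0).
  suff h : 1 <= 2 * eta * expR (2 * dK (a i) (b l)).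
    rewrite etaE in h; apply: le_trans (ln_pow_bound h); rewrite mulrC; apply: lerB.
      by rewrite mul1r.
    by apply: (le_trans K1); rewrite lerDl.
  have phab : phi k (a i) <= phi k (b l) * expR (2 * dK (a i) (b l)).
    by rewrite (dK_sym F (aO i iN) bO); exact: (dK_phi F (exist _ k bk) bO (aO i iN)).
  apply: (@far_disk_ineq_high R eta e (rad s * lam k u) (phi k (L1 (T l))) (phi k (a i)) (phi k (b l))) => //.
  + apply: le_trans (L1_mono bk (ltW s0) _ _); last by case/andP: (T01 i iN).
      have h1 := rad_Rad s01 bk; have h2 := Tn i iN.
      apply: ler_pM => //; [by rewrite subr_ge0|exact: ltW|by rewrite lerD2l lerN2].
    by apply: le_trans (Ts i); rewrite ler_peMl ?ler1n// ltW.
  + have h1 := L1_mono bk (ltW (T0 l)) (Tle l n lN) (proj2 (andP t0)).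
    have h2 := Tn n (leqnn _); have pl := phi_pos HD bk (L1_O (T01 l lN)).
    apply: (@le_trans _ _ ((1 - T n) * phi k (L1 (T l)))); first by rewrite ler_pM2r// lerD2l lerN2.
    apply: (le_trans h1); apply: (le_trans (ltW hk)); rewrite -mulrA; apply: ler_wpM2l; first exact: ltW.
    by rewrite mulrA ler_wpM2r// lam_ge0'.
  + by rewrite /b phi_lin hL; ring.
  exact: expR_gt0.
(* Length of the first path: [phi xi] vanishes at [xi], so at [a i] it is exactly [T i * phi xi o]
   and doubles at each step. *)
have an := aO n (leqnn _); have a_0 := aO 0%N (leq0n _).
have := dK_phi F (exist _ xi bxi) a_0 an; rewrite /phiB /= /a !phi_L1 phi_xi0 !mulr0 !add0r.
have y0 := phi_pos HD bxi oO.
rewrite TnE.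
move=> h; suff h0 : n%:R / 4 <= dK (L1 (T 0)) (L1 (2 ^+ n * T 0)).
  apply: le_trans h0; rewrite mulrC mul1r gerBl; apply: addr_ge0 => //; exact: le_trans ler01 K1.
have h1 : 2 ^+ n <= expR (2 * dK (L1 (T 0)) (L1 (2 ^+ n * T 0))).
  have Ty : 0 < T 0%N * phi xi o by rewrite mulr_gt0.
  by rewrite -(ler_pM2r Ty) [expR _ * _]mulrC mulrA.
have : ln (2 ^+ n) <= ln (expR (2 * dK (L1 (T 0)) (L1 (2 ^+ n * T 0)))).
  by rewrite ler_ln ?posrE ?expR_gt0 ?exprn_gt0.
rewrite expRK lnXn// -[ln 2 *+ n]mulr_natl.
move=> h2; apply: ler_quarter; apply: le_trans h2; rewrite ler_wpM2l//; exact: ln2_ge.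
Qed.

End Rails.

(** * The equivalence *)

Section Final.
Variables (R : realType) (d : nat).
Local Notation V := (Cn R d).
Local Notation C := (Cplx R).
Variables (Om : set V) (r : V -> R^o).
Hypothesis HD : good_domain Om r.
Local Notation dK := (dK Om).

(** Otherwise every boundary point and unit direction would have a nonzero derivative along some
    real line of the complex line; by joint continuity of jets and compactness, the order would be
    bounded. *)
Lemma flat_direction :
  (forall M : nat, ~ forall x, boundary Om x -> forall w : V, w != 0 ->
    vanish_order_le (fun z => r (x + cmul z w)) M) ->
  exists xi u : V, [/\ boundary Om xi, `|u| = 1 & forall k (z : C), iter_dir (nseq k (cmul z u)) r xi = 0].
Proof.
move=> inf; apply: contrapT => no.
have sr : smooth r by case: HD => _ _ _ [].
pose P (e : R) (x w : V) := exists vs : seq C, (size vs)%:R <= e^-1 /\ iter_dir [seq cmul v w | v <- vs] r x != 0.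
have [e e0 he] : exists2 e : R, 0 < e & forall x w, boundary Om x -> `|w| = 1 -> P e x w.
  apply: (compact_uniform (compact_boundary HD) (@compact_sphere R _)) => [x w bx w1|e e' x w e'0 ee [vs [h1 h2]]]; last first.
    exists vs; split => //; apply: (le_trans h1); rewrite lef_pV2 ?posrE//.
    exact: lt_le_trans ee.
  have [k [z hn]] : exists k (z : C), iter_dir (nseq k (cmul z w)) r x != 0.
    apply: contrapT => no2; apply: no; exists x, w; split => // k z.
    by apply: contrapT => /eqP hn; apply: no2; exists k, z.
  have E w' : nseq k (cmul z w') = [seq cmul v w' | v <- nseq k z] by rewrite map_nseq.
  rewrite E in hn.
  have h0 : 0 < `|iter_dir [seq cmul v w | v <- nseq k z] r x| / 2 by rewrite divr_gt0// normr_gt0.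
  have [del del0 hd] := jet_eps sr (nseq k z) x w h0.
  have m0 : 0 < Num.min del k.+1%:R^-1 by rewrite lt_min del0 invr_gt0 ltr0n.
  exists (Num.min del k.+1%:R^-1) => // x' w'.
  rewrite !lt_min => /andP[h1 _] /andP[h2 _]; exists (nseq k z); split.
    rewrite size_nseq; apply: (@le_trans _ _ k.+1%:R); first by rewrite ler_nat.
    rewrite -[leLHS]invrK lef_pV2 ?posrE ?invr_gt0 ?ltr0n//.
    by rewrite ge_min lexx orbT.
  apply/eqP => z0; have := hd x' w' h1 h2; rewrite z0 sub0r normrN.
  move: h0; set X := `|_|; lra.
apply: (inf (Num.truncn e^-1).+1) => x bx w wn.
have w0 : 0 < `|w| by rewrite normr_gt0.
have [|vs [h1 h2]] := he x (`|w|^-1 *: w) bx.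
  by rewrite normrZ gtr0_norm ?invr_gt0// mulVf ?gt_eqF.
exists [seq `|w|^-1 *: v | v <- vs]; split.
  rewrite size_map -(ler_nat R); apply: (le_trans h1); apply: ltW; exact: truncnS_gt.
have E : [seq cmul v w | v <- [seq `|w|^-1 *: v | v <- vs]] = [seq cmul v (`|w|^-1 *: w) | v <- vs].
  rewrite -map_comp; apply: eq_map => v /=.
  have := cmul_lin v (`|w|^-1) 0 w 0; rewrite !scale0r !addr0 => ->.
  by have := cmulDl 0 v w (`|w|^-1); rewrite add0r cmul0l add0r.
by rewrite iter_dir_comp cmul0l addr0 E.
Qed.

Lemma geodesicE sg (a b : R) x y : geodesic Om (kob_dist Om) sg a b x y <-> real_geodesic Om dK sg a b x y.
Proof.
split=> -[ab sa sb sO sd]; split => // s t sI tI.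
  by have := sd s t sI tI; rewrite (kob_distE HD (sO s sI) (sO t tI)) => -[].
by rewrite (kob_distE HD (sO s sI) (sO t tI)) sd.
Qed.

Definition thin_geodesics (del : R) := forall x y z s1 s2 s3 a1 b1 a2 b2 a3 b3, real_geodesic Om dK s1 a1 b1 x y ->
  real_geodesic Om dK s2 a2 b2 y z -> real_geodesic Om dK s3 a3 b3 z x -> forall s, a1 <= s <= b1 ->
    (exists2 t, a2 <= t <= b2 & dK (s1 s) (s2 t) <= del) \/
    (exists2 t, a3 <= t <= b3 & dK (s1 s) (s3 t) <= del).

Lemma gromov_hyperbolicE : gromov_hyperbolic Om (kob_dist Om) <-> exists2 del, 0 <= del & thin_geodesics del.
Proof.
split=> [[del [del0 h]]|[del del0 h]].
  exists del => // x y z s1 s2 s3 a1 b1 a2 b2 a3 b3 g1 g2 g3 s sI.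
  have := h _ _ _ _ _ _ _ _ _ _ _ _ (proj2 (geodesicE _ _ _ _ _) g1) (proj2 (geodesicE _ _ _ _ _) g2)
    (proj2 (geodesicE _ _ _ _ _) g3) => -[thn _ _].
  have [_ _ _ sO1 _] := g1; have [_ _ _ sO2 _] := g2; have [_ _ _ sO3 _] := g3.
  have [|q [[]]] := thn (s1 s); first by exists s => //=; rewrite in_itv.
    move=> [t /=]; rewrite in_itv/= => tI <-; rewrite (kob_distE HD (sO1 _ sI) (sO2 _ tI)) lee_fin => dd.
    by left; exists t.
  move=> [t /=]; rewrite in_itv/= => tI <-; rewrite (kob_distE HD (sO1 _ sI) (sO3 _ tI)) lee_fin => dd.
  by right; exists t.
exists del; split => // x y z s1 s2 s3 a1 b1 a2 b2 a3 b3 /geodesicE g1 /geodesicE g2 /geodesicE g3 A B D.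
have side x' y' z' u1 u2 u3 c1 e1 c2 e2 c3 e3 : real_geodesic Om dK u1 c1 e1 x' y' -> real_geodesic Om dK u2 c2 e2 y' z' ->
    real_geodesic Om dK u3 c3 e3 z' x' -> forall p, (u1 @` `[c1, e1]) p -> exists q,
    ((u2 @` `[c2, e2]) q \/ (u3 @` `[c3, e3]) q) /\ (kob_dist Om p q <= del%:E)%E.
  move=> k1 k2 k3 p [s /=]; rewrite in_itv/= => sI <-.
  have [_ _ _ sO1 _] := k1; have [_ _ _ sO2 _] := k2; have [_ _ _ sO3 _] := k3.
  have [[t tI dt]|[t tI dt]] := h _ _ _ _ _ _ _ _ _ _ _ _ k1 k2 k3 s sI.
    exists (u2 t); split; first by left; exists t => //=; rewrite in_itv.
    by rewrite (kob_distE HD (sO1 _ sI) (sO2 _ tI)) lee_fin.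
  exists (u3 t); split; first by right; exists t => //=; rewrite in_itv.
  by rewrite (kob_distE HD (sO1 _ sI) (sO3 _ tI)) lee_fin.
split=> p hp.
- by have [q [hq dq]] := side _ _ _ _ _ _ _ _ _ _ _ _ g1 g2 g3 p hp; exists q.
- have [q [hq dq]] := side _ _ _ _ _ _ _ _ _ _ _ _ g2 g3 g1 p hp; exists q; split => //.
  by case: hq; [right|left].
by have [q [hq dq]] := side _ _ _ _ _ _ _ _ _ _ _ _ g3 g1 g2 p hp; exists q.
Qed.

Lemma hyperbolic_finite o : Om o -> gromov_hyperbolic Om (kob_dist Om) ->
  exists M : nat, forall x, boundary Om x -> forall w : V, w != 0 -> vanish_order_le (fun z => r (x + cmul z w)) M.
Proof.
move=> oO /gromov_hyperbolicE[del del0 thn]; apply: contrapT => /forallNP inf.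
have [xi [u [bx u1 fl]]] := flat_direction inf.
have [C2 F] := kob_frame HD oO bx.
have [K K1 rl] := rails_ex HD oO bx u1 fl.
have c0 : 0 < 1 / 4 :> R by rewrite divr_gt0.
have ex x y : Om x -> Om y -> exists sg a b, real_geodesic Om dK sg a b x y := geodesic_ex HD oO bx (y := y).
by apply: (rails_absurd (dK_sym F) (dK_tri F) del0 ex thn K1 c0) rl.
Qed.

Lemma finite_hyperbolic o xi (M : nat) : Om o -> boundary Om xi ->
  (forall x, boundary Om x -> forall w : V, w != 0 -> vanish_order_le (fun z => r (x + cmul z w)) M) ->
  gromov_hyperbolic Om (kob_dist Om).
Proof.
move=> oO bx ft; have [m [CN NC]] := finite_contraction HD oO bx ft.
have [C2 F] := kob_frame HD oO bx; have [D D0 thn] := frame_thin F NC.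
by apply/gromov_hyperbolicE; exists D.
Qed.

(** Without boundary the domain is the whole space, and a bounded vector space is zero; this is the
    case [d = 0]. *)
Lemma boundary_empty_trivial o : Om o -> (forall xi, ~ boundary Om xi) -> forall x : V, x = 0.
Proof.
move=> oO nb; have [Ob _ _ _] := HD; have [M M0 hM] := bounded_ex Ob.
have all z : Om z by apply: contrapT => nz; have [t _ bt] := bd_between HD oO nz; exact: nb bt.
move=> x; apply: contrapT => /eqP xn; have x0 : 0 < `|x| by rewrite normr_gt0.
have := hM _ (all ((2 * M / `|x|) *: x)); rewrite normrZ ger0_norm.
  by rewrite divfK ?gt_eqF//; lra.
by rewrite divr_ge0// mulr_ge0// ltW.
Qed.

End Final.

Theorem theorem1p1 (R : realType) (d : nat) (Omega : set (Cn R d)) :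
  bounded_set Omega -> open Omega -> convex_set Omega -> smooth_boundary Omega ->
  (gromov_hyperbolic Omega (kob_dist Omega) <-> finite_type Omega).
Proof.
move=> Ob Oo Oc [r0 Or0].
have HD r : defining_function Omega r -> good_domain Omega r by [].
have [[p pO]|emp] := pselect (exists p, Omega p); last first.
  split=> _.
    exists r0; split => //; exists 0%N => x [xc _].
    have [y [yO _]] := xc setT filterT; by case: emp; exists y.
  exists 0; split => // x y z s1 s2 s3 a1 b1 a2 b2 a3 b3 [ab _ _ sO _].
  by case: emp; exists (s1 a1); apply: sO; rewrite lexx.
(* A frame needs a boundary point; without one the space is a single point and every triangle is
   degenerate. *)
have [[xi bx]|nb] := pselect (exists xi, boundary Omega xi); last first.
  have triv := boundary_empty_trivial (HD _ Or0) pO (fun xi bx => nb (ex_intro _ xi bx)).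
  split=> _.
    by exists r0; split => //; exists 0%N => x bx; case: nb; exists x.
  exists 0; split => // x y z s1 s2 s3 a1 b1 a2 b2 a3 b3 [ab1 _ _ _ d1] [ab2 _ _ _ _] [ab3 _ _ _ _] A B C.
  have dd y' z' : (kob_dist Omega y' z' <= 0%:E)%E.
    have := d1 a1 a1; rewrite lexx ab1 subrr normr0 => /(_ isT isT).
    by rewrite (triv y') (triv z') (triv (s1 a1)) => ->.
  have nA : A (s1 a1) by exists a1 => //=; rewrite in_itv/= lexx.
  have nB : B (s2 a2) by exists a2 => //=; rewrite in_itv/= lexx.
  by split=> q _; [exists (s2 a2)|exists (s1 a1)|exists (s1 a1)]; split => //; left.
(* Both implications hold for any defining function: [r0] serves in one direction and the given [r]
   in the other. *)
split=> [hyp|[r [Or [M ft]]]]; last exact: (finite_hyperbolic (HD _ Or) pO bx ft).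
by exists r0; split => //; exact: (hyperbolic_finite (HD _ Or0) pO hyp).
Qed.
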